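(* In the General setting, let $\mathfrak a,\mathfrak b$ be cusps. For every continuous $h:\mathbb R/\mathbb Z\to\mathbb C$, $$\frac{\sum_{r\in T_{\mathfrak a\mathfrak b}(M)}h(r)}{\#T_{\mathfrak a\mathfrak b}(M)}\to\int_{\mathbb R/\mathbb Z}h(r)\,dr\qquad(M\to\infty).$$ Moreover there is $\delta>0$ (depending only on $\Gamma$) such that if $\|h\|_{H^{1/2}}<\infty$ then $$\sum_{r\in T_{\mathfrak a\mathfrak b}(M)}h(r)=\int_{\mathbb R/\mathbb Z}h(r)\,dr\ \frac{M^2}{\pi\,\mathrm{vol}(\Gamma\backslash\mathbb H)}+O\big(\|h\|_{H^{1/2}}M^{2-\delta}\big).$$
   Context: General setting: $\Gamma\subset SL_2(\mathbb R)$ cofinite Fuchsian group with cusps; $\mathrm{vol}$ hyperbolic area; $\Gamma_\infty=\{\pm\begin{pmatrix}1&n\\0&1\end{pmatrix}\}$; fixed scaling matrices $\sigma_{\mathfrak a}$ ($\sigma_{\mathfrak a}\infty=\mathfrak a$, $\Gamma_{\mathfrak a}=\sigma_{\mathfrak a}\Gamma_\infty\sigma_{\mathfrak a}^{-1}$). $T_{\mathfrak a\mathfrak b}$ = set of $a/c\bmod1$ with $\begin{pmatrix}a&b\\c&d\end{pmatrix}\in\sigma_{\mathfrak a}^{-1}\Gamma\sigma_{\mathfrak b}$, $c>0$; $c(r)=c$ is well defined (unique double coset); $T_{\mathfrak a\mathfrak b}(M)=\{r:c(r)\le M\}$. $\|h\|_{H^A}=\sum_n|\hat h(n)|(1+|n|)^A$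 with $\hat h(n)$ the Fourier coefficients of $h$. *)

(* Defs.v *)
From HB Require Import structures.
From mathcomp Require Import all_boot all_order all_algebra.
From mathcomp Require Import all_classical all_reals all_analysis.
From mathcomp Require Import complex.
Import Order.TTheory GRing.Theory Num.Theory.
Import numFieldTopology.Exports numFieldNormedType.Exports.

Set Implicit Arguments.
Unset Strict Implicit.
Unset Printing Implicit Defensive.
Set Warnings "-redundant-factory -HB.no-new-instance".

(* The usual (norm) topology on the complex numbers R[i]. *)
HB.instance Definition _ (R : rcfType) := PseudoPointedMetric.copy R[i] (R[i])^o.

Local Open Scope classical_set_scope.
Local Open Scope ring_scope.

Definition ma {R : ringType} (g : 'M[R]_2) : R := g ord0 ord0.
Definition mb {R : ringType} (g : 'M[R]_2) : R := g ord0 ord_max.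
Definition mc {R : ringType} (g : 'M[R]_2) : R := g ord_max ord0.
Definition md {R : ringType} (g : 'M[R]_2) : R := g ord_max ord_max.

Definition parab {R : ringType} (s : R) (n : int) : 'M[R]_2 :=
  \matrix_(i < 2, j < 2)
     (if i == j then s else if i == ord0 then s * n%:~R else 0).

(* Upper half plane, points z = x + i y encoded as (x, y) *)
Definition upper_half {R : realType} : set (R * R) := [set z | 0 < z.2].

(* Moebius action  g z = (a z + b) / (c z + d)  (for det g = 1),
   written in real coordinates *)
Definition mobius {R : realType} (g : 'M[R]_2) (z : R * R) : R * R :=
  let: (x, y) := z in
  let den := (mc g * x + md g) ^+ 2 + (mc g * y) ^+ 2 in
  (((ma g * x + mb g) * (mc g * x + md g) + ma g * mc g * y ^+ 2) / den,
   y / den).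

Definition discrete_subgroup_SL2 {R : realType} (G : set 'M[R]_2) : Prop :=
  [/\ G 1%:M,
      (forall g, G g -> \det g = 1),
      (forall g h, G g -> G h -> G (g *m h)),
      (forall g, G g -> G (invmx g)) &
      (exists2 e : R, 0 < e & forall g, G g ->
          (forall i j, `|g i j - (1%:M : 'M[R]_2) i j| < e) -> g = 1%:M)].

Definition hyp_area {R : realType}
    (F : set (measurableTypeR R * measurableTypeR R)) : \bar R :=
  (\int[(@lebesgue_measure R \x @lebesgue_measure R)%E]_(p in F)
      ((p.2 : R) ^-2)%:E)%E.

Definition fund_domain {R : realType} (G : set 'M[R]_2)
    (F : set (measurableTypeR R * measurableTypeR R)) : Prop :=
  [/\ measurable F,
      F `<=` upper_half,
      (forall z, upper_half z -> exists2 w, F w & exists2 g, G g & mobius g z = w) &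
      (forall w1 w2, F w1 -> F w2 -> (exists2 g, G g & mobius g w1 = w2) -> w1 = w2)].

(* sigma is a scaling matrix for the cusp  sigma(oo) of Gamma :
   sigma in SL_2(R) and  sigma^-1 Gamma_{sigma oo} sigma = Gamma_oo,
   i.e. the elements of sigma^-1 Gamma sigma fixing oo (c = 0) are exactly
   the matrices  +-(1 n ; 0 1), n in Z. *)
Definition scaling_matrix {R : realType} (G : set 'M[R]_2) (sigma : 'M[R]_2) : Prop :=
  \det sigma = 1 /\
  forall tau : 'M[R]_2,
    ((exists2 g, G g & tau = invmx sigma *m g *m sigma) /\ mc tau = 0) <->
    (exists (s : R) (n : int), (s = 1 \/ s = -1) /\ tau = parab s n).

Definition double_set {R : realType} (G : set 'M[R]_2) (sa sb : 'M[R]_2) :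
  set 'M[R]_2 := [set tau | exists2 g, G g & tau = invmx sa *m g *m sb].

Definition frac {R : realType} (x : R) : R := x - (Num.floor x)%:~R.

(* T_ab(M), as a set of representatives in [0,1) of elements of R/Z *)
Definition Tab {R : realType} (G : set 'M[R]_2) (sa sb : 'M[R]_2) (M : R) : set R :=
  [set r | exists2 tau, double_set G sa sb tau &
             [/\ 0 < mc tau, mc tau <= M & r = frac (ma tau / mc tau)]].

Definition card_Tab {R : realType} (G : set 'M[R]_2) (sa sb : 'M[R]_2) (M : R) : R :=
  \sum_(r \in Tab G sa sb M) (1 : R).

(* functions on R/Z = 1-periodic functions on R *)
Definition periodic1 {R : realType} (h : R -> R[i]) : Prop :=
  forall x, h (x + 1) = h x.

Definition cint {R : realType} (h : R -> R[i]) : R[i] :=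
  (Rintegral (@lebesgue_measure R) `[0%R, 1%R] (fun x => complex.Re (h x)) +i*
   Rintegral (@lebesgue_measure R) `[0%R, 1%R] (fun x => complex.Im (h x)))%C.

Definition expi {R : realType} (t : R) : R[i] := (cos t +i* sin t)%C.

Definition fcoef {R : realType} (h : R -> R[i]) (n : int) : R[i] :=
  cint (fun x => h x * expi (- (2 * pi * n%:~R * x))).

Definition cabs {R : rcfType} (z : R[i]) : R := ComplexField.Normc.normc z.

Definition HA_norm {R : realType} (A : R) (h : R -> R[i]) : \bar R :=
  (\esum_(n in [set: int]) (cabs (fcoef h n) * (1 + (`|n|%:~R : R)) `^ A)%:E)%E.

(* Main.v *)
(** The lattice points behind [Tab] are the first columns of [G sb], modulo the unipotent group
    at infinity on the left.  A Markov kernel on the quotient, with profile [(rho + 2 cosh d)^-4],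
    has a spectral gap: a minorization on the thick part is combined with a Lyapunov function which
    controls the cusps.  The functions [z |-> #{v : |g^-1 v|^2 < y}], [act g orig = z], are almost
    reproduced by the kernel after averaging over [y], so their variance satisfies a convolution
    inequality, and the gap makes the variance smaller than its trivial size by a power of [y].
    Pairing the counting function with an incomplete Eisenstein series weighted by a periodic
    function [chi] and unfolding turns this into an asymptotic formula for a smoothed count of the
    columns [v] with weights [chi (v.1 / v.2)].  A Tauberian argument with second differences removes
    the smoothing, which bounds the exponential sums [sum e(n r)] with a power saving.
    Interpolation with the trivial bound makes the dependence on [n] at most [|n|^(1/2)], and
    Fejer means give the case of a merely continuous [h]. *)

Require Import Defs.
From HB Require Import structures.
From mathcomp Require Import all_boot all_order all_algebra.
From mathcomp Require Import all_classical all_reals all_analysis.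
From mathcomp Require Import measurable_realfun complex ring lra.
Import Order.TTheory GRing.Theory Num.Theory.
Import numFieldTopology.Exports numFieldNormedType.Exports.
Local Open Scope classical_set_scope.
Local Open Scope ring_scope.

(** The kernel controls averages over scales, whereas the theorem needs the count at individual
    scales. The bridge is the symmetrised count [et t]: its correlations have the form
    [Hc (s + t) + Hc (s - t)], like those of cosines, so the covariance of [et t] with [et 0], plus
    the variance of [et 0], is twice the variance of [et (t / 2)]. This combination is therefore
    nonnegative, and a comparison function turns exponential decay under iteration, known for
    bounded [t] only, into slow growth in [t]. The outcome is one good [t] somewhere in each
    interval [[T, T + 1]]. The free scale [c1] of the Eisenstein test function makes up for this
    lack of control, because the smoothed count depends on [y / c1] alone. The kernel is taken very
    wide because the drift constant of the Lyapunov function decays only like [rho ^ (-1/4)]. The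
    gap and the exponent [b] are obtained before any cusp is chosen, which makes the final saving
    independent of the cusps. *)

Notation mfunT := (measurable_fun setT).
Notation plane R := (measurableTypeR R * measurableTypeR R)%type.

Ltac pos :=
 first [ assumption | lazymatch goal with
 | |- is_true (0 <= _%:E)%E => rewrite lee_fin; pos
 | |- is_true (0 <= _ * _)%E => apply: mule_ge0; pos
 | |- is_true (0 <= _ + _)%E => apply: adde_ge0; pos
 | |- is_true (0 <= \int[_]_(x in _) _)%E => apply: integral_ge0 => ? ?; pos
 | |- is_true (0 <= \esum_(x in _) _)%E => apply: esum_ge0 => ? ?; pos
 | |- is_true (0 <= _ * _)%R => apply: mulr_ge0; pos
 | |- is_true (0 <= _ + _)%R => apply: addr_ge0; pos
 | |- is_true (0 <= _^-1)%R => rewrite invr_ge0; pos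
 | |- is_true (0 <= _ ^+ 2)%R => exact: sqr_ge0
 | |- is_true (0 <= _ ^+ _)%R => apply: exprn_ge0; pos
 | |- is_true (0 <= expR _)%R => exact: expR_ge0
 | |- is_true (0 <= Num.sqrt _)%R => exact: sqrtr_ge0
 | |- is_true (0 <= `|_|)%R => exact: normr_ge0
 | |- is_true (0 <= _%:R)%R => exact: ler0n
 | |- is_true (0 <= _ `^ _)%R => exact: powR_ge0
 | |- is_true (0 <= pi)%R => exact: pi_ge0
 | |- is_true (0 < _ * _)%R => apply: mulr_gt0; pos
 | |- is_true (0 < _ + _)%R => first [apply: addr_gt0; pos | apply: ltr_pwDl; pos | apply: ltr_wpDl; pos]
 | |- is_true (0 < _^-1)%R => rewrite invr_gt0; pos
 | |- is_true (0 < _ ^+ _)%R => apply: exprn_gt0; pos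
 | |- is_true (0 < expR _)%R => exact: expR_gt0
 | |- is_true (0 < _%:R)%R => rewrite ltr0n; pos
 | |- is_true (0 < pi)%R => exact: pi_gt0
 | |- is_true (0 <= _ - _)%R => rewrite subr_ge0; pos
 | |- forall _, _ => move=> ?; pos
 end | by apply: ltW; assumption | by [] ].

(** * Matrices and the hyperbolic plane *)

Section matrices.
Context {R : realType}.
Implicit Types (g h : 'M[R]_2).

Definition mx2 (a b c d : R) : 'M[R]_2 :=
 \matrix_(i < 2, j < 2) if i == ord0 then (if j == ord0 then a else b)
             else (if j == ord0 then c else d).

Lemma ma_mx2 a b c d : ma (mx2 a b c d) = a. Proof. by rewrite /ma mxE. Qed.
Lemma mb_mx2 a b c d : mb (mx2 a b c d) = b. Proof. by rewrite /mb mxE. Qed.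
Lemma mc_mx2 a b c d : mc (mx2 a b c d) = c. Proof. by rewrite /mc mxE. Qed.
Lemma md_mx2 a b c d : md (mx2 a b c d) = d. Proof. by rewrite /md mxE. Qed.
Definition mx2E := (ma_mx2, mb_mx2, mc_mx2, md_mx2).

Lemma ord2P (i : 'I_2) : i = ord0 \/ i = ord_max.
Proof. by case: i => [[|[|//]] ?]; [left|right]; exact: val_inj. Qed.

Lemma mx2_eq g h : ma g = ma h -> mb g = mb h -> mc g = mc h -> md g = md h -> g = h.
Proof.
move=> h1 h2 h3 h4; apply/matrixP => i j.
by case: (ord2P i) => ->; case: (ord2P j) => ->.
Qed.

Lemma mulE g h :
 ((ma (g *m h) = ma g * ma h + mb g * mc h)%R *
 (mb (g *m h) = ma g * mb h + mb g * md h)%R *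
 (mc (g *m h) = mc g * ma h + md g * mc h)%R *
 (md (g *m h) = mc g * mb h + md g * md h)%R)%type.
Proof.
have e : @ord_max 1 = lift ord0 ord0 by exact: val_inj.
by rewrite /ma /mb /mc /md !mxE !big_ord_recl !big_ord0 !addr0 -!e.
Qed.

Lemma det2 g : \det g = ma g * md g - mb g * mc g.
Proof.
have e : @ord_max 1 = lift ord0 ord0 by exact: val_inj.
rewrite (expand_det_row _ ord0) !big_ord_recl big_ord0 addr0 /cofactor /= !det_mx11 !mxE /=.
have e1 : lift (lift ord0 ord0) ord0 = ord0 :> 'I_2 by exact: val_inj.
rewrite e1 -!e /ma /mb /mc /md; rewrite /bump /=; ring.
Qed.

Lemma oneE : ((ma (1%:M : 'M[R]_2) = 1)%R * (mb (1%:M : 'M[R]_2) = 0)%R *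
 (mc (1%:M : 'M[R]_2) = 0)%R * (md (1%:M : 'M[R]_2) = 1)%R)%type.
Proof. by rewrite /ma /mb /mc /md !mxE. Qed.

Lemma oppE g : ((ma (- g) = - ma g)%R * (mb (- g) = - mb g)%R * (mc (- g) = - mc g)%R *
 (md (- g) = - md g)%R)%type.
Proof. by rewrite /ma /mb /mc /md !mxE. Qed.

Lemma invE g : \det g = 1 -> ((ma (invmx g) = md g)%R * (mb (invmx g) = - mb g)%R *
 (mc (invmx g) = - mc g)%R * (md (invmx g) = ma g)%R)%type.
Proof.
move=> dg; have -> : invmx g = mx2 (md g) (- mb g) (- mc g) (ma g).
 have ug : g \in unitmx by rewrite unitmxE dg unitr1.
 apply: (can_inj (mulKmx ug)); rewrite mulmxV //.
 move: dg; rewrite det2 => dg.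
 by apply: mx2_eq; rewrite !mulE !mx2E !oneE; lra.
by rewrite !mx2E.
Qed.

Lemma det_unit g : \det g = 1 -> g \in unitmx.
Proof. by move=> dg; rewrite unitmxE dg unitr1. Qed.

Lemma det_inv1 g : \det g = 1 -> \det (invmx g) = 1.
Proof. by move=> dg; rewrite det_inv dg invr1. Qed.

Lemma det_mul1 g h : \det g = 1 -> \det h = 1 -> \det (g *m h) = 1.
Proof. by move=> dg dh; rewrite det_mulmx dg dh mulr1. Qed.

End matrices.

Section plane.
Context {R : realType}.
Notation P := (plane R).
Implicit Types (g h : 'M[R]_2) (z w x : P) (v : R * R).

(* The point [x + i y] of the upper half plane is encoded as [(x / y, ln y)], which turns
  hyperbolic area into Lebesgue measure. In terms of the positive definite form
  [y^-1 (|z|^2, x; x, 1)] attached to the point, [al = y^-1], [be = x / y], [ga = |z|^2 / y],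
  and [SL_2] acts linearly on [(al, be, ga)]. *)
Definition al z : R := expR (- z.2 : R).
Definition be z : R := z.1.
Definition ga z : R := (1 + (z.1 : R) ^+ 2) * expR z.2.

Definition act g z : P :=
 (ma g * mc g * ga z + (ma g * md g + mb g * mc g) * be z + mb g * md g * al z,
  - ln (mc g ^+ 2 * ga z + 2 * mc g * md g * be z + md g ^+ 2 * al z)).

Lemma al_gt0 z : 0 < al z. Proof. exact: expR_gt0. Qed.
Lemma ga_gt0 z : 0 < ga z.
Proof. by rewrite mulr_gt0 ?expR_gt0 // ltr_pwDl // sqr_ge0. Qed.
Lemma al_ga z : al z * ga z = 1 + be z ^+ 2.
Proof. by rewrite /al /ga mulrCA expRN mulVf ?mulr1 // gt_eqF ?expR_gt0. Qed.

Lemma plane_eq z w : al z = al w -> be z = be w -> z = w.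
Proof.
case: z w => [t v] [t' v']; rewrite /al /be /= => /expR_inj /oppr_inj -> -> //.
Qed.

(** Multiplied by [al z], the form becomes [(al z * d + be z * c)^2 + c^2], since
    [al * ga = 1 + be^2]. *)
Lemma den_gt0 g z : \det g = 1 ->
 0 < mc g ^+ 2 * ga z + 2 * mc g * md g * be z + md g ^+ 2 * al z.
Proof.
rewrite det2 => dg; have a0 := al_gt0 z.
have [c0|c0] := eqVneq (mc g) 0.
 rewrite c0 expr0n /= !mul0r mulr0 !mul0r !add0r mulr_gt0 // exprn_even_gt0 //=.
 by apply/eqP => d0; move: dg; rewrite c0 d0; lra.
rewrite -(pmulr_rgt0 _ a0).
have -> : al z * (mc g ^+ 2 * ga z + 2 * mc g * md g * be z + md g ^+ 2 * al z) =
 (al z * md g + be z * mc g) ^+ 2 + mc g ^+ 2.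
 have := al_ga z => e.
 rewrite (_ : al z * _ = mc g ^+ 2 * (al z * ga z) + al z * (2 * mc g * md g * be z + md g ^+ 2 * al z)); last by ring.
 by rewrite e; ring.
by rewrite ltr_wpDl ?sqr_ge0 // exprn_even_gt0.
Qed.

Lemma al_act g z : \det g = 1 ->
 al (act g z) = mc g ^+ 2 * ga z + 2 * mc g * md g * be z + md g ^+ 2 * al z.
Proof. by move=> dg; rewrite /al /= opprK lnK // posrE den_gt0. Qed.

Lemma be_act g z :
 be (act g z) = ma g * mc g * ga z + (ma g * md g + mb g * mc g) * be z + mb g * md g * al z.
Proof. by []. Qed.

Lemma ga_act g z : \det g = 1 ->
 ga (act g z) = ma g ^+ 2 * ga z + 2 * ma g * mb g * be z + mb g ^+ 2 * al z.
Proof.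
move=> dg; apply: (@mulfI _ (al (act g z))); first by rewrite gt_eqF ?al_gt0.
rewrite al_ga be_act al_act //; move: dg (al_ga z); rewrite det2 => dg e.
apply/esym/eqP; rewrite -subr_eq0; apply/eqP.
transitivity ((ma g * md g - mb g * mc g) ^+ 2 * (al z * ga z - be z ^+ 2) - 1); first by ring.
by rewrite dg e; ring.
Qed.

Lemma act_mul g h z : \det g = 1 -> \det h = 1 -> act (g *m h) z = act g (act h z).
Proof.
move=> dg dh; have dgh := det_mul1 _ _ dg dh.
by apply: plane_eq; [rewrite !al_act // be_act ga_act // !mulE; ring|
 rewrite be_act [RHS]be_act ga_act // al_act // be_act !mulE; ring].
Qed.

Lemma act1 z : act 1%:M z = z.
Proof. by apply: plane_eq; rewrite ?al_act ?det1 // ?be_act !oneE; ring. Qed.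

Lemma act_opp g z : act (- g) z = act g z.
Proof. by rewrite /act !oppE; congr pair; [ring|congr (- ln _); ring]. Qed.

Lemma actK g z : \det g = 1 -> act (invmx g) (act g z) = z.
Proof. by move=> dg; rewrite -act_mul ?det_inv1 // mulVmx ?det_unit // act1. Qed.

Lemma actVK g z : \det g = 1 -> act g (act (invmx g) z) = z.
Proof. by move=> dg; rewrite -act_mul ?det_inv1 // mulmxV ?det_unit // act1. Qed.

(** Decodes the coordinates: [(t, v)] stands for the point with real part [t * exp v] and imaginary
    part [exp v]. *)
Definition Phi z : P := ((z.1 : R) * expR z.2, expR z.2).

Lemma mobius_Phi g z : \det g = 1 -> mobius g (Phi z) = Phi (act g z).
Proof.
move=> dg; rewrite /mobius /Phi.
have e0 : expR (z.2 : R) != 0 by rewrite gt_eqF ?expR_gt0.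
have eal : al z = (expR z.2)^-1 by rewrite /al expRN.
have ega : ga z = (1 + (z.1 : R) ^+ 2) * expR z.2 by [].
have e2 : expR (act g z).2 = (al (act g z))^-1 by rewrite /al expRN invrK.
have den0 := den_gt0 g z dg; have := al_act g z dg => eA.
rewrite -eA in den0.
have -> : (mc g * ((z.1 : R) * expR z.2) + md g) ^+ 2 + (mc g * expR z.2) ^+ 2 =
  al (act g z) * expR z.2.
 by rewrite eA eal ega /be; field.
have A0 : al (act g z) != 0 by rewrite gt_eqF.
rewrite e2 -[(act g z).1]/(be (act g z)) be_act eal ega /be.
congr pair; last by field; rewrite A0 e0.
by field; rewrite A0 e0.
Qed.

Definition orig : P := (0, 0).

Lemma al_orig : al orig = 1. Proof. by rewrite /al /= oppr0 expR0. Qed.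
Lemma be_orig : be orig = 0. Proof. by []. Qed.
Lemma ga_orig : ga orig = 1. Proof. by rewrite /ga /= expR0 expr0n addr0 mulr1. Qed.
Definition origE := (al_orig, be_orig, ga_orig).

(* [a^2 al + c^2 ga - 2 a c be] is [|g^-1 (a, c)|^2] for any [g] with [act g orig = z]. *)
Definition D v z : R := v.1 ^+ 2 * al z - 2 * v.1 * v.2 * be z + v.2 ^+ 2 * ga z.

Definition mulv g v : R * R := (ma g * v.1 + mb g * v.2, mc g * v.1 + md g * v.2).

Lemma D_act g v z : \det g = 1 -> D (mulv g v) (act g z) = D v z.
Proof.
move=> dg; rewrite /D al_act // be_act ga_act //=; move: dg; rewrite det2 => dg.
transitivity ((ma g * md g - mb g * mc g) ^+ 2 *
 (v.1 ^+ 2 * al z - 2 * v.1 * v.2 * be z + v.2 ^+ 2 * ga z)); first by ring.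
by rewrite dg expr1n mul1r.
Qed.

Lemma mulv_mul g h v : mulv (g *m h) v = mulv g (mulv h v).
Proof. by rewrite /mulv !mulE /=; congr pair; ring. Qed.
Lemma mulv1 v : mulv 1%:M v = v.
Proof. by rewrite /mulv !oneE !mul0r !mul1r addr0 add0r -surjective_pairing. Qed.

(* [bd z w] is twice the hyperbolic cosine of the distance. *)
Definition bd z w : R := ga z * al w + al z * ga w - 2 * be z * be w.

Lemma bdC z w : bd z w = bd w z. Proof. by rewrite /bd; ring. Qed.

Lemma bd_act g z w : \det g = 1 -> bd (act g z) (act g w) = bd z w.
Proof.
move=> dg; rewrite /bd !al_act // !be_act !ga_act //; move: dg; rewrite det2 => dg.
transitivity ((ma g * md g - mb g * mc g) ^+ 2 *
 (ga z * al w + al z * ga w - 2 * be z * be w)); first by ring.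
by rewrite dg expr1n mul1r.
Qed.

Lemma bd_orig w : bd orig w = al w + ga w.
Proof. by rewrite /bd !origE; ring. Qed.

(** An upper triangular matrix carrying [orig] to [z]; translating or conjugating by it reduces
    estimates at [z] to estimates at [orig]. *)
Definition gz z : 'M[R]_2 :=
 mx2 (expR ((z.2 : R) / 2)) ((z.1 : R) * expR ((z.2 : R) / 2)) 0 (expR (- (z.2 : R) / 2)).

Lemma gz_det z : \det (gz z) = 1.
Proof. by rewrite det2 !mx2E -expRD mulr0 subr0 -mulrDl subrr mul0r expR0. Qed.

Lemma gz_orig z : act (gz z) orig = z.
Proof.
apply: plane_eq; rewrite ?al_act ?gz_det // ?be_act !mx2E !origE.
 rewrite /al expr0n /= !mulr0 !mul0r !add0r mulr1 expr2 -expRD; congr expR; lra.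
rewrite mulr0 mul0r add0r mulr0 add0r mulr1 -mulrA -expRD -mulrDl subrr mul0r expR0 mulr1 //.
Qed.

Lemma bd_reduce z w : bd z w = bd orig (act (invmx (gz z)) w).
Proof. by rewrite -{1}(gz_orig z) -{1}(actVK (gz z) w (gz_det z)) bd_act ?gz_det. Qed.

Lemma bd_ge2 z w : 2 <= bd z w.
Proof.
rewrite bd_reduce bd_orig; set x := act _ _.
have := al_gt0 x; have := ga_gt0 x; have := al_ga x; set a := al x; set c := ga x => e c0 a0.
have : 0 <= (a - c) ^+ 2 by exact: sqr_ge0.
have : 0 <= be x ^+ 2 by exact: sqr_ge0.
move=> h1 h2; rewrite -(@ler_pXn2r _ 2%N) ?nnegrE //; last by rewrite addr_ge0 // ltW.
have : 4 * (a * c) >= 4 by rewrite e; lra.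
have -> : (a + c) ^+ 2 = (a - c) ^+ 2 + 4 * (a * c) by ring.
lra.
Qed.

Lemma bd_gt0 z w : 0 < bd z w.
Proof. exact: lt_le_trans (bd_ge2 z w). Qed.

Lemma sqr_le_le (x y : R) : 0 <= y -> x ^+ 2 <= y ^+ 2 -> x <= y.
Proof.
move=> y0 h; have [x0|/ltW x0] := leP 0 x; last exact: le_trans y0.
by rewrite -(@ler_pXn2r _ 2%N) ?nnegrE.
Qed.

(** The triangle inequality in multiplicative form, from [cosh (a + b) <= 2 cosh a cosh b]. Once the
    middle point is moved to [orig], what remains is [- 2 be be' <= al al' + ga ga'], which follows
    by squaring from [al * ga = 1 + be^2]. *)
Lemma bd_triangle z x w : bd z w <= bd z x * bd x w.
Proof.
rewrite (bdC z x) -(bd_act (invmx (gz x)) z w) ?det_inv1 ?gz_det // (bd_reduce x z) (bd_reduce x w).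
move: (act _ z) (act _ w) => {}z {}w; rewrite !bd_orig /bd.
have az := al_gt0 z; have gz := ga_gt0 z; have ez := al_ga z.
have aw := al_gt0 w; have gw := ga_gt0 w; have ew := al_ga w.
suff : - (2 * be z * be w) <= al z * al w + ga z * ga w by nra.
apply: sqr_le_le; first by rewrite addr_ge0 // mulr_ge0 ?ltW.
have -> : (al z * al w + ga z * ga w) ^+ 2 = (al z * al w - ga z * ga w) ^+ 2 + 4 * ((al z * ga z) * (al w * ga w)) by ring.
rewrite ez ew.
have := sqr_ge0 (al z * al w - ga z * ga w).
have := sqr_ge0 (be z); have := sqr_ge0 (be w); nra.
Qed.

(* [NN z A] is the squared Frobenius norm of the traceless part of [g^-1 A g], where
  [act g orig = z]; it measures how far [A] moves the point [z]. *)
Definition NN z (A : 'M[R]_2) : R :=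
 (mb A * al z + (ma A - md A) * be z - mc A * ga z) ^+ 2
 + 2 * (((ma A - md A) / 2) ^+ 2 + mb A * mc A).

Lemma NN_act g z A : \det g = 1 -> NN (act g z) (g *m A *m invmx g) = NN z A.
Proof.
move=> dg; rewrite /NN al_act // be_act ga_act // !mulE !(invE g dg) //.
move: dg; rewrite det2 => dg.
move: (ma g) (mb g) (mc g) (md g) dg => a b c d dg.
move: (ma A) (mb A) (mc A) (md A) (al z) (be z) (ga z) => p q r s u v w.
transitivity ((a * d - b * c) ^+ 4 * (q * u + (p - s) * v - r * w) ^+ 2 +
 2 * ((a * d - b * c) ^+ 2 * (((p - s) / 2) ^+ 2 + q * r))); first by field.
by rewrite dg !expr1n !mul1r.
Qed.

Lemma NN_orig A : NN orig A = 2 * ((ma A - md A) / 2) ^+ 2 + mb A ^+ 2 + mc A ^+ 2.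
Proof. by rewrite /NN !origE; field. Qed.

Lemma NN_reduce z A : NN z A = NN orig (invmx (gz z) *m A *m gz z).
Proof.
rewrite -[in LHS](gz_orig z) -[in LHS](NN_act (invmx (gz z))) ?det_inv1 ?gz_det //.
by rewrite actK ?gz_det // invmxK.
Qed.

Lemma NN_ge0 z A : 0 <= NN z A.
Proof. rewrite NN_reduce NN_orig; move: (sqr_ge0 ((ma (invmx (gz z) *m A *m gz z) - md (invmx (gz z) *m A *m gz z)) / 2)) (sqr_ge0 (mb (invmx (gz z) *m A *m gz z))) (sqr_ge0 (mc (invmx (gz z) *m A *m gz z))) => h1 h2 h3; lra. Qed.

Lemma NN_opp z A : NN z (- A) = NN z A.
Proof. by rewrite /NN !oppE; field. Qed.

(** With [w] moved to [orig], Cauchy-Schwarz bounds the square in [NN] by the norm of the traceless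
    part times [al^2 + 2 be^2 + ga^2]. This sum equals [(al + ga)^2 - 2], and the missing 2 absorbs
    the determinant term. *)
Lemma NN_ratio z w A : NN z A <= bd z w ^+ 2 * NN w A.
Proof.
rewrite -(NN_act (invmx (gz w)) z) ?det_inv1 ?gz_det // -(NN_act (invmx (gz w)) w) ?det_inv1 ?gz_det //.
have -> : act (invmx (gz w)) w = orig by rewrite -{2}(gz_orig w) actK ?gz_det.
rewrite (bdC z w) bd_reduce.
move: (invmx _ *m A *m _) (act _ z) => {}A {}z; rewrite NN_orig bd_orig.
have az := al_gt0 z; have gz := ga_gt0 z; have ez := al_ga z; rewrite /NN.
move: az gz ez; move: (al z) (be z) (ga z) => u v w0 u0 w1 e.
set p := (ma A - md A) / 2; have -> : ma A - md A = 2 * p by rewrite /p; field.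
move: p (mb A) (mc A) => p q r.
have h : (q * u + 2 * p * v - r * w0) ^+ 2 <= (2 * p ^+ 2 + q ^+ 2 + r ^+ 2) * (u ^+ 2 + 2 * v ^+ 2 + w0 ^+ 2).
 have h1 := sqr_ge0 (q * v * 2 - 2 * p * u); have h2 := sqr_ge0 (q * w0 + r * u).
 have h3 := sqr_ge0 (2 * p * w0 + r * v * 2).
 nra.
have -> : (u + w0) ^+ 2 = u ^+ 2 + 2 * v ^+ 2 + w0 ^+ 2 + 2 by (have -> : (u + w0) ^+ 2 = u^+2 + 2 * (u * w0) + w0 ^+ 2 by ring); rewrite e; ring.
have h4 : 2 * (p ^+ 2 + q * r) <= 2 * (2 * p ^+ 2 + q ^+ 2 + r ^+ 2).
 have := sqr_ge0 (q - r); have := sqr_ge0 p; have := sqr_ge0 q; have := sqr_ge0 r; nra.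
nra.
Qed.

End plane.

(** * Integration in the plane *)

Section measurability.
Context {R : realType}.

Lemma measurable_boolR : mfunT (fun b : bool => (b%:R : R)).
Proof. by move=> _ B _; rewrite setTI. Qed.

Lemma measurable_fun_natb d (T : measurableType d) (D : set T) (f : T -> bool) :
 measurable_fun D f -> measurable_fun D (fun x => ((f x)%:R : R)).
Proof. exact: measurableT_comp measurable_boolR. Qed.

Lemma measurable_fun_inv d (T : measurableType d) (f : T -> R) :
 (forall x, 0 < f x) -> mfunT f -> mfunT (fun x => (f x)^-1).
Proof.
move=> f0 mf; rewrite (_ : (fun x => _) = expR \o -%R \o (@ln R) \o f); last first.
 by apply/funext => x /=; rewrite expRN lnK // posrE.
apply: measurableT_comp mf; apply: measurableT_comp; last exact: measurable_ln.
by apply: measurableT_comp; [exact: measurable_expR|exact: oppr_measurable].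
Qed.

Lemma measurable_fun_lte d (T : measurableType d) (f : T -> R) (g : T -> \bar R) :
 mfunT f -> mfunT g ->
 mfunT (fun x => ((f x)%:E < g x)%E).
Proof.
move=> mf' mg; apply: (measurable_fun_bool true).
rewrite (_ : _ @^-1` _ = [set x | (0 < g x - (f x)%:E)%E]); last first.
 by apply/seteqP; split => x /=; case: (g x) => [r| |] //=; rewrite ?ltry // -EFinB !lte_fin subr_gt0.
apply: emeasurable_fun_o_infty => //; apply: emeasurable_funB => //.
exact/measurable_EFinP.
Qed.

End measurability.
Arguments measurable_fun_lte {R d T f g}.
Arguments measurable_fun_natb {R d T D f}.

Ltac mf :=
 lazymatch goal with
 | |- measurable_fun _ (fun _ => ?c) => exact (@measurable_cst _ _ _ _ _ c)
 | |- measurable_fun _ (fun x => @?f x + @?g x)%R => apply: (measurable_funD (f := f) (g := g)); mf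
 | |- measurable_fun _ (fun x => @?f x - @?g x)%R => apply: (measurable_funB (f := f) (g := g)); mf
 | |- measurable_fun _ (fun x => - @?f x)%R => apply: (measurable_funN (f := f)); mf
 | |- measurable_fun _ (fun x => @?f x * @?g x)%R => apply: (measurable_funM (f := f) (g := g)); mf
 | |- measurable_fun _ (fun x => @?f x ^+ _)%R => apply: (measurable_funX (f := f)); mf
 | |- measurable_fun _ (fun x => expR (@?f x)) =>
   apply: (@measurableT_comp _ _ _ _ _ _ (@expR _) _ f); [exact: measurable_expR|mf]
 | |- measurable_fun _ (fun x => ln (@?f x)) =>
   apply: (@measurableT_comp _ _ _ _ _ _ (@ln _) _ f); [exact: measurable_ln|mf]
 | |- measurable_fun _ (fun x => (@?f x) `^ _)%R =>
   apply: (@measurableT_comp _ _ _ _ _ _ (@powR _ ^~ _) _ f); [exact: measurable_powR|mf]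
 | |- measurable_fun _ (fun x => (@?f x)%:E) => apply/measurable_EFinP; rewrite /comp /=; mf
 | |- measurable_fun _ (fun x => (@?f x + @?g x)%E) => apply: (emeasurable_funD (f := f) (g := g)); mf
 | |- measurable_fun _ (fun x => (@?f x * @?g x)%E) => apply: (emeasurable_funM (f := f) (g := g)); mf
 | |- measurable_fun _ (fun x => (nat_of_bool (@?f x))%:R) =>
   apply: (measurable_fun_natb (f := f)); mf
 | |- measurable_fun _ (fun x => (@?f x) && (@?g x)) => apply: (measurable_and (f := f) (g := g)); mf
 | |- measurable_fun _ (fun x => ~~ (@?f x)) => apply: (measurable_neg (f := f)); mf
 | |- measurable_fun _ (fun x => (@?f x < @?g x)%R) => apply: (measurable_fun_ltr (f := f) (g := g)); mf
 | |- measurable_fun _ (fun x => (@?f x <= @?g x)%R) => apply: (measurable_fun_ler (f := f) (g := g)); mf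
 | |- measurable_fun _ (fun x => ((@?f x)%:E < @?g x)%E) => apply: (measurable_fun_lte (f := f) (g := g)); mf
 | |- measurable_fun _ (fun x => (@?f x, @?g x)) => apply: (measurable_fun_pair (f := f) (g := g)); mf
 | |- measurable_fun _ (fun x => (@?f x).1) =>
   first [exact: measurable_fst | apply: (@measurableT_comp _ _ _ _ _ _ fst _ f); [exact: measurable_fst|mf]]
 | |- measurable_fun _ (fun x => (@?f x).2) =>
   first [exact: measurable_snd | apply: (@measurableT_comp _ _ _ _ _ _ snd _ f); [exact: measurable_snd|mf]]
 | |- measurable_fun _ (fun x => x) => exact: measurable_id
 | |- measurable_fun _ (fun x => ?h (@?f x)) =>
   first [assumption | by eauto with mfdb | apply: (@measurableT_comp _ _ _ _ _ _ h _ f);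
    [first [assumption | by eauto with mfdb | idtac]|mf] | idtac]
 | |- _ => first [assumption | by eauto with mfdb | idtac]
 end.
#[global] Hint Resolve measurable_indic measurable_itv measurable_funTS : mfdb.

Lemma tonelli {R : realType} d1 d2 (T1 : measurableType d1) (T2 : measurableType d2)
  (m1 : {sigma_finite_measure set T1 -> \bar R}) (m2 : {sigma_finite_measure set T2 -> \bar R})
  (f : T1 -> T2 -> \bar R) :
 mfunT (fun z : T1 * T2 => f z.1 z.2) -> (forall x y, (0 <= f x y)%E) ->
 (\int[m1]_x \int[m2]_y f x y = \int[m2]_y \int[m1]_x f x y)%E.
Proof. by move=> mf' f0; rewrite (fubini_tonelli (fun z => f z.1 z.2)). Qed.

Lemma measurable_preim {R : realType} (phi : R -> R) (A : set (measurableTypeR R)) :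
 mfunT phi -> measurable A -> measurable (phi @^-1` A : set (measurableTypeR R)).
Proof. by move=> mphi mA; rewrite -[X in measurable X]setTI; exact: mphi. Qed.

(** * Change of variables for nonnegative functions on the line *)

Section substitution.
Context {R : realType}.
Notation L1 := (@lebesgue_measure R).
Local Open Scope ereal_scope.
Context (phi rho : R -> R) (D : set R)
 (mphi : mfunT phi) (mrho : mfunT rho)
 (rho0 : forall x, (0 <= rho x)%R) (mD : measurable D).
Hypothesis phi_itv : forall a b : R, (a < b)%R ->
 \int[L1]_(x in phi @^-1` `]a, b]) (rho x)%:E = L1 (`]a, b] `&` D).

Let nu (A : set (measurableTypeR R)) : \bar R := \int[L1]_(x in phi @^-1` A) (rho x)%:E.

Let nu0 : nu set0 = 0.
Proof. by rewrite /nu preimage_set0 integral_set0. Qed.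

Let nu_ge0 A : 0 <= nu A.
Proof. by apply: integral_ge0 => x _; rewrite lee_fin. Qed.

Let mpre A : measurable A -> measurable (phi @^-1` A).
Proof. by move=> mA; rewrite -[X in measurable X]setTI; exact: mphi. Qed.

Let nu_sigma_additive : semi_sigma_additive nu.
Proof.
move=> /= F mF tF mUF; rewrite /nu; apply: cvg_toP.
 apply: ereal_nondecreasing_is_cvgn => m n mn.
 by apply: lee_sum_nneg_natr => // k _ _; exact: nu_ge0.
rewrite preimage_bigcup ge0_integral_bigcup//=.
- by move=> k; apply: mpre; exact: mF.
- by apply/measurable_funTS/measurable_EFinP.
- by move=> x _; rewrite lee_fin.
- by apply/trivIsetP => i j _ _ ij; rewrite -preimage_setI; move/trivIsetP: tF => ->; rewrite ?preimage_set0.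
Qed.

HB.instance Definition _ := isMeasure.Build _ _ _ nu nu0 nu_ge0 nu_sigma_additive.

(** Both sides are measures that agree on half-open intervals, which are stable under intersection
    and generate the Borel sets; the intervals [g k] exhaust the line with finite mass. *)
Let nuE A : measurable A -> nu A = L1 (A `&` D).
Proof.
move=> mA; pose g (k : nat) : set (measurableTypeR R) := [set` `](- k%:R)%R, (k%:R : R)%R] ].
rewrite -[RHS]/(mrestr L1 mD A).
apply: (@measure_unique _ R (measurableTypeR R) (@ocitv R) g _ _ _ _ nu (mrestr L1 mD)) => //.
- by move=> B C mB mC; exact: (@measurableI _ (lebesgue_stieltjes_measure.ocitv_type R)).
- by move=> k; exists ((- k%:R)%R, k%:R).
- rewrite -subTset => x _ /=; exists (Num.bound `|x|) => //=.
 have := archi_boundP (normr_ge0 x); rewrite /g /= in_itv /= => h.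
 by move: h; rewrite ltr_norml => /andP[-> /ltW ->].
- move=> B [[a b]] /= _ <-; have [ab|ab] := ltP a b; first by rewrite /nu phi_itv.
 by rewrite set_itv_ge ?nu0 ?measure0 // -leNgt bnd_simp.
- move=> k; apply: (@le_lt_trans _ _ (L1 (g k))).
  rewrite /= /nu; have [->|k0] := eqVneq k 0%N.
   by rewrite /g oppr0 set_itvoc0 preimage_set0 integral_set0.
  rewrite phi_itv; last by rewrite -subr_gt0 opprK addr_gt0 ?ltr0n ?lt0n.
  by apply: measureIl => //; exact: measurable_itv.
 by rewrite /g /= lebesgue_measure_itv; case: ifP => _; rewrite ?ltry.
Qed.

Let ind (h : R -> \bar R) (s y : R) : \bar R := (((0 < s)%R && (s%:E < h y)%E)%:R)%:E.

(** The layer-cake formula: the levels [s] with [0 < s < h y] form an interval of length [h y], also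
    when [h y] is infinite. *)
Let layer (h : R -> \bar R) (y : R) : 0 <= h y -> \int[L1]_s ind h s y = h y.
Proof.
move=> h0; rewrite /ind.
rewrite (_ : (fun s => _) = (fun s => (\1_[set s : R | (0 < s)%R && (s%:E < h y)%E] s)%:E)); last first.
 by apply/funext => s; rewrite indicE; congr (_%:R)%:E; apply/esym; congr nat_of_bool; rewrite mem_setE.
have [[r hr]|hy] : (exists r, h y = r%:E) \/ h y = +oo.
 by move: h0; case: (h y) => [r|//|//] _; [left; exists r|right].
- rewrite (_ : [set _ | _] = `]0%R, r[%classic); last first.
  by apply/seteqP; split => s /=; rewrite hr in_itv /= lte_fin.
 rewrite integral_indic // setIT /= lebesgue_measure_itv /= hr lte_fin; case: ifPn => r0; first by rewrite sube0.
 by move: h0; rewrite hr lee_fin => h0; congr (_%:E); apply/eqP; rewrite eq_le h0 leNgt r0.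
- rewrite (_ : [set _ | _] = `]0%R, +oo[%classic); last first.
  by apply/seteqP; split => s /=; rewrite hy in_itv /= ltry.
 by rewrite integral_indic // setIT /= lebesgue_measure_itv /= ltry hy.
Qed.

(** The layer-cake formula reduces the identity to indicators of superlevel sets, where it is [nuE];
    Tonelli exchanges level and point on both sides. *)
Lemma ge0_integral_subst (h : R -> \bar R) : mfunT h -> (forall y, 0 <= h y) ->
 \int[L1]_x (h (phi x) * (rho x)%:E) = \int[L1]_(x in D) h x.
Proof.
move=> mh h0.
have mi : mfunT (fun z : plane R => ind h z.1 z.2).
 rewrite /ind; mf.
have mi2 (f : R -> R) : mfunT f ->
  mfunT (fun z : plane R => ind h z.2 (f z.1)).
 move=> mf'; exact: (measurableT_comp mi (measurable_fun_pair measurable_snd (measurableT_comp mf' measurable_fst))).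
have i0 s y : 0 <= ind h s y by rewrite lee_fin ler0n.
have mset s : measurable [set y | (0 < s)%R && (s%:E < h y)%E].
 have [s0|s0] := ltP 0%R s; last by rewrite (_ : [set _ | _] = set0) //; apply/seteqP; split => y //=; rewrite ltNge s0.
 by rewrite /= -[X in measurable X]setTI; apply: emeasurable_fun_o_infty.
have indE s y : ind h s y = (\1_[set y | (0 < s)%R && (s%:E < h y)%E] y)%:E.
 by rewrite /ind indicE; congr (_%:R)%:E; apply/esym; congr nat_of_bool; rewrite mem_setE.
transitivity (\int[L1]_x \int[L1]_s (ind h s (phi x) * (rho x)%:E)).
 apply: eq_integral => x _; rewrite ge0_integralZr ?lee_fin ?layer //.
 by rewrite /ind; mf.
rewrite tonelli; first last.
- by move=> x y; rewrite mule_ge0 ?lee_fin.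
- by apply: emeasurable_funM; [exact: mi2|mf].
transitivity (\int[L1]_s \int[L1]_(x in D) ind h s x).
 apply: eq_integral => s _ /=.
 under [RHS]eq_integral do rewrite indE.
 rewrite (_ : \int[L1]_(x in D) _ = L1 ([set y | (0 < s)%R && (s%:E < h y)%E] `&` D)); last first.
  by rewrite (integral_indic L1 mD (mset s)).
 rewrite -(nuE _ (mset s)) /nu [RHS]integral_mkcond /=.
 apply: eq_integral => x _; rewrite indE patchE indicE.
 rewrite (_ : (phi x \in _) = (x \in phi @^-1` [set y | (0 < s)%R && (s%:E < h y)%E])); last by rewrite !mem_setE.
 by case: ifP => _; rewrite ?mul1e ?mul0e.
under eq_integral do rewrite integral_mkcond.
rewrite [RHS]integral_mkcond.
rewrite tonelli; first last.
- by move=> x y; rewrite patchE; case: ifP.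
- rewrite (_ : (fun z => _) = (fun z => ind h z.1 z.2 * (\1_D z.2)%:E)).
  have m1 : mfunT (\1_D : R -> R) by exact: measurable_indic.
  by mf.
 by apply/funext => z; rewrite patchE indicE; case: ifP => _; rewrite ?mule1 ?mule0.
apply: eq_integral => y _ /=; rewrite patchE; case: ifP => yD.
 by under eq_integral do rewrite patchE yD; rewrite layer.
by under eq_integral do rewrite patchE yD; rewrite integral0.
Qed.

End substitution.

Section lebesgue.
Context {R : realType}.
Notation L1 := (@lebesgue_measure R).
Local Open Scope ereal_scope.
Implicit Types (f : R -> \bar R).

Lemma itv_measure (a b : R) : (a < b)%R -> L1 `]a, b]%classic = (b - a)%:E.
Proof. by move=> ab; rewrite lebesgue_measure_itv /= lte_fin ab EFinB. Qed.

Lemma integral_translate (c : R) f : mfunT f -> (forall y, 0 <= f y) ->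
 \int[L1]_x f (x + c)%R = \int[L1]_x f x.
Proof.
move=> mf' f0; rewrite -[RHS](@ge0_integral_subst R (fun x => x + c)%R (cst 1%R) setT) //.
- by apply: eq_integral => x _; rewrite mule1.
- mf.
- move=> a b ab; rewrite setIT itv_measure // (integral_cst L1 _ 1%:E) //=; last first.
  by apply: measurable_preim => //; mf.
 rewrite mul1e (_ : _ @^-1` _ = `](a - c)%R, (b - c)%R]%classic).
  by rewrite itv_measure ?ltrD2r //; congr (_%:E); rewrite opprB addrA subrK.
 by apply/seteqP; split => x /=; rewrite !in_itv /= ltrBlDr lerBrDr.
Qed.

Lemma integral_reflect f : mfunT f -> (forall y, 0 <= f y) ->
 \int[L1]_x f (- x)%R = \int[L1]_x f x.
Proof.
move=> mf' f0; rewrite -[RHS](@ge0_integral_subst R (fun x => - x)%R (cst 1%R) setT) //.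
- by apply: eq_integral => x _; rewrite mule1.
- mf.
- move=> a b ab; rewrite setIT itv_measure // (integral_cst L1 _ 1%:E) //=; last first.
  by apply: measurable_preim => //; mf.
 rewrite mul1e (_ : _ @^-1` _ = `[(- b)%R, (- a)%R[%classic).
  by rewrite lebesgue_measure_itv /= lte_fin ltrN2 ab -EFinB; congr (_%:E); rewrite opprK addrC.
 by apply/seteqP; split => x /=; rewrite !in_itv /= ltrNr lerNl andbC.
Qed.

Lemma integral_scale (c : R) f : (0 < c)%R -> mfunT f -> (forall y, 0 <= f y) ->
 \int[L1]_x (f (c * x)%R * c%:E) = \int[L1]_x f x.
Proof.
move=> c0 mf' f0; rewrite (@ge0_integral_subst R (fun x => c * x)%R (cst c) setT) //.
- mf.
- by move=> x; exact: ltW.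
- move=> a b ab; rewrite setIT itv_measure // (integral_cst L1 _ c%:E) //=; last first.
  by apply: measurable_preim => //; mf.
 rewrite (_ : _ @^-1` _ = `](a / c)%R, (b / c)%R]%classic).
  rewrite itv_measure ?ltr_pM2r ?invr_gt0 // -EFinM; congr (_%:E).
  by rewrite -mulrBl mulrC divfK ?gt_eqF.
 by apply/seteqP; split => x /=; rewrite !in_itv /= ltr_pdivrMr // ler_pdivlMr // ![(x * c)%R]mulrC.
Qed.

Lemma integral_expR f : mfunT f -> (forall y, 0 <= f y) ->
 \int[L1]_x (f (expR x) * (expR x)%:E) = \int[L1]_(y in `]0%R, +oo[) f y.
Proof.
move=> mf' f0; rewrite (@ge0_integral_subst R expR expR `]0%R, +oo[%classic) //.
- move=> a b ab; have [b0|b0] := leP b 0%R.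
  rewrite (_ : _ @^-1` _ = set0); last first.
   by apply/seteqP; split => x //=; rewrite in_itv /= leNgt (le_lt_trans b0 (expR_gt0 _)) andbF.
  rewrite integral_set0 (_ : _ `&` _ = set0) ?measure0 //.
  by apply/seteqP; split => x //= []; rewrite !in_itv /= andbT => /andP[_ xb] x0; move: (lt_le_trans x0 (le_trans xb b0)); rewrite ltxx.
 have FTC (c : R) : (c < ln b)%R -> \int[L1]_(x in `]c, (ln b)]) (expR x)%:E = (b - expR c)%:E.
  move=> cb; rewrite integral_itv_obnd_cbnd; last by apply: measurable_funTS; apply/measurable_EFinP; exact: measurable_expR.
  rewrite (@continuous_FTC2 _ _ expR) //.
  + by rewrite lnK ?posrE // EFinB.
  + by apply: continuous_subspaceT => x; exact: continuous_expR.
  + split => [x _||]; first exact: derivable_expR.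
    by apply: cvg_at_right_filter; exact: continuous_expR.
   by apply: cvg_at_left_filter; exact: continuous_expR.
  + by move=> x _; rewrite derive1E; exact: (@derive_val _ _ _ _ _ _ _ (is_derive_expR x)).
 have lb x : (expR x <= b)%R = (x <= ln b)%R by rewrite -[X in (_ <= X)%R]lnK ?posrE // ler_expR.
 have [a0|a0] := ltP 0%R a.
  rewrite (_ : _ `&` _ = `]a, b]%classic); last first.
   by apply/seteqP; split => x /=; rewrite !in_itv /= ?andbT; [case|move=> /andP[ax ->]; rewrite ax (lt_trans a0 ax)].
  rewrite (_ : _ @^-1` _ = `](ln a), (ln b)]%classic); last first.
   have la x : (a < expR x)%R = (ln a < x)%R by rewrite -[X in (X < _)%R]lnK ?posrE // ltr_expR.
   by apply/seteqP; split => x /=; rewrite !in_itv /= la lb.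
  by rewrite FTC ?ltr_ln ?posrE // itv_measure // lnK ?posrE.
 rewrite (_ : _ `&` _ = `]0%R, b]%classic); last first.
  apply/seteqP; split => x /=; rewrite !in_itv /= ?andbT; first by case=> /andP[_ ->] ->.
  by move=> /andP[x0 ->]; rewrite x0 (le_lt_trans a0 x0).
 (* For [a <= 0 < b] the preimage is a half-line, so its mass is obtained as the limit over bounded
    intervals ending at [ln b]. *)
 rewrite (_ : _ @^-1` _ = `]-oo, (ln b)]%classic); last first.
  apply/seteqP; split => x /=; rewrite !in_itv /= lb; first by case/andP.
  by move=> ->; rewrite (le_lt_trans a0 (expR_gt0 _)).
 rewrite itv_measure // subr0.
 rewrite (_ : `]-oo, (ln b)]%classic = \bigcup_n `](ln b - n.+1%:R)%R, (ln b)]%classic); last first.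
  apply/seteqP; split => x /=; last by case=> n _ /=; rewrite !in_itv /= => /andP[].
  rewrite in_itv /= => xb; exists (Num.bound (ln b - x)) => //=; rewrite in_itv /= xb andbT.
  rewrite ltrBlDr -ltrBlDl (lt_trans (archi_boundP _)) ?subr_ge0 // ltr_nat //.
 have H := @ge0_nondecreasing_set_cvg_integral _ (measurableTypeR R) R (fun n => `](ln b - n.+1%:R)%R, (ln b)]%classic) (fun x => (expR x)%:E) L1.
 have {}H : \int[L1]_(x in `](ln b - i.+1%:R)%R, ln b]) (expR x)%:E @[i --> \oo] -->
  \int[L1]_(x in \bigcup_i `](ln b - i.+1%:R)%R, ln b]%classic) (expR x)%:E.
  apply: H.
  + move=> m n mn; apply/subsetPset => x /=; rewrite !in_itv /= => /andP[h ->]; rewrite andbT (le_lt_trans _ h) //.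
   by rewrite lerD2l lerN2 ler_nat.
  + by move=> i; exact: measurable_itv.
  + by move=> i; apply: measurable_funTS; apply/measurable_EFinP; exact: measurable_expR.
  + by move=> i x _; rewrite lee_fin expR_ge0.
 rewrite -(cvg_lim _ H) //; apply: cvg_lim => //.
 rewrite (_ : (fun i => _) = fun n => (b - expR (ln b - n.+1%:R))%:E); last first.
  by apply/funext => n; rewrite FTC // ltrBlDr ltrDl ltr0n.
 apply: cvg_EFin; first exact: nearW.
 rewrite -[X in _ --> X]subr0; apply: cvgB; first exact: cvg_cst.
 rewrite (_ : (fun n => _) = (fun n : nat => b * (expR 1)^-1 ^+ n.+1)%R); last first.
  by apply/funext => n; rewrite expRD lnK ?posrE // expRN -[X in expR X]mulr1 expRM_natl exprVn.
 rewrite -[X in _ --> X](mulr0 b); apply: cvgM; first exact: cvg_cst.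
 rewrite (cvg_shiftS (fun n => ((expR 1 : R)^-1 ^+ n)%R)).
 apply: cvg_expr; rewrite ger0_norm ?invr_ge0 ?expR_ge0 // invf_lt1 ?expR_gt0 //.
 by rewrite -expR0 ltr_expR.
Qed.

End lebesgue.

(** * Invariance of Lebesgue measure in the coordinates [(x / y, ln y)] *)

Section plane_measure.
Context {R : realType}.
Notation P := (plane R).
Notation L1 := (@lebesgue_measure R).
Notation L2 := (L1 \x L1)%E.
Implicit Types (g : 'M[R]_2) (f : P -> \bar R).

Lemma integral_plane21 f : mfunT f -> (forall z, (0 <= f z)%E) ->
 (\int[L2]_z f z = \int[L1]_v \int[L1]_t f (t, v))%E.
Proof. by move=> mf' f0; rewrite (fubini_tonelli2 (m1 := L1) (m2 := L1) f). Qed.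

Lemma integral_plane12 f : mfunT f -> (forall z, (0 <= f z)%E) ->
 (\int[L2]_z f z = \int[L1]_t \int[L1]_v f (t, v))%E.
Proof. by move=> mf' f0; rewrite (fubini_tonelli1 (m1 := L1) (m2 := L1) f). Qed.

Lemma mpair1 f (t : R) : mfunT f -> mfunT (fun v : R => f (t, v)).
Proof. by move=> mf'; mf. Qed.
Lemma mpair2 f (v : R) : mfunT f -> mfunT (fun t : R => f (t, v)).
Proof. by move=> mf'; mf. Qed.

(** Stated through integrals of nonnegative functions, so that it composes directly and is the form
    in which unfolding uses it. *)
Definition mpres (phi : P -> P) := mfunT phi /\
 forall f, mfunT f -> (forall z, (0 <= f z)%E) ->
  (\int[L2]_z f (phi z) = \int[L2]_z f z)%E.

Lemma mpres_comp (phi psi : P -> P) : mpres phi -> mpres psi -> mpres (phi \o psi).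
Proof.
move=> [m1 h1] [m2 h2]; split; first exact: measurableT_comp.
by move=> f mf' f0; rewrite -(h1 f mf' f0); apply: (h2 (f \o phi)) => [|z]; [exact: (measurableT_comp mf' m1)|exact: f0].
Qed.

Lemma mpres_shear1 (h : R -> R) : mfunT h ->
 mpres (fun z => (z.1 + h z.2 : R, z.2)).
Proof.
move=> mh; have m1 : mfunT (fun z : P => (z.1 + h z.2 : R, z.2) : P) by mf.
split => // f mf' f0.
rewrite (integral_plane21 (fun z => f (z.1 + h z.2 : R, z.2))); mf.
rewrite (integral_plane21 f mf' f0); apply: eq_integral => v _ /=.
by rewrite (integral_translate _ (fun t => f (t, v))); mf.
Qed.

Lemma mpres_shear2 (h : R -> R) : mfunT h ->
 mpres (fun z => (z.1, z.2 + h z.1 : R)).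
Proof.
move=> mh; have m1 : mfunT (fun z : P => (z.1, z.2 + h z.1 : R) : P) by mf.
split => // f mf' f0.
rewrite (integral_plane12 (fun z => f (z.1, z.2 + h z.1 : R))); mf.
rewrite (integral_plane12 f mf' f0); apply: eq_integral => t _ /=.
by rewrite (integral_translate _ (fun v => f (t, v))); mf.
Qed.

Lemma mpres_neg : mpres (fun z => (- (z.1 : R), - (z.2 : R))).
Proof.
have m1 : mfunT (fun z : P => (- (z.1 : R), - (z.2 : R)) : P) by mf.
split => // f mf' f0.
rewrite (integral_plane12 (fun z => f (- (z.1 : R), - (z.2 : R)))); mf.
rewrite (integral_plane12 f mf' f0) -[RHS](integral_reflect (fubini_F L1 f)) /=.
- apply: eq_integral => t _.
 by rewrite (integral_reflect (fun v => f (- t, v))); mf.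
- exact: (measurable_fun_fubini_tonelli_F (m2 := L1) f).
- by move=> y; exact: integral_ge0.
Qed.

Let w : 'M[R]_2 := mx2 0 (-1) 1 0.

(** In these coordinates the inversion [z -> -1/z] is the shear by [ln (1 + t^2)] in the second
    variable followed by the point reflection. *)
Let mpres_w : mpres (act w).
Proof.
rewrite (_ : act w = (fun z => (- (z.1 : R), - (z.2 : R)) : P) \o
 (fun z => (z.1, z.2 + ln (1 + (z.1 : R) ^+ 2) : R))).
 by apply: mpres_comp; [exact: mpres_neg|apply: (mpres_shear2 (fun t => ln (1 + t ^+ 2))); mf].
apply/funext => z; rewrite /act !mx2E /= /be /ga; congr pair; first by ring.
rewrite (_ : _ + _ + _ = (1 + (z.1 : R) ^+ 2) * expR z.2); last by ring.
by rewrite lnM ?posrE ?expR_gt0 ?ltr_pwDl ?sqr_ge0 // expRK addrC.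
Qed.

Let mpres_upper g : \det g = 1 -> mc g = 0 -> mpres (act g).
Proof.
rewrite det2 => dg c0; rewrite c0 mulr0 subr0 in dg.
have d0 : md g != 0 by apply/eqP => d0; move: dg; rewrite d0 mulr0 => /eqP; rewrite eq_sym oner_eq0.
rewrite (_ : act g = (fun z => (z.1, z.2 + (- ln (md g ^+ 2)) : R) : P) \o
 (fun z => (z.1 + mb g * md g * expR (- z.2) : R, z.2))).
 by apply: mpres_comp; [apply: (mpres_shear2 (fun=> - ln (md g ^+ 2))); mf|apply: (mpres_shear1 (fun v => mb g * md g * expR (- v))); mf].
apply/funext => z; rewrite /act c0 dg /= /be /al; congr pair; first by ring.
rewrite (_ : _ + _ + _ = md g ^+ 2 * expR (- (z.2 : R))); last by ring.
by rewrite lnM ?posrE ?expR_gt0 ?exprn_even_gt0 // expRK; ring.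
Qed.

(** Bruhat decomposition: a matrix with nonzero lower left entry is an upper triangular one times
    the inversion times an upper triangular one, and upper triangular matrices act by two shears. *)
Lemma mpres_act g : \det g = 1 -> mpres (act g).
Proof.
move=> dg; have [c0|c0] := eqVneq (mc g) 0; mf.
have dw : \det w = 1 by rewrite det2 !mx2E; ring.
pose u := mx2 1 (ma g / mc g) 0 1; pose l := mx2 (mc g) (md g) 0 (mc g)^-1.
have du : \det u = 1 by rewrite det2 !mx2E; ring.
have dl : \det l = 1 by rewrite det2 !mx2E divff //; ring.
have -> : g = u *m (w *m l).
 move: dg; rewrite det2 => dg.
 apply: mx2_eq; rewrite !mulE !mx2E; try by field.
 have -> : mb g = (ma g * md g - 1) / mc g by rewrite -dg; field.
 by field.
rewrite (_ : act _ = act u \o (act w \o act l)); last first.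
 by apply/funext => z; rewrite !act_mul // det_mul1.
apply: mpres_comp; first by apply: mpres_upper => //; rewrite mx2E.
by apply: mpres_comp => //; apply: mpres_upper => //; rewrite mx2E.
Qed.

Lemma measurable_act g : \det g = 1 -> mfunT (act g).
Proof. by move=> /mpres_act[]. Qed.

Lemma integral_act g f : \det g = 1 -> mfunT f -> (forall z, (0 <= f z)%E) ->
 (\int[L2]_z f (act g z) = \int[L2]_z f z)%E.
Proof. by move=> /mpres_act[_ h]; exact: h. Qed.

(** Under [x = t * exp v], [y = exp v] the form [dx dy / y^2] becomes [dt dv]: the exponential
    substitution in [y], then a scaling in [x] on each horizontal line. *)
Lemma hyp_areaE (F : set P) : measurable F -> F `<=` upper_half ->
 hyp_area F = L2 (@Phi R @^-1` F).
Proof.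
move=> mF Fu; pose b (z : P) : R := \1_F z.
have mb : mfunT b by exact: measurable_indic.
have b0 z : 0 <= b z by pos.
have mPhi : mfunT (@Phi R) by rewrite /Phi; mf.
(* The power [y^-2] is written [exp (-2 ln y)], which is measurable on the whole plane; for [y <= 0]
   the indicator [b] vanishes, so the default value of [ln] there is harmless. *)
pose f (z : P) : \bar R := (b z * expR (- 2 * ln z.2))%:E.
have mf' : mfunT f by rewrite /f; mf.
have f0 z : (0 <= f z)%E by rewrite lee_fin mulr_ge0.
transitivity (\int[L2]_z f z)%E.
 rewrite /hyp_area integral_mkcond; apply: eq_integral => z _.
 rewrite patchE /f /b indicE; case: ifPn => zF; last by rewrite mul0r.
 have z0 : 0 < (z.2 : R) by apply: Fu; rewrite inE in zF.
 by rewrite mul1r mulNr expRN expRM_natl lnK.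
rewrite (integral_plane21 f) //.
rewrite -[RHS](_ : \int[L2]_z (b (Phi z))%:E = _)%E; last first.
 rewrite -[in RHS](setIT (@Phi R @^-1` F)) -(integral_indic L2 measurableT) //.
 by rewrite -[X in measurable X]setTI; mf.
rewrite (integral_plane21 (fun z => (b (Phi z))%:E)); last 2 first.
- by mf.
- by move=> z; rewrite lee_fin.
pose G (y : R) : \bar R := (\int[L1]_x f (x, y))%E.
have mG : mfunT G by exact: (measurable_fun_fubini_tonelli_G (m1 := L1) f).
have G0 y : (0 <= G y)%E by apply: integral_ge0.
transitivity (\int[L1]_(y in `]0%R, +oo[) G y)%E.
 rewrite [RHS]integral_mkcond; apply: eq_integral => y _; rewrite patchE.
 case: ifPn => // yn; apply: integral0_eq => x _; rewrite /f /b indicE.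
 rewrite memNset ?mul0r // => /Fu; rewrite /upper_half /= => y0.
 by move: yn; rewrite notin_setE /= in_itv /= y0.
rewrite -integral_expR //; apply: eq_integral => v _; rewrite /G.
have mfv : mfunT (fun x : R => f (x, expR v)) by mf.
rewrite -(integral_scale (expR v)) ?expR_gt0 //.
rewrite -ge0_integralZr //; last 2 first.
- apply: emeasurable_funM => //.
 by mf.
- by move=> x _; apply: mule_ge0; pos.
apply: eq_integral => x _; rewrite /f /Phi /= -!EFinM expRK mulNr expRN expRM_natl; congr (_%:E).
by rewrite [expR v * x]mulrC; field; rewrite gt_eqF ?expR_gt0.
Qed.

End plane_measure.

Section sums.
Context {R : realType}.
Local Open Scope ereal_scope.

(** Turns sums over a countable set into series over [nat], with a mask [p] that accounts for finite
    sets, so that the theorems on measurability and integration of series apply. *)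
Lemma countable_enum (T : pointedType) (A : set T) : countable A ->
 exists (e : nat -> T) (p : pred nat),
  [/\ (forall n, p n -> A (e n)), (forall x, A x -> exists2 n, p n & e n = x) &
  forall a : T -> \bar R, (forall x, A x -> 0 <= a x) ->
  \esum_(x in A) a x = \sum_(0 <= n <oo) (if p n then a (e n) else 0)].
Proof.
move=> /countable_bijP[B]; rewrite card_eq_sym => /card_set_bijP[e eB].
have eBA n : B n -> A (e n) by move=> Bn; have [+ _ _] := eB; apply.
exists e, (fun n => n \in B); split => [n|x Ax|a a0]; first by rewrite inE => /eBA.
 by have [_ _ /(_ x Ax)[n Bn en]] := eB; exists n; rewrite ?inE.
rewrite (reindex_esum _ _ _ _ eB) esum_mkcond nneseries_esumT // => n.
by case: ifPn => //; rewrite inE => /eBA /a0.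
Qed.

Lemma measurable_esum d (X : measurableType d) (T : pointedType) (A : set T) (f : T -> X -> \bar R) :
 countable A -> (forall t, A t -> mfunT (f t)) -> (forall t x, A t -> 0 <= f t x) ->
 mfunT (fun x => \esum_(t in A) f t x).
Proof.
move=> /countable_enum[e [p [pA _ E]]] mf0 f0.
rewrite (_ : (fun x => _) = fun x => \sum_(0 <= n <oo) (if p n then f (e n) x else 0)); last first.
 by apply/funext => x; rewrite E // => t; exact: f0.
apply: ge0_emeasurable_sum => [n x _ _|n _]; first by case: ifPn => // /pA /f0.
by case pn: (p n); mf.
Qed.

Lemma integral_esum d (X : measurableType d) (mu : {measure set X -> \bar R})
  (T : pointedType) (A : set T) (f : T -> X -> \bar R) :
 countable A -> (forall t, A t -> mfunT (f t)) -> (forall t x, A t -> 0 <= f t x) ->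
 \int[mu]_x (\esum_(t in A) f t x) = \esum_(t in A) \int[mu]_x f t x.
Proof.
move=> /countable_enum[e [p [pA _ E]]] mf0 f0.
rewrite E; last by move=> t At; apply: integral_ge0 => x _; exact: f0.
rewrite (_ : (fun x => _) = fun x => \sum_(0 <= n <oo) (if p n then f (e n) x else 0)); last first.
 by apply/funext => x; rewrite E // => t; exact: f0.
rewrite integral_nneseries //.
- by apply: eq_eseriesr => n _; case pn: (p n) => //; rewrite integral0.
- by move=> n; case pn: (p n); mf.
- by move=> n x _; case: ifPn => // /pA /f0.
Qed.

Lemma esum1_le_card (T : choiceType) (U : finType) (A : set T) (f : T -> U) :
 (forall x y, A x -> A y -> f x = f y -> x = y) -> \esum_(x in A) (1 : \bar R) <= (#|U|%:R)%:E.
Proof.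
move=> fi; apply: ub_ereal_sup => _ [F [Ff FA] <-].
rewrite fsbig_finite //= sumEFin lee_fin big_const_seq count_predT iter_addr_0 ler_nat.
rewrite -(size_map f) -(card_uniqP _) ?max_card //.
rewrite map_inj_in_uniq // => x y; rewrite !in_fset_set // !inE => /FA Ax /FA Ay.
exact: fi.
Qed.

Lemma finite_set_inj (T : choiceType) (U : finType) (A : set T) (f : T -> U) :
 (forall x y, A x -> A y -> f x = f y -> x = y) -> finite_set A.
Proof.
move=> fi; apply: (@card_le_finite _ _ A [set: U]) => //.
have fi' : {in A &, injective f} by move=> x y; rewrite !inE; exact: fi.
have := inj_card_eq fi'; rewrite card_eq_le => /andP[_ h].
by apply: card_le_trans h _; exact: subset_card_le.
Qed.

Lemma esum_single (T : choiceType) (A : set T) (t : T) (a : T -> \bar R) :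
 A t -> (forall x, A x -> 0 <= a x) -> (forall x, A x -> x <> t -> a x = 0) -> \esum_(x in A) a x = a t.
Proof.
move=> At a0 az; rewrite (esumID [set t]) // [X in _ + X]esum1 ?adde0; last first.
 by move=> x [Ax /az]; exact.
rewrite (_ : A `&` [set t] = [set t]) ?esum_set1 //; first exact: a0.
by apply/seteqP; split => x [] //= ->.
Qed.

End sums.

Section cells.
Context {R : realType}.

(** Codes a number between 0 and [m] by the unit interval that contains it; this is the device
    behind all the pigeonhole counts below. *)
Definition cell (m : nat) (x : R) : 'I_m.+1 := inord (Num.truncn x).

Lemma cell_close m (x y : R) : 0 <= x <= m%:R -> 0 <= y <= m%:R -> cell m x = cell m y -> `|x - y| < 1.
Proof.
move=> /andP[x0 xm] /andP[y0 ym] /(congr1 val) /=.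
have h (u : R) : 0 <= u -> u <= m%:R -> (Num.truncn u < m.+1)%N.
 by move=> u0 um; rewrite ltnS -(ler_nat R) (le_trans _ um) // truncn_le.
rewrite !inordK ?h // => e.
have /andP[a b] := truncn_itv x0; have /andP[c d] := truncn_itv y0.
rewrite e in a b; rewrite ltr_norml; rewrite -natr1 in b d; lra.
Qed.

End cells.

(** * Discrete groups *)

Section discrete.
Context {R : realType}.
Notation P := (plane R).
Implicit Types (A B M g h : 'M[R]_2) (z w : P).

Definition hd A : R := (ma A - md A) / 2.
Definition ht A : R := (ma A + md A) / 2.

Lemma maE A : ma A = ht A + hd A. Proof. by rewrite /ht /hd; field. Qed.
Lemma mdE A : md A = ht A - hd A. Proof. by rewrite /ht /hd; field. Qed.

Lemma det_ht A : \det A = 1 -> ht A ^+ 2 = 1 + hd A ^+ 2 + mb A * mc A.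
Proof.
move=> d; have -> : mb A * mc A = ma A * md A - 1 by move: d; rewrite det2; lra.
by rewrite maE mdE; ring.
Qed.

Lemma NN_scale z A B (b : R) : hd B = b * hd A -> mb B = b * mb A -> mc B = b * mc A ->
 NN z B = b ^+ 2 * NN z A.
Proof.
move=> e1 e2 e3; rewrite /NN e2 e3.
have e (C : 'M[R]_2) : ma C - md C = 2 * hd C by rewrite /hd; field.
by rewrite !e e1; field.
Qed.

Lemma NN_orig_hd A : NN orig A = 2 * hd A ^+ 2 + mb A ^+ 2 + mc A ^+ 2.
Proof. exact: NN_orig. Qed.

Lemma scalar_pm1 A : \det A = 1 -> hd A = 0 -> mb A = 0 -> mc A = 0 -> A = 1%:M \/ A = - 1%:M.
Proof.
move=> dA p0 q0 r0; have := det_ht _ dA; rewrite p0 q0 r0 expr0n mul0r !addr0 => /eqP.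
by rewrite sqrf_eq1 => /orP[] /eqP t1; [left|right]; apply: mx2_eq;
 rewrite ?oppE !oneE ?oppr0 // ?maE ?mdE p0 t1; ring.
Qed.

Lemma NN0_scalar z A : \det A = 1 -> NN z A = 0 -> A = 1%:M \/ A = - 1%:M.
Proof.
move=> dA N0; have : NN orig A <= 0.
 by rewrite -(mulr0 (bd orig z ^+ 2)) -N0 NN_ratio.
rewrite NN_orig_hd => N1.
have := sqr_ge0 (hd A); have := sqr_ge0 (mb A); have := sqr_ge0 (mc A) => h1 h2 h3.
by apply: scalar_pm1 => //; apply/eqP; rewrite -sqrf_eq0; apply/eqP; lra.
Qed.

Lemma NN_1 z : NN z 1%:M = 0.
Proof. by rewrite /NN !oneE; field. Qed.

Lemma abs_le (x y : R) : 0 <= y -> x ^+ 2 <= y ^+ 2 -> `|x| <= y.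
Proof. by move=> y0 h; apply: sqr_le_le => //; rewrite real_normK ?num_real. Qed.

Let near_num (t p q r e : R) : 0 <= t -> 0 < e <= 1 -> t ^+ 2 = 1 + p ^+ 2 + q * r ->
 2 * p ^+ 2 + q ^+ 2 + r ^+ 2 <= e ^+ 2 / 4 ->
 [/\ `|t - 1| <= e / 2, `|p| <= e / 2, `|q| <= e & `|r| <= e].
Proof.
move=> t0 /andP[e0 e1] te h.
have p2 := sqr_ge0 p; have q2 := sqr_ge0 q; have r2 := sqr_ge0 r.
have qr1 := sqr_ge0 (q - r); have qr2 := sqr_ge0 (q + r).
rewrite sqrrB in qr1; rewrite sqrrD in qr2.
have ee : e ^+ 2 <= e by rewrite expr2 -[X in _ <= X]mulr1 ler_wpM2l // ltW.
split; [|apply: abs_le; [lra|rewrite expr_div_n; lra]|apply: abs_le; [lra|lra]|apply: abs_le; [lra|lra]].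
have te1 : (t - 1) * (t + 1) = p ^+ 2 + q * r by rewrite -subr_sqr te; ring.
by rewrite ler_norml; apply/andP; split; nra.
Qed.

(* A matrix of determinant 1 with small traceless part is entrywise close to [1] or [-1]. *)
Lemma near_scalar A (e : R) : \det A = 1 -> 0 < e <= 1 -> NN orig A <= e ^+ 2 / 4 ->
 exists2 s : R, s = 1 \/ s = -1 &
 [/\ `|s * ma A - 1| <= e, `|s * mb A| <= e, `|s * mc A| <= e & `|s * md A - 1| <= e].
Proof.
move=> dA e01; rewrite NN_orig_hd => N1; have te := det_ht _ dA.
have [t0|t0] := leP 0 (ht A).
 have [] := near_num _ _ _ _ _ t0 e01 te N1; rewrite maE mdE !ler_norml => /andP[? ?] /andP[? ?] /andP[? ?] /andP[? ?].
 exists 1; first by left.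
 by split; rewrite ler_norml; apply/andP; split; lra.
have t0' : 0 <= - ht A by lra.
rewrite -sqrrN in te.
have [] := near_num _ _ _ _ _ t0' e01 te N1; rewrite maE mdE !ler_norml => /andP[? ?] /andP[? ?] /andP[? ?] /andP[? ?].
exists (-1); first by right.
by split; rewrite ler_norml; apply/andP; split; lra.
Qed.

Let entries_le3 A : \det A = 1 -> NN orig A <= 1 ->
 [/\ ma A ^+ 2 <= 9, mb A ^+ 2 <= 9, mc A ^+ 2 <= 9 & md A ^+ 2 <= 9].
Proof.
move=> dA; rewrite NN_orig_hd => N1; have te := det_ht _ dA.
have p2 := sqr_ge0 (hd A); have q2 := sqr_ge0 (mb A); have r2 := sqr_ge0 (mc A).
have qr1 := sqr_ge0 (mb A - mc A); rewrite sqrrB in qr1.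
have h1 := sqr_ge0 (ht A - hd A); have h2 := sqr_ge0 (ht A + hd A).
rewrite sqrrB in h1; rewrite sqrrD in h2.
by split; rewrite ?maE ?mdE; lra.
Qed.

Definition commut A B : 'M[R]_2 := A *m B *m invmx A *m invmx B.

Let lin_bound (x y e f k : R) : x ^+ 2 <= 4 * k -> y ^+ 2 <= 4 * k -> e ^+ 2 <= 324 -> f ^+ 2 <= 324 -> 0 <= k ->
 (x * e + y * f) ^+ 2 <= 5184 * k.
Proof.
move=> h1 h2 h3 h4 k0.
have : (x * e + y * f) ^+ 2 <= 2 * (x ^+ 2 * e ^+ 2 + y ^+ 2 * f ^+ 2).
 have := sqr_ge0 (x * e - y * f); rewrite sqrrB sqrrD !exprMn; lra.
have : x ^+ 2 * e ^+ 2 <= 4 * k * 324 by apply: ler_pM; pos.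
have : y ^+ 2 * f ^+ 2 <= 4 * k * 324 by apply: ler_pM; pos.
lra.
Qed.

Let prod_bound (x y e f : R) : x ^+ 2 <= 9 -> y ^+ 2 <= 9 -> e ^+ 2 <= 9 -> f ^+ 2 <= 9 ->
 (x * e + y * f) ^+ 2 <= 324.
Proof.
move=> h1 h2 h3 h4.
have : (x * e + y * f) ^+ 2 <= 2 * (x ^+ 2 * e ^+ 2 + y ^+ 2 * f ^+ 2).
 have := sqr_ge0 (x * e - y * f); rewrite sqrrB sqrrD !exprMn; lra.
have : x ^+ 2 * e ^+ 2 <= 9 * 9 by apply: ler_pM; pos.
have : y ^+ 2 * f ^+ 2 <= 9 * 9 by apply: ler_pM; pos.
lra.
Qed.

Let cross_bound (x y x' y' a b : R) : x ^+ 2 + y ^+ 2 <= a -> x' ^+ 2 + y' ^+ 2 <= b ->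
 (x * y' - x' * y) ^+ 2 <= a * b.
Proof.
move=> h1 h2; apply: (@le_trans _ _ ((x ^+ 2 + y ^+ 2) * (x' ^+ 2 + y' ^+ 2))).
 have := sqr_ge0 (x * x' + y * y'); rewrite -subr_ge0 => h; rewrite -subr_ge0.
 lra.
by apply: ler_pM => //; pos.
Qed.

(** [A B A^-1 B^-1 - 1 = (A B - B A) A^-1 B^-1]. The bracket involves only the traceless parts,
    hence is bilinear in two small quantities, and the entries of [A] and [B] are at most 3 in
    absolute value. The second bound serves to exclude the commutator [-1]. *)
Lemma commut_small A B : \det A = 1 -> \det B = 1 -> NN orig A <= 1 -> NN orig B <= 1 ->
 NN orig (commut A B) <= 20736 * (NN orig A * NN orig B) /\
 (ma (commut A B) - 1) ^+ 2 <= 5184 * (NN orig A * NN orig B).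
Proof.
move=> dA dB NA NB; pose E := invmx A *m invmx B; pose X := A *m B - B *m A.
have cE : commut A B = 1%:M + X *m E.
 rewrite /X mulmxBl /E !mulmxA mulmxK ?det_unit // mulmxV ?det_unit //.
 by rewrite addrC subrK.
have [a1 a2 a3 a4] := entries_le3 _ dA NA; have [b1 b2 b3 b4] := entries_le3 _ dB NB.
have k0 : 0 <= NN orig A * NN orig B by rewrite mulr_ge0 ?NN_ge0.
have subE : ((ma X = mb A * mc B - mb B * mc A)%R * (mb X = 2 * (hd A * mb B - hd B * mb A))%R *
 (mc X = 2 * (mc A * hd B - mc B * hd A))%R * (md X = - (mb A * mc B - mb B * mc A))%R)%type.
 have sE (u : 'M[R]_2 -> R) : u = @ma R \/ u = @mb R \/ u = @mc R \/ u = @md R -> u X = u (A *m B) - u (B *m A).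
  by move=> [|[|[]]] ->; rewrite /ma /mb /mc /md !mxE.
 by do !split; rewrite sE ?mulE ?maE ?mdE; do ?[by left|by right; left|by right; right; left|by right; right; right]; ring.
have NAe := NN_orig_hd A; have NBe := NN_orig_hd B.
have s1 := sqr_ge0 (hd A); have s2 := sqr_ge0 (mb A); have s3 := sqr_ge0 (mc A).
have t1 := sqr_ge0 (hd B); have t2 := sqr_ge0 (mb B); have t3 := sqr_ge0 (mc B).
have x1 : ma X ^+ 2 <= 4 * (NN orig A * NN orig B).
 rewrite subE (le_trans (cross_bound _ _ _ _ (NN orig A) (NN orig B) _ _)) //; lra.
have x4 : md X ^+ 2 <= 4 * (NN orig A * NN orig B) by move: x1; rewrite !subE sqrrN.
have x2 : mb X ^+ 2 <= 4 * (NN orig A * NN orig B).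
 by rewrite subE exprMn (_ : 2 ^+ 2 = 4 :> R) ?ler_pM2l //; [apply: cross_bound; lra|ring].
have x3 : mc X ^+ 2 <= 4 * (NN orig A * NN orig B).
 by rewrite subE exprMn (_ : 2 ^+ 2 = 4 :> R) ?ler_pM2l //; [apply: cross_bound; lra|ring].
have e1 : ma E ^+ 2 <= 324 by rewrite mulE !(invE A dA) !(invE B dB); apply: prod_bound; rewrite ?sqrrN.
have e2 : mb E ^+ 2 <= 324 by rewrite mulE !(invE A dA) !(invE B dB); apply: prod_bound; rewrite ?sqrrN.
have e3 : mc E ^+ 2 <= 324 by rewrite mulE !(invE A dA) !(invE B dB); apply: prod_bound; rewrite ?sqrrN.
have e4 : md E ^+ 2 <= 324 by rewrite mulE !(invE A dA) !(invE B dB); apply: prod_bound; rewrite ?sqrrN.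
have z1 := lin_bound _ _ _ _ _ x1 x2 e1 e3 k0.
have z2 := lin_bound _ _ _ _ _ x1 x2 e2 e4 k0.
have z3 := lin_bound _ _ _ _ _ x3 x4 e1 e3 k0.
have z4 := lin_bound _ _ _ _ _ x3 x4 e2 e4 k0.
rewrite -!mulE in z1 z2 z3 z4.
have addE : ((ma (commut A B) = 1 + ma (X *m E))%R * (mb (commut A B) = mb (X *m E))%R *
 (mc (commut A B) = mc (X *m E))%R * (md (commut A B) = 1 + md (X *m E))%R)%type.
 by rewrite cE; do !split; rewrite /ma /mb /mc /md !mxE // add0r.
split; last by rewrite addE addrC addKr.
rewrite NN_orig_hd !addE /hd !addE.
have := sqr_ge0 (ma (X *m E) + md (X *m E)); rewrite sqrrD => hh.
rewrite (_ : 1 + ma (X *m E) - (1 + md (X *m E)) = ma (X *m E) - md (X *m E)); last by ring.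
rewrite expr_div_n sqrrB.
move: (ma (X *m E)) (mb (X *m E)) (mc (X *m E)) (md (X *m E)) (NN orig A * NN orig B) z1 z2 z3 z4 hh k0.
by clear; move=> x y z t k *; lra.
Qed.

(** Up to factors, the entries of [A B - B A] are the components of the cross product of the two
    traceless parts, which are therefore parallel. *)
Lemma commute_proportional A B : A *m B = B *m A -> ~ (hd A = 0 /\ mb A = 0 /\ mc A = 0) ->
 exists b, [/\ hd B = b * hd A, mb B = b * mb A & mc B = b * mc A].
Proof.
move=> AB nA.
have c1 : mb A * mc B = mb B * mc A by have := congr1 (@ma R) AB; rewrite !mulE; lra.
have c2 : hd A * mb B = hd B * mb A by have := congr1 (@mb R) AB; rewrite !mulE !maE !mdE; lra.
have c3 : mc A * hd B = mc B * hd A by have := congr1 (@mc R) AB; rewrite !mulE !maE !mdE; lra.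
have [p0|p0] := eqVneq (hd A) 0; last first.
 by exists (hd B / hd A); split; [by rewrite divfK|apply: (mulfI p0); rewrite [RHS](_ : _ = hd B * mb A); [lra|by field]|apply: (mulfI p0); rewrite [RHS](_ : _ = hd B * mc A); [lra|by field]].
have [q0|q0] := eqVneq (mb A) 0; last first.
 by exists (mb B / mb A); split; [apply: (mulfI q0); rewrite [RHS](_ : _ = mb B * hd A); [lra|by field]|by rewrite divfK|apply: (mulfI q0); rewrite [RHS](_ : _ = mb B * mc A); [lra|by field]].
have [r0|r0] := eqVneq (mc A) 0; last first.
 by exists (mc B / mc A); split; [apply: (mulfI r0); rewrite [RHS](_ : _ = mc B * hd A); [lra|by field]|apply: (mulfI r0); rewrite [RHS](_ : _ = mc B * mb A); [lra|by field]|by rewrite divfK].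
by exfalso; apply: nA.
Qed.

End discrete.

Section group.
Context {R : realType}.
Notation P := (plane R).
Context (G : set 'M[R]_2) (dG : discrete_subgroup_SL2 G) (hN : G (- 1%:M)).
Implicit Types (A B M g h : 'M[R]_2) (z w : P).

Lemma group1 : G 1%:M. Proof. by case: dG. Qed.
Lemma group_det g : G g -> \det g = 1. Proof. by case: dG => _ + _ _ _; exact. Qed.
Lemma group_mul g h : G g -> G h -> G (g *m h). Proof. by case: dG => _ _ + _ _; exact. Qed.
Lemma group_inv g : G g -> G (invmx g). Proof. by case: dG => _ _ _ + _; exact. Qed.
Lemma group_opp g : G g -> G (- g). Proof. by move=> Gg; have -> : - g = (- 1%:M) *m g by [rewrite mulNmx mul1mx]; exact: group_mul. Qed.

Definition pm1 g := g = 1%:M \/ g = - 1%:M.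

Lemma NN_pm1 z g : pm1 g -> NN z g = 0.
Proof. by move=> [] ->; rewrite ?NN_opp NN_1. Qed.

Lemma subE g h : ((ma (g - h) = ma g - ma h)%R * (mb (g - h) = mb g - mb h)%R *
 (mc (g - h) = mc g - mc h)%R * (md (g - h) = md g - md h)%R)%type.
Proof. by rewrite /ma /mb /mc /md !mxE. Qed.

Let conj_close h M (K e : R) : \det h = 1 -> 0 <= K -> 0 <= e ->
 [/\ `|ma h| <= K, `|mb h| <= K, `|mc h| <= K & `|md h| <= K] ->
 [/\ `|ma M| <= e, `|mb M| <= e, `|mc M| <= e & `|md M| <= e] ->
 forall i j, `|(h *m M *m invmx h) i j| <= 4 * (K * e * K).
Proof.
move=> dh K0 e0 [h1 h2 h3 h4] [m1 m2 m3 m4].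
have t3 (x y u : R) : `|x| <= K -> `|y| <= e -> `|u| <= K -> `|x * y * u| <= K * e * K.
 by move=> hx hy hu; rewrite !normrM !ler_pM.
have t4 (x1 x2 x3 x4 k : R) : `|x1| <= k -> `|x2| <= k -> `|x3| <= k -> `|x4| <= k ->
  `|(x1 + x2) + (x3 + x4)| <= 4 * k.
 move=> a b c d; have -> : 4 * k = (k + k) + (k + k) by ring.
 by do 2?[apply: (le_trans (ler_normD _ _)); apply: lerD].
have fin (x x1 x2 x3 x4 : R) : x = (x1 + x2) + (x3 + x4) -> `|x1| <= K * e * K -> `|x2| <= K * e * K ->
 `|x3| <= K * e * K -> `|x4| <= K * e * K -> `|x| <= 4 * (K * e * K) by move=> ->; exact: t4.
move=> i j; case: (ord2P i) => ->; case: (ord2P j) => ->.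
- rewrite -[_ ord0 ord0]/(ma _) !mulE !(invE h dh).
 apply: (fin _ (ma h * ma M * md h) (mb h * mc M * md h) (ma h * mb M * - mc h) (mb h * md M * - mc h)); [by ring| | | |]; by apply: t3; rewrite ?normrN.
- rewrite -[_ ord0 ord_max]/(mb _) !mulE !(invE h dh).
 apply: (fin _ (ma h * ma M * - mb h) (mb h * mc M * - mb h) (ma h * mb M * ma h) (mb h * md M * ma h)); [by ring| | | |]; by apply: t3; rewrite ?normrN.
- rewrite -[_ ord_max ord0]/(mc _) !mulE !(invE h dh).
 apply: (fin _ (mc h * ma M * md h) (md h * mc M * md h) (mc h * mb M * - mc h) (md h * md M * - mc h)); [by ring| | | |]; by apply: t3; rewrite ?normrN.
- rewrite -[_ ord_max ord_max]/(md _) !mulE !(invE h dh).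
 apply: (fin _ (mc h * ma M * - mb h) (md h * mc M * - mb h) (mc h * mb M * ma h) (md h * md M * ma h)); [by ring| | | |]; by apply: t3; rewrite ?normrN.
Qed.

(** Conjugation by [gz z] turns a small [NN z g] into entries close to those of [1] or of [-1].
    Undoing the conjugation costs a factor that depends on [z], and discreteness then applies to [g]
    or to [- g]. *)
Lemma isolated z : exists2 d : R, 0 < d & forall g, G g -> NN z g < d -> pm1 g.
Proof.
case: (dG) => _ _ _ _ [e e0 He].
pose h := gz z; have dh : \det h = 1 by exact: gz_det.
pose K := 1 + `|ma h| + `|mb h| + `|mc h| + `|md h|.
have n1 := normr_ge0 (ma h); have n2 := normr_ge0 (mb h); have n3 := normr_ge0 (mc h); have n4 := normr_ge0 (md h).
have K1 : 1 <= K by rewrite /K; lra.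
have K0 : 0 < K by lra.
have K2 : 0 < K * K by pos.
pose f := Num.min 1 (e / (8 * (K * K))).
have f0 : 0 < f by rewrite lt_min ltr01 divr_gt0 // mulr_gt0.
have f1 : f <= 1 by rewrite ge_min lexx.
have fe : 4 * (K * f * K) < e.
 have : f <= e / (8 * (K * K)) by rewrite ge_min lexx orbT.
 rewrite ler_pdivlMr ?mulr_gt0 // => hf; rewrite (_ : K * f * K = f * (K * K)); last by ring.
 lra.
have key g : G g -> [/\ `|ma (invmx h *m g *m h) - 1| <= f, `|mb (invmx h *m g *m h)| <= f,
  `|mc (invmx h *m g *m h)| <= f & `|md (invmx h *m g *m h) - 1| <= f] -> g = 1%:M.
 move=> Gg [b1 b2 b3 b4]; apply: He => // i j.
 have -> : g i j - (1%:M : 'M[R]_2) i j = (h *m (invmx h *m g *m h - 1%:M) *m invmx h) i j.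
  rewrite mulmxBr mulmxBl mulmx1 mulmxV ?det_unit // -!mulmxA mulmxV ?det_unit // mulmx1 !mulmxA.
  by rewrite mulmxV ?det_unit // mul1mx !mxE.
 apply: le_lt_trans fe; apply: conj_close => //; first by lra.
 - pos.
 - by rewrite /K; split; lra.
 - by rewrite !subE !oneE !subr0.
exists (f ^+ 2 / 4); first by pos.
move=> g Gg; rewrite NN_reduce -/h => /ltW.
have dg : \det (invmx h *m g *m h) = 1 by rewrite !det_mul1 ?det_inv1 // group_det.
move=> /(near_scalar _ f dg)[|s [] -> bnd]; first by rewrite f0.
 by left; apply: key => //; rewrite !mul1r in bnd.
right; rewrite -(opprK g); congr (- _); apply: key; first exact: group_opp.
by rewrite mulmxN mulNmx !oppE; rewrite !mulN1r in bnd.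
Qed.

Lemma near_min z : (exists2 g, G g & ~ pm1 g) ->
 exists A, [/\ G A, ~ pm1 A & forall C, G C -> ~ pm1 C -> NN z A <= 4 * NN z C].
Proof.
move=> [g0 Gg0 ng0]; have [d d0 hd] := isolated z.
pose S := [set NN z C | C in [set C | G C /\ ~ pm1 C]].
have S0 : has_inf S.
 by split; [exists (NN z g0); exists g0|exists 0 => _ [C _ <-]; exact: NN_ge0].
have Sd : d <= inf S.
 apply: lb_le_inf; first by case: S0.
 by move=> _ [C [GC nC] <-]; rewrite leNgt; apply/negP => /(hd _ GC).
have [_ [A [GA nA] <-] hA] := inf_adherent (lt_le_trans d0 Sd) S0.
exists A; split => // C GC nC.
have : inf S <= NN z C by apply: ge_inf; [case: S0|exists C].
lra.
Qed.

(** Small enough for two purposes: [4 * 20736 * kap < 1], so that the commutator of two elements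
    below [kap] undercuts a near-minimal element, and [5184 * kap^2 < 4], so that it is not [-1]. *)
Definition kap : R := (20 ^+ 4)^-1.

Lemma kap_gt0 : 0 < kap. Proof. by rewrite /kap invr_gt0 exprn_gt0 // ltr0n. Qed.
Lemma kapE : kap * (400 * 400) = 1.
Proof.
have -> : 400 * 400 = 20 ^+ 4 :> R by ring.
by rewrite /kap mulVf // expf_neq0 pnatr_eq0.
Qed.

Let fin_arith (k x y : R) : 0 < k -> k * (400 * 400) = 1 -> y <= k -> x <= y * k -> 4 <= 5184 * x -> False.
Proof.
move=> k0 k1 yk xy h; have : y * k <= k * k by rewrite ler_wpM2r // ltW.
have : k * k <= k * 1 by rewrite ler_wpM2l //; lra.
lra.
Qed.

(* The commutator of two short elements is much shorter, hence trivial. *)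
Lemma short_proportional z A B : G A -> ~ pm1 A -> G B ->
 (forall C, G C -> ~ pm1 C -> NN z A <= 4 * NN z C) -> NN z A <= kap -> NN z B <= kap ->
 exists b, [/\ hd B = b * hd A, mb B = b * mb A & mc B = b * mc A].
Proof.
move=> GA nA GB minA NA NB; have dA := group_det _ GA; have dB := group_det _ GB.
have nA0 : ~ (hd A = 0 /\ mb A = 0 /\ mc A = 0).
 by move=> [? [? ?]]; apply: nA; exact: scalar_pm1.
apply: commute_proportional => //.
pose h := gz z; have dh : \det h = 1 by exact: gz_det.
pose c g := invmx h *m g *m h.
have dc g : \det g = 1 -> \det (c g) = 1 by move=> dg; rewrite !det_mul1 ?det_inv1.
have cM g k : c (g *m k) = c g *m c k.
 by rewrite /c !mulmxA -[_ *m h *m invmx h]mulmxA mulmxV ?det_unit // mulmx1.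
have cV g : \det g = 1 -> c (invmx g) = invmx (c g).
 move=> dg; apply: (can_inj (mulKmx (det_unit _ (dc _ dg)))).
 by rewrite mulmxV ?det_unit ?dc // -cM mulmxV ?det_unit // /c mulmx1 mulVmx ?det_unit.
have cc : c (commut A B) = commut (c A) (c B) by rewrite /commut !cM !cV.
have N0 : 0 < NN z A.
 rewrite lt_neqAle NN_ge0 andbT eq_sym; apply/eqP => e; apply: nA; exact: NN0_scalar e.
have k0 := kap_gt0; have kk := kapE.
have k1 : kap <= 1 by lra.
have GC : G (commut A B) by rewrite /commut; do ?apply: group_mul => //; exact: group_inv.
have [] := commut_small (c A) (c B); rewrite ?dc // -?NN_reduce ?(le_trans NA) ?(le_trans NB) //.
rewrite -cc -!NN_reduce => C1 C2.
have AB : NN z A * NN z B <= NN z A * kap by rewrite ler_wpM2l // ltW.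
(* A nontrivial commutator would give [NN z A <= 4 * 20736 * kap * NN z A] by near-minimality, which
   is false for positive [NN z A]. *)
have [C|C] : pm1 (commut A B) by apply: contrapT => /(minA _ GC); have : NN z A * kap * (400 * 400) = NN z A by [rewrite -mulrA kk mulr1]; clear -C1 AB N0; lra.
 have : commut A B *m B *m A = B *m A by rewrite C mul1mx.
 by rewrite /commut mulmxKV ?det_unit // mulmxKV ?det_unit.
exfalso; move: C2; rewrite C /c mulmxN mulmx1 mulNmx mulVmx ?det_unit // oppE oneE.
have -> : (-1 - 1 : R) ^+ 2 = 4 by ring.
apply: (fin_arith kap (NN z A * NN z B) (NN z A) k0 kk NA AB).
Qed.

(** Pigeonhole on the entries of [gz z ^-1 g gz z], which are bounded when [g] moves [z] by a
    bounded amount: two elements in one cell have a quotient so close to [1] that the separation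
    hypothesis makes it [1] or [-1]. The finite type depends on [d] and [K] only, which later gives
    counts uniform in [z]. *)
Lemma grid (d K : R) : 0 < d -> 0 < K -> exists U : finType, forall z,
 (forall g, G g -> NN z g < d -> pm1 g) -> exists f : 'M[R]_2 -> U, forall g h,
  G g -> G h -> bd z (act g z) <= K -> bd z (act h z) <= K -> f g = f h -> g = h.
Proof.
move=> d0 K0; pose k := K + 1; have k0 : 0 < k by rewrite /k; lra.
pose e := Num.min (2^-1) (d / (32 * (k * k))).
have kk0 : 0 < 32 * (k * k) by pos.
have e0 : 0 < e by rewrite lt_min invr_gt0 ltr0n divr_gt0.
have e1 : e <= 2^-1 by rewrite ge_min lexx.
have ed : 16 * (k * k) * (e * e) < d.
 have : e <= d / (32 * (k * k)) by rewrite ge_min lexx orbT.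
 rewrite ler_pdivlMr // => h; have : e * e <= e * 1 by rewrite ler_wpM2l; lra.
 have kk : 0 < k * k by pos.
 move=> /(ler_wpM2l (ltW kk)) h2.
 have : 0 < e * (k * k) by pos.
 lra.
pose m := Num.bound (2 * k / e).
exists ('I_m.+1 * 'I_m.+1 * ('I_m.+1 * 'I_m.+1))%type => z sep.
pose c g := invmx (gz z) *m g *m gz z.
pose q (x : R) := cell m ((x + k) / e).
exists (fun g => (q (ma (c g)), q (mb (c g)), (q (mc (c g)), q (md (c g))))).
have bnd g : G g -> bd z (act g z) <= K ->
  [/\ `|ma (c g)| <= k, `|mb (c g)| <= k, `|mc (c g)| <= k & `|md (c g)| <= k].
 move=> Gg; rewrite bd_reduce -{2}(gz_orig z) -!act_mul ?det_mul1 ?det_inv1 ?gz_det ?group_det // bd_orig.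
 have dg := group_det _ Gg.
 rewrite -/(c g) al_act ?ga_act ?det_mul1 ?det_inv1 ?gz_det // !origE => hK.
 have s1 := sqr_ge0 (ma (c g)); have s2 := sqr_ge0 (mb (c g)).
 have s3 := sqr_ge0 (mc (c g)); have s4 := sqr_ge0 (md (c g)).
 have kK : K <= k ^+ 2 by rewrite /k sqrrD; have := sqr_ge0 K; lra.
 by split; (apply: abs_le; [pos|lra]).
have qc x y : `|x| <= k -> `|y| <= k -> q x = q y -> `|x - y| <= e.
 have r u : `|u| <= k -> 0 <= (u + k) / e <= m%:R.
  rewrite ler_norml => /andP[u1 u2]; have u3 : 0 <= u + k by lra.
  rewrite divr_ge0 ?(ltW e0) //=.
  apply: le_trans (ltW (archi_boundP _)); last by pos.
  by rewrite ler_pM2r ?invr_gt0; lra.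
 move=> hx hy /(cell_close _ _ _ (r _ hx) (r _ hy)).
 rewrite -mulrBl opprD addrACA subrr addr0 normrM (gtr0_norm (_ : 0 < e^-1)) ?invr_gt0 //.
 by rewrite ltr_pdivrMr // mul1r => /ltW.
move=> g h Gg Gh /(bnd _ Gg)[a1 a2 a3 a4] /(bnd _ Gh)[b1 b2 b3 b4] [].
move=> /(qc _ _ a1 b1) c1 /(qc _ _ a2 b2) c2 /(qc _ _ a3 b3) c3 /(qc _ _ a4 b4) c4.
have dg := group_det _ Gg; have dh := group_det _ Gh.
have dcg : \det (c g) = 1 by rewrite !det_mul1 ?det_inv1 ?gz_det.
have Ggh : G (invmx g *m h) by apply: group_mul => //; exact: group_inv.
have cgh : c (invmx g *m h) = invmx (c g) *m c h.
 apply: (can_inj (mulKmx (det_unit _ dcg))); rewrite mulKVmx ?det_unit // /c !mulmxA.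
 by rewrite -[_ *m gz z *m invmx (gz z)]mulmxA mulmxV ?det_unit ?gz_det // mulmx1 mulmxK ?det_unit.
have : NN z (invmx g *m h) < d.
 rewrite NN_reduce -/(c _) cgh NN_orig_hd /hd !(mulE (invmx (c g)) (c h)) !(invE _ dcg).
 move: dcg; rewrite det2; move: a1 a2 a3 a4 c1 c2 c3 c4; clear -ed e0 k0.
 move: (ma (c g)) (mb (c g)) (mc (c g)) (md (c g)) (ma (c h)) (mb (c h)) (mc (c h)) (md (c h)).
 move=> a b x y a' b' x' y' a1 a2 a3 a4 c1 c2 c3 c4 dt.
 have pr (u v s t : R) : `|u| <= k -> `|v| <= k -> `|s| <= e -> `|t| <= e -> (u * s + v * t) ^+ 2 <= 4 * (k * k) * (e * e).
  move=> h1 h2 h3 h4.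
  have h5 : `|u * s + v * t| <= k * e + k * e.
   by apply: (le_trans (ler_normD _ _)); rewrite !normrM lerD // ler_pM.
  rewrite -[(u * s + v * t) ^+ 2]real_normK ?num_real //.
  have := ler_pM (normr_ge0 _) (normr_ge0 _) h5 h5; rewrite -expr2; lra.
 have N (u : R) : `|u| <= k -> `|- u| <= k by rewrite normrN.
 have p1 := pr _ _ _ _ a4 (N _ a2) c1 c3; have p2 := pr _ _ _ _ a4 (N _ a2) c2 c4.
 have p3 := pr _ _ _ _ (N _ a3) a1 c1 c3; have p4 := pr _ _ _ _ (N _ a3) a1 c2 c4.
 set k2 := 4 * (k * k) * (e * e) in p1 p2 p3 p4.
 have -> : y * a' + - b * x' = 1 - (y * (a - a') + - b * (x - x')) by rewrite -dt; ring.
 have -> : - x * b' + a * y' = 1 - (- x * (b - b') + a * (y - y')) by rewrite -dt; ring.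
 have -> : y * b' + - b * y' = - (y * (b - b') + - b * (y - y')) by ring.
 have -> : - x * a' + a * x' = - (- x * (a - a') + a * (x - x')) by ring.
 have kd : 4 * k2 < d by rewrite /k2; lra.
 move: p1 p2 p3 p4 kd; move: (_ + _) (- x * (b - b') + _) (y * (b - b') + _) (- x * (a - a') + _) k2.
 clear => X Y Z T k2 p1 p4 p2 p3 kd; rewrite !sqrrN.
 have -> : (1 - X - (1 - Y)) / 2 = (Y - X) / 2 by ring.
 have := sqr_ge0 (X + Y); rewrite expr_div_n sqrrB sqrrD => h; lra.
move=> /(sep _ Ggh)[gh|gh]; first by rewrite -[LHS]mulmx1 -gh mulKVmx ?det_unit.
(* The quotient [-1] is impossible: with [g] and [- g] in one cell all entries would be at most 1/4,
   against determinant 1. *)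
exfalso; have hg : h = - g by rewrite -[LHS](mulKVmx (det_unit _ dg)) gh mulmxN mulmx1.
have cN : c h = - c g by rewrite hg /c mulmxN mulNmx.
move: dcg c1 c2 c3 c4; rewrite det2 cN !oppE !opprK; clear -e1 e0.
move: (ma (c g)) (mb (c g)) (mc (c g)) (md (c g)) => a b x y dt.
have hh (u : R) : `|u + u| <= e -> `|u| <= 4^-1.
 by rewrite !ler_norml => /andP[? ?]; apply/andP; split; lra.
move=> /hh h1 /hh h2 /hh h3 /hh h4.
have : `|a * y - b * x| <= 4^-1 * 4^-1 + 4^-1 * 4^-1.
 by apply: (le_trans (ler_normB _ _)); rewrite !normrM lerD // ler_pM.
rewrite dt normr1 => h; lra.
Qed.

Lemma countable_group : countable G.
Proof.
rewrite (_ : G = \bigcup_(n in [set: nat]) [set g | G g /\ bd orig (act g orig) <= n.+1%:R]).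
 apply: bigcup_countable => // n _; apply: finite_set_countable.
 have [d d0 sep] := isolated orig.
 have [U /(_ orig sep)[f fi]] := grid d n.+1%:R d0 (ltr0Sn _ _).
 by apply: (finite_set_inj _ _ _ f) => g h [Gg bg] [Gh bh]; exact: fi.
apply/seteqP; split => [g Gg|g [n _ []] //].
exists (Num.bound (bd orig (act g orig))) => //; split => //.
rewrite (le_trans (ltW (archi_boundP _))) ?ler_nat //; exact: ltW (bd_gt0 _ _).
Qed.

End group.
Arguments group_det {R G}.
Arguments group_mul {R G}.
Arguments group_inv {R G}.
Arguments group_opp {R G}.
Arguments isolated {R G}.
Arguments near_min {R G}.
Arguments short_proportional {R G}.
Arguments grid {R G}.
Arguments countable_group {R G}.

(** * Scaling matrices and Shimizu's lemma *)

Section scaling.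
Context {R : realType} (G : set 'M[R]_2) (dG : discrete_subgroup_SL2 G) (sb : 'M[R]_2)
 (hsb : scaling_matrix G sb).

Lemma scaling_det : \det sb = 1. Proof. by case: hsb. Qed.

Lemma parab_mx2 (s : R) (n : int) : parab s n = mx2 s (s * n%:~R) 0 s.
Proof.
apply/matrixP => i j; rewrite /parab /mx2 !mxE.
by case: (ord2P i) => ->; case: (ord2P j) => ->.
Qed.

Lemma scaling_parab (s : R) (n : int) : s = 1 \/ s = -1 -> G (sb *m parab s n *m invmx sb).
Proof.
move=> hs; case: hsb => db /(_ (parab s n))[_ H].
have [|[g Gg ->] _] := H; first by exists s, n.
by rewrite !mulmxA mulmxV ?det_unit // mul1mx mulmxK ?det_unit.
Qed.

Lemma scaling_fix g : G g -> mc (invmx sb *m g *m sb) = 0 ->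
 exists (s : R) (n : int), (s = 1 \/ s = -1) /\ invmx sb *m g *m sb = parab s n.
Proof. by move=> Gg c0; case: hsb => db /(_ (invmx sb *m g *m sb))[H _]; apply: H; split => //; exists g. Qed.

Lemma scaling_opp1 : G (- 1%:M).
Proof.
have := scaling_parab (-1) 0 (or_intror erefl).
rewrite (_ : parab _ _ = - 1%:M); first by rewrite mulmxN mulmx1 mulNmx mulmxV ?det_unit ?scaling_det.
by rewrite parab_mx2; apply: mx2_eq; rewrite !mx2E oppE oneE ?mulr0 ?oppr0.
Qed.

(* Shimizu's lemma: the unipotent element at infinity and its conjugate by [tau] cannot both be short. *)
Lemma mc_lower g : G g -> mc (invmx sb *m g *m sb) != 0 -> kap / 4 <= mc (invmx sb *m g *m sb) ^+ 2.
Proof.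
set tau := invmx sb *m g *m sb => Gg c0; rewrite leNgt; apply/negP => small.
have db := scaling_det; have dg := group_det dG _ Gg.
have dt : \det tau = 1 by rewrite !det_mul1 ?det_inv1.
have hN := scaling_opp1.
pose u : 'M[R]_2 := parab 1 1; have uE : u = mx2 1 1 0 1 by rewrite /u parab_mx2 mulr1.
pose T := sb *m u *m invmx sb; have GT : G T by apply: scaling_parab; left.
pose T2 := g *m T *m invmx g; have GT2 : G T2 by do ?apply: group_mul => //; exact: group_inv.
have T2E : T2 = sb *m (tau *m u *m invmx tau) *m invmx sb.
 have -> : invmx tau = invmx sb *m invmx g *m sb.
  apply: (can_inj (mulKmx (det_unit _ dt))); rewrite mulmxV ?det_unit // /tau !mulmxA.
  by rewrite -[_ *m sb *m invmx sb]mulmxA mulmxV ?det_unit // mulmx1 -[_ *m g *m invmx g]mulmxA mulmxV ?det_unit // mulmx1 mulVmx ?det_unit.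
 rewrite /T2 /T /tau !mulmxA mulmxV ?det_unit // mul1mx -!mulmxA; congr (g *m _).
 by rewrite mulmxV ?det_unit // mulmx1 !mulmxA.
pose c := mc tau; pose a := ma tau; have cn : 0 < `|c| by rewrite normr_gt0.
(* The point at height [1 / al0] on the vertical geodesic above [a / c], the image of infinity under
   [tau]. Along it [T] and its conjugate [T2] have norms [al0^2] and [(c^2 / al0)^2], which agree at
   [al0 = |c|]. *)
pose w (al0 : R) : plane R := (a / c * al0, - ln al0).
have c00 : c != 0 by [].
have alw x : 0 < x -> al (w x) = x by move=> x0; rewrite /al opprK lnK.
have NT x : 0 < x -> NN (act sb (w x)) T = x ^+ 2.
 by move=> x0; rewrite NN_act // /NN uE !mx2E alw //; field.
have NT2 x : 0 < x -> NN (act sb (w x)) T2 = (c ^+ 2 / x) ^+ 2.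
 move=> x0; have x00 : x != 0 by rewrite gt_eqF.
 rewrite T2E NN_act // -{1}(actVK tau (w x) dt) NN_act // /NN uE !mx2E al_act ?det_inv1 // !(invE _ dt).
 have ga_w : ga (w x) = (1 + (a / c * x) ^+ 2) / x.
  have := al_ga (w x); rewrite alw // => e.
  by apply: (mulfI x00); rewrite e /be /=; field; rewrite x00 c00.
 by rewrite alw // ga_w /be /= -/c -/a; field; rewrite x00 c00.
have NTc := NT _ cn; have NT2c := NT2 _ cn.
have ec : `|c| ^+ 2 = c ^+ 2 by rewrite real_normK ?num_real.
have e2c : (c ^+ 2 / `|c|) ^+ 2 = c ^+ 2.
 by rewrite -ec expr2 mulfK ?gt_eqF.
rewrite ec in NTc; rewrite e2c in NT2c.
have nT : ~ pm1 T.
 move=> h; have : NN (act sb (w `|c|)) T = 0 by exact: NN_pm1.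
 by rewrite NTc => /eqP; rewrite sqrf_eq0; apply/negP.
have [A [GA nA minA]] := near_min dG hN (act sb (w `|c|)) (ex_intro2 _ _ T GT nT).
rewrite -/c in small.
have NA : NN (act sb (w `|c|)) A <= kap by have := minA _ GT nT; rewrite NTc; lra.
have NTk : NN (act sb (w `|c|)) T <= kap by rewrite NTc; have := sqr_ge0 c; lra.
have NT2k : NN (act sb (w `|c|)) T2 <= kap by rewrite NT2c -NTc.
have [b1 [p1 q1 r1]] := short_proportional dG _ _ _ GA nA GT minA NA NTk.
have [b2 [p2 q2 r2]] := short_proportional dG _ _ _ GA nA GT2 minA NA NT2k.
(* [T] and [T2] have traceless parts proportional to that of [A], so the ratio of their norms is the
   same at all points. It is 1 at [al0 = |c|] but not at [al0 = |c| / 2]. *)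
have key w' : b1 ^+ 2 * NN w' T2 = b2 ^+ 2 * NN w' T.
 by rewrite (NN_scale _ A T b1) // (NN_scale _ A T2 b2) //; ring.
have c2 : 0 < c ^+ 2 by rewrite exprn_even_gt0.
have b10 : 0 < b1 ^+ 2.
 rewrite exprn_even_gt0 //=; apply/eqP => b0; move: NTc; rewrite (NN_scale _ A T b1) // b0 expr0n mul0r; lra.
have := key (act sb (w `|c|)); rewrite NTc NT2c => /(mulIf (lt0r_neq0 c2)) e12.
have c5 : 0 < `|c| / 2 by pos.
have := key (act sb (w (`|c| / 2))); rewrite NT // NT2 // e12.
have -> : c ^+ 2 / (`|c| / 2) = 2 * (c ^+ 2 / `|c|) by field; rewrite gt_eqF.
rewrite exprMn e2c expr_div_n ec -e12 => /(mulfI (lt0r_neq0 b10)); lra.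
Qed.

End scaling.

(** * Unfolding *)

Section unfolding.
Context {R : realType}.
Notation P := (plane R).
Notation L1 := (@lebesgue_measure R).
Notation L2 := (L1 \x L1)%E.
Context (G : set 'M[R]_2) (dG : discrete_subgroup_SL2 G) (hN : G (- 1%:M)).
Implicit Types (g h : 'M[R]_2) (z w : P) (phi : P -> \bar R).

(** Equivalent points of [F] coincide, but a point may have a nontrivial stabiliser; such points are
    shown to be negligible. *)
Definition fdom (F : set P) := [/\ measurable F,
 (forall z, exists2 g, G g & F (act g z)) &
 (forall z g, F z -> G g -> F (act g z) -> act g z = z)].

Lemma Phi_inj z w : Phi z = Phi w -> z = w.
Proof.
case: z w => [t v] [t' v'] [] h /expR_inj vv; move: h; rewrite vv => /(mulIf _) -> //.
by rewrite gt_eqF ?expR_gt0.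
Qed.

Lemma Phi_upper z : upper_half (Phi z).
Proof. by rewrite /upper_half /Phi /= expR_gt0. Qed.

Lemma fund_domain_plane F : fund_domain G F -> fdom (@Phi R @^-1` F).
Proof.
move=> [mF Fu cov inj]; split.
- have mPhi : mfunT (@Phi R) by rewrite /Phi; mf.
 by rewrite -[X in measurable X]setTI; mf.
- move=> z; have [w Fw [g Gg gw]] := cov _ (Phi_upper z); exists g => //=.
 by rewrite -mobius_Phi ?(group_det dG) // gw.
- move=> z g Fz Gg Fg; apply: Phi_inj; apply/esym; apply: inj => //.
 by exists g => //; rewrite mobius_Phi ?(group_det dG).
Qed.

(** With the first fixed point moved to [orig], [g] becomes a rotation matrix other than [1] and
    [-1]. A second fixed point solves a linear system in [ga - al] and [be] whose determinant is a
    nonzero multiple of [c^2 + d^2 = 1], so it is [orig] as well. *)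
Let fixed_unique g z w : \det g = 1 -> ~ pm1 g -> act g z = z -> act g w = w -> w = z.
Proof.
move=> dg ng gz' gw; pose h := gz z; have dh : \det h = 1 by exact: gz_det.
pose c := invmx h *m g *m h; have dc : \det c = 1 by rewrite !det_mul1 ?det_inv1.
have co : act c orig = orig by rewrite !act_mul ?det_mul1 ?det_inv1 // gz_orig gz' -{1}(gz_orig z) actK.
pose w' := act (invmx h) w.
have cw : act c w' = w' by rewrite /c /w' !act_mul ?det_mul1 ?det_inv1 // actVK // gw.
suff w'0 : w' = orig by rewrite -(actVK h w dh) -/w' w'0 gz_orig.
have nc : ~ (hd c = 0 /\ mb c = 0 /\ mc c = 0).
 move=> [c1 [c2 c3]]; apply: ng; apply: (NN0_scalar z) => //.
 by rewrite NN_reduce -/h -/c NN_orig_hd c1 c2 c3 expr0n mulr0 !addr0.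
have := congr1 al co; have := congr1 be co; have := congr1 al cw; have := congr1 be cw.
clearbody w' c; rewrite !be_act !al_act // al_orig be_orig ga_orig; move: dc nc; rewrite det2 /hd => dc nc e4 e3 e2 e1.
move: dc nc e1 e2 e3 e4 (al_ga w') (al_gt0 w').
move=> dc nc e1 e2 e3 e4 ew a0.
have e1' : mc c ^+ 2 + md c ^+ 2 = 1 by lra.
have e2' : ma c * mc c + mb c * md c = 0 by lra.
have ea : ma c = md c.
 transitivity (ma c * (mc c ^+ 2 + md c ^+ 2)); first by rewrite e1' mulr1.
 transitivity (mc c * (ma c * mc c + mb c * md c) + md c * (ma c * md c - mb c * mc c)); first by ring.
 by rewrite e2' dc; ring.
have eb : mb c = - mc c.
 transitivity (mb c * (mc c ^+ 2 + md c ^+ 2)); first by rewrite e1' mulr1.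
 transitivity (md c * (ma c * mc c + mb c * md c) - mc c * (ma c * md c - mb c * mc c)); first by ring.
 by rewrite e2' dc; ring.
have c0 : mc c != 0 by apply/eqP => c0; apply: nc; rewrite ea eb c0 subrr mul0r oppr0.
have f1 : mc c * (ga w' - al w') + 2 * md c * be w' = 0.
 apply: (mulfI c0); rewrite mulr0.
 have : mc c ^+ 2 * ga w' + 2 * mc c * md c * be w' + md c ^+ 2 * al w' - (mc c ^+ 2 + md c ^+ 2) * al w' = 0 by rewrite e1' e3; ring.
 lra.
have f2 : md c * (ga w' - al w') - 2 * mc c * be w' = 0.
 apply: (mulfI c0); rewrite mulr0; move: e4; rewrite ea eb => e4.
 have : md c * mc c * ga w' + (md c * md c + - mc c * mc c) * be w' + - mc c * md c * al w' - (mc c ^+ 2 + md c ^+ 2) * be w' = 0 by rewrite e1' e4; ring.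
 lra.
have g1 : ga w' = al w'.
 apply/eqP; rewrite -subr_eq0; apply/eqP.
 transitivity ((mc c ^+ 2 + md c ^+ 2) * (ga w' - al w')); first by rewrite e1' mul1r.
 transitivity (mc c * (mc c * (ga w' - al w') + 2 * md c * be w') + md c * (md c * (ga w' - al w') - 2 * mc c * be w')); first by ring.
 by rewrite f1 f2; ring.
have g2 : be w' = 0.
 move: f2; rewrite g1 subrr mulr0 add0r => /eqP; rewrite oppr_eq0 mulf_eq0 mulf_eq0 pnatr_eq0 (negPf c0) /=.
 by move/eqP.
apply: plane_eq; rewrite ?al_orig //.
move: ew; rewrite g1 g2 expr0n addr0 => /eqP; rewrite -expr2 sqrf_eq1 => /orP[/eqP|/eqP am]; lra.
Qed.

Let null_set1 z : L2.-negligible [set z].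
Proof.
exists [set z]; split => //.
 rewrite (_ : [set z] = [set z.1] `*` [set z.2]); first exact: measurableX.
 by apply/seteqP; split => [_ ->|[a b] [/= -> ->]]; case: z.
rewrite (_ : [set z] = [set z.1] `*` [set z.2]); last first.
 by apply/seteqP; split => [_ ->|[a b] [/= -> ->]]; case: z.
by rewrite product_measure1E //= lebesgue_measure_set1 mul0e.
Qed.

Let fixed_null : L2.-negligible [set z | exists g, [/\ G g, ~ pm1 g & act g z = z]].
Proof.
have cG : countable [set g | G g /\ ~ pm1 g].
 by apply: sub_countable (countable_group dG hN); apply: subset_card_le => g [].
have [e [p [pA pS _]]] := @countable_enum R _ _ cG.
apply: (@negligibleS _ _ _ L2 (\bigcup_n [set z | p n /\ act (e n) z = z])).
 by move=> z [g [Gg ng gz']]; have [n pn en] := pS g (conj Gg ng); exists n => //=; rewrite en.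
apply: negligible_bigcup => n.
have [[z [pn ez]]|ne] := pselect (exists z, p n /\ act (e n) z = z).
 apply: (negligibleS _ (null_set1 z)) => w [_ ew] /=.
 have [Gn nn] := pA _ pn; exact: (fixed_unique (e n) z w (group_det dG _ Gn)).
rewrite (_ : [set _ | _] = set0); first exact: negligible_set0.
by apply/seteqP; split => w //= h; apply: ne; exists w.
Qed.

Definition gsum phi z : \bar R := (\esum_(g in G) phi (act g z))%E.

Let measurable_ga phi g : G g -> mfunT phi -> mfunT (fun z => phi (act g z)).
Proof. by move=> Gg mphi; mf; exact: measurable_act (group_det dG _ Gg). Qed.

Lemma measurable_gsum phi : mfunT phi -> (forall z, (0 <= phi z)%E) ->
 mfunT (gsum phi).
Proof.
move=> mphi phi0; apply: measurable_esum => [|g Gg|//]; first exact: countable_group.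
mf.
Qed.

Lemma gsum_ge0 phi z : (forall z, (0 <= phi z)%E) -> (0 <= gsum phi z)%E.
Proof. by move=> phi0; exact: esum_ge0. Qed.

Lemma group_bij_inv : set_bij G G (fun g => invmx g).
Proof.
split; first by move=> g Gg; exact: group_inv.
- by move=> g h _ _; exact: (can_inj (@invmxK _ _)).
- by move=> g Gg; exists (invmx g); [exact: group_inv|rewrite invmxK].
Qed.

(* Up to a null set of fixed points every point has exactly the two translates [g z] and [(-g) z] in [F]. *)
Lemma unfold_integral (F : set P) phi : fdom F -> mfunT phi -> (forall z, (0 <= phi z < +oo)%E) ->
 (\int[L2]_(z in F) gsum phi z = 2%:E * \int[L2]_z phi z)%E.
Proof.
move=> [mF cov inj] mphi phi_fin; have phi0 z : (0 <= phi z)%E by case/andP: (phi_fin z).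
pose b z : \bar R := (\1_F z)%:E.
have mb : mfunT b by apply/measurable_EFinP; mf.
have b0 z : (0 <= b z)%E by rewrite lee_fin indicE ler0n.
have ms : mfunT (gsum b) by exact: measurable_gsum.
(* Off the fixed points the indicator of [F] sums to 2 over the group, so [2 * phi] may be replaced
   by [phi * gsum b]; invariance of the measure then moves each [g] from [b] to [phi]. *)
have s2 z : ~ (exists g, [/\ G g, ~ pm1 g & act g z = z]) -> gsum b z = 2%:E.
 move=> nf; have [g Gg Fg] := cov z.
 have Gmg : G (- g) by exact: group_opp dG hN _ Gg.
 have uniq h : G h -> F (act h z) -> h = g \/ h = - g.
  move=> Gh Fh; have Gq : G (invmx g *m h) by apply: (group_mul dG) => //; exact: group_inv.
  have [dg dh] := (group_det dG _ Gg, group_det dG _ Gh).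
  have hz : act h z = act g z.
   have e : act (h *m invmx g) (act g z) = act h z by rewrite act_mul ?det_inv1 // actK.
   rewrite -e; apply: inj => //; last by rewrite e.
   by apply: (group_mul dG) => //; exact: group_inv.
  have [q|q] : pm1 (invmx g *m h).
   apply: contrapT => nq; apply: nf; exists (invmx g *m h); split => //.
   by rewrite act_mul ?det_inv1 // hz actK.
  - by left; rewrite -(mulKVmx (det_unit _ dg) h) q mulmx1.
  - by right; rewrite -(mulKVmx (det_unit _ dg) h) q mulmxN mulmx1.
 have gN : - g <> g.
  move=> e; have := group_det dG _ Gg; rewrite det2.
  have e1 (u : 'M[R]_2 -> R) : u (- g) = - u g -> u g = 0 by rewrite e; lra.
  have -> : ma g = 0 by apply: (e1 (@ma R)); rewrite oppE.
  have -> : Defs.mb g = 0 by apply: (e1 (@Defs.mb R)); rewrite oppE.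
  rewrite !mul0r subrr => /eqP.
  by rewrite eq_sym oner_eq0.
 have bE h : G h -> b (act h z) = if `[<h = g \/ h = - g>] then 1%E else 0%E.
  move=> Gh; rewrite /b indicE; case: asboolP => [hg|hg].
   by rewrite mem_set //; case: hg => ->; rewrite ?act_opp.
  by rewrite memNset // => /(uniq _ Gh).
 rewrite /gsum (eq_esum bE) (esumID [set g]); last by move=> x _; case: ifP.
 rewrite (_ : G `&` [set g] = [set g]); last by apply/seteqP; split => x [] //= ->.
 rewrite esum_set1; last by case: ifP.
 rewrite asboolT; last by left.
 rewrite (esum_single _ _ (- g)).
 - by rewrite asboolT //; right.
 - by split.
 - by move=> x _; case: ifP.
 - by move=> x [Gx xg] xm; rewrite asboolF // => -[].
transitivity (\int[L2]_z (2%:E * phi z))%E; last by rewrite ge0_integralZl_EFin // ler0n.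
transitivity (\int[L2]_z (phi z * gsum b z))%E; last first.
 apply: ge0_ae_eq_integral => //.
 - mf.
 - by mf.
 - by move=> z _; rewrite mule_ge0 ?gsum_ge0.
 - by move=> z _; rewrite mule_ge0 // lee_fin ler0n.
 - apply: negligibleS fixed_null => z /= h; apply: contrapT => nf; apply: h => _.
  by rewrite s2 // muleC.
have cG := countable_group dG hN.
rewrite integral_mkcond.
transitivity (\int[L2]_z \esum_(g in G) (phi (act g z) * b z))%E.
 apply: eq_integral => z _; rewrite patchE /b indicE; case: ifPn => zF.
  by rewrite /gsum; apply: eq_esum => g _; rewrite mule1.
 by rewrite esum1 // => g _; rewrite mule0.
rewrite integral_esum //; first last.
- by move=> g z Gg; rewrite mule_ge0.
- by move=> g Gg; mf.
transitivity (\int[L2]_z \esum_(g in G) (phi z * b (act g z)))%E; last first.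
 apply: eq_integral => z _; rewrite /gsum.
 have [e [p [pA _ E]]] := @countable_enum R _ _ cG.
 rewrite !E //; last by move=> g Gg; rewrite mule_ge0.
 have -> : phi z = (fine (phi z))%:E by rewrite fineK // ge0_fin_numE; case/andP: (phi_fin z).
 rewrite -nneseriesZl; last by move=> n _; case: ifP.
 by apply: eq_eseriesr => n _; case: ifP => // _; rewrite mule0.
rewrite [RHS](integral_esum _ _ _ _ _ _ cG); first last.
- by move=> g z Gg; rewrite mule_ge0.
- by move=> g Gg; mf.
rewrite [RHS](reindex_esum _ _ _ _ group_bij_inv); apply: eq_esum => g Gg.
have dg := group_det dG _ Gg.
rewrite -[RHS](integral_act g) //.
- by apply: eq_integral => z _; rewrite actK.
- by apply: emeasurable_funM => //; apply: measurable_ga => //; exact: group_inv.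
- by move=> z; rewrite mule_ge0.
Qed.

End unfolding.

(** * Bounded functions and symmetric Markov kernels on a finite measure space *)

Section bounded_functions.
Context {d : measure_display} {T : measurableType d} {R : realType}
 (mu : {finite_measure set T -> \bar R}).
Implicit Types (f h : T -> R).

Definition bmf f := mfunT f /\ exists M, forall x, `|f x| <= M.

Definition Int f : R := fine (\int[mu]_x (f x)%:E)%E.

Lemma bmf_cst (c : R) : bmf (fun=> c).
Proof. by split; mf. Qed.

Lemma bmfD f h : bmf f -> bmf h -> bmf (fun x => f x + h x).
Proof.
move=> [mf' [M fM]] [mh [N hN]]; split; mf.
by exists (M + N) => x; rewrite (le_trans (ler_normD _ _)) ?lerD.
Qed.

Lemma bmfM f h : bmf f -> bmf h -> bmf (fun x => f x * h x).
Proof.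
move=> [mf' [M fM]] [mh [N hN]]; split; mf.
by exists (M * N) => x; rewrite normrM ler_pM.
Qed.

Lemma bmfN f : bmf f -> bmf (fun x => - f x).
Proof.
by move=> [mf' [M fM]]; split; [mf|exists M => x; rewrite normrN].
Qed.

Lemma bmfB f h : bmf f -> bmf h -> bmf (fun x => f x - h x).
Proof. by move=> bf bh; exact: bmfD bf (bmfN _ bh). Qed.

Lemma bmfX f n : bmf f -> bmf (fun x => f x ^+ n).
Proof.
move=> [mf' [M fM]]; split; mf.
by exists (M ^+ n) => x; rewrite normrX lerXn2r ?nnegrE // (le_trans (normr_ge0 _) (fM x)).
Qed.

Lemma bmf_indic (A : set T) : measurable A -> bmf (\1_A).
Proof.
move=> mA; split; mf.
by exists 1 => x; rewrite indicE; case: (_ \in _); rewrite ?normr1 ?normr0.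
Qed.

Lemma bmf_integrable f : bmf f -> mu.-integrable setT (EFin \o f).
Proof.
move=> [mf' [M fM]]; apply: measurable_bounded_integrable => //.
 exact: fin_num_fun_lty.
by exists M; split; [exact: num_real|move=> N MN x _; rewrite /= (le_trans (fM x)) // ltW].
Qed.

Lemma IntE f : bmf f -> (\int[mu]_x (f x)%:E = (Int f)%:E)%E.
Proof. by move=> /bmf_integrable bf; rewrite /Int fineK //; exact: (integrable_fin_num measurableT bf). Qed.

Lemma IntD f h : bmf f -> bmf h -> Int (fun x => f x + h x) = Int f + Int h.
Proof.
move=> bf bh; apply: EFin_inj; rewrite EFinD -!IntE //; last exact: bmfD.
by rewrite (integralD_EFin measurableT) //; exact: bmf_integrable.
Qed.

Lemma IntZ (c : R) f : bmf f -> Int (fun x => c * f x) = c * Int f.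
Proof.
move=> bf; apply: EFin_inj; rewrite EFinM -!IntE //; last by apply: bmfM => //; exact: bmf_cst.
by rewrite -(integralZl measurableT) //; exact: bmf_integrable.
Qed.

Lemma IntB f h : bmf f -> bmf h -> Int (fun x => f x - h x) = Int f - Int h.
Proof.
move=> bf bh; rewrite (IntD f (fun x => - h x)) //; last exact: bmfN.
by rewrite -[in RHS]mulN1r -IntZ //; congr (_ + Int _); apply/funext => x; rewrite mulN1r.
Qed.

Lemma Int_ge0 f : (forall x, 0 <= f x) -> 0 <= Int f.
Proof. by move=> f0; rewrite fine_ge0 // integral_ge0 // => x _; rewrite lee_fin. Qed.

Lemma Int_le f h : bmf f -> bmf h -> (forall x, f x <= h x) -> Int f <= Int h.
Proof.
move=> bf bh fh; rewrite -subr_ge0 -IntB //; apply: Int_ge0 => x; by rewrite subr_ge0.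
Qed.

Definition vol := Int (fun=> 1).
Hypothesis vol_gt0 : 0 < vol.

Lemma Int_cst (c : R) : Int (fun=> c) = c * vol.
Proof. by rewrite /vol -IntZ; [congr Int; apply/funext => x; rewrite mulr1|exact: bmf_cst]. Qed.

Definition Cov f h := Int (fun x => f x * h x) - Int f * Int h / vol.
Definition Var f := Cov f f.

Lemma Int_centered f (c : R) : bmf f ->
 Int (fun x => (f x - c) ^+ 2) = Var f + vol * (Int f / vol - c) ^+ 2.
Proof.
move=> bf; rewrite (_ : (fun x => _) = fun x => (f x * f x + (- 2 * c) * f x) + c ^+ 2); last first.
 by apply/funext => x; ring.
rewrite IntD; [|by apply: bmfD; [exact: bmfM|apply: bmfM => //; exact: bmf_cst]|exact: bmf_cst].
rewrite IntD; [|exact: bmfM|by apply: bmfM => //; exact: bmf_cst].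
by rewrite IntZ // Int_cst /Var /Cov; field; rewrite gt_eqF.
Qed.

Lemma Var_le f (c : R) : bmf f -> Var f <= Int (fun x => (f x - c) ^+ 2).
Proof. by move=> bf; rewrite Int_centered // lerDl mulr_ge0 ?sqr_ge0 // ltW. Qed.

Lemma Var_ge0 f : bmf f -> 0 <= Var f.
Proof.
move=> bf; have := Int_ge0 (fun x => (f x - Int f / vol) ^+ 2) (fun x => sqr_ge0 _).
by rewrite Int_centered // subrr expr0n mulr0 addr0.
Qed.

(** Cauchy-Schwarz, from nonnegativity of the variance of [f + s h] as a polynomial in [s]. When
    [Var h = 0] this polynomial is affine, and a suitable [s] would give it the value -1 if the
    covariance were nonzero. *)
Lemma Cov_sqr f h : bmf f -> bmf h -> Cov f h ^+ 2 <= Var f * Var h.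
Proof.
move=> bf bh.
have E (s : R) : Var (fun x => f x + s * h x) = Var f + 2 * s * Cov f h + s ^+ 2 * Var h.
 have bsh : bmf (fun x => s * h x) by apply: bmfM => //; exact: bmf_cst.
 rewrite /Var /Cov (_ : (fun x => _ * _) = fun x => (f x * f x + (2 * s) * (f x * h x)) + s ^+ 2 * (h x * h x)); last first.
  by apply/funext => x; ring.
 have b1 : bmf (fun x => f x * f x) by exact: bmfM.
 have b2 : bmf (fun x => f x * h x) by exact: bmfM.
 have b3 : bmf (fun x => h x * h x) by exact: bmfM.
 have c2 : bmf (fun x => (2 * s) * (f x * h x)) by apply: bmfM => //; exact: bmf_cst.
 have c3 : bmf (fun x => s ^+ 2 * (h x * h x)) by apply: bmfM => //; exact: bmf_cst.
 rewrite (IntD _ _ (bmfD _ _ b1 c2) c3) (IntD _ _ b1 c2) (IntD f _ bf bsh).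
 by rewrite (IntZ _ _ b2) (IntZ _ _ b3) (IntZ _ _ bh); field; rewrite gt_eqF.
have P (s : R) : 0 <= Var f + 2 * s * Cov f h + s ^+ 2 * Var h.
 by rewrite -E; apply: Var_ge0; apply: bmfD => //; apply: bmfM => //; exact: bmf_cst.
have [h0|h0] := eqVneq (Var h) 0.
 rewrite h0 mulr0; have := P (- (Var f + 1) / (2 * Cov f h)); rewrite h0 mulr0 addr0.
 have [-> _|c0] := eqVneq (Cov f h) 0; first by rewrite expr0n.
 have -> : 2 * (- (Var f + 1) / (2 * Cov f h)) * Cov f h = - (Var f + 1) by field.
 lra.
have hp : 0 < Var h by rewrite lt_neqAle eq_sym h0 Var_ge0.
have := P (- Cov f h / Var h); rewrite -(pmulr_rge0 _ hp).
have -> : Var h * (Var f + 2 * (- Cov f h / Var h) * Cov f h + (- Cov f h / Var h) ^+ 2 * Var h) =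
 Var f * Var h - Cov f h ^+ 2 by field.
lra.
Qed.

Section kernel.
Context (k : T -> T -> \bar R) (mk : mfunT (fun z : T * T => k z.1 z.2))
 (k0 : forall x y, (0 <= k x y)%E) (kC : forall x y, k x y = k y x)
 (k1 : forall x, (\int[mu]_y k x y = 1)%E).

Lemma measurable_kx x : mfunT (k x).
Proof. exact: (measurableT_comp mk (pair1_measurable x)). Qed.

Let mmul (f : T -> T -> R) : mfunT (fun z : T * T => f z.1 z.2) ->
 mfunT (fun z : T * T => (k z.1 z.2 * (f z.1 z.2)%:E)%E).
Proof. by move=> mf'; mf. Qed.

Lemma kernel_tonelli (f : T -> T -> R) : mfunT (fun z : T * T => f z.1 z.2) ->
 (forall x y, 0 <= f x y) ->
 (\int[mu]_x \int[mu]_y (k x y * (f x y)%:E) = \int[mu]_x \int[mu]_y (k x y * (f y x)%:E))%E.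
Proof.
move=> mf' f0; rewrite (tonelli _ _ _ _ mu mu (fun x y => k x y * (f x y)%:E)%E); last 2 first.
- mf.
- by move=> x y; rewrite mule_ge0 ?lee_fin.
by apply: eq_integral => y _; apply: eq_integral => x _; rewrite kC.
Qed.

(** Truncation to a real number is faithful on [bmp], the bounded nonnegative functions, for which
    the integral is finite; the operator is used on these only. *)
Definition Kop f x : R := fine (\int[mu]_y (k x y * (f y)%:E))%E.

Let mkf f x : mfunT f -> mfunT (fun y => (k x y * (f y)%:E)%E).
Proof. by move=> mf'; apply: emeasurable_funM; [exact: measurable_kx|exact/measurable_EFinP]. Qed.

Let kint_le f M x : mfunT f -> (forall y, 0 <= f y <= M) ->
 (\int[mu]_y (k x y * (f y)%:E) <= M%:E)%E.
Proof.
move=> mf' fM; have M0 : 0 <= M by have /andP[h1 h2] := fM x; exact: le_trans h2.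
rewrite -[leRHS]mule1 -(k1 x) -ge0_integralZl_EFin //; last exact: measurable_kx.
apply: ge0_le_integral => //.
- by move=> y _; rewrite mule_ge0 // lee_fin; case/andP: (fM y).
- exact: mkf.
- by mf; exact: measurable_kx.
- by move=> y _; rewrite muleC lee_wpmul2r // lee_fin; case/andP: (fM y).
Qed.

Definition bmp f := bmf f /\ forall x, 0 <= f x.

Lemma bmp_bound f : bmp f -> exists M, forall y, 0 <= f y <= M.
Proof. by move=> [[_ [M fM]] f0]; exists M => y; rewrite f0 -[f y]ger0_norm ?fM. Qed.

Lemma KopE f x : bmp f -> (\int[mu]_y (k x y * (f y)%:E) = (Kop f x)%:E)%E.
Proof.
move=> bf; have [[mf' _] f0] := bf; have [M fM] := bmp_bound _ bf.
rewrite fineK // ge0_fin_numE; last by apply: integral_ge0 => y _; rewrite mule_ge0 // lee_fin.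
exact: le_lt_trans (kint_le f M x mf' fM) (ltry _).
Qed.

Lemma Kop_bmp f : bmp f -> bmp (Kop f).
Proof.
move=> bf; have [[mf' _] f0] := bf; have [M fM] := bmp_bound _ bf.
have K0 x : 0 <= Kop f x by rewrite fine_ge0 // integral_ge0 // => y _; rewrite mule_ge0 // lee_fin.
split => //; split.
 apply/measurable_EFinP; rewrite (_ : _ \o _ = fun x => \int[mu]_y (k x y * (f y)%:E))%E; last first.
  by apply/funext => x; rewrite KopE.
 apply: (measurable_fun_fubini_tonelli_F (m2 := mu) (fun z => k z.1 z.2 * (f z.2)%:E)%E).
  by mf.
 by move=> z; rewrite mule_ge0 // lee_fin.
exists M => x; rewrite ger0_norm // -lee_fin -KopE //; exact: kint_le.
Qed.

Lemma dform f h : bmp f -> bmp h ->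
 (\int[mu]_x \int[mu]_y (k x y * (f x * h y)%:E) = (Int (fun x => f x * Kop h x))%:E)%E.
Proof.
move=> bf bh; have [[mh _] h0] := bh; have [[mf' _] f0] := bf; have [bK K0] := Kop_bmp _ bh.
rewrite -IntE; last exact: bmfM (proj1 bf) bK.
apply: eq_integral => x _.
under eq_integral do rewrite EFinM muleCA.
rewrite ge0_integralZl_EFin ?KopE //; first by move=> y _; rewrite mule_ge0 // lee_fin.
exact: mkf.
Qed.

Let bmp_cst1 : bmp (fun=> 1). Proof. by split => //; exact: bmf_cst. Qed.

Lemma Kop1 x : Kop (fun=> 1) x = 1.
Proof. by rewrite /Kop; under eq_integral do rewrite mule1; rewrite k1. Qed.

Lemma Kop_sym f h : bmp f -> bmp h -> Int (fun x => f x * Kop h x) = Int (fun x => h x * Kop f x).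
Proof.
move=> bf bh; apply: EFin_inj; apply: etrans (dform h f bh bf); apply: etrans (esym (dform f h bf bh)) _.
have [[mh _] h0] := bh; have [[mf' _] f0] := bf.
apply: (etrans (kernel_tonelli (fun x y => f x * h y) _ _)).
- by mf.
- by pos.
- by apply: eq_integral => x _; apply: eq_integral => y _; rewrite mulrC.
Qed.

Lemma Int_Kop f : bmp f -> Int (Kop f) = Int f.
Proof.
move=> bf; have := Kop_sym (fun=> 1) f bmp_cst1 bf.
rewrite (_ : (fun x => 1 * Kop f x) = Kop f); last by apply/funext => x; rewrite mul1r.
by move=> ->; congr Int; apply/funext => x; rewrite Kop1 mulr1.
Qed.

(** The Dirichlet form of the kernel, without the customary factor 1/2. *)
Definition E2 f : \bar R := (\int[mu]_x \int[mu]_y (k x y * ((f x - f y) ^+ 2)%:E))%E.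

Let mdf f : mfunT f -> mfunT (fun z : T * T => f z.1).
Proof. by move=> mf'; mf. Qed.
Let mds f : mfunT f -> mfunT (fun z : T * T => f z.2).
Proof. by move=> mf'; mf. Qed.

Let kint2 (f : T -> T -> R) : \bar R := (\int[mu]_x \int[mu]_y (k x y * (f x y)%:E))%E.

Let kint2_F (f : T -> T -> R) : mfunT (fun z : T * T => f z.1 z.2) -> (forall x y, 0 <= f x y) ->
 mfunT (fun x => \int[mu]_y (k x y * (f x y)%:E))%E.
Proof.
move=> mf' f0; apply: (measurable_fun_fubini_tonelli_F (m2 := mu) (fun z => k z.1 z.2 * (f z.1 z.2)%:E)%E).
 mf.
by move=> z; rewrite mule_ge0 // lee_fin.
Qed.

Let kint2_s (f : T -> T -> R) x : mfunT (fun z : T * T => f z.1 z.2) ->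
 mfunT (fun y => (k x y * (f x y)%:E))%E.
Proof.
move=> mf'; apply: emeasurable_funM; first exact: measurable_kx.
by mf; exact: (measurableT_comp mf' (pair1_measurable x)).
Qed.

Let kint2_ge0 (f : T -> T -> R) : (forall x y, 0 <= f x y) -> (0 <= kint2 f)%E.
Proof.
by move=> f0; apply: integral_ge0 => x _; apply: integral_ge0 => y _; rewrite mule_ge0 // lee_fin.
Qed.

Let kint2D (f h : T -> T -> R) :
 mfunT (fun z : T * T => f z.1 z.2) -> (forall x y, 0 <= f x y) ->
 mfunT (fun z : T * T => h z.1 z.2) -> (forall x y, 0 <= h x y) ->
 kint2 (fun x y => f x y + h x y) = (kint2 f + kint2 h)%E.
Proof.
move=> mf' f0 mh h0; rewrite /kint2.
rewrite -(ge0_integralD mu measurableT); first last.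
- exact: kint2_F.
- by move=> x _; apply: integral_ge0 => y _; rewrite mule_ge0 // lee_fin.
- exact: kint2_F.
- by move=> x _; apply: integral_ge0 => y _; rewrite mule_ge0 // lee_fin.
apply: eq_integral => x _; rewrite -(ge0_integralD mu measurableT); first last.
- exact: kint2_s.
- by move=> y _; rewrite mule_ge0 // lee_fin.
- exact: kint2_s.
- by move=> y _; rewrite mule_ge0 // lee_fin.
by apply: eq_integral => y _; rewrite EFinD ge0_muleDr ?lee_fin.
Qed.

Let kint2_le (f h : T -> T -> R) :
 mfunT (fun z : T * T => f z.1 z.2) -> (forall x y, 0 <= f x y) ->
 mfunT (fun z : T * T => h z.1 z.2) -> (forall x y, f x y <= h x y) ->
 (kint2 f <= kint2 h)%E.
Proof.
move=> mf' f0 mh fh; have h0 x y : 0 <= h x y by exact: le_trans (fh x y).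
apply: ge0_le_integral => //.
- by move=> x _; apply: integral_ge0 => y _; rewrite mule_ge0 // lee_fin.
- exact: kint2_F.
- exact: kint2_F.
move=> x _; apply: ge0_le_integral => //.
- by move=> y _; rewrite mule_ge0 // lee_fin.
- exact: kint2_s.
- exact: kint2_s.
- by move=> y _; rewrite lee_wpmul2l // lee_fin.
Qed.

Let sq_bmp f : bmf f -> bmp (fun x => f x ^+ 2).
Proof. by move=> bf; split; [exact: bmfX|move=> x; pos]. Qed.

Let kint2_sq1 f : bmf f -> kint2 (fun x y => f x ^+ 2) = (Int (fun x => f x ^+ 2))%:E.
Proof.
move=> bf; have := dform _ _ (sq_bmp _ bf) bmp_cst1; rewrite /kint2.
under eq_integral do under eq_integral do rewrite mulr1.
by move=> ->; congr (Int _)%:E; apply/funext => x; rewrite Kop1 mulr1.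
Qed.

Let kint2_sq2 f : bmf f -> kint2 (fun x y => f y ^+ 2) = (Int (fun x => f x ^+ 2))%:E.
Proof.
move=> bf; apply: etrans (kint2_sq1 _ bf); apply: esym; apply: kernel_tonelli.
 by mf; case: bf.
by pos.
Qed.

Let mdiff f : bmf f -> mfunT (fun z : T * T => (f z.1 - f z.2) ^+ 2).
Proof.
by move=> [mf' _]; mf.
Qed.

Lemma E2_ge0 f : (0 <= E2 f)%E.
Proof. by apply: (kint2_ge0 (fun x y => (f x - f y) ^+ 2)) => x y; pos. Qed.

Lemma E2E f : bmp f -> E2 f = (2 * Int (fun x => f x ^+ 2) - 2 * Int (fun x => f x * Kop f x))%:E.
Proof.
move=> bf; have [[mf' fb] f0] := bf.
have bb : bmf (fun x => f x * Kop f x) by apply: bmfM; [exact: (proj1 bf)|case: (Kop_bmp _ bf)].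
have b2 : bmp (fun x => 2 * f x).
 by split; [apply: bmfM; [exact: bmf_cst|exact: (proj1 bf)]|move=> x; pos].
have e1 := dform _ _ b2 bf; rewrite (_ : Int _ = 2 * Int (fun x => f x * Kop f x)) in e1; last first.
 by rewrite -IntZ //; congr Int; apply/funext => x; rewrite mulrA.
have mp : mfunT (fun z : T * T => 2 * f z.1 * f z.2).
 apply: measurable_funM; last mf.
 by mf.
have p0 x y : 0 <= 2 * f x * f y by pos.
have mx : mfunT (fun z : T * T => f z.1 ^+ 2).
 by mf.
have my : mfunT (fun z : T * T => f z.2 ^+ 2).
 by mf.
have := kint2D (fun x y => (f x - f y) ^+ 2) (fun x y => 2 * f x * f y) (mdiff _ (proj1 bf)) (fun x y => sqr_ge0 _) mp p0.
rewrite (_ : (fun x y => _) = fun x y => f x ^+ 2 + f y ^+ 2); last first.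
 by apply/funext => x; apply/funext => y; ring.
rewrite (kint2D _ _ mx (fun x y => sqr_ge0 _) my (fun x y => sqr_ge0 _)).
rewrite kint2_sq1 ?kint2_sq2; [|exact: (proj1 bf)|exact: (proj1 bf)].
rewrite [kint2 (fun x y => 2 * f x * f y)]e1 -/(E2 f) => h.
have : (E2 f = (Int (fun x => f x ^+ 2))%:E + (Int (fun x => f x ^+ 2))%:E - (2 * Int (fun x => f x * Kop f x))%:E)%E.
 by rewrite h addeK.
by move=> ->; rewrite -!EFinD; congr (_%:E); ring.
Qed.

Lemma Kop_le f h x : bmp f -> bmp h -> (forall y, f y <= h y) -> Kop f x <= Kop h x.
Proof.
move=> bf bh fh; rewrite -lee_fin -!KopE //.
have [[mf' _] f0] := bf; have [[mh _] h0] := bh.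
apply: ge0_le_integral => //.
- by move=> y _; rewrite mule_ge0 // lee_fin.
- exact: mkf.
- exact: mkf.
- by move=> y _; rewrite lee_wpmul2l // lee_fin.
Qed.

Lemma KopD f h x : bmp f -> bmp h -> Kop (fun y => f y + h y) x = Kop f x + Kop h x.
Proof.
move=> bf bh; have [[mf' _] f0] := bf; have [[mh _] h0] := bh.
apply: EFin_inj; rewrite EFinD -!KopE //; last first.
 by split; [apply: bmfD; [case: bf|case: bh]|move=> y; pos].
rewrite -(ge0_integralD mu measurableT); first last.
- exact: mkf.
- by move=> y _; rewrite mule_ge0 // lee_fin.
- exact: mkf.
- by move=> y _; rewrite mule_ge0 // lee_fin.
by apply: eq_integral => y _; rewrite EFinD ge0_muleDr ?lee_fin.
Qed.

Lemma KopZ (c : R) f x : 0 <= c -> bmp f -> Kop (fun y => c * f y) x = c * Kop f x.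
Proof.
move=> c0 bf; have [[mf' _] f0] := bf.
apply: EFin_inj; rewrite EFinM -!KopE //; last first.
 by split; [apply: bmfM; [exact: bmf_cst|case: bf]|move=> y; pos].
rewrite -ge0_integralZl_EFin //; [|by move=> y _; rewrite mule_ge0 // lee_fin|exact: mkf].
by apply: eq_integral => y _; rewrite EFinM muleCA.
Qed.

(** Jensen's inequality for the probability density [k x], obtained by applying the kernel to
    [2 m f <= f^2 + m^2] with [m = Kop f x]. *)
Lemma Kop_sqr f x : bmp f -> Kop f x ^+ 2 <= Kop (fun y => f y ^+ 2) x.
Proof.
move=> bf; have [bK K0] := Kop_bmp _ bf; set m := Kop f x.
have bm : bmp (fun y => 2 * m * f y).
 by split; [apply: bmfM; [exact: bmf_cst|case: bf]|move=> y; case: bf => _ f0; rewrite !mulr_ge0 ?K0].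
have bc : bmp (fun y => m ^+ 2 * 1).
 by split; [exact: bmf_cst|move=> y; pos].
have bs : bmp (fun y => f y ^+ 2) by apply: sq_bmp; case: bf.
have bsm : bmp (fun y => f y ^+ 2 + m ^+ 2 * 1).
 by split; [apply: bmfD; [case: bs|case: bc]|move=> y; pos].
have := Kop_le _ _ x bm bsm; rewrite (KopD _ _ _ bs bc).
rewrite (KopZ (2 * m) f) ?mulr_ge0 ?K0 // (KopZ (m ^+ 2) (fun=> 1)) ?sqr_ge0 // Kop1 -/m => hh.
have {}hh := hh (fun y => _); have : 2 * m * m <= Kop (fun y => f y ^+ 2) x + m ^+ 2 * 1.
 by apply: hh => y; have := sqr_ge0 (f y - m); rewrite sqrrB; lra.
lra.
Qed.

Lemma Int_Kop_sqr f : bmp f -> Int (fun x => Kop f x ^+ 2) <= Int (fun x => f x ^+ 2).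
Proof.
move=> bf; have b2 := sq_bmp _ (proj1 bf); rewrite -[leRHS]Int_Kop //; apply: Int_le.
- by apply: bmfX; case: (Kop_bmp _ bf).
- by case: (Kop_bmp _ b2).
- by move=> x; exact: Kop_sqr.
Qed.

(** The lazy version of the kernel. A gap for the Dirichlet form excludes spectrum near 1 only;
    averaging with the identity moves the spectrum near -1 to 0. *)
Definition Pop f x := (f x + Kop f x) / 2.

Lemma Pop_bmp f : bmp f -> bmp (Pop f).
Proof.
move=> bf; have [bK K0] := Kop_bmp _ bf; have [bf' f0] := bf; split.
 by apply: bmfM; [exact: bmfD|exact: bmf_cst].
by move=> x; rewrite divr_ge0 ?addr_ge0.
Qed.

Lemma Int_Pop f : bmp f -> Int (Pop f) = Int f.
Proof.
move=> bf; have [bK K0] := Kop_bmp _ bf; have [bf' f0] := bf.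
rewrite (_ : Pop f = fun x => 2^-1 * (f x + Kop f x)); last by apply/funext => x; rewrite mulrC.
by rewrite IntZ ?IntD ?Int_Kop //; [field|exact: bmfD].
Qed.

(** As [Kop] contracts the square norm, passing from [f] to [Pop f] lowers the square integral by at
    least a quarter of [E2 f], while the mean is unchanged. *)
Lemma Var_Pop (C : R) f : 0 < C -> bmp f -> ((Var f)%:E <= C%:E * E2 f)%E ->
 Var (Pop f) <= (1 - (4 * C)^-1) * Var f.
Proof.
move=> C0 bf; rewrite E2E // -EFinM lee_fin => h.
have [bK K0] := Kop_bmp _ bf; have [bf' f0] := bf.
have Ksq := Int_Kop_sqr _ bf.
have e : Int (fun x => Pop f x * Pop f x) =
 4^-1 * (Int (fun x => f x ^+ 2) + 2 * Int (fun x => f x * Kop f x) + Int (fun x => Kop f x ^+ 2)).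
 rewrite -IntZ; last exact: bmfM.
 rewrite -IntD; [|exact: bmfX|by apply: bmfM; [exact: bmf_cst|exact: bmfM]].
 rewrite -IntD; [|by apply: bmfD; [exact: bmfX|apply: bmfM; [exact: bmf_cst|exact: bmfM]]|exact: bmfX].
 rewrite -IntZ.
  by congr Int; apply/funext => x; rewrite /Pop; field.
 by do ![apply: bmfD|exact: bmfX]; apply: bmfM; [exact: bmf_cst|exact: bmfM].
have v : Var f = Int (fun x => f x ^+ 2) - Int f * Int f / vol.
 done.
rewrite {1}/Var /Cov e Int_Pop // mulrBl mul1r.
have : (4 * C)^-1 * Var f <= (4 * C)^-1 * (C * (2 * Int (fun x => f x ^+ 2) - 2 * Int (fun x => f x * Kop f x))).
 by rewrite ler_wpM2l // invr_ge0 mulr_ge0 // ltW.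
rewrite mulrA (_ : (4 * C)^-1 * C = 4^-1); last by field; rewrite gt_eqF.
lra.
Qed.

Section gap.
Context (V : T -> R) (a b : R) (mV : mfunT V) (V1 : forall x, 1 <= V x)
 (a0 : 0 <= a) (a1 : a < 1) (b0 : 0 <= b)
 (drift : forall x, (\int[mu]_y (k x y * (V y)%:E) <= (a * V x + b)%:E)%E)
 (minor : forall V0 : R, exists2 e : R, 0 < e & forall x y, V x <= V0 -> V y <= V0 -> (e%:E <= k x y)%E).

(** Where [V] exceeds this height, [b <= (1 - a) / 2 * V], so the drift condition still contracts
    there, with factor [(1 + a) / 2]. *)
Let V0 := 2 * b / (1 - a) + 1.
Let C := [set x | V x <= V0].
Let Vp x : 0 < V x. Proof. exact: lt_le_trans (V1 x). Qed.

Let mC : measurable C.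
Proof.
rewrite (_ : C = V @^-1` `]-oo, V0]%classic); last by apply/seteqP; split => x /=; rewrite in_itv.
by rewrite -[X in measurable X]setTI; apply: mV.
Qed.

(* By AM-GM, [2 f(x) f(y) <= f(x)^2 V(y)/V(x) + f(y)^2 V(x)/V(y)]. *)
Let lyapunov f : bmf f ->
 (((1 - a) * Int (fun x => f x ^+ 2))%:E <= E2 f + (2 * b * Int (fun x => \1_C x * f x ^+ 2))%:E)%E.
Proof.
move=> bf; have [mf' fb] := bf.
pose q x y := f x ^+ 2 * (V y / V x).
have mVi : mfunT (fun x => (V x)^-1) by exact: measurable_fun_inv.
have mq : mfunT (fun z : T * T => q z.1 z.2).
 apply: measurable_funM; first by mf.
 by apply: measurable_funM; [mf|exact: (mdf (fun x => (V x)^-1))].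
have mq' : mfunT (fun z : T * T => q z.2 z.1).
 apply: measurable_funM; first by mf.
 by apply: measurable_funM; [mf|exact: (mds (fun x => (V x)^-1))].
have q0 x y : 0 <= q x y by rewrite mulr_ge0 ?sqr_ge0 // divr_ge0 ?ltW.
have mx : mfunT (fun z : T * T => f z.1 ^+ 2) by mf.
have my : mfunT (fun z : T * T => f z.2 ^+ 2).
 by mf.
have bC : bmf (\1_C) by exact: bmf_indic.
have bCf : bmf (fun x => \1_C x * f x ^+ 2) by apply: bmfM => //; exact: bmfX.
have kq : (kint2 q <= ((1 + a) / 2 * Int (fun x => f x ^+ 2) + b * Int (fun x => \1_C x * f x ^+ 2))%:E)%E.
 rewrite -IntZ; last exact: bmfX.
 rewrite -[X in (_ + X)%:E]IntZ // -IntD; [|by apply: bmfM; [exact: bmf_cst|exact: bmfX]|by apply: bmfM; [exact: bmf_cst|]].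
 rewrite -IntE; last by apply: bmfD; apply: bmfM; [exact: bmf_cst|exact: bmfX|exact: bmf_cst|].
 apply: ge0_le_integral => //.
 - by move=> x _; apply: integral_ge0 => y _; rewrite mule_ge0 // lee_fin.
 - exact: kint2_F.
 - apply/measurable_EFinP; apply: measurable_funD; apply: measurable_funM => //; first mf.
  by case: bCf.
 move=> x _; rewrite /q.
 under eq_integral do rewrite [V _ / V x]mulrC mulrA EFinM muleCA.
 rewrite ge0_integralZl_EFin //; [|by move=> y _; rewrite mule_ge0 // lee_fin ltW|exact: mkf|by rewrite mulr_ge0 ?sqr_ge0 // invr_ge0 ltW].
 have c0 : 0 <= f x ^+ 2 / V x by rewrite mulr_ge0 ?sqr_ge0 // invr_ge0 ltW.
 apply: (le_trans (lee_wpmul2l _ (drift x))); first by pos.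
 rewrite -EFinM lee_fin (_ : f x ^+ 2 / V x * (a * V x + b) = f x ^+ 2 * (a + b / V x)); last first.
  by field; rewrite gt_eqF.
 rewrite (_ : (1 + a) / 2 * _ + _ = f x ^+ 2 * ((1 + a) / 2 + b * \1_C x)); last by ring.
 apply: ler_wpM2l; first pos.
 rewrite indicE; case: (boolP (x \in C)) => xC /=.
  have : b / V x <= b by rewrite ler_pdivrMr // ler_peMr.
  rewrite mulr1; set u := b / V x; move: (u) => u' u'b.
  have := a1; move: a => a'; lra.
 have {}xC : V0 < V x by rewrite ltNge; apply/negP => h; move/negP: xC; apply; rewrite inE.
 have : b / V x <= (1 - a) / 2.
  rewrite ler_pdivrMr //; have : 2 * b / (1 - a) <= V x by rewrite /V0 in xC; lra.
  by rewrite ler_pdivrMr ?subr_gt0 //; lra.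
 lra.
have : (kint2 (fun x y => f x ^+ 2 + f y ^+ 2)%R <= kint2 (fun x y => (f x - f y) ^+ 2 + (q x y + q y x))%R)%E.
 apply: kint2_le.
 - mf.
 - by pos.
 - by mf.
 - move=> x y; rewrite /q; have := Vp x; have := Vp y; move: (V x) (V y) => u v v0 u0.
  have : 0 <= (f x * v - f y * u) ^+ 2 / (u * v) by pos.
  rewrite (_ : _ / (u * v) = f x ^+ 2 * (v / u) + f y ^+ 2 * (u / v) - 2 * f x * f y); last by field; rewrite !gt_eqF.
  lra.
rewrite (kint2D _ _ mx (fun x y => sqr_ge0 _) my (fun x y => sqr_ge0 _)).
rewrite kint2_sq1 // kint2_sq2 // kint2D; [|mf|by pos|mf|by pos].
rewrite kint2D //.
have -> : kint2 (fun x y => q y x) = kint2 q by rewrite /kint2 [RHS](kernel_tonelli q).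
rewrite -/(E2 f) => h.
have h2 : ((Int (fun x => f x ^+ 2))%:E + (Int (fun x => f x ^+ 2))%:E <=
 E2 f + ((1 + a) / 2 * Int (fun x => f x ^+ 2) + b * Int (fun x => \1_C x * f x ^+ 2))%:E +
  ((1 + a) / 2 * Int (fun x => f x ^+ 2) + b * Int (fun x => \1_C x * f x ^+ 2))%:E)%E.
 by apply: (le_trans h); rewrite addeA; exact: (leeD (leeD (lexx _) kq) kq).
have := E2_ge0 f; case: (E2 f) h2 => [e| |] //; last by move=> _ _; rewrite addye // leey.
by move=> + e0; rewrite -!EFinD !lee_fin; lra.
Qed.

(** The constant [c] is the mean of [f] over [C]. The kernel is at least [e] on [C x C], and there
    the double integral of [(f x - f y)^2] is twice the mass of [C] times the integral of
    [(f - c)^2] over [C]. *)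
Let poincare f : bmf f -> exists c,
 forall e, 0 < e -> (forall x y, V x <= V0 -> V y <= V0 -> (e%:E <= k x y)%E) ->
 ((2 * e * Int (\1_C) * Int (fun x => \1_C x * (f x - c) ^+ 2))%:E <= E2 f)%E.
Proof.
move=> bf; have bC : bmf (\1_C) by exact: bmf_indic.
set m := Int (\1_C); have m0 : 0 <= m by apply: Int_ge0 => x; rewrite indicE ler0n.
have bCf : bmf (fun x => \1_C x * f x) by exact: bmfM.
have bCff : bmf (fun x => \1_C x * f x ^+ 2) by apply: bmfM => //; exact: bmfX.
exists (Int (fun x => \1_C x * f x) / m) => e e0 he.
have [mz|mz] := eqVneq m 0; first by rewrite mz mulr0 mul0r E2_ge0.
set c := _ / m.
have lin (g : T -> R) (u v w : R) : bmf g -> bmf (fun x => \1_C x * (u * g x + v)).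
 move=> bg; apply: bmfM => //; apply: bmfD; last exact: bmf_cst.
 by apply: bmfM => //; exact: bmf_cst.
have J : Int (fun x => \1_C x * (f x - c) ^+ 2) =
  Int (fun x => \1_C x * f x ^+ 2) - 2 * c * Int (fun x => \1_C x * f x) + c ^+ 2 * m.
 rewrite -!IntZ // -IntB //; last by apply: bmfM => //; exact: bmf_cst.
 rewrite -IntD; [|by apply: bmfB => //; apply: bmfM => //; exact: bmf_cst|by apply: bmfM => //; exact: bmf_cst].
 by congr Int; apply/funext => x; ring.
pose g x y : R := \1_C x * \1_C y * (f x - f y) ^+ 2.
have inner x : (\int[mu]_y (g x y)%:E = (\1_C x * (m * f x ^+ 2 - 2 * Int (fun x => \1_C x * f x) * f x + Int (fun x => \1_C x * f x ^+ 2)))%:E)%E.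
 have -> : \1_C x * (m * f x ^+ 2 - 2 * Int (fun x => \1_C x * f x) * f x + Int (fun x => \1_C x * f x ^+ 2)) =
  (\1_C x * f x ^+ 2) * m - (2 * \1_C x * f x) * Int (fun x => \1_C x * f x) + \1_C x * Int (fun x => \1_C x * f x ^+ 2) by ring.
 rewrite -!IntZ // -IntB; [|by apply: bmfM => //; exact: bmf_cst|by apply: bmfM => //; exact: bmf_cst].
 rewrite -IntD; [|by apply: bmfB; apply: bmfM => //; exact: bmf_cst|by apply: bmfM => //; exact: bmf_cst].
 rewrite -IntE; last by apply: bmfD; [apply: bmfB|]; apply: bmfM => //; exact: bmf_cst.
 by apply: eq_integral => y _; congr (_%:E); rewrite /g; ring.
have total : (\int[mu]_x \int[mu]_y (g x y)%:E = (2 * m * Int (fun x => \1_C x * (f x - c) ^+ 2))%:E)%E.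
 under eq_integral do rewrite inner.
 rewrite J (_ : 2 * m * _ = m * Int (fun x => \1_C x * f x ^+ 2) - (2 * Int (fun x => \1_C x * f x)) * Int (fun x => \1_C x * f x) + Int (fun x => \1_C x * f x ^+ 2) * m); last first.
  by rewrite /c; field.
 rewrite -!IntZ // -IntB; [|by apply: bmfM => //; exact: bmf_cst|by apply: bmfM => //; exact: bmf_cst].
 rewrite -IntD; [|by apply: bmfB; apply: bmfM => //; exact: bmf_cst|by apply: bmfM => //; exact: bmf_cst].
 rewrite -IntE; last by apply: bmfD; [apply: bmfB|]; apply: bmfM => //; exact: bmf_cst.
 by apply: eq_integral => x _; congr (_%:E); ring.
rewrite (_ : 2 * e * m * _ = e * (2 * m * Int (fun x => \1_C x * (f x - c) ^+ 2))); last by ring.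
have g0 x y : 0 <= g x y by rewrite /g !indicE mulr_ge0 ?sqr_ge0 // mulr_ge0.
have mg : mfunT (fun z : T * T => g z.1 z.2).
 have m1 : mfunT (\1_C : T -> R) by mf.
 by apply: measurable_funM; [mf|exact: mdiff].
have mgF : mfunT (fun x => \int[mu]_y (g x y)%:E)%E.
 apply: (measurable_fun_fubini_tonelli_F (m2 := mu) (fun z => (g z.1 z.2)%:E)); mf.
 by move=> z; rewrite lee_fin.
rewrite EFinM -total -ge0_integralZl_EFin //; last 2 first.
- by move=> x _; apply: integral_ge0 => y _; rewrite lee_fin.
- pos.
apply: ge0_le_integral => //.
- move=> x _; apply: mule_ge0; first by pos.
 by apply: integral_ge0 => y _; rewrite lee_fin.
- by mf.
- by apply: (kint2_F (fun x y => (f x - f y) ^+ 2)) => //; [exact: mdiff|move=> x y; pos].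
move=> x _; have mgx : mfunT (fun y => (g x y)%:E).
 by mf; exact: (measurableT_comp mg (pair1_measurable x)).
rewrite -ge0_integralZl_EFin //; last 2 first.
- by move=> y _; rewrite lee_fin.
- pos.
apply: ge0_le_integral => //.
- by move=> y _; apply: mule_ge0; rewrite lee_fin // ltW.
- by apply: emeasurable_funM => //; mf.
- by apply: (kint2_s (fun x y => (f x - f y) ^+ 2)); exact: mdiff.
move=> y _; rewrite /g !indicE; case: (boolP (x \in C)) => xC; last by rewrite !mul0r mule0 mule_ge0 // lee_fin sqr_ge0.
case: (boolP (y \in C)) => yC; last by rewrite mulr0 mul0r mule0 mule_ge0 // lee_fin sqr_ge0.
rewrite !mul1r lee_wpmul2r ?lee_fin ?sqr_ge0 //.
by apply: he; [rewrite inE in xC|rewrite inE in yC].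
Qed.

(** [lyapunov] is applied to [f - c], with [c] the mean of [f] over [C]. This shift leaves [E2]
    unchanged, and [poincare] bounds the remaining integral over [C] by a multiple of [E2]. *)
Lemma spectral_gap : exists2 K : R, 0 < K & forall f, bmf f -> ((Var f)%:E <= K%:E * E2 f)%E.
Proof.
have [e e0 he] := minor V0.
have bC : bmf (\1_C) by exact: bmf_indic.
set m := Int (\1_C); have m0 : 0 <= m by apply: Int_ge0 => x; rewrite indicE ler0n.
have a1' : 0 < 1 - a by rewrite subr_gt0.
(* If [m = 0] the inner quotient is 0 by convention; the integral over [C] vanishes in that case, so
   the same constant is correct. *)
exists ((1 + b / (e * m)) / (1 - a)).
 by pos.
move=> f bf; have [c hc] := poincare f bf; have {hc} := hc e e0 he.
have bfc : bmf (fun x => f x - c) by apply: bmfB => //; exact: bmf_cst.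
have := lyapunov _ bfc; rewrite (_ : E2 (fun x => f x - c) = E2 f); last first.
 rewrite /E2; apply: eq_integral => x _; apply: eq_integral => y _.
 by congr (_ * (_ ^+ 2)%:E)%E; ring.
have := Var_le f c bf; rewrite -/m.
set J := Int (fun x => \1_C x * (f x - c) ^+ 2); set I2 := Int (fun x => (f x - c) ^+ 2).
have Jm : m = 0 -> J = 0.
 move=> mz; have [_ [M hM]] := bfc; apply/eqP; rewrite eq_le; apply/andP; split; last first.
  by apply: Int_ge0 => x; pos.
 rewrite -(mulr0 (M ^+ 2)) -mz -IntZ //; apply: Int_le.
 - by apply: bmfM => //; exact: bmfX.
 - by apply: bmfM => //; exact: bmf_cst.
 - move=> x; rewrite mulrC; apply: ler_wpM2r; first by pos.
  rewrite -[leLHS]real_normK ?num_real // lerXn2r // nnegrE.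
  exact: le_trans (hM x).
have := E2_ge0 f; case: (E2 f) => [E| |] //; last first.
 by move=> *; rewrite gt0_muley ?leey // lte_fin divr_gt0 // ltr_pwDl // divr_ge0 ?mulr_ge0 // ltW.
rewrite -!EFinD -EFinM !lee_fin => E0 h1 h2 h3.
rewrite mulrAC ler_pdivlMr //; apply: (@le_trans _ _ ((1 - a) * I2)); first by rewrite mulrC ler_wpM2l // ltW.
apply: (le_trans h2); rewrite [leRHS]mulrDl mul1r lerD2l.
have [mz|mz] := eqVneq m 0; first by rewrite Jm // mulr0 mulr_ge0 // divr_ge0 // mulr_ge0 // ltW.
have mp : 0 < m by rewrite lt_neqAle eq_sym mz.
rewrite [leRHS]mulrAC ler_pdivlMr ?mulr_gt0 //.
rewrite (_ : 2 * b * J * (e * m) = b * (2 * e * m * J)); last by ring.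
exact: ler_wpM2l.
Qed.

End gap.
End kernel.
End bounded_functions.

Ltac bm := first [ assumption | exact: bmf_cst | apply: bmfD; bm | apply: bmfB; bm | apply: bmfM; bm | apply: bmfX; bm | by [] ].

Section integrals.
Context {R : realType}.
Notation L1 := (@lebesgue_measure R).
Local Open Scope ereal_scope.

Lemma integral_restr d (T : measurableType d) (mu : {measure set T -> \bar R}) (D : set T)
  (mD : measurable D) (fD : mu D < +oo) (f : T -> \bar R) :
 mfunT f -> (forall x, 0 <= f x) ->
 \int[mfrestr mD fD]_x f x = \int[mu]_(x in D) f x.
Proof.
move=> mf' f0; have mDc : measurable (~` D) by exact: measurableC.
rewrite -(setUv D) ge0_integral_setU //; first last.
- by apply/disj_setPS => x [].
- exact: measurable_funTS.
have -> : \int[mfrestr mD fD]_(x in D) f x = \int[mu]_(x in D) f x.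
 by apply: eq_measure_integral => A mA AD; rewrite /= /mfrestr /mrestr (setIidl AD).
rewrite [X in _ + X](_ : _ = 0) ?adde0 //.
apply: null_set_integral => //; first exact: measurable_funTS.
by rewrite /= /mfrestr /mrestr setICl measure0.
Qed.

Lemma integral_oneDsqrV_fin : \int[L1]_t ((1 + t ^+ 2)^-1)%:E < +oo.
Proof.
rewrite (ge0_symfun_integralT (f := fun t : R => ((1 + t ^+ 2)^-1)%R)).
- rewrite (_ : [set x : R | (0 <= x)%R] = `[0%R, +oo[%classic); last first.
  by apply/seteqP; split => x /=; rewrite in_itv andbT.
 by rewrite (integral0y_oneDsqr R) -EFinM ltry.
- by pos.
- by move=> t; exact: continuous_oneDsqrV.
- by move=> t /=; rewrite sqrrN.
Qed.

Lemma continuous_expabs : continuous (fun v : R => expR (- `|v|)%R).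
Proof.
move=> v; apply: (@continuous_comp _ _ _ (fun v : R => - `|v|)%R (@expR R)); last exact: continuous_expR.
by apply: (@continuous_comp _ _ _ (fun v : R => `|v|)%R (@GRing.opp R)); [exact: norm_continuous|exact: opp_continuous].
Qed.

Lemma integral_exp_abs_fin : \int[L1]_v (expR (- `|v|))%:E < +oo.
Proof.
rewrite (ge0_symfun_integralT (f := fun v : R => expR (- `|v|)%R)); last 3 first.
- done.
- exact: continuous_expabs.
- by move=> t /=; rewrite normrN.
apply: (@le_lt_trans _ _ (2%:E * 1%:E)); last by rewrite -EFinM ltry.
apply: lee_wpmul2l; first by pos.
have mE : measurable [set x : measurableTypeR R | (0 <= x)%R].
 rewrite (_ : [set x : R | (0 <= x)%R] = `[0%R, +oo[%classic); last first.
  by apply/seteqP; split => x /=; rewrite in_itv andbT.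
 mf.
rewrite -(@integral_exponential_pdf R 1) // integral_mkcond.
apply: ge0_le_integral => //.
- by move=> v _; rewrite patchE; case: ifP => _; pos.
- apply: (measurable_restrictT _ _).1 => //; apply: (@measurable_funTS _ _ _ _ _ (fun x : R => (expR (- `|x|))%:E)); apply/measurable_EFinP.
 by mf.
- by mf; exact: measurable_exponential_pdf.
- move=> v _; rewrite patchE; case: ifPn => v0; last by rewrite lee_fin exponential_pdf_ge0.
 have {}v0 : (0 <= v)%R by rewrite inE in v0.
 rewrite lee_fin /exponential_pdf patchE mem_set ?mul1r ?mulN1r ?ger0_norm //=.
 by rewrite in_itv /= v0.
Qed.

Lemma FTC (f F : R -> R) (a b : R) : (a <= b)%R ->
 (forall x, (a <= x <= b)%R -> is_derive x 1%R F (f x)) ->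
 (forall x, (a <= x <= b)%R -> {for x, continuous f}) ->
 \int[L1]_(x in `[a, b]) (f x)%:E = (F b - F a)%:E.
Proof.
rewrite le_eqVlt => /predU1P[<- _ _|ab dF cf].
 by rewrite set_itv1 integral_set1 subrr.
have cF x : (a <= x <= b)%R -> {for x, continuous F}.
 by move=> /dF xd; apply: differentiable_continuous; apply/derivable1_diffP; exact: ex_derive.
rewrite (@continuous_FTC2 _ _ F) //.
- by apply: continuous_in_subspaceT => x; rewrite inE /= in_itv; exact: cf.
- split => [x xab||].
 + have : (a <= x <= b)%R by move: xab; rewrite in_itv => /andP[/ltW -> /ltW ->].
  by move=> /dF xd; exact: ex_derive.
 + by apply: cvg_at_right_filter; apply: cF; rewrite lexx ltW.
 + by apply: cvg_at_left_filter; apply: cF; rewrite lexx ltW.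
- move=> x xab; have : (a <= x <= b)%R by move: xab; rewrite in_itv => /andP[/ltW -> /ltW ->].
 by move=> /dF xd; rewrite derive1E; exact: derive_val.
Qed.

Lemma integral_sqrtV_le (l : R) : (0 < l)%R ->
 \int[L1]_u ((`|u| <= l)%R%:R / Num.sqrt (1 + `|u|))%:E <= (4 * Num.sqrt l)%:E.
Proof.
move=> l0.
have s0 (u : R) : (0 < Num.sqrt (1 + `|u|))%R by pos.
have cs : continuous (fun u : R => (Num.sqrt (1 + `|u|))^-1)%R.
 move=> u; apply: (@cvgV _ _ _ _ (fun u => Num.sqrt (1 + `|u|))%R); first by rewrite gt_eqF.
 apply: (@continuous_comp _ _ _ (fun u : R => 1 + `|u|)%R (@Num.sqrt R)); last exact: sqrt_continuous.
 by apply: cvgD; [exact: cvg_cst|exact: norm_continuous].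
have mh : mfunT (fun u : measurableTypeR R => ((`|u| <= l)%R%:R / Num.sqrt (1 + `|u|))%:E).
 apply/measurable_EFinP; apply: measurable_funM; last by apply: continuous_measurable_fun; exact: cs.
 apply: measurable_fun_natb; apply: measurable_fun_ler; last mf.
 mf.
have h0 (u : R) : 0 <= ((`|u| <= l)%R%:R / Num.sqrt (1 + `|u|))%:E.
 done.
have H : \int[L1]_(x in `[0%R, l]) ((Num.sqrt (1 + `|x|))^-1%R)%:E <= (2 * Num.sqrt l)%:E.
 rewrite [leLHS](_ : _ = ((2 * Num.sqrt (1 + l) - 2 * Num.sqrt (1 + 0))%R)%:E).
  rewrite lee_fin addr0 sqrtr1 mulr1.
  have : (Num.sqrt (1 + l) <= 1 + Num.sqrt l)%R.
   rewrite -[leRHS]ger0_norm // -sqrtr_sqr ler_wsqrtr // sqrrD expr1n mul1r sqr_sqrtr ?(ltW l0) //.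
   by have := sqrtr_ge0 l; lra.
  lra.
 apply: (FTC _ (fun u => 2 * Num.sqrt (1 + u))%R); [pos| |by move=> x _; exact: cs].
  move=> x /andP[x0 _]; rewrite ger0_norm //.
  have x1 : (0 < 1 + x)%R by rewrite ltr_pwDl.
  have := is_derive1_sqrt x1 => ds.
  apply: is_derive_eq; rewrite /GRing.scale /=.
  have s1 : (0 < Num.sqrt (1 + x))%R by rewrite sqrtr_gt0.
  lra.
pose g (u : R) : \bar R := ((`|u| <= l)%R%:R / Num.sqrt (1 + `|u|))%:E.
pose g1 (u : R) : \bar R := g u * ((0 <= u)%R%:R)%:E.
have mg1 : mfunT g1.
 apply: emeasurable_funM => //; apply/measurable_EFinP; apply: measurable_fun_natb.
 by apply: measurable_fun_ler; mf.
have g10 u : 0 <= g1 u by rewrite mule_ge0 // lee_fin.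
apply: (@le_trans _ _ (\int[L1]_u (g1 u + g1 (- u)%R))).
 apply: ge0_le_integral => //.
 - by apply: emeasurable_funD => //; mf.
 - move=> u _; rewrite -/(g u) /g1 (_ : g (- u)%R = g u); last by rewrite /g normrN.
  rewrite oppr_ge0; have [u0|u0] := leP 0%R u.
   by rewrite mule1 leeDl // mule_ge0 // lee_fin.
  by rewrite mule0 add0e (ltW u0) mule1.
rewrite ge0_integralD; mf.
rewrite (integral_reflect g1) //.
have -> : \int[L1]_u g1 u = \int[L1]_(x in `[0%R, l]) ((Num.sqrt (1 + `|x|))^-1%R)%:E.
 rewrite [RHS]integral_mkcond; apply: eq_integral => u _; rewrite patchE mem_setE in_itv /= /g1 /g.
 have [u0|u0] := leP 0%R u; last by rewrite mule0.
 by rewrite (ger0_norm u0) /=; case: ifP => _; rewrite mule1 ?mul1r ?mul0r.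
apply: (le_trans (leeD H H)); rewrite -EFinD lee_fin; lra.
Qed.
End integrals.
Section roots.
Context {R : realType}.
Implicit Types x y : R.

(** The exponent 1/8 is dictated by horocycles: along them [NN] dominates the square of a quadratic
    polynomial in [t], so [NN^(-1/8)] has singularities no worse than [|t - t0|^(-1/2)], which are
    integrable. *)
Definition q4 x := Num.sqrt (Num.sqrt x).
Definition q8 x := Num.sqrt (q4 x).

Lemma q4_ge0 x : 0 <= q4 x. Proof. exact: sqrtr_ge0. Qed.
Lemma q8_ge0 x : 0 <= q8 x. Proof. exact: sqrtr_ge0. Qed.
Lemma q4_gt0 x : 0 < x -> 0 < q4 x. Proof. by move=> x0; rewrite !sqrtr_gt0. Qed.
Lemma q8_gt0 x : 0 < x -> 0 < q8 x. Proof. by move=> x0; rewrite sqrtr_gt0 q4_gt0. Qed.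
Lemma q4M x y : 0 <= x -> q4 (x * y) = q4 x * q4 y.
Proof. by move=> x0; rewrite /q4 sqrtrM // sqrtrM // sqrtr_ge0. Qed.
Lemma q8M x y : 0 <= x -> q8 (x * y) = q8 x * q8 y.
Proof. by move=> x0; rewrite /q8 q4M // sqrtrM // q4_ge0. Qed.
Lemma q4_le x y : x <= y -> q4 x <= q4 y. Proof. by move=> xy; rewrite !ler_wsqrtr. Qed.
Lemma q8_le x y : x <= y -> q8 x <= q8 y. Proof. by move=> xy; rewrite ler_wsqrtr // q4_le. Qed.
Lemma q4X x : 0 <= x -> q4 (x ^+ 4) = x.
Proof. by move=> x0; rewrite /q4 (exprM x 2 2) sqrtr_sqr ger0_norm ?sqr_ge0 // sqrtr_sqr ger0_norm. Qed.
Lemma q8_sqr x : q8 (x ^+ 2) = q4 `|x|.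
Proof. by rewrite /q8 /q4 sqrtr_sqr. Qed.
Lemma q8_X4 x : 0 <= x -> q8 (x ^+ 4) = Num.sqrt x.
Proof. by move=> x0; rewrite /q8 q4X. Qed.
Lemma q8V4 : 2^-1 <= q8 4^-1.
Proof.
have -> : 4^-1 = (2^-1) ^+ 2 :> R by field.
rewrite q8_sqr -[leLHS](q4X) //; apply: q4_le.
rewrite ger0_norm // exprVn lef_pV2 ?posrE //.
lra.
Qed.

Lemma q8_ge1 x : 1 <= x -> 1 <= q8 x.
Proof.
have e : q8 1 = 1 :> R by rewrite /q8 /q4 !sqrtr1.
by move=> x1; rewrite -e; exact: q8_le.
Qed.
End roots.

(** * The point-pair kernel [(rho + bd)^-m] and its total mass *)

Section kernel_function.
Context {R : realType}.
Notation P := (plane R).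
Notation L1 := (@lebesgue_measure R).
Notation L2 := (L1 \x L1)%E.
Implicit Types (g A : 'M[R]_2) (z w : P).

Lemma measurable_bd : mfunT (fun u : P * P => bd u.1 u.2).
Proof. by rewrite /bd /al /ga /be; mf. Qed.

Lemma measurable_bdz z : mfunT (bd z).
Proof. exact: (measurableT_comp measurable_bd (pair1_measurable z)). Qed.

Context (rho : R) (rho1 : 1 <= rho).

(** The power 4 is the transition kernel. The power 3 dominates that kernel times [bd], which is how
    fast the Lyapunov function can grow between two points. *)
Definition kf (m : nat) z w : R := (rho + bd z w) ^- m.

Let rb z w : 1 <= rho + bd z w. Proof. by rewrite (le_trans rho1) // lerDl ltW ?bd_gt0. Qed.
Let rb0 z w : 0 < rho + bd z w. Proof. exact: lt_le_trans (rb z w). Qed.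

Lemma kf_gt0 m z w : 0 < kf m z w. Proof. by rewrite invr_gt0 exprn_gt0. Qed.
Lemma kfC m z w : kf m z w = kf m w z. Proof. by rewrite /kf bdC. Qed.
Lemma kf_act m g z w : \det g = 1 -> kf m (act g z) (act g w) = kf m z w.
Proof. by move=> dg; rewrite /kf bd_act. Qed.
Lemma kf_bd z w : kf 4 z w * bd z w <= kf 3 z w.
Proof.
apply: (@le_trans _ _ (kf 4 z w * (rho + bd z w))).
 by rewrite ler_wpM2l ?(ltW (kf_gt0 _ _ _)) // lerDr (le_trans _ rho1).
have := rb0 z w; rewrite /kf; move: (rho + bd z w) => r r0.
by rewrite (_ : r ^- 4 * r = r ^- 3) //; field; rewrite gt_eqF.
Qed.

Lemma kf43 z w : kf 4 z w <= kf 3 z w.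
Proof.
by rewrite /kf lef_pV2 ?posrE ?exprn_gt0 // ler_weXn2l.
Qed.

Lemma measurable_kf m : mfunT (fun u : P * P => kf m u.1 u.2).
Proof.
apply: measurable_fun_inv; first by pos.
by apply: measurable_funX; apply: measurable_funD; [mf|exact: measurable_bd].
Qed.

Lemma measurable_kfz m z : mfunT (fun w => (kf m z w)%:E).
Proof. by mf; exact: (measurableT_comp (measurable_kf m) (pair1_measurable z)). Qed.

Lemma kf_ge0 m z w : (0 <= (kf m z w)%:E)%E. Proof. by rewrite lee_fin ltW ?kf_gt0. Qed.

Definition Ik m : \bar R := (\int[L2]_w (kf m orig w)%:E)%E.

Lemma integral_kf m z : (\int[L2]_w (kf m z w)%:E = Ik m)%E.
Proof.
rewrite /Ik -[RHS](integral_act (invmx (gz z))) ?det_inv1 ?gz_det //; first last.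
- exact: kf_ge0.
- exact: measurable_kfz.
by apply: eq_integral => w _; rewrite /kf bd_reduce.
Qed.

(** [bd orig w] dominates [exp |v|] and its square dominates [1 + t^2], so the third power is at
    most the integrable product [(1 + t^2)^-1 * exp (- |v|)]. *)
Lemma Ik3_fin : (Ik 3 < +oo)%E.
Proof.
pose a (t : R) : \bar R := ((1 + t ^+ 2)^-1)%:E; pose b (v : R) : \bar R := (expR (- `|v|))%:E.
have ma : mfunT a by apply/measurable_EFinP; apply: continuous_measurable_fun => t; exact: continuous_oneDsqrV.
have mb : mfunT b by apply/measurable_EFinP; mf.
have a0 t : (0 <= a t)%E by rewrite lee_fin invr_ge0 addr_ge0 ?sqr_ge0.
have b0 v : (0 <= b v)%E by rewrite lee_fin expR_ge0.
have mab : mfunT (fun w : P => (a w.1 * b w.2)%E).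
 by mf.
apply: (@le_lt_trans _ _ (\int[L2]_w (a w.1 * b w.2))%E).
 apply: ge0_le_integral => //.
 - by move=> w _; exact: kf_ge0.
 - exact: measurable_kfz.
 - move=> w _; rewrite /a /b -EFinM lee_fin /kf expRN -invfM lef_pV2 ?posrE ?exprn_gt0 //; last first.
   by pos.
  have := al_ga w; have := al_gt0 w; have := ga_gt0 w => g0 l0 e.
  have h1 : 1 + be w ^+ 2 <= (rho + bd orig w) ^+ 2.
   rewrite bd_orig -e; apply: (@le_trans _ _ ((al w + ga w) ^+ 2)).
    by rewrite sqrrD; have := sqr_ge0 (al w); have := sqr_ge0 (ga w); nra.
   by rewrite lerXn2r ?nnegrE ?addr_ge0 ?(ltW l0) ?(ltW g0) ?(le_trans _ rho1) // lerDr (le_trans _ rho1).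
  have h2 : expR `|w.2 : R| <= rho + bd orig w.
   rewrite bd_orig; apply: (@le_trans _ _ (al w + ga w)); last by rewrite lerDr (le_trans _ rho1).
   have : expR (w.2 : R) <= ga w by rewrite /ga ler_peMl // lerDl sqr_ge0.
   rewrite /al in l0 *; have [v0|v0] := leP 0 (w.2 : R); first by rewrite ger0_norm; lra.
   by rewrite ltr0_norm; have := g0; lra.
  by rewrite [leRHS]exprSr; apply: ler_pM; pos.
rewrite (integral_plane21 (fun w => a w.1 * b w.2)%E) //; last by move=> w; rewrite mule_ge0.
under eq_integral do rewrite /= ge0_integralZr //.
rewrite ge0_integralZl //; last exact: integral_ge0.
apply: lte_mul_pinfty; first exact: integral_ge0.
 by rewrite ge0_fin_numE ?integral_oneDsqrV_fin // integral_ge0.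
exact: integral_exp_abs_fin.
Qed.

Lemma Ik_fin : (Ik 4 < +oo)%E.
Proof.
apply: le_lt_trans Ik3_fin; apply: ge0_le_integral => //.
- by move=> w _; exact: kf_ge0.
- exact: measurable_kfz.
- exact: measurable_kfz.
- by move=> w _; rewrite lee_fin kf43.
Qed.

Lemma Ik_gt0 : (0 < Ik 4)%E.
Proof.
pose Q : set P := `[0, 1]%classic `*` `[0, 1]%classic.
have mQ : measurable Q by apply: measurableX; mf.
have L1I : L1 `[0 : R, 1]%classic = 1%E by rewrite lebesgue_measure_itv lte_fin ltr01 sube0.
have LQ : L2 Q = 1%E.
 by rewrite /Q product_measure1E //= L1I mule1.
pose c := (rho + (1 + 2 * expR 1)) ^- 4.
have e1 := expR_gt0 (1 : R).
have c0 : 0 < c by rewrite /c invr_gt0 exprn_gt0; have := rho1; lra.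
apply: (@lt_le_trans _ _ (\int[L2]_w (c * \1_Q w)%:E)%E).
 under eq_integral do rewrite EFinM.
 rewrite ge0_integralZl_EFin //; last 2 first.
 - by mf.
 - pos.
 by rewrite integral_indic // setIT [X in (_ * X)%E]LQ mule1 lte_fin.
apply: ge0_le_integral => //.
- by move=> w _; rewrite lee_fin mulr_ge0 ?(ltW c0) // indicE ler0n.
- by mf.
- exact: measurable_kfz.
- move=> w _; rewrite lee_fin indicE; case: (boolP (w \in Q)) => wQ; last by rewrite mulr0 ltW ?kf_gt0.
 rewrite mulr1 /c /kf lef_pV2 ?posrE ?exprn_gt0 //; last by have := rho1; lra.
 have pos : 0 <= rho + (1 + 2 * expR 1) by have := rho1; lra.
 rewrite lerXn2r ?nnegrE ?(ltW (rb0 _ _)) //.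
 rewrite lerD2l bd_orig; move: wQ; rewrite inE => -[/=]; rewrite !in_itv /= => /andP[t0 t1] /andP[v0 v1].
 rewrite lerD //; first by rewrite /al -expR0 ler_expR oppr_le0.
 rewrite /ga ler_pM ?addr_ge0 ?sqr_ge0 ?ler_expR //.
 by rewrite (_ : 2 = 1 + 1) // lerD2l expr_le1.
Qed.

End kernel_function.

(** * Averages of [NN^(-1/8)] against the kernel *)

Section drift.
Context {R : realType}.
Notation P := (plane R).
Notation L1 := (@lebesgue_measure R).
Notation L2 := (L1 \x L1)%E.
Implicit Types (g A : 'M[R]_2) (z w : P).

Definition hk (u : R) : R := (Num.sqrt (1 + `|u|))^-1.

Let s1 (u : R) : 1 <= Num.sqrt (1 + `|u|).
Proof. by rewrite -[leLHS]sqrtr1 ler_wsqrtr // lerDl. Qed.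
Let s0 (u : R) : 0 < Num.sqrt (1 + `|u|). Proof. done. Qed.

Lemma hk_ge0 u : 0 <= hk u. Proof. by rewrite invr_ge0 ltW. Qed.

Lemma continuous_hk : continuous hk.
Proof.
move=> u; apply: (@cvgV _ _ _ _ (fun u => Num.sqrt (1 + `|u|))%R); first by rewrite gt_eqF.
apply: (@continuous_comp _ _ _ (fun u : R => 1 + `|u|)%R (@Num.sqrt R)); last exact: sqrt_continuous.
by apply: cvgD; [exact: cvg_cst|exact: norm_continuous].
Qed.

Lemma measurable_hk : mfunT hk.
Proof. by apply: continuous_measurable_fun; exact: continuous_hk. Qed.

(* [l] is the width of the bump [(B + t^2 Y)^-4]. *)
Lemma integral_bump_le (B Y tau : R) : 0 < Y -> Y <= B ->
 (\int[L1]_t ((B + t ^+ 2 * Y) ^- 4 * hk (t - tau))%:E <=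
  (33 / q4 (B / Y))%:E * \int[L1]_t ((B + t ^+ 2 * Y) ^- 4)%:E)%E.
Proof.
move=> Y0 YB; have B0 : 0 < B by exact: lt_le_trans YB.
pose l := Num.sqrt (B / Y); have BY : 1 <= B / Y by rewrite ler_pdivlMr ?mul1r.
have l1 : 1 <= l by rewrite -[leLHS]sqrtr1 ler_wsqrtr.
have l0 : 0 < l by exact: lt_le_trans l1.
have sl0 : 0 < Num.sqrt l by rewrite sqrtr_gt0.
have l2 : l ^+ 2 * Y = B by rewrite sqr_sqrtr ?divfK ?gt_eqF // divr_ge0 ?ltW.
pose f (t : R) : R := (B + t ^+ 2 * Y) ^- 4.
have d0 t : 0 < B + t ^+ 2 * Y by pos.
have f0 t : 0 <= f t by rewrite invr_ge0 exprn_ge0 ?ltW.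
have mf : mfunT f.
 by apply: measurable_fun_inv => [t|]; [rewrite exprn_gt0|mf].
have mht (c : R) : mfunT (fun t : R => hk (t - c)).
 by apply: (measurableT_comp measurable_hk); mf.
pose g (u : R) : \bar R := ((`|u| <= l)%R%:R / Num.sqrt (1 + `|u|))%:E.
have g0 u : (0 <= g u)%E by rewrite lee_fin divr_ge0.
have mg : mfunT g.
 apply/measurable_EFinP; apply: measurable_funM; last exact: measurable_hk.
 apply: measurable_fun_natb; apply: measurable_fun_ler; last mf.
 mf.
have mgt : mfunT (fun t : R => g (t - tau)).
 by mf.
have B4 : 0 <= B ^- 4 by pos.
have sl0' : 0 <= (Num.sqrt l)^-1 by pos.
rewrite -/(q4 _).
(* Within distance [l] of [tau] the bump is bounded by [B^-4]; farther away [hk] is at most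
   [l^(-1/2)]. The first part integrates to at most [4 l^(1/2) B^-4], which is 32 times [l^(-1/2)]
   times the lower bound [2 l (2 B)^-4] for the mass of the bump; the second part adds 1 to the
   32. *)
apply: (@le_trans _ _ (\int[L1]_t ((B ^- 4)%:E * g (t - tau)%R + ((Num.sqrt l)^-1)%:E * (f t)%:E))%E).
 apply: ge0_le_integral => //.
 - by move=> t _; rewrite lee_fin; exact: mulr_ge0 (f0 t) (hk_ge0 _).
 - by mf.
 - apply: emeasurable_funD; mf.
 - move=> t _; rewrite -/(f t) /g -!EFinM -EFinD lee_fin /hk.
  have [tl|tl] := leP (`|t - tau|) l.
   rewrite mul1r; apply: ler_wpDr; first by pos.
   rewrite ler_wpM2r // /f lef_pV2 ?posrE ?exprn_gt0 // lerXn2r ?nnegrE ?(ltW B0) ?(ltW (d0 _)) //.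
   by rewrite lerDl mulr_ge0 ?sqr_ge0 ?ltW.
  rewrite mul0r mulr0 add0r mulrC ler_wpM2r // lef_pV2 ?posrE // ler_wsqrtr //.
  lra.
rewrite ge0_integralD //; first last.
- by mf.
- by move=> t _; rewrite mule_ge0 // lee_fin.
- by mf.
- by move=> t _; rewrite mule_ge0 // lee_fin.
have mfE : mfunT (fun t => (f t)%:E) by mf.
have fE0 t : (0 <= (f t)%:E)%E by rewrite lee_fin.
rewrite !ge0_integralZl_EFin //.
rewrite (_ : (\int[L1]_t g (t - tau)%R = \int[L1]_t g t)%E); last by rewrite (integral_translate (- tau) g).
have If : ((2 * l * (2 * B) ^- 4)%:E <= \int[L1]_t (f t)%:E)%E.
 have mI : measurable `[(- l)%R, l]%classic by mf.
 apply: (@le_trans _ _ (\int[L1]_t ((2 * B) ^- 4 * \1_(`[(- l)%R, l]%classic) t)%:E)%E).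
  under eq_integral do rewrite EFinM.
  rewrite ge0_integralZl_EFin //; last 2 first.
  - by mf.
  - lra.
  rewrite integral_indic // setIT /= lebesgue_measure_itv /= lte_fin.
  rewrite (lt_trans _ l0) ?oppr_lt0 // -EFinD -EFinM lee_fin opprK.
  lra.
 apply: ge0_le_integral => //.
 - by move=> t _; rewrite lee_fin mulr_ge0 // invr_ge0 exprn_ge0 // mulr_ge0 // ltW.
 - by mf.
 - move=> t _; rewrite lee_fin indicE; case: (boolP (t \in _)) => tl; last by rewrite mulr0.
  rewrite mulr1 /f lef_pV2 ?posrE ?mulr_gt0 // lerXn2r ?nnegrE ?(ltW (d0 _)) ?mulr_ge0 ?(ltW B0) //.
  rewrite (_ : 2 * B = B + B); last by ring.
  rewrite lerD2l -l2 ler_wpM2r ?(ltW Y0) // -[t ^+ 2]real_normK ?num_real // lerXn2r ?nnegrE ?(ltW l0) //.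
  by move: tl; rewrite inE /= in_itv -ler_norml.
have h4 := integral_sqrtV_le l l0.
have : ((B ^- 4)%:E * \int[L1]_t g t <= (32 / Num.sqrt l)%:E * \int[L1]_t (f t)%:E)%E.
 apply: (@le_trans _ _ ((B ^- 4)%:E * (4 * Num.sqrt l)%:E)%E); first exact: lee_wpmul2l.
 apply: (@le_trans _ _ ((32 / Num.sqrt l)%:E * (2 * l * (2 * B) ^- 4)%:E)%E); last by apply: lee_wpmul2l => //; pos.
 rewrite -!EFinM lee_fin -{3}(sqr_sqrtr (ltW l0)).
 rewrite le_eqVlt; apply/orP; left; apply/eqP; field.
 lra.
move=> hh; apply: (le_trans (leeD hh (lexx _))).
have : (0 <= \int[L1]_t (f t)%:E)%E by apply: integral_ge0 => t _; pos.
rewrite -ge0_muleDl; [|by pos|by pos].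
move=> i0; apply: lee_wpmul2r => //; rewrite lee_fin /q4 -/l.
lra.
Qed.

(** Completing the square in [t] shows that, up to the factor [(r / Y)^2], [NN] is at least
    [((t Y - p / r)^2 - d)^2 + Y^4]. The centres are the two roots of the inner polynomial when
    [d >= 0], and twice its vertex otherwise; the nearer centre gives the bound. *)
Lemma NN_lower A (v : R) : mc A != 0 -> exists t1 t2 : R, forall t,
 (q8 (NN ((t, v) : P) A))^-1 <= 2 / q4 (`|mc A| * expR v) * (hk (t - t1) + hk (t - t2)).
Proof.
move=> r0; pose Y := expR v; have Y0 : 0 < Y by exact: expR_gt0.
have Y00 : Y != 0 by rewrite gt_eqF.
pose r := mc A; pose p := hd A; pose q := mb A; pose d := (p ^+ 2 + q * r) / r ^+ 2.
have NNE t : NN ((t, v) : P) A = (r / Y) ^+ 2 * (((t * Y - p / r) ^+ 2 - d) ^+ 2 + 2 * (t * Y - p / r) ^+ 2 * Y ^+ 2 + Y ^+ 4).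
 rewrite /NN /al /be /ga /= expRN -/Y -/r -/q (_ : ma A - md A = 2 * p); last by rewrite /p /hd; field.
 by rewrite /d; field; rewrite Y00 r0.
have rY : 0 < q4 (`|r| * Y) by rewrite q4_gt0 // mulr_gt0 // normr_gt0.
have key t m : 0 <= m -> Y ^+ 2 * m ^+ 2 <= `|(t * Y - p / r) ^+ 2 - d| ->
  (q8 (NN ((t, v) : P) A))^-1 <= 2 / q4 (`|r| * Y) * (Num.sqrt (1 + m))^-1.
 move=> m0 hm; have sm : 0 < Num.sqrt (1 + m) by rewrite sqrtr_gt0 ltr_pwDl.
 have : q8 ((r * Y) ^+ 2 * ((1 + m) / 2) ^+ 4) <= q8 (NN ((t, v) : P) A).
  apply: q8_le; rewrite NNE (_ : (r * Y) ^+ 2 = (r / Y) ^+ 2 * Y ^+ 4); last by field.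
  rewrite -mulrA ler_wpM2l ?sqr_ge0 //.
  have h1 : Y ^+ 4 * m ^+ 4 <= ((t * Y - p / r) ^+ 2 - d) ^+ 2.
   rewrite -[leRHS]real_normK ?num_real // (_ : Y ^+ 4 * m ^+ 4 = (Y ^+ 2 * m ^+ 2) ^+ 2); last by ring.
   by apply: lerXn2r; rewrite ?nnegrE; pos.
  have h2 : 0 <= 2 * (t * Y - p / r) ^+ 2 * Y ^+ 2.
   pos.
  have h3 : ((1 + m) / 2) ^+ 4 <= 1 + m ^+ 4.
   have a1 : ((1 + m) / 2) ^+ 2 <= (1 + m ^+ 2) / 2 by have := sqr_ge0 (1 - m); rewrite expr_div_n sqrrB sqrrD; lra.
   have a2 : ((1 + m ^+ 2) / 2) ^+ 2 <= 1 + m ^+ 4.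
    have := sqr_ge0 (1 - m ^+ 2); have := sqr_ge0 (1 + m ^+ 2); rewrite expr_div_n sqrrB sqrrD (_ : m ^+ 4 = (m ^+ 2) ^+ 2); last by ring.
    lra.
   apply: le_trans a2; rewrite (_ : ((1 + m) / 2) ^+ 4 = (((1 + m) / 2) ^+ 2) ^+ 2); last by ring.
   by rewrite lerXn2r ?nnegrE ?sqr_ge0 // divr_ge0 // addr_ge0 ?sqr_ge0.
  have Y4 : 0 <= Y ^+ 4 by pos.
  have := ler_wpM2l Y4 h3; lra.
 rewrite q8M ?sqr_ge0 // q8_sqr normrM (gtr0_norm Y0) q8_X4 ?divr_ge0 ?addr_ge0 // => h.
 have h2 : Num.sqrt (1 + m) / 2 <= Num.sqrt ((1 + m) / 2).
  rewrite ler_pdivrMr // -[X in _ * X]ger0_norm // -sqrtr_sqr -sqrtrM ?divr_ge0 ?addr_ge0 //.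
  by rewrite ler_wsqrtr // (_ : (1 + m) / 2 * 2 ^+ 2 = (1 + m) * 2); [lra|field].
 have h3 : 0 < q4 (`|r| * Y) * (Num.sqrt (1 + m) / 2) by pos.
 rewrite (_ : 2 / _ * _ = (q4 (`|r| * Y) * (Num.sqrt (1 + m) / 2))^-1); last by field; rewrite !gt_eqF.
 have h4 : q4 (`|r| * Y) * (Num.sqrt (1 + m) / 2) <= q8 (NN (t, v) A).
  by apply: le_trans h; rewrite ler_wpM2l // ltW.
 by rewrite lef_pV2 ?posrE // (lt_le_trans h3).
have c0 : 0 <= 2 / q4 (`|r| * Y) by pos.
have [d0|d0] := leP 0 d.
 pose s := Num.sqrt d; have s2 : s ^+ 2 = d by rewrite sqr_sqrtr.
 exists ((p / r + s) / Y), ((p / r - s) / Y) => t.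
 set t1 := _ / Y; set t2 := (_ - s) / Y.
 have e : (t * Y - p / r) ^+ 2 - d = Y ^+ 2 * (t - t1) * (t - t2).
  by rewrite -s2 /t1 /t2; field; rewrite Y00 r0.
 have [le|/ltW le] := leP `|t - t1| `|t - t2|.
  apply: (le_trans (key t `|t - t1| _ _)) => //; last by rewrite ler_wpM2l // lerDl hk_ge0.
  rewrite e -mulrA normrM (ger0_norm (sqr_ge0 Y)) ler_wpM2l ?sqr_ge0 //.
  by rewrite normrM expr2 ler_wpM2l.
 apply: (le_trans (key t `|t - t2| _ _)) => //; last by rewrite ler_wpM2l // lerDr hk_ge0.
 rewrite e -mulrA normrM (ger0_norm (sqr_ge0 Y)) ler_wpM2l ?sqr_ge0 //.
 by rewrite normrM expr2 ler_wpM2r.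
exists (p / r / Y), (p / r / Y) => t; apply: (le_trans (key t `|t - p / r / Y| _ _)) => //.
 have -> : Y ^+ 2 * `|t - p / r / Y| ^+ 2 = (t * Y - p / r) ^+ 2.
  by rewrite real_normK ?num_real //; field; rewrite Y00 r0.
 rewrite ger0_norm; first by lra.
 by have := sqr_ge0 (t * Y - p / r); lra.
by rewrite ler_wpM2l // lerDl hk_ge0.
Qed.

Lemma measurable_q8NN A : mfunT (fun w : P => q8 (NN w A)).
Proof.
have ms : mfunT (@Num.sqrt R) by apply: continuous_measurable_fun; exact: sqrt_continuous.
apply: (measurableT_comp ms); apply: (measurableT_comp ms); apply: (measurableT_comp ms).
by rewrite /NN /al /be /ga; mf.
Qed.

Context (rho : R) (rho1 : 1 <= rho).

Let mV (f : P -> R) : mfunT f -> (forall w, 0 <= f w) -> mfunT (fun w => (f w)^-1).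
Proof.
move=> mf' f0; rewrite (_ : (fun w => _) = fun w => f w `^ (-1)).
 exact: (@measurableT_comp _ _ _ _ _ _ (@powR R ^~ (-1)) _ f (measurable_powR _) mf').
by apply/funext => w; rewrite powR_inv1.
Qed.

Lemma measurable_kfNN z A : mfunT (fun w => (kf rho 4 z w / q8 (NN w A))%:E).
Proof.
apply/measurable_EFinP; apply: measurable_funM.
 by apply/measurable_EFinP; exact: measurable_kfz.
by apply: mV => [|w]; [exact: measurable_q8NN|exact: q8_ge0].
Qed.

Let kN_ge0 z w A : (0 <= (kf rho 4 z w / q8 (NN w A))%:E)%E.
Proof. by rewrite lee_fin divr_ge0 ?q8_ge0 // ltW // kf_gt0. Qed.

(** On each horocycle [v = const] the kernel is a bump [(B + t^2 Y)^-4] with [B >= rho], and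
    [NN_lower] has two centres, whence [132 = 2 * 2 * 33]. The height cancels in
    [q4 (|r| Y) * q4 (B / Y) = q4 (|r| B)], which leaves the gain [rho^(-1/4)]. *)
Lemma drift_orig A : mc A != 0 ->
 (\int[L2]_w (kf rho 4 orig w / q8 (NN w A))%:E <= (132 / (q4 `|mc A| * q4 rho))%:E * Ik rho 4)%E.
Proof.
move=> r0; have qr : 0 < q4 `|mc A| by rewrite q4_gt0 // normr_gt0.
have rho0 : 0 < rho by exact: lt_le_trans rho1.
have qrho : 0 < q4 rho by rewrite q4_gt0.
rewrite (integral_plane21 (fun w => (kf rho 4 orig w / q8 (NN w A))%:E)) //; last exact: measurable_kfNN.
rewrite /Ik (integral_plane21 (fun w => (kf rho 4 orig w)%:E)); last 2 first.
- exact: measurable_kfz.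
- by move=> w; exact: kf_ge0.
have mG : mfunT (fun v : R => \int[L1]_t (kf rho 4 orig (t, v))%:E)%E.
 by apply: (measurable_fun_fubini_tonelli_G (m1 := L1) (fun w => (kf rho 4 orig w)%:E)); [exact: measurable_kfz|move=> w; exact: kf_ge0].
have G0 v : (0 <= \int[L1]_t (kf rho 4 orig (t, v))%:E)%E by apply: integral_ge0 => t _; exact: kf_ge0.
have c0 : 0 <= 132 / (q4 `|mc A| * q4 rho) by pos.
rewrite -ge0_integralZl_EFin //.
apply: ge0_le_integral => //.
- by move=> v _; apply: integral_ge0.
- by apply: (measurable_fun_fubini_tonelli_G (m1 := L1) (fun w => (kf rho 4 orig w / q8 (NN w A))%:E)); [exact: measurable_kfNN|].
- by mf.
move=> v _; pose Y := expR v; have Y0 : 0 < Y by exact: expR_gt0.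
pose B := rho + expR (- v) + Y; have YB : Y <= B by rewrite lerDr addr_ge0 ?expR_ge0 // ltW.
have B0 : 0 < B by exact: lt_le_trans YB.
have rB : rho <= B by rewrite /B -addrA lerDl addr_ge0 // ltW.
have kE t : kf rho 4 orig (t, v) = (B + t ^+ 2 * Y) ^- 4.
 by rewrite /kf bd_orig /al /ga /= /B -/Y; congr (_ ^- 4); ring.
under eq_integral do rewrite kE; under [X in (_ <= _ * X)%E]eq_integral do rewrite kE.
have [t1 [t2 hN]] := NN_lower A v r0.
have qrY : 0 < q4 (`|mc A| * Y) by rewrite q4_gt0 // mulr_gt0 // normr_gt0.
have c1 : 0 <= 2 / q4 (`|mc A| * Y) by pos.
have d0 t : 0 < B + t ^+ 2 * Y by pos.
have f0 t : 0 <= (B + t ^+ 2 * Y) ^- 4 by pos.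
have mf' : mfunT (fun t : R => (B + t ^+ 2 * Y) ^- 4).
 by apply: measurable_fun_inv => [t|]; [rewrite exprn_gt0|mf].
have mfh c : mfunT (fun t : R => ((B + t ^+ 2 * Y) ^- 4 * hk (t - c))%:E).
 apply/measurable_EFinP; apply: measurable_funM => //.
 by apply: (measurableT_comp measurable_hk); mf.
have fh0 c t : (0 <= ((B + t ^+ 2 * Y) ^- 4 * hk (t - c))%:E)%E by rewrite lee_fin mulr_ge0 ?hk_ge0.
apply: (@le_trans _ _ (\int[L1]_t ((2 / q4 (`|mc A| * Y))%:E * (((B + t ^+ 2 * Y) ^- 4 * hk (t - t1))%:E + ((B + t ^+ 2 * Y) ^- 4 * hk (t - t2))%:E)))%E).
 apply: ge0_le_integral => //.
 - by move=> t _; rewrite -kE.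
 - have := mpair2 _ v (measurable_kfNN orig A).
  by under eq_fun do rewrite kE.
 - by apply: emeasurable_funM; [mf|exact: emeasurable_funD (mfh t1) (mfh t2)].
 - move=> t _; rewrite -EFinD -EFinM lee_fin -mulrDr mulrCA; apply: ler_wpM2l => //; exact: hN.
rewrite ge0_integralZl_EFin //; [|by move=> t _; rewrite adde_ge0|exact: emeasurable_funD (mfh t1) (mfh t2)].
rewrite ge0_integralD //; last 2 first.
- exact: mfh.
- exact: mfh.
apply: (le_trans (lee_wpmul2l _ (leeD (integral_bump_le B Y t1 Y0 YB) (integral_bump_le B Y t2 Y0 YB)))); first by pos.
have i0 : (0 <= \int[L1]_t ((B + t ^+ 2 * Y) ^- 4)%:E)%E by apply: integral_ge0 => t _; rewrite lee_fin.
rewrite -ge0_muleDl ?lee_fin ?divr_ge0 ?q4_ge0 // muleA -EFinD -EFinM; apply: lee_wpmul2r => //.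
have qB : 0 < q4 (B / Y) by rewrite q4_gt0 // divr_gt0.
rewrite lee_fin [leLHS](_ : _ = 132 / (q4 (`|mc A| * Y) * q4 (B / Y))); last first.
 lra.
rewrite -q4M ?mulr_ge0 ?(ltW Y0) // -mulrA [Y * _]mulrC divfK ?gt_eqF // -q4M //.
rewrite ler_wpM2l // lef_pV2 ?posrE ?q4_gt0 ?mulr_gt0 ?normr_gt0 //.
by apply: q4_le; rewrite ler_wpM2l.
Qed.

(** A rotation by 45 degrees moves the difference of the diagonal entries into the lower left entry;
    its direction [e] is chosen so that the cross term is nonnegative. *)
Let rot45 (a b x y s : R) : s ^+ 2 = 2^-1 -> exists2 e : R, e ^+ 2 = 1 &
 ((a - y) / 2) ^+ 2 <= (- (e * s) * (a * s + b * (e * s)) + s * (x * s + y * (e * s))) ^+ 2.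
Proof.
move=> s2.
have e0 (e : R) : e ^+ 2 = 1 -> - (e * s) * (a * s + b * (e * s)) + s * (x * s + y * (e * s)) = (x - b) / 2 - e * ((a - y) / 2).
 move=> e2; transitivity (s ^+ 2 * (x - e ^+ 2 * b - e * (a - y))); first by ring.
 by rewrite e2 s2; field.
have [h|h] := leP 0 ((x - b) * (a - y)).
 exists (-1); first by rewrite sqrrN expr1n.
 rewrite e0 ?sqrrN ?expr1n //; have := sqr_ge0 ((x - b) / 2).
 rewrite (_ : ((x - b) / 2 - -1 * ((a - y) / 2)) ^+ 2 = ((x - b) / 2) ^+ 2 + ((a - y) / 2) ^+ 2 + (x - b) * (a - y) / 2); last by field.
 lra.
exists 1; first by rewrite expr1n.
rewrite e0 ?expr1n //; have := sqr_ge0 ((x - b) / 2).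
rewrite (_ : ((x - b) / 2 - 1 * ((a - y) / 2)) ^+ 2 = ((x - b) / 2) ^+ 2 + ((a - y) / 2) ^+ 2 - (x - b) * (a - y) / 2); last by field.
lra.
Qed.

(* After a suitable rotation the lower left entry carries a quarter of the norm. *)
Lemma rotation A : exists k : 'M[R]_2, [/\ \det k = 1, act k orig = orig &
 NN orig A / 4 <= mc (invmx k *m A *m k) ^+ 2].
Proof.
have [h1|h1] := leP (NN orig A / 4) (mc A ^+ 2).
 by exists 1%:M; rewrite det1 act1 invmx1 mul1mx mulmx1.
have [h2|h2] := leP (NN orig A / 4) (mb A ^+ 2).
 pose k : 'M[R]_2 := mx2 0 (-1) 1 0; have dk : \det k = 1 by rewrite det2 !mx2E; ring.
 exists k; split => //; last first.
  rewrite !mulE !(invE _ dk) !mx2E; set E := (X in _ <= X ^+ 2).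
  by rewrite (_ : E = - mb A) ?sqrrN // /E; ring.
 by apply: plane_eq; rewrite ?al_act // ?be_act !mx2E !origE; ring.
pose s : R := Num.sqrt 2^-1; have s2 : s ^+ 2 = 2^-1 by rewrite sqr_sqrtr ?invr_ge0.
have [e e2 he] := rot45 (ma A) (mb A) (mc A) (md A) s s2.
pose k : 'M[R]_2 := mx2 s (- (e * s)) (e * s) s.
have dk : \det k = 1.
 rewrite det2 !mx2E; transitivity (s ^+ 2 * (1 + e ^+ 2)); first by ring.
 by rewrite e2 s2; field.
exists k; split => //.
 apply: plane_eq; rewrite ?al_act // ?be_act !mx2E !origE; last by ring.
 transitivity (s ^+ 2 * (1 + e ^+ 2)); first by ring.
 by rewrite e2 s2; field.
move: he; rewrite !mulE !(invE _ dk) !mx2E => he.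
rewrite (_ : ((- (e * s) * ma A + s * mc A) * s + (- (e * s) * mb A + s * md A) * (e * s)) =
 - (e * s) * (ma A * s + mb A * (e * s)) + s * (mc A * s + md A * (e * s))); last by ring.
apply: le_trans he; move: h1 h2; rewrite NN_orig; lra.
Qed.

Lemma conj_cancel g A : \det g = 1 -> A = g *m (invmx g *m A *m g) *m invmx g.
Proof.
by move=> dg; rewrite !mulmxA mulmxV ?det_unit // mul1mx -mulmxA mulmxV ?det_unit // mulmx1.
Qed.

(** The matrix [g] carries [orig] to [z] and contains the rotation that gives the conjugate of [A] a
    large lower left entry. The quarter lost there costs a factor 2, by [q8V4], whence
    [264 = 2 * 132]. *)
Lemma drift_point z A : 0 < NN z A ->
 (\int[L2]_w (kf rho 4 z w / q8 (NN w A))%:E <= (264 / q4 rho / q8 (NN z A))%:E * Ik rho 4)%E.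
Proof.
move=> N0; have [k [dk ko hk']] := rotation (invmx (gz z) *m A *m gz z).
pose g := gz z *m k; have dg : \det g = 1 by rewrite det_mul1 ?gz_det.
have go : act g orig = z by rewrite act_mul ?gz_det // ko gz_orig.
pose A' := invmx g *m A *m g.
have A'E : A' = invmx k *m (invmx (gz z) *m A *m gz z) *m k.
 rewrite /A'; have -> : invmx g = invmx k *m invmx (gz z).
  apply: (can_inj (mulKmx (det_unit _ dg))); rewrite mulmxV ?det_unit // /g !mulmxA.
  by rewrite -[_ *m k *m invmx k]mulmxA mulmxV ?det_unit // mulmx1 mulmxV ?det_unit ?gz_det.
 by rewrite /g !mulmxA.
have AE : A = g *m A' *m invmx g by exact: conj_cancel.
rewrite -A'E -NN_reduce in hk'.
have r0 : mc A' != 0.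
 by apply/eqP => r0; move: hk'; rewrite r0 expr0n /=; lra.
rewrite -(integral_act g) //; last exact: measurable_kfNN.
have -> : (\int[L2]_w (kf rho 4 z (act g w) / q8 (NN (act g w) A))%:E = \int[L2]_w (kf rho 4 orig w / q8 (NN w A'))%:E)%E.
 by apply: eq_integral => w _; rewrite {1}AE NN_act // -{1}go kf_act.
apply: (le_trans (drift_orig A' r0)); apply: lee_wpmul2r.
 by apply: integral_ge0 => w _; exact: kf_ge0.
have qr : 0 < q4 rho by rewrite q4_gt0 // (lt_le_trans _ rho1).
have qN : 0 < q8 (NN z A) by rewrite q8_gt0.
have qm : 0 < q4 `|mc A'| by rewrite q4_gt0 // normr_gt0.
rewrite lee_fin (_ : 264 / q4 rho / q8 (NN z A) = 132 / (q8 (NN z A) / 2 * q4 rho)); last by field; rewrite !gt_eqF.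
rewrite ler_wpM2l // lef_pV2 ?posrE ?mulr_gt0 ?divr_gt0 // ler_wpM2r ?(ltW qr) //.
rewrite -q8_sqr; apply: le_trans (q8_le _ _ hk'); rewrite q8M ?NN_ge0 // ler_wpM2l ?(ltW qN) //.
exact: q8V4.
Qed.

End drift.

(** * The Lyapunov function *)

Section lyapunov_function.
Context {R : realType}.
Notation P := (plane R).
Notation L2 := (@lebesgue_measure R \x @lebesgue_measure R)%E.
Context (G : set 'M[R]_2) (dG : discrete_subgroup_SL2 G) (hN : G (- 1%:M)).
Implicit Types (g h A : 'M[R]_2) (z w : P).

Let mqN g : mfunT (fun z => (q8 (NN z g))^-1).
Proof.
rewrite (_ : (fun w => _) = fun w => q8 (NN w g) `^ (-1)).
 exact: (@measurableT_comp _ _ _ _ _ _ (@powR R ^~ (-1)) _ _ (measurable_powR _) (measurable_q8NN g)).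
by apply/funext => w; rewrite powR_inv1 // q8_ge0.
Qed.

(** The clauses pin down [V] as 1 plus the supremum of [NN z g ^ (-1/8)] over nontrivial [g]. It is
    large where some nontrivial element, conjugated to [z], is close to [1] or [-1], which is what
    happens high in a cusp. *)
Definition is_lyapunov (V : P -> R) := [/\ mfunT V, (forall z, 1 <= V z),
 (forall z g, G g -> ~ pm1 g -> (q8 (NN z g))^-1 <= V z - 1) &
 (forall z c, 0 <= c -> (forall g, G g -> ~ pm1 g -> (q8 (NN z g))^-1 <= c) -> V z <= 1 + c)].

Lemma lyapunov_exists : exists V, is_lyapunov V.
Proof.
have cS : countable [set g | G g /\ ~ pm1 g].
 by apply: sub_countable (countable_group dG hN); apply: subset_card_le => g [].
have [e [p [pA pS _]]] := @countable_enum R _ _ cS.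
pose h (n : nat) z : R := if p n then (q8 (NN z (e n)))^-1 else 0.
have mh n : mfunT (h n) by rewrite /h; case: (p n); mf.
have h0 n z : 0 <= h n z by rewrite /h; case: ifP => // _; rewrite invr_ge0 q8_ge0.
have hub z : has_ubound (range (h ^~ z)).
 have [d d0 hd] := isolated dG hN z; exists (q8 d)^-1 => _ [n _ <-]; rewrite /h.
 case: ifPn => [pn|_]; last by rewrite invr_ge0 q8_ge0.
 have [Gn nn] := pA _ pn; rewrite lef_pV2 ?posrE ?q8_gt0 //.
  by apply: q8_le; rewrite leNgt; apply/negP => /(hd _ Gn).
 by apply: lt_le_trans d0 _; rewrite leNgt; apply/negP => /(hd _ Gn).
have sE z : sups (h ^~ z) 0 = sup (range (h ^~ z)).
 by rewrite /sups /sdrop; congr sup; apply/seteqP; split => _ [n _ <-]; exists n.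
have hs n z : h n z <= sup (range (h ^~ z)) by apply: ub_le_sup => //; exists n.
exists (fun z => 1 + sups (h ^~ z) 0); split.
- apply: measurable_funD; mf.
 by apply: measurable_fun_sups => [|m _]; [move=> t _; exact: hub|exact: mh].
- by move=> z; rewrite sE lerDl (le_trans (h0 0 z)).
- move=> z g Gg ng; have [n pn <-] := pS g (conj Gg ng); rewrite sE addrC addKr.
 by apply: le_trans (hs n z); rewrite /h pn.
- move=> z c c0 hc; rewrite sE lerD2l; apply: ge_sup; first by exists (h 0%N z); exists 0%N.
 move=> _ [n _ <-]; rewrite /h; case: ifPn => // pn; have [Gn nn] := pA _ pn; exact: hc.
Qed.

Context (V : P -> R) (hV : is_lyapunov V).

Lemma lyapunov_act g z : G g -> V (act g z) = V z.
Proof.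
have [_ V1 Vge Vle] := hV.
suff H h w : G h -> V (act h w) <= V w.
 move=> Gg; apply/eqP; rewrite eq_le H //=.
 by have := H _ (act g z) (group_inv dG _ Gg); rewrite actK // (group_det dG _ Gg).
move=> Gh; rewrite -[leRHS](subrKC 1); apply: Vle; first by rewrite subr_ge0.
move=> k Gk nk; have dh := group_det dG _ Gh.
have kE : k = h *m (invmx h *m k *m h) *m invmx h by exact: conj_cancel.
rewrite kE NN_act //; apply: Vge.
 by do ?apply: (group_mul dG) => //; exact: group_inv.
by move=> pk; apply: nk; rewrite kE; case: pk => ->; [left|right];
 rewrite ?mulmxN ?mulNmx mulmx1 mulmxV ?det_unit.
Qed.

(** Elements with [NN z h >= kap / 4] contribute at most [C * bd z w] at [w], by [NN_ratio]. If a
    near-minimal [A] lies below [kap], then by [short_proportional] every element below [kap] has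
    traceless part a multiple of that of [A], with squared factor at least 1/4, so all of these
    contribute at most [2 / q8 (NN w A)]. Deep in a cusp a single element thus controls the
    supremum. *)
Lemma lyapunov_growth z (C := (q8 (kap / 4))^-1 : R) :
 (exists A, [/\ 0 < NN z A, (q8 (NN z A))^-1 <= V z &
   forall w, V w <= 1 + (C * bd z w + 2 / q8 (NN w A))]) \/
 (forall w, V w <= 1 + C * bd z w).
Proof.
have [_ V1 Vge Vle] := hV; have k0 := @kap_gt0 R.
have k4 : 0 < kap / 4 :> R by pos.
have C0 : 0 < C by rewrite invr_gt0 q8_gt0.
have Cb w : 0 <= C * bd z w by rewrite mulr_ge0 // ltW ?bd_gt0.
have [[g Gg ng]|noS] := pselect (exists2 g, G g & ~ pm1 g); last first.
 by right=> w; apply: Vle => // h Gh nh; exfalso; apply: noS; exists h.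
have [A [GA nA minA]] := near_min dG hN z (ex_intro2 _ _ g Gg ng).
have far h w : G h -> ~ pm1 h -> kap / 4 <= NN z h -> (q8 (NN w h))^-1 <= C * bd z w.
 move=> Gh nh hk'; have b1 : 1 <= bd z w by rewrite (le_trans _ (bd_ge2 z w)) // ler1n.
 have b0 : 0 < bd z w by exact: bd_gt0.
 have : q8 (kap / 4) <= bd z w * q8 (NN w h).
  apply: (le_trans (q8_le _ _ (le_trans hk' (NN_ratio z w h)))).
  rewrite q8M ?sqr_ge0 // ler_wpM2r ?q8_ge0 // q8_sqr (gtr0_norm b0).
  by rewrite -[leRHS](q4X _ (ltW b0)); apply: q4_le; rewrite -[leLHS]expr1 ler_weXn2l.
 have q0 : 0 < q8 (NN w h).
  rewrite q8_gt0 // lt_neqAle NN_ge0 andbT eq_sym; apply/eqP => e; apply: nh.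
  exact: NN0_scalar (group_det dG _ Gh) e.
 move=> hh; rewrite /C mulrC ler_pdivlMr ?q8_gt0 // mulrC ler_pdivrMr //.
have [hA|hA] := leP (NN z A) kap; last first.
 right=> w; apply: Vle => // h Gh nh; apply: far => //.
 by have := minA _ Gh nh; lra.
have NA0 : 0 < NN z A.
 rewrite lt_neqAle NN_ge0 andbT eq_sym; apply/eqP => e; apply: nA.
 exact: NN0_scalar (group_det dG _ GA) e.
left; exists A; split => //; first by have := Vge z _ GA nA; lra.
move=> w; have i0 : 0 <= 2 / q8 (NN w A) by rewrite divr_ge0 ?q8_ge0.
apply: Vle => [|h Gh nh]; first by pos.
have [hh|hh] := leP (NN z h) kap; last first.
 by apply: ler_wpDr => //; apply: far => //; lra.
apply: ler_wpDl => //.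
have [b [b1 b2 b3]] := short_proportional dG _ _ _ GA nA Gh minA hA hh.
have bz := NN_scale z A h b b1 b2 b3; have bw := NN_scale w A h b b1 b2 b3.
have b4 : 4^-1 <= b ^+ 2.
 have := minA _ Gh nh; rewrite bz mulrA -[leLHS]mul1r ler_pM2r //.
 lra.
have qA : 0 < q8 (NN w A).
 rewrite q8_gt0 // lt_neqAle NN_ge0 andbT eq_sym; apply/eqP => e; apply: nA.
 exact: NN0_scalar (group_det dG _ GA) e.
rewrite bw q8M ?sqr_ge0 // invfM; apply: ler_wpM2r; first by pos.
have b5 : 2^-1 <= q8 (b ^+ 2) by apply: le_trans q8V4 _; exact: q8_le.
by rewrite -[leRHS]invrK lef_pV2 ?posrE // (lt_le_trans _ b5) // invr_gt0.
Qed.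

End lyapunov_function.

(** * The spectral gap *)

Section automorphic_kernel.
Context {R : realType}.
Notation P := (plane R).
Notation L1 := (@lebesgue_measure R).
Notation L2 := (L1 \x L1)%E.
Context (G : set 'M[R]_2) (dG : discrete_subgroup_SL2 G) (hN : G (- 1%:M)) (F : set P)
 (hF : fdom G F) (mF : measurable F) (finF : (L2 F < +oo)%E).
Implicit Types (g h A : 'M[R]_2) (z w : P).

Definition muF : {finite_measure set P -> \bar R} := mfrestr mF finF.

Lemma integral_muF (f : P -> \bar R) : mfunT f -> (forall z, (0 <= f z)%E) ->
 (\int[muF]_z f z = \int[L2]_(z in F) f z)%E.
Proof. by move=> mf' f0; rewrite /muF integral_restr. Qed.

Context (rho : R) (rho1 : 1 <= rho).

Definition Ikr : R := fine (Ik rho 4).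

Lemma IkrE : Ik rho 4 = Ikr%:E.
Proof. by rewrite /Ikr fineK // ge0_fin_numE ?Ik_fin // ltW // Ik_gt0. Qed.

Lemma Ikr_gt0 : 0 < Ikr. Proof. by rewrite -lte_fin -IkrE; exact: Ik_gt0. Qed.

(** The 2 in the normalisation is due to [-1], which makes every term of the sum over [G] occur
    twice. *)
Definition kG z w : \bar R := ((2 * Ikr)^-1%:E * gsum G (fun x => (kf rho 4 z x)%:E) w)%E.

Let c0 : 0 <= (2 * Ikr)^-1. Proof. by rewrite invr_ge0 mulr_ge0 // ltW ?Ikr_gt0. Qed.
Let k0 z w : (0 <= (kf rho 4 z w)%:E)%E. Proof. exact: kf_ge0. Qed.

Lemma kG_ge0 z w : (0 <= kG z w)%E.
Proof. by rewrite mule_ge0 // gsum_ge0. Qed.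

Lemma measurable_kG : mfunT (fun u : P * P => kG u.1 u.2).
Proof.
apply: emeasurable_funM; mf.
rewrite /gsum; apply: measurable_esum.
- exact: countable_group.
- move=> g Gg; apply/measurable_EFinP.
 have mact : mfunT (fun u : P * P => act g u.2).
  by mf; exact: measurable_act (group_det dG _ Gg).
 have : mfunT ((fun u : P * P => kf rho 4 u.1 u.2) \o (fun u : P * P => (u.1, act g u.2))).
  by apply: measurableT_comp; [exact: measurable_kf|mf].
 by [].
- done.
Qed.

Lemma kG_sym z w : kG z w = kG w z.
Proof.
rewrite /kG /gsum; congr (_ * _)%E; rewrite (reindex_esum _ _ _ _ (group_bij_inv _ dG)).
apply: eq_esum => g Gg; have dg := group_det dG _ Gg.
by rewrite kfC -(kf_act rho 4 g) ?actVK.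
Qed.

(** For an invariant function the sum over [G] unfolds the integral over [F] into one over the whole
    plane. *)
Lemma integral_kG z (f : P -> R) : mfunT f -> (forall w, 0 <= f w) ->
 (forall g w, G g -> f (act g w) = f w) ->
 (\int[muF]_w (kG z w * (f w)%:E) = Ikr^-1%:E * \int[L2]_w (kf rho 4 z w * f w)%:E)%E.
Proof.
move=> mf' f0 fG.
have mkz : mfunT (kG z) by exact: (measurableT_comp measurable_kG (pair1_measurable z)).
have mkf : mfunT (fun w => (kf rho 4 z w * f w)%:E).
 by mf; apply/measurable_EFinP; exact: measurable_kfz.
rewrite integral_muF; last 2 first.
- by mf.
- by move=> w; rewrite mule_ge0 ?kG_ge0 // lee_fin.
have kf0 w : (0 <= (kf rho 4 z w * f w)%:E)%E by rewrite lee_fin mulr_ge0 // ltW ?kf_gt0.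
have E w : (kG z w * (f w)%:E = (2 * Ikr)^-1%:E * gsum G (fun w => (kf rho 4 z w * f w)%:E) w)%E.
 rewrite /kG -muleA; congr (_ * _)%E; rewrite /gsum.
 have [e [p [pA _ E]]] := @countable_enum R _ _ (countable_group dG hN).
 rewrite !E //.
 rewrite muleC -nneseriesZl => [|n _]; last by case: ifP.
 apply: eq_eseriesr => n _; case: ifPn => [pn|_]; last by rewrite mule0.
 by rewrite fG 1?muleC //; exact: pA.
under eq_integral do rewrite E.
rewrite ge0_integralZl_EFin //; first last.
- by apply: measurable_funTS; exact: measurable_gsum.
- by move=> w _; rewrite gsum_ge0.
rewrite (unfold_integral _ dG hN) //; last by move=> w; rewrite kf0 ltry.
by rewrite muleA -EFinM; congr (_%:E * _)%E; field; rewrite gt_eqF ?Ikr_gt0.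
Qed.

Lemma kG_int z : (\int[muF]_w kG z w = 1)%E.
Proof.
have := integral_kG z (cst 1) (measurable_cst _) (fun=> ler01) (fun _ _ _ => erefl).
under eq_integral do rewrite mule1; move=> ->.
under eq_integral do rewrite mulr1.
by rewrite integral_kf // IkrE -EFinM mulVf // gt_eqF ?Ikr_gt0.
Qed.

Section with_lyapunov.
Context (V : P -> R) (hV : is_lyapunov G V).

Let C : R := (q8 (kap / 4))^-1.

(** By [lyapunov_growth] the average of [V] splits into the mass of the kernel, the [bd] term, which
    the third power of the kernel absorbs, and one function [2 NN^(-1/8)], to which [drift_point]
    applies; [528 = 2 * 264]. *)
Lemma kG_drift z : (\int[muF]_w (kG z w * (V w)%:E) <=
 (528 / q4 rho * V z + (1 + C * fine (Ik rho 3) / Ikr))%:E)%E.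
Proof.
have [c [c1 ec ->]] : exists c : R, [/\ 0 <= c, 264 = c & 528 = 2 * c].
 by exists 264; split; [pos|reflexivity|lra].
have [mV V1 _ _] := hV.
have I0 := Ikr_gt0.
have V0 w : 0 <= V w by exact: le_trans (V1 w).
have C0 : 0 <= C by rewrite invr_ge0 q8_ge0.
have qr : 0 <= q4 rho by exact: q4_ge0.
have I3 : Ik rho 3 = (fine (Ik rho 3))%:E.
 by rewrite fineK // ge0_fin_numE ?Ik3_fin // integral_ge0 // => w _; exact: kf_ge0.
have I30 : 0 <= fine (Ik rho 3) by rewrite fine_ge0 // integral_ge0 // => w _; exact: kf_ge0.
rewrite integral_kG //; last by move=> g w Gg; exact: (lyapunov_act _ dG _ hV).
have mk m : mfunT (fun w => (kf rho m z w)%:E) by exact: measurable_kfz.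
have mkr m : mfunT (kf rho m z) by apply/measurable_EFinP; mf.
have mkC : mfunT (fun w => (C * kf rho 3 z w)%:E).
 by mf.
have mkV : mfunT (fun w => (kf rho 4 z w * V w)%:E).
 by mf.
have kp m w : 0 <= kf rho m z w by rewrite ltW // kf_gt0.
have base : (\int[L2]_w ((kf rho 4 z w)%:E + (C * kf rho 3 z w)%:E) = (Ikr + C * fine (Ik rho 3))%:E)%E.
 rewrite ge0_integralD //; last by move=> w _; rewrite lee_fin mulr_ge0.
 rewrite EFinD EFinM -I3 -IkrE; congr (_ + _)%E; first exact: integral_kf.
 under eq_integral do rewrite EFinM.
 rewrite ge0_integralZl_EFin //.
  by congr (_ * _)%E; exact: integral_kf.
 by move=> w _; exact: kf_ge0.
rewrite lee_pdivrMl // -EFinM.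
have [[A [N0 NV hA]]|h] := lyapunov_growth _ dG hN _ hV z; last first.
 apply: (@le_trans _ _ (Ikr + C * fine (Ik rho 3))%:E).
  rewrite -base; apply: ge0_le_integral => //.
  - by move=> w _; rewrite lee_fin mulr_ge0.
  - exact: emeasurable_funD.
  - move=> w _; rewrite -EFinD lee_fin; apply: (le_trans (ler_wpM2l (kp 4 w) (h w))).
   by rewrite mulrDr mulr1 lerD2l mulrCA ler_wpM2l // kf_bd.
 rewrite lee_fin (_ : Ikr * _ = Ikr * ((2 * c) / q4 rho * V z) + (Ikr + C * fine (Ik rho 3))); last by field; rewrite !gt_eqF // q4_gt0 // (lt_le_trans _ rho1).
 rewrite lerDr; apply: mulr_ge0; first pos.
 by pos.
have mN := measurable_kfNN _ rho1 z A.
have N0' w : (0 <= (kf rho 4 z w / q8 (NN w A))%:E)%E by rewrite lee_fin divr_ge0 ?q8_ge0.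
apply: (@le_trans _ _ (\int[L2]_w (((kf rho 4 z w)%:E + (C * kf rho 3 z w)%:E) + 2%:E * (kf rho 4 z w / q8 (NN w A))%:E))%E).
 apply: ge0_le_integral => //.
 - by move=> w _; rewrite lee_fin mulr_ge0.
 - by apply: emeasurable_funD; [exact: emeasurable_funD|apply: emeasurable_funM => //; mf].
 - move=> w _; rewrite -EFinM -!EFinD lee_fin; apply: (le_trans (ler_wpM2l (kp 4 w) (hA w))).
  rewrite mulrDr mulr1 -addrA lerD2l mulrDr; apply: lerD.
   by rewrite mulrCA ler_wpM2l // kf_bd.
  by rewrite mulrCA.
rewrite ge0_integralD //; first last.
- by apply: emeasurable_funM => //; mf.
- by move=> w _; rewrite mule_ge0 // lee_fin.
- exact: emeasurable_funD.
- by move=> w _; rewrite adde_ge0 // lee_fin mulr_ge0.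
rewrite base ge0_integralZl_EFin //.
have := drift_point _ rho1 z A N0; rewrite ec IkrE -EFinM => hd.
have hd2 : (2%:E * \int[L2]_w (kf rho 4 z w / q8 (NN w A))%:E <= (2 * (c / q4 rho / q8 (NN z A) * Ikr))%:E)%E.
 by rewrite EFinM; exact: lee_wpmul2l.
apply: (le_trans (leeD (lexx _) hd2)); rewrite -EFinD lee_fin.
rewrite (_ : Ikr * ((2 * c) / q4 rho * V z + (1 + C * fine (Ik rho 3) / Ikr)) = Ikr + C * fine (Ik rho 3) + 2 * (c / q4 rho * Ikr) * V z); last by field; rewrite !gt_eqF // q4_gt0 // (lt_le_trans _ rho1).
rewrite lerD2l (_ : 2 * _ = 2 * (c / q4 rho * Ikr) * (q8 (NN z A))^-1); last by ring.
apply: ler_wpM2l => //; apply: mulr_ge0; first pos.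
by pos.
Qed.

End with_lyapunov.

(** With this radius the ball about [orig] contains the unit square, so that all balls have area at
    least 1. *)
Let k00 : R := 1 + 2 * expR 1.

Let ball_box z : (`[0, 1]%classic `*` `[0, 1]%classic) z -> bd orig z <= k00.
Proof.
move=> [/=]; rewrite !in_itv /= => /andP[t0 t1] /andP[v0 v1]; rewrite bd_orig /k00.
rewrite lerD //; first by rewrite /al -expR0 ler_expR oppr_le0.
rewrite /ga ler_pM ?addr_ge0 ?sqr_ge0 ?ler_expR //.
by rewrite (_ : 2 = 1 + 1) // lerD2l expr_le1.
Qed.

Let ball z : set P := [set w | bd z w <= k00].

Let mball z : measurable (ball z).
Proof.
rewrite (_ : ball z = bd z @^-1` `]-oo, k00]%classic); last by apply/seteqP; split => x /=; rewrite in_itv.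
by rewrite -[X in measurable X]setTI; apply: measurable_bdz.
Qed.

Let mind z : mfunT (fun x => (\1_(ball z) x)%:E : \bar R).
Proof. by mf. Qed.

Let ind0 z w : (0 <= (\1_(ball z) w)%:E :> \bar R)%E.
Proof. done. Qed.

Let ball_area z : L2 (ball z) = L2 (ball orig).
Proof.
have E x : L2 (ball x) = (\int[L2]_w (\1_(ball x) w)%:E)%E by rewrite integral_indic // setIT.
rewrite !E -[LHS](integral_act (gz z)) ?gz_det //.
apply: eq_integral => w _; have e : bd z (act (gz z) w) = bd orig w.
 by rewrite -{1}(gz_orig z) bd_act ?gz_det.
rewrite !indicE (_ : (act (gz z) w \in ball z) = (w \in ball orig)) //.
by apply/idP/idP; rewrite !inE /ball /= e.
Qed.

Let ball_gt0 : (1 <= L2 (ball orig))%E.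
Proof.
pose Q : set P := `[0, 1]%classic `*` `[0, 1]%classic.
have mQ : measurable Q by apply: measurableX; mf.
have L1I : L1 `[0 : R, 1]%classic = 1%E by rewrite lebesgue_measure_itv lte_fin ltr01 sube0.
have <- : L2 Q = 1%E by rewrite /Q product_measure1E //= L1I mule1.
by apply: le_measure; rewrite ?inE //; exact: ball_box.
Qed.

Let gcount z (w : P) : \bar R := gsum G (fun x => (\1_(ball z) x)%:E) w.

Let mgcount z : mfunT (gcount z).
Proof.
exact: measurable_gsum.
Qed.

Let gcount_int z : (\int[L2]_(w in F) gcount z w = 2%:E * L2 (ball orig))%E.
Proof.
rewrite (unfold_integral _ dG hN) //; last by move=> w; rewrite ind0 ltry.
by rewrite -(ball_area z) integral_indic // setIT.
Qed.

Lemma muF_gt0 : (0 < L2 F)%E.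
Proof.
rewrite lt_neqAle measure_ge0 andbT; apply/eqP => F0.
have := gcount_int orig; rewrite null_set_integral //; last exact: measurable_funTS (mgcount _).
move=> e; have : (0 < 2%:E * L2 (ball orig))%E.
 by apply: mule_gt0; [rewrite lte_fin|apply: lt_le_trans ball_gt0; pos].
by rewrite -e ltxx.
Qed.

(** If [g0 w] lies in the ball about [z], then any other [h w] in it makes [h g0^-1] move [z] by a
    bounded amount, and [grid] counts these elements uniformly. *)
Let gcount_le (d : R) : 0 < d -> exists2 m : R, 0 < m & forall z,
 (forall g, G g -> NN z g < d -> pm1 g) -> forall w, (gcount z w <= m%:E)%E.
Proof.
have k1 : 0 < k00 by rewrite /k00; pos.
move=> d0; have [U hU] := grid dG d (k00 * k00) d0 (mulr_gt0 k1 k1).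
exists (#|U|%:R + 1); first by rewrite ltr_wpDl.
move=> z /hU[f fi] w; pose A := [set g | G g /\ bd z (act g w) <= k00].
have -> : gcount z w = (\esum_(g in A) (1 : \bar R))%E.
 rewrite (_ : A = G `&` [set g | bd z (act g w) <= k00]) // esum_mkcondr.
 apply: eq_esum => g Gg; rewrite indicE.
 rewrite (_ : (g \in _) = (act g w \in ball z)) //.
 by case: (_ \in _).
have [[g0 [Gg0 hg0]]|nA] := pselect (exists g, A g); last first.
 rewrite (_ : A = set0) ?esum_set0 //.
 by apply/seteqP; split => g // Ag; apply: nA; exists g.
have d0' := group_det dG _ Gg0.
have b h : G h -> bd z (act h w) <= k00 -> bd z (act (h *m invmx g0) z) <= k00 * k00.
 move=> Gh hh; have dh := group_det dG _ Gh.
 apply: (le_trans (bd_triangle z (act h w) _)); apply: ler_pM; rewrite ?(ltW (bd_gt0 _ _)) //.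
 rewrite -(bd_act (invmx h)) ?det_inv1 // actK // act_mul ?det_inv1 // actK //.
 by rewrite -(bd_act g0) // actVK // bdC.
apply: (@le_trans _ _ (#|U|%:R)%:E); last by rewrite lee_fin lerDl.
apply: (esum1_le_card _ _ A (fun g => f (g *m invmx g0))) => g h [Gg hg] [Gh hh] e.
have Gm k : G k -> G (k *m invmx g0) by move=> Gk; apply: (group_mul dG) => //; exact: group_inv.
have := fi _ _ (Gm _ Gg) (Gm _ Gh) (b _ Gg hg) (b _ Gh hh) e.
by move=> /(congr1 (mulmx^~ g0)); rewrite !mulmxKV ?det_unit.
Qed.

(** Points of [F] whose whole orbit stays away from [orig]. These sets decrease to the empty set, so
    their area tends to 0 by finiteness of the area of [F]. *)
Let far (n : nat) : set P := [set w | F w /\ forall g, G g -> n%:R < bd orig (act g w)].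

Let mfar n : measurable (far n).
Proof.
rewrite (_ : far n = F `&` \bigcap_(g in G) (fun w => bd orig (act g w)) @^-1` `]n%:R, +oo[%classic); last first.
 apply/seteqP; split => [w [Fw h]|w [Fw h]]; split => // g Gg; first by rewrite /= in_itv andbT; exact: h.
 by have := h g Gg; rewrite /= in_itv andbT.
have [e [p [pA pS _]]] := @countable_enum R _ _ (countable_group dG hN).
pose A g : set P := (fun w => bd orig (act g w)) @^-1` `]n%:R, +oo[%classic.
rewrite -/A (_ : \bigcap_(g in G) A g = \bigcap_(k in [set k | p k]) A (e k)); last first.
 apply/seteqP; split => [w h k /pA Gk|w h g /pS[k pk <-]]; [exact: h|exact: h].
apply: measurableI => //; apply: bigcap_measurableType => k /pA.
move: (e k) => g Gg; rewrite /A -[X in measurable X]setTI.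
by apply: (measurableT_comp (measurable_bdz orig) (measurable_act _ (group_det dG _ Gg))).
Qed.

Let far_cvg : L2 (far n) @[n --> \oo] --> (0 : \bar R).
Proof.
have e : \bigcap_n far n = set0.
 apply/seteqP; split => // w h; have [_ hw] := h 0%N I.
 have [_ /(_ _ (group1 _ dG))] := h (Num.bound (bd orig w)) I.
 by rewrite act1 => /lt_trans/(_ (archi_boundP (ltW (bd_gt0 _ _)))); rewrite ltxx.
rewrite -[X in _ --> X](@measure0 _ _ _ L2) -e; apply: nonincreasing_cvg_mu => //.
- by apply: le_lt_trans finF; apply: le_measure => [||w []//]; rewrite inE; mf.
- by rewrite e.
- move=> m n mn; apply/subsetPset => w [Fw h]; split => // g Gg.
 by apply: le_lt_trans (h g Gg); rewrite ler_nat.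
Qed.

Section minorization.
Context (V : P -> R) (hV : is_lyapunov G V).

(** Where [V <= V0], nontrivial elements stay away from [1] and [-1], so [gcount z] is bounded by
    some [m]. If no translate of [z] came near [orig], [gcount z] would vanish on [F] outside
    [far n], and its integral [2 * L2 (ball orig)] would be at most [m * L2 (far n)], which is
    smaller once [n] is large. *)
Lemma thick_bounded (V0 : R) : exists n : R, forall z, V z <= V0 -> exists2 g, G g & bd orig (act g z) <= n.
Proof.
have [_ V1 Vge _] := hV.
have [V0p|V0n] := ltP 0 V0; last first.
 by exists 0 => z /le_trans/(_ V0n) h; have := le_trans (V1 z) h; rewrite ler10.
pose d := ((V0 + 1)^-1 : R) ^+ 8.
have i0 : 0 <= (V0 + 1)^-1 by pos.
have d0 : 0 < d by rewrite exprn_gt0 // invr_gt0; lra.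
have [m m0 hm] := gcount_le d d0.
have [n hn] : exists n, (m%:E * L2 (far n) < 2%:E * L2 (ball orig))%E.
 have /fine_cvgP[fn /cvgrPdist_lt cv] := far_cvg.
 have e0 : 0 < 2 / m by pos.
 have [n [f1 f2]] : exists n, L2 (far n) \is a fin_num /\ `|0 - fine (L2 (far n))| < 2 / m.
  near \oo => n; exists n; split; near: n => //; exact: cv.
 exists n; apply: (@lt_le_trans _ _ 2%:E).
  rewrite -(fineK f1) -EFinM lte_fin mulrC -ltr_pdivlMr // (le_lt_trans _ f2) //.
  by rewrite sub0r normrN ler_norm.
 by rewrite -[leLHS]mule1; apply: lee_wpmul2l.
exists (n%:R * k00) => z Vz; apply: contrapT => nz.
have sep g : G g -> NN z g < d -> pm1 g.
 move=> Gg gd; apply: contrapT => ng; have := le_trans (Vge z g Gg ng) (lerB Vz (lexx 1)).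
 have q0 : 0 < q8 (NN z g).
  rewrite q8_gt0 // lt_neqAle NN_ge0 andbT eq_sym; apply/eqP => e; apply: ng.
  exact: NN0_scalar (group_det dG _ Gg) e.
 have : q8 (NN z g) <= (V0 + 1)^-1.
  apply: (le_trans (q8_le _ _ (ltW gd))); rewrite /d (exprM _ 2 4) q8_X4 ?sqr_ge0 //.
  by rewrite sqrtr_sqr ger0_norm.
 rewrite -[leRHS]invrK => h; have : V0 + 1 <= (q8 (NN z g))^-1.
  by rewrite -[leLHS]invrK lef_pV2 ?posrE //; [rewrite invrK in h|lra].
 lra.
have sub w : F w -> ~ far n w -> gcount z w = 0%E.
 move=> Fw nw; apply: esum1 => g Gg; rewrite indicE memNset //= /ball /= => hb.
 apply: nw; split => // h Gh; rewrite ltNge; apply/negP => hh; apply: nz.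
 exists (h *m invmx g); first by apply: (group_mul dG) => //; exact: group_inv.
 have [dg dh] := (group_det dG _ Gg, group_det dG _ Gh).
 apply: (le_trans (bd_triangle orig (act h w) _)); apply: ler_pM; rewrite ?(ltW (bd_gt0 _ _)) //.
 rewrite -(bd_act (invmx h)) ?det_inv1 // actK // act_mul ?det_inv1 // actK //.
 by rewrite -(bd_act g) // actVK // bdC.
have := gcount_int z; apply/eqP; rewrite lt_eqF //; apply: le_lt_trans hn.
have <- : (\int[L2]_(w in F) (m * \1_(far n) w)%:E = m%:E * L2 (far n))%E.
 under eq_integral do rewrite EFinM.
 rewrite ge0_integralZl_EFin; mf.
 congr (_ * _)%E; apply: etrans (integral_indic L2 mF (mfar n)) _.
 by rewrite setIidl // => w [].
apply: ge0_le_integral => //.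
- by move=> w _; apply: gsum_ge0 => x; pos.
- by apply: measurable_funTS; mf.
- by mf.
- move=> w Fw; rewrite indicE; case: (boolP (w \in far n)) => wf.
  by rewrite mulr1; exact: hm.
 rewrite sub ?mulr0 // => h; move/negP: wf; apply; exact: mem_set.
Unshelve. all: by end_near.
Qed.

(** One term of the sum suffices: both points have translates within a bounded distance of [orig],
    hence some translate of [w] is within a bounded distance of [z]. *)
Lemma kG_minor (V0 : R) : exists2 e : R, 0 < e & forall z w, V z <= V0 -> V w <= V0 -> (e%:E <= kG z w)%E.
Proof.
have [n hn] := thick_bounded V0.
pose m := `|n| ^+ 2; have m0 : 0 <= m by exact: sqr_ge0.
have rm : 0 < rho + m by rewrite ltr_pwDl // (lt_le_trans _ rho1).
exists ((2 * Ikr)^-1 * (rho + m) ^- 4).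
 by rewrite mulr_gt0 // invr_gt0 ?exprn_gt0 // mulr_gt0 // Ikr_gt0.
move=> z w /hn[g Gg hg] /hn[h Gh hh]; rewrite EFinM /kG lee_wpmul2l //.
have [dg dh] := (group_det dG _ Gg, group_det dG _ Gh).
pose k := invmx g *m h; have Gk : G k by apply: (group_mul dG) => //; exact: group_inv.
have hk' : bd z (act k w) <= m.
 rewrite /k act_mul ?det_inv1 // -(bd_act g) // actVK //.
 apply: (le_trans (bd_triangle _ orig _)); rewrite /m expr2 ler_pM ?(ltW (bd_gt0 _ _)) //.
  by rewrite bdC (le_trans hg) // ler_norm.
 by rewrite (le_trans hh) // ler_norm.
apply: (@le_trans _ _ (kf rho 4 z (act k w))%:E).
 rewrite lee_fin /kf lef_pV2 ?posrE ?exprn_gt0 ?(lt_le_trans _ (_ : rho <= rho + bd z (act k w))) ?lerDl ?(ltW (bd_gt0 _ _)) ?(lt_le_trans _ rho1) //.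
 rewrite lerXn2r ?nnegrE ?lerD2l // addr_ge0 ?(ltW (bd_gt0 _ _)) // (le_trans _ rho1) //.
rewrite /gsum; apply: esum_ge; exists [set k].
 by split; [exact: finite_set1|move=> x ->].
by rewrite fsbig_set1.
Qed.

End minorization.

End automorphic_kernel.
Arguments muF {R F}.

Section automorphic_gap.
Context {R : realType}.
Notation P := (plane R).
Notation L2 := (@lebesgue_measure R \x @lebesgue_measure R)%E.
Context (G : set 'M[R]_2) (dG : discrete_subgroup_SL2 G) (hN : G (- 1%:M)) (F : set P)
 (hF : fdom G F) (mF : measurable F) (finF : (L2 F < +oo)%E).

Lemma vol_muF : vol (muF mF finF) = fine (L2 F).
Proof.
by rewrite /vol /Int integral_muF // integral_cst // mul1e.
Qed.

Lemma vol_gt0 : 0 < vol (muF mF finF).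
Proof.
rewrite vol_muF fine_gt0 // (muF_gt0 _ dG hN _ hF) //.
Qed.

(** Solves [528 / q4 rho0 = 1 / 2], which makes the drift a contraction by one half. *)
Definition rho0 : R := 1056 ^+ 4.

Lemma rho0_ge1 : 1 <= rho0. Proof. by rewrite exprn_ege1 // ler1n. Qed.

Lemma automorphic_gap : exists2 th : R, 0 <= th < 1 & forall f, bmp f ->
 Var (muF mF finF) (Pop (muF mF finF) (kG G rho0) f) <= th * Var (muF mF finF) f.
Proof.
have [V hV] := lyapunov_exists _ dG hN; have [mV V1 _ _] := hV.
have mk := measurable_kG _ dG hN _ rho0_ge1.
have k0 := kG_ge0 G _ rho0_ge1.
have kC := kG_sym _ dG rho0.
have k1 := kG_int _ dG hN _ hF mF finF _ rho0_ge1.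
pose b := 1 + (q8 (kap / 4))^-1 * fine (Ik rho0 3) / Ikr rho0.
have q1056 : 528 / q4 rho0 = 2^-1.
 have [c [c1 -> ec]] : exists c : R, [/\ 0 < c, 528 = c & 1056 = 2 * c].
  by exists 528; split; [rewrite ltr0n|reflexivity|lra].
 by rewrite /rho0 ec q4X ?mulr_ge0 ?(ltW c1) // invfM mulrCA mulfV ?mulr1 // gt_eqF.
have a1 : (2^-1 : R) < 1 by rewrite invf_lt1 // ltr1n.
have b0 : 0 <= b.
 rewrite /b; apply: addr_ge0 => //; apply: divr_ge0; last exact: ltW (Ikr_gt0 _ rho0_ge1).
 apply: mulr_ge0; first by rewrite invr_ge0 q8_ge0.
 by rewrite fine_ge0 // integral_ge0 // => w _; exact: (kf_ge0 _ rho0_ge1).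
have hd z : (\int[muF mF finF]_w (kG G rho0 z w * (V w)%:E) <= (2^-1 * V z + b)%:E)%E.
 by have := kG_drift _ dG hN _ hF mF finF _ rho0_ge1 _ hV z; rewrite q1056.
have hm := kG_minor _ dG hN _ hF mF finF _ rho0_ge1 _ hV.
have [K K0 hK] := spectral_gap (muF mF finF) vol_gt0 (kG G rho0) mk k0 kC k1 V 2^-1 b mV V1 a1 b0 hd hm.
(* Enlarging [K] to [K + 1] keeps the rate nonnegative. *)
exists (1 - (4 * (K + 1))^-1).
 have : (4 * (K + 1))^-1 <= 1 by rewrite invf_le1; lra.
 have : 0 < (4 * (K + 1))^-1 by pos.
 lra.
move=> f bf; apply: Var_Pop => //; first lra.
apply: (le_trans (hK f (proj1 bf))); apply: lee_wpmul2r; first by apply: E2_ge0.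
by rewrite lee_fin lerDl.
Qed.

End automorphic_gap.

(** * Column vectors *)

Section vectors.
Context {R : realType}.
Notation P := (plane R).
Implicit Types (g M : 'M[R]_2) (v w : R * R) (z : P).

Definition col1 M : R * R := (ma M, mc M).
Definition wedge v w : R := v.1 * w.2 - v.2 * w.1.
Definition negv v : R * R := (- v.1, - v.2).

Lemma col1_mul g M : col1 (g *m M) = mulv g (col1 M).
Proof. by rewrite /col1 /mulv !mulE. Qed.

Lemma mulv10 M : mulv M (1, 0) = col1 M.
Proof. by rewrite /mulv /col1 !mulr1 !mulr0 !addr0. Qed.

Lemma wedge_mulv g v w : \det g = 1 -> wedge (mulv g v) (mulv g w) = wedge v w.
Proof.
rewrite det2 /wedge /mulv /= => dg.
transitivity ((ma g * md g - mb g * mc g) * (v.1 * w.2 - v.2 * w.1)); first by ring.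
by rewrite dg mul1r.
Qed.

Lemma D10 z : D (1, 0) z = al z.
Proof. by rewrite /D /=; ring. Qed.

Lemma D_neg v z : D (negv v) z = D v z.
Proof. by rewrite /D /=; ring. Qed.

Lemma D_orig v : D v orig = v.1 ^+ 2 + v.2 ^+ 2.
Proof. by rewrite /D !origE; ring. Qed.

Lemma D_col M z : \det M = 1 -> D (col1 M) z = al (act (invmx M) z).
Proof. by move=> dM; rewrite -mulv10 -{1}(actVK M z dM) D_act // D10. Qed.

Lemma mulvK g v : \det g = 1 -> mulv (invmx g) (mulv g v) = v.
Proof. by move=> dg; rewrite -mulv_mul mulVmx ?det_unit // mulv1. Qed.

Lemma mulvVK g v : \det g = 1 -> mulv g (mulv (invmx g) v) = v.
Proof. by move=> dg; rewrite -mulv_mul mulmxV ?det_unit // mulv1. Qed.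

Lemma D_reduce v z : D v z = D (mulv (invmx (gz z)) v) orig.
Proof. by rewrite -[RHS](D_act (gz z)) ?gz_det // mulvVK ?gz_det // gz_orig. Qed.

Lemma mulv_negv g v : mulv g (negv v) = negv (mulv g v).
Proof. by rewrite /mulv /negv /=; congr pair; ring. Qed.

Lemma negvK : involutive negv.
Proof. by move=> [a b]; rewrite /negv !opprK. Qed.

Definition separated (d : R) (W : set (R * R)) := forall v w, W v -> W w ->
 v = w \/ v = negv w \/ d <= `|wedge v w|.

Let slope_close (d y p q p' q' : R) (m : nat) : 0 < d -> 0 < y -> 2 * (y / d) <= m%:R ->
 p != 0 -> p' != 0 -> `|q| <= `|p| -> `|q'| <= `|p'| -> p ^+ 2 < y -> p' ^+ 2 < y ->
 cell m ((q / p + 1) * (y / d)) = cell m ((q' / p' + 1) * (y / d)) -> `|p * q' - q * p'| < d.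
Proof.
move=> d0 y0 hm p0 p0' qp qp' py py'; have K0 : 0 < y / d by pos.
have r (a b : R) : b != 0 -> `|a| <= `|b| -> 0 <= (a / b + 1) * (y / d) <= m%:R.
 move=> b0 ab; have : `|a / b| <= 1 by rewrite normrM normrV ?unitfE // ler_pdivrMr ?normr_gt0 // mul1r.
 rewrite ler_norml => /andP[h1 h2]; apply/andP; split; first by rewrite mulr_ge0; lra.
 by apply: le_trans hm; rewrite ler_pM2r; lra.
move=> /(cell_close _ _ _ (r _ _ p0 qp) (r _ _ p0' qp')).
rewrite -mulrBl normrM (gtr0_norm K0) -ltr_pdivlMr //.
set X := _ - _ => hX; have -> : p * q' - q * p' = p * p' * - X by rewrite /X; field; rewrite p0 p0'.
rewrite normrM normrN; have ppy : `|p * p'| <= y.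
 have := sqr_ge0 (`|p| - `|p'|); rewrite sqrrB normrM !real_normK ?num_real; lra.
apply: (@le_lt_trans _ _ (y * `|X|)); first by rewrite ler_wpM2r.
by rewrite mulrC -ltr_pdivlMr //; apply: lt_le_trans hX _; rewrite mul1r invf_div.
Qed.

(* The slopes of separated vectors of length at most [r] differ by at least [d / r ^ 2]. *)
Lemma card_separated (d : R) (W : set (R * R)) : 0 < d -> separated d W -> (forall v, W v -> v <> (0, 0)) ->
 forall z y, 0 < y -> (\esum_(v in W) ((D v z < y)%R%:R)%:E <= (8 * (1 + d^-1) * (1 + y))%:E)%E.
Proof.
move=> d0 sep W0 z y y0; pose A := [set v | W v /\ D v z < y].
have -> : (\esum_(v in W) ((D v z < y)%R%:R)%:E = \esum_(v in A) (1 : \bar R))%E.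
 rewrite (_ : A = W `&` [set v | D v z < y]) // esum_mkcondr.
 apply: eq_esum => v _; rewrite (_ : (v \in _) = (D v z < y)); first by case: ifP.
 by apply/idP/idP; rewrite inE.
pose c v := mulv (invmx (gz z)) v; pose K := y / d.
have K0 : 0 < K by rewrite divr_gt0.
pose m := (Num.truncn (2 * K)).+1.
have hm : 2 * K <= m%:R.
 by have /andP[_ /ltW] := truncn_itv (mulr_ge0 (ler0n R 2) (ltW K0)).
have hm2 : m%:R <= 2 * K + 1.
 by rewrite /m -natr1 lerD2r truncn_le mulr_ge0 // ltW.
(* The code records which coordinate is the larger, its sign, which separates a vector from its
   negative, and a cell for the slope, which then lies between -1 and 1. *)
pose f v : bool * bool * 'I_m.+1 := if `|(c v).2| <= `|(c v).1|
 then (true, 0 < (c v).1, cell m (((c v).2 / (c v).1 + 1) * K))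
 else (false, 0 < (c v).2, cell m (((c v).1 / (c v).2 + 1) * K)).
have dz : \det (invmx (gz z)) = 1 by rewrite det_inv1 ?gz_det.
have c0 v : W v -> ~ ((c v).1 = 0 /\ (c v).2 = 0).
 move=> Wv [e1 e2]; apply: (W0 v Wv); rewrite -(mulvVK (gz z) v) ?gz_det // -/(c v).
 by rewrite /mulv e1 e2 !mulr0 !addr0.
have cy v : A v -> (c v).1 ^+ 2 + (c v).2 ^+ 2 < y by move=> [_]; rewrite D_reduce D_orig.
apply: (@le_trans _ _ (#|{: bool * bool * 'I_m.+1}|%:R)%:E); last first.
 rewrite !card_prod card_bool card_ord lee_fin !natrM -natr1.
 have di : 0 < d^-1 by pos.
 have : 0 < y * d^-1 by pos.
 rewrite /K in hm2; nra.
apply: (esum1_le_card _ _ A f) => v w Av Aw.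
have [[Wv _] [Ww _]] := (Av, Aw).
have cv := cy _ Av; have cw := cy _ Aw.
have fin : `|wedge v w| < d -> ((0 < (c v).1) = (0 < (c w).1) /\ (c v).1 != 0) \/
  ((0 < (c v).2) = (0 < (c w).2) /\ (c v).2 != 0) -> v = w.
 move=> h sg; have [//|[vw|]] := sep v w Wv Ww; last by move/(lt_le_trans h); rewrite ltxx.
 have e : c v = negv (c w) by rewrite vw /c mulv_negv.
 by case: sg; rewrite e oppr_gt0 oppr_eq0 => -[h1 h2]; exfalso; move: h1 h2; case: ltgtP.
rewrite /f; case: ifPn => hv; case: ifPn => hw // [].
 move=> s /(slope_close d y _ _ _ _ m d0 y0 hm) H.
 have p1 u : W u -> `|(c u).2| <= `|(c u).1| -> (c u).1 != 0.
  move=> Wu hu; apply/eqP => e; apply: (c0 u Wu); split => //.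
  by apply/eqP; rewrite -normr_le0 (le_trans hu) // e normr0.
 apply: fin; last by left; split => //; exact: p1.
 rewrite -(wedge_mulv (invmx (gz z))) //; apply: H => //; rewrite ?p1 //.
  by apply: le_lt_trans cv; rewrite lerDl sqr_ge0.
 by apply: le_lt_trans cw; rewrite lerDl sqr_ge0.
move=> s /(slope_close d y _ _ _ _ m d0 y0 hm) H.
rewrite -ltNge in hv; rewrite -ltNge in hw.
have p1 u : `|(c u).1| < `|(c u).2| -> (c u).2 != 0.
 by move=> hu; rewrite -normr_gt0 (le_lt_trans _ hu).
apply: fin; last by right; split => //; exact: p1.
rewrite -(wedge_mulv (invmx (gz z))) // /wedge -normrN opprB; apply: H => //; rewrite ?p1 ?(ltW hv) ?(ltW hw) //.
 by apply: le_lt_trans cv; rewrite lerDr sqr_ge0.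
by apply: le_lt_trans cw; rewrite lerDr sqr_ge0.
Qed.

End vectors.

Section cusp_vectors.
Context {R : realType}.
Notation P := (plane R).
Notation L1 := (@lebesgue_measure R).
Notation L2 := (L1 \x L1)%E.
Context (G : set 'M[R]_2) (dG : discrete_subgroup_SL2 G) (sa sb : 'M[R]_2)
 (hsa : scaling_matrix G sa) (hsb : scaling_matrix G sb).
Implicit Types (g h : 'M[R]_2) (v w : R * R) (z : P).

Let da : \det sa = 1. Proof. exact: scaling_det _ _ hsa. Qed.
Let db : \det sb = 1. Proof. exact: scaling_det _ _ hsb. Qed.
Let hN : G (- 1%:M). Proof. exact: scaling_opp1 _ _ hsb. Qed.
Let dab g : G g -> \det (invmx sa *m g *m sb) = 1.
Proof. by move=> Gg; rewrite !det_mul1 ?det_inv1 // (group_det dG). Qed.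

Definition Vab : set (R * R) := [set v | exists2 g, G g & v = col1 (invmx sa *m g *m sb)].

Lemma Vab_neq0 v : Vab v -> v <> (0, 0).
Proof.
move=> [g Gg ->] [e1 e2]; have := dab g Gg; rewrite det2 e1 e2 !mul0r mulr0 subrr => /eqP.
lra.
Qed.

Definition sepd : R := Num.sqrt (kap / 4).
Lemma sepd_gt0 : 0 < sepd. Proof. by rewrite sqrtr_gt0 divr_gt0 ?kap_gt0. Qed.

(** The wedge of two columns is, up to sign, the lower left entry of their quotient conjugated by
    [sb]. Either [mc_lower] bounds it from below, or it vanishes; in that case the quotient is
    parabolic up to sign and preserves the column up to sign. *)
Lemma Vab_sep : separated sepd Vab.
Proof.
move=> _ _ [g Gg ->] [h Gh ->]; have Ggh : G (invmx h *m g) by apply: (group_mul dG) => //; exact: group_inv.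
have dh := group_det dG _ Gh.
set k := invmx sb *m (invmx h *m g) *m sb.
have E : invmx sa *m g *m sb = invmx sa *m h *m sb *m k.
 rewrite /k !mulmxA -[_ *m sb *m invmx sb]mulmxA mulmxV ?det_unit // mulmx1.
 by rewrite -[_ *m h *m invmx h]mulmxA mulmxV ?det_unit // mulmx1.
have [c0|c0] := eqVneq (mc k) 0.
 have [s [n [s1 kE]]] := scaling_fix _ _ hsb _ Ggh c0.
 rewrite E col1_mul /k kE parab_mx2.
 by case: s1 => ->; [left|right; left]; rewrite -mulv10 /mulv /negv /col1 !mx2E /=; congr pair; ring.
right; right; have := mc_lower _ dG _ hsb _ Ggh c0 => hk'.
rewrite E col1_mul -[X in wedge _ X]mulv10 wedge_mulv ?dab // /wedge /= mulr0 sub0r mulr1 normrN.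
by rewrite /sepd -[leRHS]sqrtr_sqr ler_wsqrtr.
Qed.

Lemma Vab_card z y : 0 < y ->
 (\esum_(v in Vab) ((D v z < y)%R%:R)%:E <= (8 * (1 + sepd^-1) * (1 + y))%:E)%E.
Proof. by move=> y0; apply: card_separated => //; [exact: sepd_gt0|exact: Vab_sep|exact: Vab_neq0]. Qed.

Lemma Vab_neg v : Vab v -> Vab (negv v).
Proof.
move=> [g Gg ->]; exists (- g); first exact: group_opp dG hN _ Gg.
by rewrite mulmxN mulNmx /col1 /negv !oppE.
Qed.

Lemma Vab_shift v (n : int) : Vab v -> Vab (v.1 + n%:~R * v.2, v.2).
Proof.
move=> [g Gg ->]; exists (sa *m parab 1 n *m invmx sa *m g).
 by apply: (group_mul dG) => //; apply: (scaling_parab _ _ hsa); left.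
have -> : invmx sa *m (sa *m parab 1 n *m invmx sa *m g) *m sb = parab 1 n *m (invmx sa *m g *m sb).
 by rewrite !mulmxA mulVmx ?det_unit // mul1mx.
by rewrite [RHS]col1_mul parab_mx2 /mulv !mx2E; congr pair; ring.
Qed.

Lemma Vab_countable : countable Vab.
Proof.
have -> : Vab = (fun g => col1 (invmx sa *m g *m sb)) @` G.
 by apply/seteqP; split => [v [g Gg ->]|v [g Gg <-]]; exists g.
apply: card_le_trans (countable_group dG hN); exact: card_image_le.
Qed.

End cusp_vectors.

(** * Incomplete Eisenstein series and counting functions *)

Section strip.
Context {R : realType}.
Notation P := (plane R).
Notation L1 := (@lebesgue_measure R).
Notation L2 := (L1 \x L1)%E.
Implicit Types (z : P).

(** The real part of the encoded point. *)
Definition Xc z : R := (z.1 : R) * expR z.2.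
Definition strip z : bool := 0 <= Xc z < 1.

Lemma Xc_al z : Xc z = be z / al z.
Proof. by rewrite /Xc /be /al expRN invrK. Qed.

Lemma det_parab (n : int) : \det (parab (1 : R) n) = 1.
Proof. by rewrite parab_mx2 det2 !mx2E; ring. Qed.

Lemma al_parab (n : int) z : al (act (parab 1 n) z) = al z.
Proof. by rewrite al_act ?det_parab // parab_mx2 !mx2E; ring. Qed.

Lemma Xc_parab (n : int) z : Xc (act (parab 1 n) z) = Xc z + n%:~R.
Proof.
rewrite !Xc_al al_parab be_act parab_mx2 !mx2E; field; rewrite gt_eqF ?al_gt0 //.
Qed.

Lemma strip_unique z (n : int) : strip (act (parab 1 n) z) = (n == - Num.floor (Xc z)).
Proof.
rewrite /strip Xc_parab; apply/idP/eqP => [/andP[h1 h2]|->].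
 have : Num.floor (Xc z) = - n; last by move=> ->; rewrite opprK.
 by apply: floor_def; rewrite intrD rmorphN; apply/andP; split; lra.
rewrite rmorphN /=; have := floor_itv (Xc z) => /andP[h1 h2].
lra.
Qed.

Lemma measurable_strip : mfunT (fun z => ((strip z)%:R : R)).
Proof.
have mX : mfunT Xc by rewrite /Xc; mf.
by mf; apply: measurable_and; mf|| mf.
Qed.

(** At level [v] the strip has width [exp (- v)] in [t], and this is the Jacobian of
    [s = al z = exp (- v)]. *)
Lemma strip_integral (h : R -> \bar R) : mfunT h -> (forall y, (0 <= h y)%E) ->
 (\int[L2]_z (h (al z) * ((strip z)%:R)%:E) = \int[L1]_(y in `]0%R, +oo[) h y)%E.
Proof.
move=> mh h0; have mal : mfunT (@al R) by rewrite /al; mf.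
rewrite (integral_plane21 (fun z => h (al z) * ((strip z)%:R)%:E)%E); last 2 first.
- apply: emeasurable_funM; first mf.
 by apply/measurable_EFinP; exact: measurable_strip.
- by move=> z; rewrite mule_ge0 // lee_fin.
pose u (x : R) : \bar R := ((0 <= x < 1)%R%:R)%:E.
have mu : mfunT u.
 apply/measurable_EFinP; apply: measurable_fun_natb; apply: measurable_and.
  by apply: measurable_fun_ler; mf.
 by mf.
have u0 x : (0 <= u x)%E by rewrite lee_fin.
have u1 : (\int[L1]_x u x = 1)%E.
 rewrite (_ : u = fun x => (\1_(`[0%R, 1%R[%classic) x)%:E); last first.
  by apply/funext => x; rewrite indicE mem_setE in_itv.
 by rewrite integral_indic // setIT /= lebesgue_measure_itv lte_fin ltr01 sube0.
have E (v : R) : (\int[L1]_t (h (al (t, v)) * ((strip (t, v))%:R)%:E) = h (expR (- v)) * (expR (- v))%:E)%E.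
 transitivity (\int[L1]_t (h (expR (- v)) * ((strip (t, v))%:R)%:E))%E; first by [].
 rewrite ge0_integralZl //; last first.
  by apply: (mpair2 (fun z => ((strip z)%:R : R)%:E) v); apply/measurable_EFinP; exact: measurable_strip.
 congr (_ * _)%E; have := integral_scale (expR v) u (expR_gt0 v) mu u0; rewrite u1 => e.
 have mus : mfunT (fun t : R => u (expR v * t)) by mf.
 have -> : (\int[L1]_t ((strip (t, v))%:R)%:E = \int[L1]_t u (expR v * t)%R)%E.
  by apply: eq_integral => t _; rewrite /u /strip /Xc mulrC.
 have cE : (0 <= (expR v)%:E)%E by pos.
 move: e; rewrite ge0_integralZr //.
 set J := (\int[L1]_x _)%E; have J0 : (0 <= J)%E by apply: integral_ge0.
 move=> e; have : (J * (expR v)%:E * (expR (- v))%:E = (expR (- v))%:E)%E by rewrite e mul1e.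
 by rewrite -muleA -EFinM -expRD subrr expR0 mule1.
under eq_integral do rewrite E.
have mhe : mfunT (fun v : R => h (expR v) * (expR v)%:E)%E.
 apply: emeasurable_funM; first by mf.
 by mf.
rewrite (integral_reflect (fun v => h (expR v) * (expR v)%:E)%E) //; last first.
 by move=> v; rewrite mule_ge0 // lee_fin expR_ge0.
exact: integral_expR.
Qed.

End strip.

Section eisenstein.
Context {R : realType}.
Notation P := (plane R).
Notation L1 := (@lebesgue_measure R).
Notation L2 := (L1 \x L1)%E.
Context (G : set 'M[R]_2) (dG : discrete_subgroup_SL2 G) (hN : G (- 1%:M)) (F : set P)
 (hF : fdom G F) (mF : measurable F) (finF : (L2 F < +oo)%E) (sa : 'M[R]_2) (da : \det sa = 1).

(** In the uses below [psi] contains the indicator of the strip, which selects one element, up to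
    sign, from each coset of the cusp stabiliser; the sum over all of [G] is then twice the usual
    incomplete Eisenstein series. *)
Definition Eis (psi : P -> R) z : \bar R := gsum G (fun w => (psi (act (invmx sa) w))%:E) z.

Let mpsi (psi : P -> R) : mfunT psi ->
 mfunT (fun w => (psi (act (invmx sa) w))%:E).
Proof.
move=> mp; apply/measurable_EFinP; apply: (measurableT_comp mp).
by apply: measurable_act; rewrite det_inv1.
Qed.

Lemma measurable_Eis (psi : P -> R) : mfunT psi -> (forall z, 0 <= psi z) -> mfunT (Eis psi).
Proof. by move=> mp p0; apply: measurable_gsum => //; [exact: mpsi|move=> z; rewrite lee_fin]. Qed.

Lemma Eis_integral (psi f : P -> R) : mfunT psi -> (forall z, 0 <= psi z) ->
 mfunT f -> (forall z, 0 <= f z) -> (forall g z, G g -> f (act g z) = f z) ->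
 (\int[muF mF finF]_z (Eis psi z * (f z)%:E) = 2%:E * \int[L2]_z (psi z * f (act sa z))%:E)%E.
Proof.
move=> mp p0 mf' f0 fG; have mE := measurable_Eis psi mp p0.
have E0 z : (0 <= Eis psi z)%E by apply: gsum_ge0 => w; rewrite lee_fin.
rewrite integral_muF; last 2 first.
- by mf.
- by move=> z; rewrite mule_ge0 // lee_fin.
have E z : (Eis psi z * (f z)%:E = gsum G (fun w => (psi (act (invmx sa) w) * f w)%:E) z)%E.
 rewrite /Eis /gsum.
 have [e [p [pA _ E]]] := @countable_enum R _ _ (countable_group dG hN).
 rewrite !E; last 2 first.
 - by move=> g Gg; rewrite lee_fin mulr_ge0.
 - by move=> g Gg; rewrite lee_fin.
 rewrite muleC -nneseriesZl => [|n _]; last by case: ifP => _; rewrite lee_fin.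
 apply: eq_eseriesr => n _; case: ifPn => [pn|_]; last by rewrite mule0.
 by rewrite fG 1?muleC //; exact: pA.
under eq_integral do rewrite E.
have mpf : mfunT (fun w => (psi (act (invmx sa) w) * f w)%:E).
 by apply/measurable_EFinP; apply: measurable_funM => //; apply/measurable_EFinP; exact: mpsi.
have pf0 w : 0 <= psi (act (invmx sa) w) * f w by pos.
rewrite (unfold_integral _ dG hN) //; last by move=> z; rewrite lee_fin pf0 ltry.
congr (_ * _)%E; rewrite -(integral_act sa) //.
by apply: eq_integral => z _; rewrite actK.
Qed.

End eisenstein.

Section counting.
Context {R : realType}.
Notation P := (plane R).
Notation L1 := (@lebesgue_measure R).
Notation L2 := (L1 \x L1)%E.
Context (G : set 'M[R]_2) (dG : discrete_subgroup_SL2 G) (sb : 'M[R]_2) (hsb : scaling_matrix G sb).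
Implicit Types (g h : 'M[R]_2) (v w : R * R) (z : P) (y : R).

Let db : \det sb = 1. Proof. exact: scaling_det _ _ hsb. Qed.
Let hN : G (- 1%:M). Proof. exact: scaling_opp1 _ _ hsb. Qed.

Definition Vb : set (R * R) := [set v | exists2 g, G g & v = col1 (g *m sb)].

Lemma Vb_act g v : G g -> Vb v -> Vb (mulv g v).
Proof.
move=> Gg [h Gh ->]; exists (g *m h); first exact: group_mul.
by rewrite -col1_mul mulmxA.
Qed.

Lemma Vb_countable : countable Vb.
Proof.
have -> : Vb = (fun g => col1 (g *m sb)) @` G.
 by apply/seteqP; split => [v [g Gg ->]|v [g Gg <-]]; exists g.
apply: card_le_trans (countable_group dG hN); exact: card_image_le.
Qed.

Definition cnt y z : \bar R := (\esum_(v in Vb) ((D v z < y)%R%:R)%:E)%E.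

Lemma cnt_ge0 y z : (0 <= cnt y z)%E.
Proof. by apply: esum_ge0 => v _; pos. Qed.

Lemma cnt_Vab sa y z : \det sa = 1 ->
 cnt y (act sa z) = (\esum_(v in Vab G sa sb) ((D v z < y)%R%:R)%:E)%E.
Proof.
move=> da; rewrite /cnt (reindex_esum (Vab G sa sb) _ (mulv sa)).
 by apply: eq_esum => v _; rewrite D_act.
split.
- move=> _ [g Gg ->]; exists g => //.
 by rewrite -col1_mul !mulmxA mulmxV ?det_unit // mul1mx.
- by move=> v w _ _ /(congr1 (mulv (invmx sa))); rewrite !mulvK.
- move=> _ [g Gg ->]; exists (col1 (invmx sa *m g *m sb)); first by exists g.
 by rewrite -col1_mul !mulmxA mulmxV ?det_unit // mul1mx.
Qed.

Lemma cnt_act g y z : G g -> cnt y (act g z) = cnt y z.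
Proof.
move=> Gg; have dg := group_det dG _ Gg.
rewrite /cnt (reindex_esum Vb _ (mulv g)).
 by apply: eq_esum => v _; rewrite D_act.
split.
- by move=> v; exact: Vb_act.
- by move=> v w _ _ /(congr1 (mulv (invmx g))); rewrite !mulvK.
- move=> v Vv; exists (mulv (invmx g) v); last by rewrite mulvVK.
 by apply: Vb_act => //; exact: group_inv.
Qed.

Definition Ccnt : R := 8 * (1 + sepd^-1).
Lemma Ccnt_ge0 : 0 <= Ccnt.
Proof. by rewrite /Ccnt; apply: mulr_ge0 => //; rewrite addr_ge0 // invr_ge0 ltW ?sepd_gt0. Qed.

Lemma cnt_le y z : 0 < y -> (cnt y z <= (Ccnt * (1 + y))%:E)%E.
Proof.
by move=> y0; rewrite -(actVK sb z db) cnt_Vab //; exact: (Vab_card _ dG _ _ hsb hsb).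
Qed.

(** Halving counts the columns up to sign. *)
Definition N y z : R := fine (cnt y z) / 2.

Lemma cntE y z : 0 < y -> cnt y z = (2 * N y z)%:E.
Proof.
move=> y0; rewrite /N mulrC divfK // fineK // ge0_fin_numE ?cnt_ge0 //.
exact: le_lt_trans (cnt_le y z y0) (ltry _).
Qed.

Lemma N_ge0 y z : 0 <= N y z.
Proof. by rewrite divr_ge0 // fine_ge0 // cnt_ge0. Qed.

Lemma N_le y z : 0 < y -> N y z <= Ccnt * (1 + y).
Proof.
move=> y0; have := cnt_le y z y0; rewrite cntE // lee_fin; have := N_ge0 y z; lra.
Qed.

Lemma N_act g y z : G g -> N y (act g z) = N y z.
Proof. by move=> Gg; rewrite /N cnt_act. Qed.

Lemma measurable_D v : mfunT (D v : P -> R).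
Proof. by rewrite /D /al /be /ga; mf. Qed.

Lemma measurable_cnt2 : mfunT (fun u : measurableTypeR R * P => cnt u.1 u.2).
Proof.
rewrite /cnt; apply: measurable_esum; first exact: Vb_countable.
- move=> v Vv; apply/measurable_EFinP; apply: measurable_fun_natb; apply: measurable_fun_ltr; last mf.
 exact: (measurableT_comp (measurable_D v) measurable_snd).
- done.
Qed.

Lemma measurable_N2 : mfunT (fun u : measurableTypeR R * P => N u.1 u.2).
Proof.
apply: measurable_funM; last mf.
by apply: (measurableT_comp _ measurable_cnt2); mf.
Qed.

Lemma measurable_N y : mfunT (N y).
Proof. exact: (measurableT_comp measurable_N2 (pair1_measurable (y : measurableTypeR R))). Qed.

(** Two elements with the same column differ by an element of the cusp stabiliser. Equality of the
    columns, rather than equality up to sign, makes this an integer translation with sign [+1]. *)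
Let fibre_K g h : G g -> G h -> col1 (invmx g *m sb) = col1 (invmx h *m sb) ->
 exists n : int, forall z, act (invmx sb *m g) z = act (parab 1 n) (act (invmx sb *m h) z) /\ (n = 0 -> g = h).
Proof.
move=> Gg Gh e; have [dg dh] := (group_det dG _ Gg, group_det dG _ Gh).
have Gk : G (g *m invmx h) by apply: (group_mul dG) => //; exact: group_inv.
pose K := invmx sb *m (g *m invmx h) *m sb.
have dK : \det K = 1 by rewrite !det_mul1 ?det_inv1.
have e1 : invmx h *m sb = invmx g *m sb *m K.
 rewrite /K !mulmxA -[_ *m sb *m invmx sb]mulmxA mulmxV ?det_unit // mulmx1.
 by rewrite mulVmx ?det_unit // mul1mx.
have e2 : invmx sb *m g = K *m (invmx sb *m h).
 rewrite /K !mulmxA -[_ *m sb *m invmx sb]mulmxA mulmxV ?det_unit // mulmx1.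
 by rewrite -[_ *m invmx h *m h]mulmxA mulVmx ?det_unit // mulmx1.
have cK : col1 K = (1, 0).
 have : col1 (invmx g *m sb *m K) = col1 (invmx g *m sb) by rewrite -e1.
 rewrite col1_mul -[in RHS]mulv10 => /(congr1 (mulv (invmx (invmx g *m sb)))).
 by rewrite !mulvK ?det_mul1 ?det_inv1.
have K0 : mc K = 0 by have := congr1 snd cK.
have [s [n [_ KE]]] := scaling_fix _ _ hsb _ Gk K0.
have s1 : s = 1 by have := congr1 fst cK; rewrite /K KE parab_mx2 /col1 mx2E.
exists n => z; split; first by rewrite e2 act_mul ?det_mul1 ?det_inv1 // /K KE s1.
move=> n0; have K1 : K = 1%:M.
 by rewrite /K KE s1 n0 parab_mx2; apply: mx2_eq; rewrite !mx2E oneE ?mulr0.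
have : sb *m (invmx sb *m g) = sb *m (invmx sb *m h) by rewrite e2 K1 mul1mx.
by rewrite !mulmxA mulmxV ?det_unit // !mul1mx.
Qed.

(* Among the elements of [G] with a given column exactly one moves [z] into the strip. *)
Lemma cnt_Eis y z : cnt y z = Eis G sb (fun w => (al w < y)%R%:R * (strip w)%:R) z.
Proof.
pose Gz := [set g | G g /\ strip (act (invmx sb) (act g z))].
have -> : Eis G sb (fun w => (al w < y)%R%:R * (strip w)%:R) z =
  (\esum_(g in Gz) ((al (act (invmx sb) (act g z)) < y)%R%:R)%:E)%E.
 rewrite /Eis /gsum (_ : Gz = G `&` [set g | strip (act (invmx sb) (act g z))]) // esum_mkcondr.
 apply: eq_esum => g Gg; rewrite (_ : (g \in _) = strip (act (invmx sb) (act g z))).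
  by case: ifP => _; rewrite ?mulr1 ?mulr0.
 by apply/idP/idP; rewrite inE.
rewrite /cnt (reindex_esum Gz _ (fun g => col1 (invmx g *m sb))).
 apply: eq_esum => g [Gg _]; have dg := group_det dG _ Gg.
 have dgi : \det (invmx g *m sb) = 1 by rewrite det_mul1 ?det_inv1.
 have E : invmx (invmx g *m sb) = invmx sb *m g.
  apply: (can_inj (mulKmx (det_unit _ dgi))); rewrite mulmxV ?det_unit // !mulmxA.
  by rewrite -[_ *m sb *m invmx sb]mulmxA mulmxV ?det_unit // mulmx1 mulVmx ?det_unit.
 by rewrite (D_col _ _ dgi) E act_mul ?det_inv1.
split.
- by move=> g [Gg _]; exists (invmx g) => //; exact: group_inv.
- move=> g h /set_mem[Gg sg] /set_mem[Gh sh] e0; have [n Hn] := fibre_K _ _ Gg Gh e0.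
 have [e] := Hn z; apply; move: sg sh.
 rewrite -!act_mul ?det_inv1 // ?(group_det dG) // e.
 rewrite -[X in _ -> strip X -> _](act1 _) => h1 h2.
 move: h1; rewrite strip_unique => /eqP ->.
 have : strip (act (parab 1 0) (act (invmx sb *m h) z)).
  by move: h2; rewrite (_ : parab 1 0 = 1%:M) // parab_mx2; apply: mx2_eq; rewrite !mx2E oneE ?mulr0.
 by rewrite strip_unique => /eqP <-.
- move=> _ [g0 Gg0 ->]; have d0 := group_det dG _ Gg0.
 pose n : int := - Num.floor (Xc (act (invmx sb *m invmx g0) z)).
 pose g := sb *m parab 1 n *m invmx sb *m invmx g0.
 have Gg : G g by apply: (group_mul dG); [apply: (scaling_parab _ _ hsb); left|exact: group_inv].
 have dg := group_det dG _ Gg.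
 exists g.
  split => //; rewrite -act_mul ?det_inv1 // /g !mulmxA mulVmx ?det_unit // mul1mx.
  by rewrite -mulmxA act_mul ?det_parab ?det_mul1 ?det_inv1 // strip_unique.
 have : invmx g *m sb *m parab 1 n = g0 *m sb.
  apply: (can_inj (mulKmx (det_unit _ dg))); rewrite !mulmxA mulmxV ?det_unit // mul1mx.
  rewrite /g -[_ *m invmx g0 *m g0]mulmxA mulVmx ?det_unit // mulmx1.
  by rewrite -[_ *m invmx sb *m sb]mulmxA mulVmx ?det_unit // mulmx1.
 move=> <-; rewrite [RHS]col1_mul (_ : col1 (parab 1 n) = (1, 0)) ?mulv10 //.
 by rewrite parab_mx2 /col1 !mx2E.
Qed.

Context (F : set P) (hF : fdom G F) (mF : measurable F) (finF : (L2 F < +oo)%E).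

Lemma bmp_N y : 0 < y -> bmp (N y : P -> R).
Proof.
move=> y0; split; last exact: N_ge0.
split; first exact: measurable_N.
by exists (Ccnt * (1 + y)) => z; rewrite ger0_norm ?N_ge0 // N_le.
Qed.

Let mstr y : mfunT (fun w : P => (al w < y)%R%:R * (strip w)%:R : R).
Proof.
apply: measurable_funM; last exact: measurable_strip.
by apply: measurable_fun_natb; apply: measurable_fun_ltr; [rewrite /al; mf|mf].
Qed.

(** Unfolding leaves the area of the part of the strip where [al < y], which is [y]; the factor 2 of
    the unfolding cancels against the halving in [N]. *)
Lemma Int_N y : 0 < y -> Int (muF mF finF) (N y) = y.
Proof.
move=> y0; have := @Eis_integral _ _ dG hN _ hF mF finF _ db _ (cst 1) (mstr y) _ (measurable_cst _) (fun=> ler01) (fun _ _ _ => erefl).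
have -> : (\int[L2]_z ((al z < y)%R%:R * (strip z)%:R * cst 1 (act sb z))%:E = y%:E)%E.
 have mh : mfunT (fun x : R => ((x < y)%R%:R)%:E : \bar R).
  apply/measurable_EFinP; apply: measurable_fun_natb.
  by mf.
 have := strip_integral (fun x => ((x < y)%R%:R)%:E) mh (fun x => lee_tofin (ler0n R _)).
 under eq_integral do rewrite -EFinM -[X in X%:E]mulr1; move=> ->.
 rewrite integral_mkcond (_ : _ \_ _ = fun x : R => (\1_(`]0, y[%classic) x)%:E); last first.
  apply/funext => x; rewrite patchE indicE !mem_setE !in_itv /= andbT.
  by case: (0 < x).
 by rewrite integral_indic // setIT /= lebesgue_measure_itv lte_fin y0 sube0.
under eq_integral do rewrite mule1 -cnt_Eis cntE //.
rewrite -EFinM => H; have {}H : (\int[muF mF finF]_z (2 * N y z)%:E = (2 * y)%:E)%E.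
 by apply: H => z; pos.
apply: (mulfI (_ : 2 != 0 :> R)) => //; rewrite -IntZ; last by case: (bmp_N y y0).
by rewrite /Int H.
Qed.

End counting.

HB.instance Definition _ := isPointed.Build int 0.

Lemma esumZl {R : realType} (T : pointedType) (A : set T) (c : R) (a : T -> \bar R) :
 countable A -> 0 <= c -> (forall x, A x -> (0 <= a x)%E) ->
 (\esum_(x in A) (c%:E * a x) = c%:E * \esum_(x in A) a x)%E.
Proof.
move=> cA c0 a0; have [e [p [pA _ E]]] := @countable_enum R _ _ cA.
rewrite !E //; last by move=> x Ax; rewrite mule_ge0 ?a0.
rewrite -nneseriesZl => [|n _]; last by case: ifPn => // /pA /a0.
by apply: eq_eseriesr => n _; case: ifP => // _; rewrite mule0.
Qed.

Section pairing.
Context {R : realType}.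
Notation P := (plane R).
Notation L1 := (@lebesgue_measure R).
Notation L2 := (L1 \x L1)%E.
Context (G : set 'M[R]_2) (dG : discrete_subgroup_SL2 G) (sa sb : 'M[R]_2)
 (hsa : scaling_matrix G sa) (hsb : scaling_matrix G sb).
Implicit Types (g h : 'M[R]_2) (v w r : R * R) (z : P) (y : R).

Let cV : countable (Vab G sa sb). Proof. exact: Vab_countable dG _ _ hsb. Qed.

(* Representatives, up to sign and translation, of the columns with nonzero lower entry. *)
Definition RP : set (R * R) := [set v | Vab G sa sb v /\ 0 < v.2 /\ 0 <= v.1 < v.2].

Definition shiftv (n : int) v : R * R := (v.1 + n%:~R * v.2, v.2).

Definition ind v y z : R := (D v z < y)%R%:R.

Lemma ind_ge0 v y z : 0 <= ind v y z. Proof. done. Qed.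

Lemma measurable_ind v y : mfunT (ind v y).
Proof. by apply: measurable_fun_natb; apply: measurable_fun_ltr; [exact: measurable_D|mf]. Qed.

Lemma ind_shift r n y z : ind (shiftv n r) y (act (parab 1 n) z) = ind r y z.
Proof.
rewrite /ind; have -> : shiftv n r = mulv (parab 1 n) r.
 by rewrite parab_mx2 /mulv /shiftv !mx2E; congr pair; ring.
by rewrite D_act // det_parab.
Qed.

Definition Vpos : set (R * R) := [set v | Vab G sa sb v /\ 0 < v.2].
Definition Vzero : set (R * R) := [set v | Vab G sa sb v /\ v.2 = 0].

Lemma Vab_split (f : R * R -> \bar R) : (forall v, (0 <= f v)%E) -> (forall v, f (negv v) = f v) ->
 (\esum_(v in Vab G sa sb) f v = \esum_(v in Vzero) f v + 2%:E * \esum_(v in Vpos) f v)%E.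
Proof.
move=> f0 fN; rewrite (esumID [set v | v.2 = 0]) //; congr (_ + _)%E.
rewrite (esumID [set v | 0 < v.2]) //.
rewrite (_ : Vab G sa sb `&` ~` [set v | v.2 = 0] `&` [set v | 0 < v.2] = Vpos); last first.
 apply/seteqP; split => [v [[Vv _] v0]|v [Vv v0]]; split => //; split => //= e.
 lra.
rewrite [X in (_ + X)%E](reindex_esum Vpos _ negv).
 rewrite [X in (_ + X)%E](eq_esum (fun v _ => fN v)) -[X in _ = (X * _)%E](_ : 1%:E + 1%:E = 2%:E)%E //.
 by rewrite ge0_muleDl ?mul1e.
split.
- move=> v [Vv v0]; split; first by split; [exact: (Vab_neg _ dG _ _ hsb)|move=> /eqP; rewrite oppr_eq0 gt_eqF].
 by rewrite /= oppr_gt0 => h; have := lt_trans v0 h; rewrite ltxx.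
- by move=> v w _ _ /(congr1 negv); rewrite !negvK.
- move=> v [[Vv v0] /= vn]; exists (negv v); last exact: negvK.
 split; first exact: (Vab_neg _ dG _ _ hsb).
 by rewrite oppr_gt0 lt_neqAle leNgt; apply/andP; split; [apply/eqP|apply/negP].
Qed.

(** Division with remainder of the upper entry by the lower one. *)
Lemma Vpos_bij : set_bij (RP `*`` fun=> [set: int]) Vpos (fun rn => shiftv rn.2 rn.1).
Proof.
split.
- move=> [r n] [[Vr [r0 _]] _]; split => //; exact: (Vab_shift _ dG _ _ hsa).
- move=> [[a c] n] [[a' c'] n'] /set_mem[[_ /= [c0 /andP[h1 h2]]] _] /set_mem[[_ /= [c0' /andP[h1' h2']]] _].
 rewrite /shiftv => -[e1 e2]; rewrite -{}e2 in c0' h2' e1 *.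
 have nn : n = n'.
  have e : (n - n')%:~R * c = a' - a by rewrite intrB mulrBl; lra.
  apply/eqP; rewrite -subr_eq0 -[_ == 0](intr_eq0 R).
  have lt1 : `|(n - n')%:~R : R| < 1.
   by rewrite -(ltr_pM2r c0) mul1r -{1}(gtr0_norm c0) -normrM e ltr_norml; apply/andP; split; lra.
  by move: lt1; rewrite -intr_norm -[1]/(1%:~R) ltr_int intr_eq0 -[X in _ < X]add0r ltzD1 normr_le0.
 by move: e1; rewrite nn => /addIr ->.
- move=> [a c] [Vv /= c0]; pose n := Num.floor (a / c).
 exists (shiftv (- n) (a, c), n); last by rewrite /shiftv /= rmorphN; congr pair; ring.
 split => //; split; first exact: (Vab_shift _ dG _ _ hsa).
 split => //=; rewrite rmorphN /= mulNr.
 have /andP[h1 h2] := floor_itv (a / c); rewrite -/n in h1 h2.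
 by move: h1 h2; rewrite ler_pdivlMr // ltr_pdivrMr // intrD mulrDl => h1 h2; apply/andP; split; lra.
Qed.

(** A second unfolding: the columns with positive lower entry are the integer translates of the
    representatives, and the translates of the strip tile the plane, so the sum over translations
    removes the strip. *)
Lemma pair_pos (psi : P -> R) y : mfunT psi -> (forall z, 0 <= psi z) ->
 (forall (n : int) z, psi (act (parab 1 n) z) = psi z) ->
 (\int[L2]_z ((psi z * (strip z)%:R)%:E * \esum_(v in Vpos) (ind v y z)%:E) =
  \esum_(r in RP) \int[L2]_z (psi z * ind r y z)%:E)%E.
Proof.
move=> mp p0 pT.
have cVp : countable Vpos by apply: sub_countable cV; apply: subset_card_le => v [].
have cRP : countable RP by apply: sub_countable cV; apply: subset_card_le => v [].
have mps : mfunT (fun z => psi z * (strip z)%:R).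
 by apply: measurable_funM => //; exact: measurable_strip.
have ps0 z : 0 <= psi z * (strip z)%:R by pos.
transitivity (\int[L2]_z \esum_(v in Vpos) ((psi z * (strip z)%:R) * ind v y z)%:E)%E.
 by apply: eq_integral => z _; rewrite -esumZl // => v _; rewrite lee_fin ind_ge0.
rewrite integral_esum //; first last.
- by move=> v z _; rewrite lee_fin mulr_ge0 // ind_ge0.
- by move=> v _; apply/measurable_EFinP; apply: measurable_funM => //; exact: measurable_ind.
rewrite (reindex_esum _ _ _ _ Vpos_bij).
transitivity (\esum_(r in RP) \esum_(n in [set: int])
  \int[L2]_z (psi z * (strip z)%:R * ind (shiftv n r) y z)%:E)%E.
 rewrite (esum_esum (fun _ _ _ _ => _)) //.
 by move=> r n _ _; apply: integral_ge0 => z _; rewrite lee_fin mulr_ge0 // ind_ge0.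
apply: eq_esum => r _.
have cZ : countable [set: int] by [].
transitivity (\esum_(n in [set: int]) \int[L2]_z (psi z * (strip (act (parab 1 n) z))%:R * ind r y z)%:E)%E.
 apply: eq_esum => n _; rewrite -[LHS](integral_act _ _ (det_parab n)); first last.
 - by move=> z; rewrite lee_fin mulr_ge0 // ind_ge0.
 - by apply/measurable_EFinP; apply: measurable_funM => //; exact: measurable_ind.
 by apply: eq_integral => z _; rewrite pT ind_shift.
rewrite -integral_esum //; first last.
- by move=> n z _; rewrite lee_fin !mulr_ge0 // ind_ge0.
- move=> n _; apply/measurable_EFinP; apply: measurable_funM; last exact: measurable_ind.
 apply: measurable_funM => //; apply: (measurableT_comp measurable_strip).
 by apply: measurable_act; exact: det_parab.
apply: eq_integral => z _.
rewrite (esum_single _ _ (- Num.floor (Xc z))) //.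
- by rewrite strip_unique eqxx mulr1.
- by move=> n _; rewrite lee_fin !mulr_ge0 // ind_ge0.
- by move=> n _ /eqP hn; rewrite strip_unique (negbTE hn) mulr0 mul0r.
Qed.

End pairing.

(** * Correlations of the counting functions *)

Section correlation.
Context {R : realType}.
Notation P := (plane R).
Notation L1 := (@lebesgue_measure R).
Notation L2 := (L1 \x L1)%E.
Context (G : set 'M[R]_2) (dG : discrete_subgroup_SL2 G) (sb : 'M[R]_2) (hsb : scaling_matrix G sb)
 (F : set P) (hF : fdom G F) (mF : measurable F) (finF : (L2 F < +oo)%E).
Implicit Types (g h : 'M[R]_2) (v w r : R * R) (z : P) (x y : R).

Let db : \det sb = 1. Proof. exact: scaling_det _ _ hsb. Qed.
Let hN : G (- 1%:M). Proof. exact: scaling_opp1 _ _ hsb. Qed.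
Let mu := muF mF finF.

Let mal y : mfunT (fun z : P => (al z < y)%R%:R : R).
Proof. by apply: measurable_fun_natb; apply: measurable_fun_ltr; [rewrite /al; mf|mf]. Qed.

Let Vzero_self : Vzero G sb sb = [set (1, 0); (-1, 0)].
Proof.
apply/seteqP; split => v.
 move=> [[g Gg ->] /= c0]; have [s [n [s1 ->]]] := scaling_fix _ _ hsb _ Gg c0.
 by rewrite parab_mx2 /col1 !mx2E; case: s1 => ->; [left|right].
have H (s : R) : s = 1 \/ s = -1 -> Vzero G sb sb (s, 0).
 move=> s1; split => //; exists (sb *m parab s 0 *m invmx sb); first exact: scaling_parab.
 by rewrite !mulmxA mulVmx ?det_unit // mul1mx -mulmxA mulVmx ?det_unit // mulmx1 parab_mx2 /col1 !mx2E.
by case=> ->; apply: H; [left|right].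
Qed.

Let K2 x y : \bar R := (\esum_(r in RP G sb sb) \int[L2]_z ((al z < x)%R%:R * ind r y z)%:E)%E.

Let K2_ge0 x y : (0 <= K2 x y)%E.
Proof. by apply: esum_ge0 => r _; apply: integral_ge0 => z _; rewrite lee_fin mulr_ge0 // ind_ge0. Qed.

(** One factor is unfolded as an Eisenstein series. Of the columns counted by the other factor,
    [(1, 0)] and its negative contribute the area [min x y]; those with nonzero lower entry make up
    [K2]. *)
Let NN_integral x y : 0 < x -> 0 < y ->
 (Int mu (fun z => N G sb x z * N G sb y z))%:E = ((Num.min x y)%:E + K2 x y)%E.
Proof.
move=> x0 y0; have [bx _] := bmp_N _ dG _ hsb x x0; have [by_ _] := bmp_N _ dG _ hsb y y0.
rewrite -IntE; last bm.
pose psi z : R := (al z < x)%R%:R * (strip z)%:R.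
have mp : mfunT psi by apply: measurable_funM; [exact: mal|exact: measurable_strip].
have p0 z : 0 <= psi z by rewrite mulr_ge0.
have my := measurable_N _ dG _ hsb y; have y0' z := N_ge0 G sb y z.
have := Eis_integral _ dG hN _ hF mF finF _ db psi _ mp p0 my y0' (fun g z => N_act _ dG sb g y z).
have mxy : mfunT (fun z => (N G sb x z * N G sb y z)%:E).
 by apply/measurable_EFinP; apply: measurable_funM; [exact: measurable_N _ dG _ hsb x|mf].
have xy0 z : (0 <= (N G sb x z * N G sb y z)%:E)%E by rewrite lee_fin mulr_ge0 // N_ge0.
have eZ : (\int[mu]_z (Eis G sb psi z * (N G sb y z)%:E) =
  2%:E * \int[mu]_z (N G sb x z * N G sb y z)%:E)%E.
 rewrite -(@ge0_integralZl_EFin _ _ _ mu setT measurableT _ (fun z _ => xy0 z) mxy 2 (ler0n R 2)).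
 apply: eq_integral => z _; rewrite -[Eis _ _ _ _](cnt_Eis _ dG _ hsb x z) (cntE _ dG _ hsb _ _ x0).
 exact: (congr1 EFin (esym (mulrA _ _ _))).
have h2 (a b : \bar R) : (2%:E * a = 2%:E * b -> a = b)%E.
 by move=> /(congr1 (fun e => (2^-1)%:E * e)%E); rewrite !muleA -!EFinM mulVf // !mul1e.
move=> eE; apply: etrans (h2 _ _ (etrans (esym eZ) eE)) _.
have E z : (psi z * N G sb y (act sb z))%:E =
  (((al z < x)%R%:R * (strip z)%:R * (al z < y)%R%:R)%:E +
   ((al z < x)%R%:R * (strip z)%:R)%:E * \esum_(v in Vpos G sb sb) (ind v y z)%:E)%E.
 have := cnt_Vab G sb sb y z db; rewrite (cntE _ dG _ hsb) //.
 rewrite (Vab_split _ dG _ _ hsb (fun v => (ind v y z)%:E)) => [|v|v]; last 2 first.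
 - by rewrite lee_fin ind_ge0.
 - by rewrite /ind D_neg.
 have -> : (\esum_(v in Vzero G sb sb) (ind v y z)%:E = (2 * (al z < y)%R%:R)%:E)%E.
  have n1 : (-1, 0) <> (1, 0) :> R * R.
   by move=> [/eqP]; rewrite eq_sym -subr_eq0 opprK (_ : 1 + 1 = 2%:R) ?pnatr_eq0.
  rewrite Vzero_self (esumID [set (1, 0)]); last by move=> v _; rewrite lee_fin ind_ge0.
  rewrite (_ : _ `&` [set (1, 0)] = [set (1, 0)]); last first.
   by apply/seteqP; split => [v []//|v ->]; split => //; left.
  rewrite (_ : _ `&` ~` _ = [set (-1, 0)]); last first.
   by apply/seteqP; split => [v [] []//|v ->]; split => //; right.
  rewrite !esum_set1 ?lee_fin // /ind (_ : (-1, 0) = negv (1, 0)); last by rewrite /negv oppr0.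
  by rewrite D_neg D10 -EFinD; congr (_%:E); ring.
 have e0 : (0 <= \esum_(v in Vpos G sb sb) (ind v y z)%:E)%E by apply: esum_ge0 => v _; rewrite lee_fin ind_ge0.
 move: e0; case: (\esum_(v in Vpos _ _ _) _)%E => [s| |] // s0.
  rewrite -EFinM -EFinD => -[e]; rewrite -EFinM -EFinD; congr (_%:E).
  have -> : N G sb y (act sb z) = (al z < y)%R%:R + s by lra.
  by rewrite /psi; ring.
 by rewrite mulry gtr0_sg // mul1e addey.
under eq_integral do rewrite E.
have mpos : mfunT (fun z => \esum_(v in Vpos G sb sb) (ind v y z)%:E)%E.
 apply: measurable_esum.
 - by apply: (sub_countable _ (Vab_countable _ dG sb sb hsb)); apply: subset_card_le => v [].
 - by move=> v _; mf; exact: measurable_ind.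
 - by move=> v z' _; rewrite lee_fin ind_ge0.
have esum0 z : (0 <= \esum_(v in Vpos G sb sb) (ind v y z)%:E)%E by apply: esum_ge0 => v _; rewrite lee_fin ind_ge0.
rewrite ge0_integralD //; first last.
- by apply: emeasurable_funM => //; exact/measurable_EFinP.
- by move=> z _; rewrite mule_ge0.
- by apply/measurable_EFinP; apply: measurable_funM => //; mf.
rewrite (pair_pos _ dG _ _ hsb hsb (fun z => (al z < x)%R%:R)) //; last by move=> n z; rewrite al_parab.
congr (_ + _)%E.
have mh : mfunT (fun s : R => ((s < x)%R%:R * (s < y)%R%:R)%:E : \bar R).
 by mf.
have := strip_integral _ mh (fun s => lee_tofin (mulr_ge0 (ler0n R _) (ler0n R _))).
move=> e; transitivity (\int[L2]_z (((al z < x)%R%:R * (al z < y)%R%:R)%:E * ((strip z)%:R)%:E))%E.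
 by apply: eq_integral => z _; rewrite mulrAC.
apply: etrans e _.
have m0 : 0 < Num.min x y by rewrite lt_min x0.
rewrite integral_mkcond (_ : _ \_ _ = fun s : R => (\1_(`]0, Num.min x y[%classic) s)%:E); last first.
 apply/funext => s; rewrite patchE indicE !mem_setE !in_itv /= andbT lt_min.
 by case: (0 < s) => //=; case: (s < x); case: (s < y); rewrite ?mulr1 ?mulr0.
by rewrite integral_indic // setIT /= lebesgue_measure_itv lte_fin m0 sube0.
Qed.

(* The diagonal matrices act on both conditions. *)
Let K2_scale x y (c : R) : 0 < c -> K2 x y = K2 (c * x) (c^-1 * y).
Proof.
move=> c0; apply: eq_esum => -[a d] [_ /= [d0 _]].
have d00 : d != 0 by rewrite gt_eqF.
pose s := Num.sqrt c; have s0 : 0 < s by rewrite sqrtr_gt0.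
have s2 : s ^+ 2 = c by rewrite sqr_sqrtr // ltW.
pose M : 'M[R]_2 := mx2 1 (- (a / d)) 0 1; have dM : \det M = 1 by rewrite det2 !mx2E; ring.
pose S : 'M[R]_2 := mx2 s 0 0 s^-1; have dS : \det S = 1 by rewrite det2 !mx2E mulfV ?gt_eqF //; ring.
have mi u v (x' y' : R) : mfunT (fun z : P => (ind u x' z * ind v y' z)%:E).
 by apply/measurable_EFinP; apply: measurable_funM; exact: measurable_ind.
have i0 u v x' y' z : (0 <= (ind u x' z * ind v y' z)%:E :> \bar R)%E by rewrite lee_fin mulr_ge0 // ind_ge0.
have E x' y' : (\int[L2]_z ((al z < x')%R%:R * ind (a, d) y' z)%:E = \int[L2]_z (ind (1, 0) x' z * ind (0, d) y' z)%:E)%E.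
  rewrite -[RHS](integral_act M _ dM (mi _ _ _ _) (i0 _ _ _ _)); apply: eq_integral => z _.
 rewrite /ind -(D_act (invmx M) (1, 0)) ?det_inv1 // -(D_act (invmx M) (0, d)) ?det_inv1 // actK //.
 have e1 : mulv (invmx M) (1, 0) = (1, 0) by rewrite /mulv !(invE _ dM) !mx2E /=; congr pair; ring.
 have e2 : mulv (invmx M) (0, d) = (a, d) by rewrite /mulv !(invE _ dM) !mx2E /=; congr pair; field.
 by rewrite e1 e2 D10.
rewrite !E -[LHS](integral_act S) //; apply: eq_integral => z _.
rewrite /ind -(D_act (invmx S) (1, 0)) ?det_inv1 // -(D_act (invmx S) (0, d)) ?det_inv1 // actK //.
have e1 : D (mulv (invmx S) (1, 0)) z = c^-1 * D (1, 0) z.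
 by rewrite /mulv !(invE _ dS) !mx2E /D /= -s2; field; rewrite gt_eqF.
have e2 : D (mulv (invmx S) (0, d)) z = c * D (0, d) z.
 by rewrite /mulv !(invE _ dS) !mx2E /D /= -s2; ring.
by rewrite e1 e2 ltr_pdivrMl // -ltr_pdivlMl.
Qed.

(** The off-diagonal correlation depends on [x * y] only, by [K2_scale]; this is the resulting
    function of one variable. *)
Definition Kc (p : R) : R := fine (K2 1 p).

Lemma Int_NN x y : 0 < x -> 0 < y ->
 Int mu (fun z => N G sb x z * N G sb y z) = Num.min x y + Kc (x * y).
Proof.
move=> x0 y0; have := NN_integral x y x0 y0.
rewrite (K2_scale x y x^-1) ?invr_gt0 // mulVf ?gt_eqF // invrK /Kc.
have := K2_ge0 1 (x * y); case: (K2 1 (x * y)) => [k| |] //= k0.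
by rewrite -EFinD => -[].
Qed.

(** The weights normalise [N y] by [y^(-1/2)], and symmetrising makes the function even in [t]. With
    this choice the correlations obey an addition formula and the kernel acts by convolution with an
    even function. *)
Definition et (t : R) z : R := expR (- (t / 2)) * N G sb (expR t) z + expR (t / 2) * N G sb (expR (- t)) z.

Lemma bmp_et t : bmp (et t).
Proof.
have [b1 _] := bmp_N _ dG _ hsb _ (expR_gt0 t); have [b2 _] := bmp_N _ dG _ hsb _ (expR_gt0 (- t)).
split; last by move=> z; rewrite addr_ge0 // mulr_ge0 ?N_ge0.
by bm.
Qed.

Lemma Int_et t : Int mu (et t) = expR (t / 2) + expR (- (t / 2)).
Proof.
have [b1 _] := bmp_N _ dG _ hsb _ (expR_gt0 t); have [b2 _] := bmp_N _ dG _ hsb _ (expR_gt0 (- t)).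
rewrite IntD; [|by bm|by bm].
rewrite !IntZ // !(Int_N _ dG _ hsb _ hF) ?expR_gt0 // -!expRD.
by congr (expR _ + expR _); lra.
Qed.

Definition Hc (u : R) : R := 2 * expR (- (`|u| / 2)) + expR (- (u / 2)) * Kc (expR u) + expR (u / 2) * Kc (expR (- u)).

(** Among the four products, [exp (- (u + v) / 2)] times the minimum of [exp u] and [exp v] is
    [exp (- |u - v| / 2)], while [Kc] sees only [u + v]. Regrouping according to [s + t] and [s - t]
    gives the same function [Hc] twice. *)
Lemma Int_et_et s t : Int mu (fun z => et s z * et t z) = Hc (s + t) + Hc (s - t).
Proof.
have b u := proj1 (bmp_N _ dG _ hsb _ (expR_gt0 u)).
rewrite (_ : (fun z => _) = fun z =>
  (expR (- (s / 2)) * expR (- (t / 2))) * (N G sb (expR s) z * N G sb (expR t) z) +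
  (expR (s / 2) * expR (t / 2)) * (N G sb (expR (- s)) z * N G sb (expR (- t)) z) +
  ((expR (- (s / 2)) * expR (t / 2)) * (N G sb (expR s) z * N G sb (expR (- t)) z) +
  (expR (s / 2) * expR (- (t / 2))) * (N G sb (expR (- s)) z * N G sb (expR t) z))); last first.
 apply/funext => z; rewrite /et; move: (N _ _ (expR s) z) (N _ _ (expR (- s)) z) (N _ _ (expR t) z) (N _ _ (expR (- t)) z) => *; ring.
have bb (c u v : R) : bmf (fun z : P => c * (N G sb (expR u) z * N G sb (expR v) z)).
 by bm.
rewrite IntD; [|exact: bmfD|exact: bmfD].
rewrite IntD // IntD // !IntZ; try exact: bmfM.
rewrite !Int_NN ?expR_gt0 // -!expRD.
have mn (u v : R) : expR (- (u / 2)) * expR (- (v / 2)) * Num.min (expR u) (expR v) = expR (- (`|u - v| / 2)).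
 rewrite -!expRD; have [uv|uv] := leP u v.
  by rewrite min_l ?ler_expR // -expRD ler0_norm ?subr_le0 //; congr expR; lra.
 by rewrite min_r ?ler_expR ?(ltW uv) // -expRD gtr0_norm ?subr_gt0 //; congr expR; lra.
have m1 := mn s t; have m2 := mn (- s) (- t); have m3 := mn s (- t); have m4 := mn (- s) t.
rewrite -!expRD in m1 m2 m3 m4.
have n2 : `|- s - - t| = `|s - t| by rewrite -normrN; congr `|_|; ring.
have n4 : `|- s - t| = `|s - - t| by rewrite -normrN; congr `|_|; ring.
rewrite n2 in m2; rewrite n4 in m4; rewrite !opprK in m3 m4.
rewrite /Hc !mulrDr.
rewrite (_ : s / 2 + t / 2 = - ((- s) / 2) + - ((- t) / 2)); last by lra.
rewrite (_ : - (s / 2) + t / 2 = - (s / 2) + - ((- t) / 2)); last by lra.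
rewrite (_ : s / 2 + - (t / 2) = - ((- s) / 2) + - (t / 2)); last by lra.
rewrite m1 m2 m3 m4.
have k1 : - (s / 2) + - (t / 2) = - ((s + t) / 2) by lra.
have k2 : - (- s / 2) + - (- t / 2) = (s + t) / 2 by lra.
have k3 : - (s / 2) + - (- t / 2) = - ((s - t) / 2) by lra.
have k4 : - (- s / 2) + - (t / 2) = (s - t) / 2 by lra.
have k5 : - s + - t = - (s + t) by lra.
have k6 : - s + t = - (s - t) by lra.
rewrite k1 k2 k3 k4 k5 k6.
have fin (a a' c d e f p q r' s' : R) : a + c * p + (a + d * q) + (a' + e * r' + (a' + f * s')) =
  2 * a' + c * p + d * q + (2 * a + e * r' + f * s') by ring.
exact: fin.
Qed.

End correlation.

(** * The averaging operator on the counting functions *)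

Lemma integral_cst_itv {R : realType} (k a b : R) : 0 <= k -> a <= b ->
 (\int[@lebesgue_measure R]_s (k * \1_(`[a, b]%classic) s)%:E = (k * (b - a))%:E)%E.
Proof.
move=> k0 ab; under eq_integral do rewrite EFinM.
have mI : mfunT (fun s : R => (\1_(`[a, b]%classic) s)%:E : \bar R).
 by mf.
rewrite ge0_integralZl_EFin //.
rewrite integral_indic // setIT /= lebesgue_measure_itv /= lte_fin EFinM.
by move: ab; rewrite le_eqVlt => /predU1P[->|->]; rewrite ?ltxx ?subrr.
Qed.

Section radial.
Context {R : realType}.
Notation P := (plane R).
Notation L1 := (@lebesgue_measure R).
Notation L2 := (L1 \x L1)%E.
Implicit Types (g M : 'M[R]_2) (v w : R * R) (z : P) (y u t s : R).
Context (rho : R) (rho1 : 1 <= rho).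

Let gi u s : R := (rho + expR u + expR (- u) + s ^+ 2) ^- 4.

Let gi_base u s : 1 <= rho + expR u + expR (- u) + s ^+ 2.
Proof. by rewrite !ler_wpDr ?sqr_ge0. Qed.

Let gi_gt0 u s : 0 < gi u s.
Proof. by rewrite invr_gt0 exprn_gt0 // (lt_le_trans _ (gi_base u s)). Qed.

Let measurable_gi : mfunT (fun x : plane R => gi x.1 x.2).
Proof.
apply: measurable_fun_inv; first by move=> x; rewrite exprn_gt0 // (lt_le_trans _ (gi_base _ _)).
by mf.
Qed.

Let gE u : \bar R := (\int[L1]_s (gi u s)%:E)%E.

Let gE_ge0 u : (0 <= gE u)%E.
Proof. by apply: integral_ge0 => s _; rewrite lee_fin ltW. Qed.

Let gE_fin u : gE u = (fine (gE u))%:E.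
Proof.
rewrite fineK // ge0_fin_numE //; apply: le_lt_trans (@integral_oneDsqrV_fin R).
apply: ge0_le_integral => //.
- by move=> s _; rewrite lee_fin ltW.
- by mf; exact: (measurableT_comp measurable_gi (pair1_measurable (u : measurableTypeR R))).
- by apply/measurable_EFinP; apply: continuous_measurable_fun => t; exact: continuous_oneDsqrV.
- move=> s _; have b1 := gi_base u s; rewrite lee_fin lef_pV2 ?posrE ?exprn_gt0 ?(lt_le_trans _ b1) //.
  apply: le_trans (_ : rho + expR u + expR (- u) + s ^+ 2 <= _).
   by rewrite lerD2r !ler_wpDr.
  by rewrite -[leLHS]expr1 ler_weXn2l.
 by pos.
Qed.

(** The kernel integrated over a horocycle, normalised by its total mass and multiplied by
    [exp (u / 2)], which makes it even: the Abel transform of the profile. *)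
Definition gam u : R := fine (gE u) / Ikr rho.

Lemma gam_ge0 u : 0 <= gam u.
Proof. exact: divr_ge0 (fine_ge0 (gE_ge0 u)) (ltW (Ikr_gt0 _ rho1)). Qed.

Lemma gamN u : gam (- u) = gam u.
Proof.
rewrite /gam; have -> // : gE (- u) = gE u.
have giN s : gi (- u) s = gi u s by rewrite /gi opprK [rho + _ + _]addrAC.
by apply: eq_integral => s _; rewrite giN.
Qed.

Lemma measurable_gam : mfunT gam.
Proof.
apply: measurable_funM; last mf.
apply: (measurableT_comp (fine_measurable measurableT)).
apply: (measurable_fun_fubini_tonelli_F (m2 := L1) (fun x : plane R => (gi x.1 x.2)%:E)).
- exact/measurable_EFinP.
- by move=> x; rewrite lee_fin ltW.
Qed.

(** Positive mass away from [u = 0], where [cosh (u / 2) > 1], is what later forces the mass of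
    [gam] strictly below 1. *)
Lemma gam_lower : exists2 c : R, 0 < c & forall u, 1 <= u <= 2 -> c <= gam u.
Proof.
have I0 := Ikr_gt0 _ rho1; pose B := rho + expR 2 + 1 + 1.
have B0 : 0 < B by rewrite /B; have := expR_gt0 (2 : R); have := rho1; lra.
exists (B ^- 4 / Ikr rho) => [|u /andP[u1 u2]]; first by pos.
rewrite /gam ler_pM2r ?invr_gt0 // -lee_fin -gE_fin.
have -> : (B ^- 4)%:E = (\int[L1]_s (B ^- 4 * \1_(`[0%R, 1%R]%classic) s)%:E)%E.
 by rewrite integral_cst_itv ?subr0 ?mulr1 // invr_ge0 exprn_ge0 // ltW.
apply: ge0_le_integral => //.
- by move=> s _; rewrite lee_fin mulr_ge0 // invr_ge0 exprn_ge0 // ltW.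
- by mf.
- by mf; exact: (measurableT_comp measurable_gi (pair1_measurable (u : measurableTypeR R))).
- move=> s _; rewrite lee_fin indicE mem_setE in_itv; case: (boolP (0 <= (s : R) <= 1)) => [/andP[s0 s1]|_]; last by rewrite mulr0 ltW.
 rewrite mulr1 lef_pV2 ?posrE ?exprn_gt0 ?(lt_le_trans _ (gi_base u s)) //.
 rewrite lerXn2r ?nnegrE ?(ltW B0) ?(le_trans _ (gi_base u s)) // /B.
 have h1 : expR u <= expR 2 by rewrite ler_expR.
 have h2 : expR (- u) <= 1 by rewrite -expR0 ler_expR; lra.
 have h3 : s ^+ 2 <= 1 by rewrite expr_le1.
 lra.
Qed.

Lemma kf_radial u : (\int[L1]_t (kf rho 4 orig (t, u))%:E = (Ikr rho * expR (- (u / 2)) * gam u)%:E)%E.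
Proof.
have I0 := Ikr_gt0 _ rho1.
have mg : mfunT (fun s : R => (gi u s)%:E).
 by mf; exact: (measurableT_comp measurable_gi (pair1_measurable (u : measurableTypeR R))).
have g0 s : (0 <= (gi u s)%:E)%E by rewrite lee_fin ltW.
have := integral_scale (expR (u / 2)) _ (expR_gt0 _) mg g0; rewrite -/(gE u) gE_fin.
rewrite ge0_integralZr //; last first.
 by apply: (measurableT_comp mg); mf.
have -> : (\int[L1]_t (kf rho 4 orig (t, u))%:E = \int[L1]_t (gi u (expR (u / 2) * t)%R)%:E)%E.
 apply: eq_integral => t _; congr (_%:E); rewrite /kf bd_orig /gi /al /ga /be /=; congr (_ ^- _).
 by rewrite exprMn [expR (u / 2) ^+ 2]expr2 -expRD -splitr; ring.
move=> /(congr1 (fun x => x * (expR (- (u / 2)))%:E)%E).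
rewrite -muleA -!EFinM -expRD subrr expR0 mule1 => ->; congr (_%:E).
by rewrite /gam; field; rewrite gt_eqF.
Qed.

(** Coordinates adapted to the vector: [A] carries [orig] to [z] and satisfies [D (col1 M) (act A w)
    = D (col1 M) z * al w]. The condition then depends on the height of [w] alone, and the kernel is
    integrated over horocycles. *)
Lemma kf_count M z y : \det M = 1 ->
 (\int[L2]_w (kf rho 4 z w * (D (col1 M) w < y)%R%:R)%:E =
  \int[L1]_u (Ikr rho * expR (- (u / 2)) * gam u * (D (col1 M) z < y * expR u)%R%:R)%:E)%E.
Proof.
move=> dM; pose A := M *m gz (act (invmx M) z).
have dA : \det A = 1 by rewrite det_mul1 ?gz_det.
have Az : act A orig = z by rewrite act_mul ?gz_det // gz_orig actVK.
have DA w : D (col1 M) (act A w) = D (col1 M) z * al w.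
 rewrite act_mul ?gz_det // -mulv10 D_act // D10 mulv10 D_col //.
 move: (act (invmx M) z) => x; transitivity (expR (- (x.2 : R) / 2) ^+ 2 * al w).
  by rewrite al_act ?gz_det // !mx2E; ring.
 by rewrite expr2 -expRD /al -!expRD; congr expR; lra.
have mD : mfunT (fun w : P => (kf rho 4 z w * (D (col1 M) w < y)%R%:R)%:E).
 apply/measurable_EFinP; apply: measurable_funM; last first.
  by apply: measurable_fun_natb; apply: measurable_fun_ltr; [exact: measurable_D|mf].
 exact: (measurableT_comp (measurable_kf _ rho1 4) (pair1_measurable z)).
have D0 w : (0 <= (kf rho 4 z w * (D (col1 M) w < y)%R%:R)%:E)%E.
 by rewrite lee_fin mulr_ge0 // ltW // kf_gt0.
rewrite -(integral_act A _ dA mD D0).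
pose b w : R := (D (col1 M) z * al w < y)%R%:R.
transitivity (\int[L2]_w (kf rho 4 orig w * b w)%:E)%E.
 by apply: eq_integral => w _; rewrite DA -{1}Az kf_act.
have mb : mfunT b.
 apply: measurable_fun_natb; apply: measurable_fun_ltr; last mf.
 by rewrite /al; mf.
rewrite (integral_plane21 (fun w => (kf rho 4 orig w * b w)%:E)); last 2 first.
- by mf; exact: (measurableT_comp (measurable_kf _ rho1 4) (pair1_measurable orig)).
- by move=> w; rewrite lee_fin mulr_ge0 // ltW // kf_gt0.
apply: eq_integral => u _.
have -> : (D (col1 M) z < y * expR u)%R%:R = b (0, u) :> R.
 by rewrite /b /al expRN ltr_pdivrMr ?expR_gt0.
transitivity (\int[L1]_t ((kf rho 4 orig (t, u))%:E * (b (0, u))%:E))%E.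
 done.
rewrite ge0_integralZr ?lee_fin //; first by rewrite kf_radial -EFinM.
- by apply: (mpair2 (fun w => (kf rho 4 orig w)%:E)); exact: measurable_kfz.
- by move=> t _; exact: kf_ge0.
Qed.

End radial.

Section averaging.
Context {R : realType}.
Notation P := (plane R).
Notation L1 := (@lebesgue_measure R).
Notation L2 := (L1 \x L1)%E.
Context (G : set 'M[R]_2) (dG : discrete_subgroup_SL2 G) (sb : 'M[R]_2) (hsb : scaling_matrix G sb)
 (F : set P) (hF : fdom G F) (mF : measurable F) (finF : (L2 F < +oo)%E).
Implicit Types (g h : 'M[R]_2) (v w r : R * R) (z : P) (x y t u : R).

Let db : \det sb = 1. Proof. exact: scaling_det _ _ hsb. Qed.
Let hN : G (- 1%:M). Proof. exact: scaling_opp1 _ _ hsb. Qed.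
Let mu := muF mF finF.
Let K := Kop mu (kG G rho0).
Let c0 : R := Ikr rho0.
Let c00 : 0 < c0. Proof. exact: Ikr_gt0 _ rho0_ge1. Qed.
Let ga0 u := gam_ge0 _ (@rho0_ge1 R) u.
Let kf0 z w : 0 <= kf (rho0 : R) 4 z w. Proof. exact: ltW (kf_gt0 _ rho0_ge1 4 z w). Qed.
Let mkf z : mfunT (kf (rho0 : R) 4 z).
Proof. exact: (measurableT_comp (measurable_kf _ rho0_ge1 4) (pair1_measurable z)). Qed.

Let mk := measurable_kG _ dG hN _ (@rho0_ge1 R).
Let k0 := kG_ge0 G _ (@rho0_ge1 R).
Let kC := kG_sym _ dG (rho0 : R).
Let k1 := kG_int _ dG hN _ hF mF finF _ (@rho0_ge1 R).

Let w1 u : R := c0 * expR (- (u / 2)) * gam rho0 u.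
Let w10 u : 0 <= w1 u.
Proof. exact: mulr_ge0 (mulr_ge0 (ltW c00) (expR_ge0 _)) (ga0 u). Qed.
Let mw1 : mfunT w1.
Proof. by apply: measurable_funM; [mf|exact: measurable_gam _ rho0_ge1]. Qed.

Let kf_cnt z y : 0 < y -> (\int[L2]_w ((kf rho0 4 z w)%:E * cnt G sb y w) =
 \int[L1]_u ((w1 u)%:E * cnt G sb (y * expR u) z))%E.
Proof.
move=> y0; have cV : countable (Vb G sb) by exact: Vb_countable _ dG _ hsb.
have mD v : mfunT (fun w : P => (kf rho0 4 z w * (D v w < y)%R%:R)%:E).
 apply/measurable_EFinP; apply: measurable_funM; first mf.
 by apply: measurable_fun_natb; apply: measurable_fun_ltr; [exact: measurable_D|mf].
have D0 v w : (0 <= (kf rho0 4 z w * (D v w < y)%R%:R)%:E :> \bar R)%E by rewrite lee_fin mulr_ge0.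
transitivity (\esum_(v in Vb G sb) \int[L2]_w (kf rho0 4 z w * (D v w < y)%R%:R)%:E)%E.
 rewrite -integral_esum //; apply: eq_integral => w _.
 rewrite /cnt -esumZl //; by apply: eq_esum => v _; rewrite -EFinM.
transitivity (\esum_(v in Vb G sb) \int[L1]_u (w1 u * (D v z < y * expR u)%R%:R)%:E)%E.
 apply: eq_esum => _ [g Gg ->]; apply: kf_count; first exact: rho0_ge1.
 by rewrite det_mul1 ?(group_det dG _ Gg).
rewrite -integral_esum //; first last.
- by move=> v u _; rewrite lee_fin mulr_ge0.
- move=> v _; apply/measurable_EFinP; apply: measurable_funM; first mf.
 by mf.
apply: eq_integral => u _; rewrite /cnt -esumZl //; by apply: eq_esum => v _; rewrite -EFinM.
Qed.

Let measurable_Ne z y c : mfunT (fun u : R => N G sb (y * expR (c * u)) z).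
Proof.
apply: (measurableT_comp (f := fun s : measurableTypeR R => N G sb s z)).
 exact: (measurableT_comp (measurable_N2 _ dG _ hsb) (pair2_measurable z)).
by mf.
Qed.

(** [kf_count] summed over all columns: averaging in the point amounts to averaging in the scale. *)
Lemma Kop_N z y : 0 < y ->
 ((K (N G sb y) z)%:E = \int[L1]_u (gam rho0 u * (expR (- (u / 2)) * N G sb (y * expR u) z))%:E)%E.
Proof.
move=> y0; have bN := bmp_N _ dG _ hsb y y0.
rewrite -(KopE mu _ mk k0 k1 _ z bN).
rewrite (integral_kG _ dG hN _ hF mF finF _ rho0_ge1) //; last 3 first.
- by case: bN => -[].
- by case: bN.
- by move=> g w Gg; exact: N_act _ dG _ _ _ _ Gg.
have m1 : mfunT (fun u => (gam rho0 u * (expR (- (u / 2)) * N G sb (y * expR u) z))%:E).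
 apply/measurable_EFinP; apply: measurable_funM; first exact: measurable_gam _ rho0_ge1.
 apply: measurable_funM; first by mf.
 by have := measurable_Ne z y 1; congr (measurable_fun _ _); apply/funext => u; rewrite mul1r.
have p1 u : (0 <= (gam rho0 u * (expR (- (u / 2)) * N G sb (y * expR u) z))%:E :> \bar R)%E.
 rewrite lee_fin; exact: mulr_ge0 (ga0 u) (mulr_ge0 (expR_ge0 _) (N_ge0 _ _ _ _)).
have e : (2%:E * \int[L2]_w (kf rho0 4 z w * N G sb y w)%:E =
  (2 * c0)%:E * \int[L1]_u (gam rho0 u * (expR (- (u / 2)) * N G sb (y * expR u) z))%:E)%E.
 rewrite -ge0_integralZl_EFin //; first last.
 - apply/measurable_EFinP; apply: measurable_funM; mf.
  exact: measurable_N _ dG _ hsb y.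
 - by move=> w _; rewrite lee_fin; exact: mulr_ge0 (kf0 _ _) (N_ge0 _ _ _ _).
 rewrite -ge0_integralZl_EFin //; last by pos.
 transitivity (\int[L2]_w ((kf rho0 4 z w)%:E * cnt G sb y w))%E.
  by apply: eq_integral => w _; rewrite (cntE _ dG _ hsb) // -!EFinM mulrCA.
 rewrite kf_cnt //; apply: eq_integral => u _.
 rewrite (cntE _ dG _ hsb) ?mulr_gt0 ?expR_gt0 // -!EFinM; congr (_%:E); rewrite /w1; ring.
move: e => /(congr1 (fun e => ((2 * c0)^-1)%:E * e)%E); rewrite !muleA -!EFinM mulVf ?mul1e; last first.
 by rewrite gt_eqF // mulr_gt0.
by move=> <-; rewrite invfM mulrAC mulVf // mul1r.
Qed.

Lemma measurable_et2 : mfunT (fun x : measurableTypeR R * P => et G sb x.1 x.2).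
Proof.
have mN (c : R) : mfunT (fun x : measurableTypeR R * P => N G sb (expR (c * x.1)) x.2).
 have m1 : mfunT (fun x : measurableTypeR R * P => expR (c * x.1) : measurableTypeR R).
  by mf.
 exact: (measurableT_comp (measurable_N2 _ dG _ hsb) (measurable_fun_pair m1 measurable_snd)).
have me (c : R) : mfunT (fun x : measurableTypeR R * P => expR (c * x.1)).
 by mf.
have : mfunT (fun p : measurableTypeR R * P => expR (- 2^-1 * p.1) * N G sb (expR (1 * p.1)) p.2 +
  expR (2^-1 * p.1) * N G sb (expR (-1 * p.1)) p.2).
 by mf.
by congr (measurable_fun _ _); apply/funext => p; rewrite /et mul1r mulN1r mulNr [_^-1 * _]mulrC.
Qed.

Lemma measurable_et z : mfunT (fun t : R => et G sb t z).
Proof. exact: (measurableT_comp measurable_et2 (pair2_measurable (T1 := measurableTypeR R) z)). Qed.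

(** The weights of [et] absorb the factor [exp (- u / 2)] of [Kop_N]; in the second summand [u] is
    reflected, which evenness of [gam] allows. *)
Lemma Kop_et t z : ((K (et G sb t) z)%:E = \int[L1]_u (gam rho0 u * et G sb (t + u) z)%:E)%E.
Proof.
have bN (s : R) := bmp_N _ dG _ hsb _ (expR_gt0 s).
have bZ (c s : R) : 0 <= c -> bmp (fun z : P => c * N G sb (expR s) z).
 move=> c_0; split; last by move=> w; rewrite mulr_ge0 // N_ge0.
 by apply: bmfM; [bm|case: (bN s)].
rewrite /K /et (KopD mu _ mk k0 k1) ?(KopZ mu _ mk k0 k1) //; try exact: bZ (expR_ge0 _).
have mA (e : R) : mfunT (fun u : R =>
  (gam rho0 u * (expR (e * ((t + u) / 2)) * N G sb (expR (- e * (t + u))) z))%:E).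
 apply/measurable_EFinP; apply: measurable_funM; first exact: measurable_gam _ rho0_ge1.
 apply: measurable_funM; first by mf.
 have := measurable_Ne z (expR (- e * t)) (- e); congr (measurable_fun _ _).
 by apply/funext => u; rewrite -expRD mulrDr.
have pA (e u : R) : (0 <= (gam rho0 u * (expR (e * ((t + u) / 2)) * N G sb (expR (- e * (t + u))) z))%:E :> \bar R)%E.
 by rewrite lee_fin; exact: mulr_ge0 (ga0 u) (mulr_ge0 (expR_ge0 _) (N_ge0 _ _ _ _)).
transitivity (\int[L1]_u ((gam rho0 u * (expR (-1 * ((t + u) / 2)) * N G sb (expR (- -1 * (t + u))) z))%:E +
  (gam rho0 u * (expR (1 * ((t + u) / 2)) * N G sb (expR (- 1 * (t + u))) z))%:E))%E; last first.
 by apply: eq_integral => u _; rewrite -EFinD -mulrDr opprK !mul1r !mulN1r.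
have EK (e : R) : ((expR (e * (t / 2)) * K (N G sb (expR (- e * t))) z)%:E =
  \int[L1]_u (gam rho0 u * (expR (e * (t / 2) - u / 2) * N G sb (expR (- e * t + u)) z))%:E)%E.
 rewrite EFinM Kop_N ?expR_gt0 // -ge0_integralZl_EFin //; first last.
 - apply/measurable_EFinP; apply: measurable_funM; first exact: measurable_gam _ rho0_ge1.
  apply: measurable_funM; first by mf.
  by have := measurable_Ne z (expR (- e * t)) 1; congr (measurable_fun _ _); apply/funext => u; rewrite mul1r.
 - by move=> u _; rewrite lee_fin; exact: mulr_ge0 (ga0 u) (mulr_ge0 (expR_ge0 _) (N_ge0 _ _ _ _)).
 by apply: eq_integral => u _; rewrite -EFinM !expRD; congr (_%:E); ring.
rewrite (ge0_integralD L1 measurableT (fun u _ => pA (-1) u) (mA (-1)) (fun u _ => pA 1 u) (mA 1)).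
rewrite EFinD; congr (_ + _)%E.
 have := EK (-1); rewrite opprK mul1r mulN1r => ->; apply: eq_integral => u _.
 by rewrite mul1r mulN1r; congr (_ * (expR _ * _))%:E; lra.
rewrite -(integral_reflect _ (mA 1) (pA 1)).
have := EK 1; rewrite mul1r mulN1r => ->; apply: eq_integral => u _.
rewrite gamN !mul1r mulN1r; congr (_ * (expR _ * N G sb (expR _) z))%:E; lra.
Qed.

Lemma Int_Kop_et f t : bmp f -> ((Int mu (fun z => K (et G sb t) z * f z))%:E =
 \int[L1]_u (gam rho0 u * Int mu (fun z => et G sb (t + u) z * f z))%:E)%E.
Proof.
move=> bf; have [bff f0] := bf; have bt s := bmp_et _ dG _ hsb s.
have bK := Kop_bmp mu _ mk k0 k1 _ (bt t).
rewrite -IntE; last by apply: bmfM => //; case: bK.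
have mf2 : mfunT (fun x : measurableTypeR R * P => (gam rho0 x.1 * (et G sb (t + x.1) x.2 * f x.2))%:E).
 apply/measurable_EFinP; apply: measurable_funM.
  exact: (measurableT_comp (measurable_gam _ rho0_ge1) measurable_fst).
 mf; last by case: bff => mff _; mf.
 have m1 : mfunT (fun x : measurableTypeR R * P => t + x.1 : measurableTypeR R).
  by mf.
 exact: (measurableT_comp measurable_et2 (measurable_fun_pair m1 measurable_snd)).
have p2 (u : measurableTypeR R) z : (0 <= (gam rho0 u * (et G sb (t + u) z * f z))%:E :> \bar R)%E.
 by rewrite lee_fin; exact: mulr_ge0 (ga0 u) (mulr_ge0 (proj2 (bt _) _) (f0 z)).
transitivity (\int[mu]_z \int[L1]_u (gam rho0 u * (et G sb (t + u) z * f z))%:E)%E.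
 apply: eq_integral => z _; rewrite EFinM Kop_et -ge0_integralZr ?lee_fin //.
 - by apply: eq_integral => u _; rewrite -EFinM mulrA.
 - apply/measurable_EFinP; apply: measurable_funM; first exact: measurable_gam _ rho0_ge1.
  have m1 : mfunT (fun u : R => t + u) by mf.
  exact: (measurableT_comp (measurable_et z) m1).
 - by move=> u _; rewrite lee_fin; exact: mulr_ge0 (ga0 u) (proj2 (bt _) _).
rewrite -(tonelli _ _ _ _ L1 mu (fun u z => (gam rho0 u * (et G sb (t + u) z * f z))%:E) mf2 p2).
apply: eq_integral => u _; have bb : bmf (fun z => et G sb (t + u) z * f z) by apply: bmfM => //; case: (bt (t + u)).
rewrite EFinM -IntE // -ge0_integralZl_EFin //.
- by move=> z _; rewrite lee_fin; exact: mulr_ge0 (proj2 (bt _) _) (f0 z).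
- by apply/measurable_EFinP; case: bb.
Qed.

End averaging.

(** * Decay of nonnegative solutions of a convolution equation *)

(* [psi <= 1_[-L,L] + x A psi] for [psi t = e^(-beta |t|)] when [beta < 1/2] is close to [1/2] and [L] is large:
  iterating this reduces the growth of [Q 0] at infinity to the decay of [Q j = A^j (Q 0)] on [[-L, L]]. *)
Definition ge0_mfun {R : realType} (f : R -> \bar R) := mfunT f /\ forall t, (0 <= f t)%E.

Section convolution.
Context {R : realType}.
Notation L1 := (@lebesgue_measure R).
Local Open Scope ereal_scope.
Context (gm : R -> R) (mgm : mfunT gm) (gm0 : forall u, (0 <= gm u)%R)
 (gmN : forall u, gm (- u)%R = gm u)
 (gm2 : \int[L1]_u (gm u * (expR (u / 2) + expR (- (u / 2))))%:E = 2%:E)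
 (gm_lower : exists2 c : R, (0 < c)%R & forall u, (1 <= u <= 2)%R -> (c <= gm u)%R).
Implicit Types (f : R -> \bar R) (t u : R).

Let mgE : mfunT (fun u => (gm u)%:E). Proof. exact/measurable_EFinP. Qed.
Let gE0 u : 0 <= (gm u)%:E. Proof. by rewrite lee_fin. Qed.

Lemma gm_half : \int[L1]_u (gm u * expR (- (u / 2)))%:E = 1.
Proof.
have m1 (e : R) : mfunT (fun u => (gm u * expR (e * (u / 2)))%:E).
 by mf.
have p1 (e : R) u : 0 <= (gm u * expR (e * (u / 2)))%:E by rewrite lee_fin mulr_ge0 // expR_ge0.
have E : \int[L1]_u (gm u * expR (- (u / 2)))%:E = \int[L1]_u (gm u * expR (u / 2))%:E.
 transitivity (\int[L1]_u (gm u * expR (-1 * (u / 2)))%:E); first by under eq_integral do rewrite -mulN1r.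
 rewrite -(integral_reflect _ (m1 (-1)%R) (p1 (-1)%R)); apply: eq_integral => u _.
 by rewrite gmN mulN1r mulNr opprK.
have := gm2; set X := \int[L1]_u _ in E *.
have X0 : 0 <= X by apply: integral_ge0 => u _; rewrite lee_fin mulr_ge0 // expR_ge0.
have -> : \int[L1]_u (gm u * (expR (u / 2) + expR (- (u / 2))))%:E = X + X.
 rewrite {1}E /X -(ge0_integralD L1 measurableT).
 - by apply: eq_integral => u _; rewrite -EFinD mulrDr.
 - by move=> u _; rewrite lee_fin mulr_ge0 // expR_ge0.
 - by mf.
 - by move=> u _; rewrite lee_fin mulr_ge0 // expR_ge0.
 - by mf.
by case: X X0 {E} => [x| |] // _ [e]; congr (_%:E); lra.
Qed.

Let gI : \bar R := \int[L1]_u (gm u)%:E.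

Let cosh1 u : (2 <= expR (u / 2) + expR (- (u / 2)))%R /\
 ((1 <= u)%R -> (2 + 16^-1 <= expR (u / 2) + expR (- (u / 2)))%R).
Proof.
pose a := expR (u / 4); pose b := expR (- (u / 4)).
have -> : expR (u / 2) = (a * a)%R by rewrite -expRD; congr expR; lra.
have -> : expR (- (u / 2)) = (b * b)%R by rewrite -expRD; congr expR; lra.
have ab : (a * b)%R = 1%R by rewrite -expRD subrr expR0.
have sq : (0 <= (a - b) * (a - b))%R by rewrite -expr2 sqr_ge0.
split => [|u1]; first by lra.
have a1 : (1 + 4^-1 <= a)%R by apply: le_trans (expR_ge1Dx _); lra.
have b1 : (b <= 1)%R by rewrite -expR0 ler_expR; lra.
have : (4^-1 * 4^-1 <= (a - b) * (a - b))%R by apply: ler_pM; lra.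
lra.
Qed.

(** [exp (u / 2) + exp (- u / 2)] is at least 2, with a definite surplus on [[1, 2]], where [gm] is
    bounded below; the normalisation [gm2] therefore forces the mass of [gm] itself below 1. *)
Let gI_lt1 : gI < 1.
Proof.
have [c c0 hc] := gm_lower; pose k : R := (c / 32)%R.
have k0 : (0 < k)%R by rewrite divr_gt0.
have mI : mfunT (fun u : R => (k * \1_(`[1%R, 2%R]%classic) u)%:E).
 by mf.
have pI u : 0 <= (k * \1_(`[1%R, 2%R]%classic) u)%:E by rewrite lee_fin mulr_ge0 // ltW.
have IE : \int[L1]_u (k * \1_(`[1%R, 2%R]%classic) u)%:E = k%:E.
 by rewrite integral_cst_itv ?(ltW k0) ?ler1n //; congr (_%:E); ring.
have H : gI + k%:E <= 1.
 rewrite -IE -(ge0_integralD L1 measurableT) //.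
 have -> : 1 = \int[L1]_u (2^-1 * (gm u * (expR (u / 2) + expR (- (u / 2)))))%:E.
  under eq_integral do rewrite EFinM.
  rewrite ge0_integralZl_EFin //.
  - by rewrite gm2 -EFinM mulVf.
  - by move=> u _; rewrite lee_fin; pos.
  - by mf.
 apply: ge0_le_integral => //.
 - by move=> u _; rewrite adde_ge0.
 - exact: emeasurable_funD.
 - by mf.
 - move=> u _; rewrite -EFinD lee_fin; have [h1 h2] := cosh1 u; have g0 := gm0 u.
  set e := (expR _ + _)%R in h1 h2 *.
  rewrite indicE mem_setE in_itv; case: (boolP (1 <= (u : R) <= 2)%R) => [/andP[u1 u2]|_].
   have /hc g1 : (1 <= u <= 2)%R by rewrite u1.
   have {}h2 := h2 u1; rewrite mulr1 /k.
   have : (0 <= gm u * (e - (2 + 16^-1)))%R by rewrite mulr_ge0 // subr_ge0.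
   lra.
  have : (0 <= gm u * (e - 2))%R by rewrite mulr_ge0 // subr_ge0.
  by rewrite mulr0; lra.
apply: (lt_le_trans _ H); rewrite lteDl //.
rewrite ge0_fin_numE ?integral_ge0 //; apply: le_lt_trans (ltry 1).
by apply: (le_trans _ H); rewrite leeDl // lee_fin ltW.
Qed.

(** The factor by which [Aop] multiplies constants; it is below 1, whereas [exp (t / 2)] and
    [exp (- t / 2)] are preserved. *)
Definition hA : R := ((1 + fine gI) / 2)%R.

Let gIE : gI = (fine gI)%:E.
Proof. by rewrite fineK // ge0_fin_numE ?integral_ge0 // (lt_trans gI_lt1) // ltry. Qed.

Lemma hA_lt1 : (2^-1 <= hA < 1)%R.
Proof.
have f0 : (0 <= fine gI)%R by rewrite fine_ge0 // integral_ge0.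
have : (fine gI < 1)%R by rewrite -lte_fin -gIE; exact: gI_lt1.
by rewrite /hA => f1; apply/andP; split; lra.
Qed.

(** [Cv] and [Aop] are the counterparts, in the variable [t], of [Kop] and [Pop]. *)
Definition Cv f t : \bar R := \int[L1]_u ((gm u)%:E * f (t + u)%R).
Definition Aop f t : \bar R := (2^-1)%:E * (f t + Cv f t).

Notation nn := ge0_mfun.

Let mtr f t : mfunT f -> mfunT (fun u : R => f (t + u)%R).
Proof.
move=> mf'; have m1 : mfunT (fun u : R => t + u)%R by mf.
mf.
Qed.

Let mgf f t : mfunT f -> mfunT (fun u : R => (gm u)%:E * f (t + u)%R).
Proof. by move=> mf'; mf. Qed.

Let mg2 f : mfunT f ->
 mfunT (fun x : plane R => (gm x.2)%:E * f (x.1 + x.2)%R).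
Proof.
move=> mf'; apply: emeasurable_funM; first mf.
have m1 : mfunT (fun x : plane R => x.1 + x.2 : measurableTypeR R)%R.
 by mf.
mf.
Qed.

Let Cv_nn f : nn f -> nn (Cv f).
Proof.
move=> [mf' f0]; split; last by move=> t; apply: integral_ge0 => u _; rewrite mule_ge0.
apply: (measurable_fun_fubini_tonelli_F (m2 := L1) (fun x : plane R => (gm x.2)%:E * f (x.1 + x.2)%R)).
- mf.
- by move=> x; rewrite mule_ge0.
Qed.

Let half0 : 0 <= (2^-1)%:E :> \bar R. Proof. done. Qed.

Lemma Aop_nn f : nn f -> nn (Aop f).
Proof.
move=> nf; have [mf' f0] := nf; have [mC C0] := Cv_nn f nf; split; last by move=> t; rewrite mule_ge0 // adde_ge0.
by apply: emeasurable_funM; [mf|exact: emeasurable_funD].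
Qed.

Let Aop_le f h t : nn f -> nn h -> (forall s, f s <= h s) -> Aop f t <= Aop h t.
Proof.
move=> [mf' f0] [mh h0] fh; rewrite /Aop lee_wpmul2l // leeD //; apply: ge0_le_integral => //.
- by move=> u _; rewrite mule_ge0.
- mf.
- mf.
- by move=> u _; rewrite lee_wpmul2l.
Qed.

Lemma AopDZ (c : R) f h t : (0 <= c)%R -> nn f -> nn h -> Aop (fun s => f s + c%:E * h s) t = Aop f t + c%:E * Aop h t.
Proof.
move=> c0 [mf' f0] [mh h0]; have cE : 0 <= c%:E by pos.
have E : Cv (fun s => f s + c%:E * h s) t = Cv f t + c%:E * Cv h t.
 rewrite /Cv -ge0_integralZl_EFin //; [|by move=> u _; rewrite mule_ge0|mf].
 rewrite -(ge0_integralD L1 measurableT); first last.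
 - by mf.
 - by move=> u _; rewrite !mule_ge0.
 - mf.
 - by move=> u _; rewrite mule_ge0.
 by apply: eq_integral => u _; rewrite ge0_muleDr ?mule_ge0 // muleCA.
have C0 k : (forall s, 0 <= k s) -> 0 <= Cv k t by move=> k0; apply: integral_ge0 => u _; rewrite mule_ge0.
rewrite /Aop E; have hc := C0 h h0; have fc := C0 f f0.
have P1 := adde_ge0 (f0 t) fc; have P2 := mule_ge0 cE (adde_ge0 (h0 t) hc).
by rewrite addeACA -ge0_muleDr // (ge0_muleDr _ P1 P2) [X in _ + X]muleCA.
Qed.

Lemma Aop_cst (c : R) t : (0 <= c)%R -> Aop (fun=> c%:E) t = (hA * c)%:E.
Proof.
move=> c0; have E : Cv (fun=> c%:E) t = (fine gI)%:E * c%:E.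
 by rewrite /Cv ge0_integralZr // -gIE.
transitivity ((2^-1 * (c + fine gI * c))%R%:E); first by rewrite /Aop E.
by congr (_%:E); rewrite /hA; ring.
Qed.

Let Cv_sym f h : nn f -> nn h -> \int[L1]_t (f t * Cv h t) = \int[L1]_t (Cv f t * h t).
Proof.
move=> [mf' f0] [mh h0].
have T1 k l : nn k -> nn l -> \int[L1]_t (k t * Cv l t) = \int[L1]_u ((gm u)%:E * \int[L1]_t (k t * l (t + u)%R)).
 move=> [mk k0] [ml l0].
 transitivity (\int[L1]_t \int[L1]_u (k t * ((gm u)%:E * l (t + u)%R))).
  apply: eq_integral => t _; rewrite /Cv -ge0_integralZl //.
  - mf.
  - by move=> u _; rewrite mule_ge0.
 rewrite (tonelli _ _ _ _ L1 L1 (fun t u => k t * ((gm u)%:E * l (t + u)%R))); last 2 first.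
 - by mf.
 - by move=> t u; rewrite !mule_ge0.
 apply: eq_integral => u _.
 rewrite -ge0_integralZl //.
 - by apply: eq_integral => t _; rewrite muleCA.
 - mf.
 - by move=> t _; rewrite mule_ge0.
rewrite (T1 f h (conj mf' f0) (conj mh h0)); under [RHS]eq_integral do rewrite muleC.
rewrite (T1 h f (conj mh h0) (conj mf' f0)).
have mS k l : nn k -> nn l -> mfunT (fun u : R => (gm u)%:E * \int[L1]_t (k t * l (t + u)%R)).
 move=> [mk k0] [ml l0]; apply: emeasurable_funM => //.
 apply: (measurable_fun_fubini_tonelli_F (m2 := L1) (fun x : plane R => k x.2 * l (x.2 + x.1)%R)).
  apply: emeasurable_funM; first mf.
  have m1 : mfunT (fun x : plane R => x.2 + x.1 : measurableTypeR R)%R.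
   by mf.
  mf.
 by move=> x; rewrite mule_ge0.
rewrite -[RHS]integral_reflect; last 2 first.
- exact: mS.
- by move=> u; rewrite mule_ge0 // integral_ge0 // => t _; rewrite mule_ge0.
apply: eq_integral => u _; rewrite gmN; congr (_ * _).
rewrite -[RHS](integral_translate u); last 2 first.
- by mf.
- by move=> t; rewrite mule_ge0.
by apply: eq_integral => t _; rewrite addrK muleC.
Qed.

Let Aop_sym f h : nn f -> nn h -> \int[L1]_t (f t * Aop h t) = \int[L1]_t (Aop f t * h t).
Proof.
move=> nf nh; have [[mf' f0] [mh h0]] := (nf, nh).
have [[mCf Cf0] [mCh Ch0]] := (Cv_nn f nf, Cv_nn h nh).
transitivity ((2^-1)%:E * (\int[L1]_t (f t * h t) + \int[L1]_t (f t * Cv h t))).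
 rewrite -(ge0_integralD L1 measurableT); first last.
 - mf.
 - by move=> t _; rewrite mule_ge0.
 - mf.
 - by move=> t _; rewrite mule_ge0.
 rewrite -ge0_integralZl_EFin //; last 2 first.
 - by move=> t _; rewrite adde_ge0 // mule_ge0.
 - by apply: emeasurable_funD; mf.
 by apply: eq_integral => t _; rewrite /Aop -ge0_muleDr // muleCA.
rewrite Cv_sym //.
rewrite -(ge0_integralD L1 measurableT); first last.
- mf.
- by move=> t _; rewrite mule_ge0.
- mf.
- by move=> t _; rewrite mule_ge0.
rewrite -ge0_integralZl_EFin //; last 2 first.
- by move=> t _; rewrite adde_ge0 // mule_ge0.
- by apply: emeasurable_funD; mf.
by apply: eq_integral => t _; rewrite /Aop -ge0_muleDl // muleA.
Qed.

Let iter_nn n f : nn f -> nn (iter n Aop f).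
Proof. by move=> nf; elim: n => //= n; exact: Aop_nn. Qed.

Let iter_sym n f h : nn f -> nn h -> \int[L1]_t (iter n Aop f t * h t) = \int[L1]_t (f t * iter n Aop h t).
Proof.
elim: n f h => [//|n IH] f h nf nh.
by rewrite iterSr IH //=; [rewrite Aop_sym //; exact: iter_nn|exact: Aop_nn].
Qed.

Let psi (b : R) t : \bar R := (expR (- (b * `|t|)))%:E.
Let boxE (L : R) t : \bar R := (\1_(`[- L, L]%classic) t)%:E.

Let psi_nn b : nn (psi b).
Proof.
split; last by move=> t; rewrite lee_fin expR_ge0.
apply/measurable_EFinP; apply: (measurableT_comp (f := expR)); first mf.
by mf.
Qed.

Let box_nn L : nn (boxE L).
Proof. by split; [apply/measurable_EFinP; mf|move=> t; rewrite lee_fin]. Qed.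

Let boxP L t : boxE L t = if (`|t| <= L)%R then 1 else 0.
Proof. by rewrite /boxE indicE mem_setE in_itv -ler_norml; case: ifP. Qed.

Let gm_box (y : R) : (y < 1)%R -> exists2 L : R, (0 <= L)%R &
 y%:E <= \int[L1]_u (boxE L u * (gm u * expR (- (u / 2)))%:E).
Proof.
move=> y1; pose w u : \bar R := (gm u * expR (- (u / 2)))%:E.
have mw : mfunT w by apply/measurable_EFinP; mf.
have w0 u : 0 <= w u by rewrite lee_fin mulr_ge0 // expR_ge0.
pose s n u := boxE n%:R u * w u.
have ms n : mfunT (s n) by apply: emeasurable_funM => //; case: (box_nn n%:R).
have s0 n u : setT u -> 0 <= s n u by move=> _; rewrite mule_ge0; case: (box_nn n%:R).
have nds u : setT u -> nondecreasing_seq (s ^~ u).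
 move=> _ n m nm; rewrite /s !boxP; case: ifPn => [h|_]; last by rewrite mul0e mule_ge0 //; case: ifP.
 by rewrite (le_trans h) // ler_nat.
have := @cvg_monotone_convergence _ _ _ L1 _ measurableT _ ms s0 nds.
have -> : \int[L1]_(x in setT) limn (s ^~ x) = 1.
 rewrite -[RHS]gm_half; apply: eq_integral => u _; apply: cvg_lim => //; apply: cvg_near_cst.
 have [n nu] : exists n, (`|u| <= n%:R)%R by exists (Num.truncn `|u|).+1; have /andP[_ /ltW] := truncn_itv (normr_ge0 u).
 by near=> m; rewrite /s boxP ifT ?mul1e // (le_trans nu) // ler_nat; near: m; exact: nbhs_infty_ge.
move=> /cvg_lim H.
have y1E : y%:E < limn (fun n => \int[L1]_u s n u) by rewrite H.
have cv : cvgn (fun n => \int[L1]_u s n u).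
 apply: ereal_nondecreasing_is_cvgn => n m nm; apply: ge0_le_integral => //.
 - exact: s0.
 - mf.
 - mf.
 - by move=> u _; exact: (nds u I _ _ nm).
have [n hn] : exists n, y%:E <= \int[L1]_u s n u.
 apply: contrapT => /forallNP hn; move: y1E; apply/negP; rewrite -leNgt.
 by apply: lime_le => //; near=> n; have /negP := hn n; rewrite -ltNge => /ltW.
by exists n%:R.
Unshelve. all: by end_near.
Qed.

Let Aop_psi (x : R) : (1 < x)%R -> exists b L : R, [/\ (0 <= b < 2^-1)%R, (0 <= L)%R &
 forall t, psi b t <= boxE L t + x%:E * Aop (psi b) t].
Proof.
(* [y] solves [x * (1 + y) / 2 = 1], so it suffices that beyond [L] the convolution multiplies [psi]
   by at least [y]. The window [[-L, L]] carries mass at least [y' = (1 + y) / 2] of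
   [gm * exp (- u / 2)], and lowering the exponent from 1/2 to [b = 1/2 - e] costs at most the
   factor [exp (- e L)], which is close to 1. *)
move=> x1; pose y : R := (2 / x - 1)%R; have x0 : (0 < x)%R by lra.
have y1 : (-1 < y < 1)%R.
 rewrite /y; have : (0 < 2 / x)%R by pos.
 have : (2 / x < 2)%R by rewrite ltr_pdivrMr // ltr_pMr.
 lra.
pose y' : R := ((y + 1) / 2)%R.
have [h1 h2] : (0 < y' /\ y' < 1)%R by rewrite /y'; move: y1 => /andP[? ?]; split; lra.
have [L L0 hL] := gm_box y' h2.
pose e : R := ((1 - y) / (4 * (L + 1)))%R.
have L10 : (0 < L + 1)%R by lra.
have e0 : (0 < e)%R by rewrite /e divr_gt0; move: y1 => /andP[? ?]; lra.
have eh : (e <= 2^-1)%R.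
 by rewrite /e ler_pdivrMr; move: y1 => /andP[? ?]; lra.
have eL : (y <= (1 - e * L) * y')%R.
 have : (e * L <= (1 - y) / 4)%R.
  have -> : (e * L = (1 - y) / 4 * (L / (L + 1)))%R by rewrite /e; field; rewrite gt_eqF.
  rewrite ler_piMr //; first by move: y1 => /andP[? ?]; lra.
  by rewrite ler_pdivrMr // mul1r; lra.
 move=> h; have : (e * L * y' <= (1 - y) / 4 * 1)%R.
  by apply: ler_pM => //; pos.
 have yy : (y' = (y + 1) / 2)%R by [].
 rewrite mulrBl mul1r; move: y1 => /andP[? ?]; lra.
pose b : R := (2^-1 - e)%R.
exists b, L; split => //; first by rewrite /b; apply/andP; split; lra.
have pN t : psi b (- t)%R = psi b t by rewrite /psi normrN.
have AN t : Aop (psi b) (- t)%R = Aop (psi b) t.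
 suff E : Cv (psi b) (- t)%R = Cv (psi b) t by rewrite /Aop pN E.
 have [mp p0] := psi_nn b.
 rewrite /Cv -[RHS]integral_reflect; [|mf|by move=> u; rewrite mule_ge0].
 by apply: eq_integral => u _; rewrite gmN -pN opprD !opprK.
have box0 t : 0 <= boxE L t by case: (box_nn L).
have [_ A0] := Aop_nn _ (psi_nn b).
suff main t : (L < t)%R -> psi b t <= x%:E * Aop (psi b) t.
 move=> t; have [tL|tL] := leP `|t|%R L.
  rewrite boxP tL; apply: (@le_trans _ _ 1); last by rewrite leeDl // mule_ge0 // lee_fin ltW.
  by rewrite lee_fin -expR0 ler_expR oppr_le0 mulr_ge0 //; rewrite /b; lra.
 rewrite boxP [(`|t| <= L)%R]leNgt tL add0e; have [t0|t0] := leP 0%R t.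
  by apply: main; rewrite -(ger0_norm t0).
 by rewrite -pN -AN; apply: main; rewrite -(ltr0_norm t0).
move=> tL; have t0 : (0 <= t)%R by lra.
have [mp p0] := psi_nn b.
have H : y%:E * psi b t <= Cv (psi b) t.
 have mw : mfunT (fun u => boxE L u * (gm u * expR (- (u / 2)))%:E).
  by apply: emeasurable_funM; [case: (box_nn L)|mf].
 have w0 u : 0 <= boxE L u * (gm u * expR (- (u / 2)))%:E by rewrite mule_ge0 // lee_fin mulr_ge0 // expR_ge0.
 pose c : R := (expR (- (e * L)) * expR (- (b * `|t|)))%R.
 have c0 : (0 <= c)%R by rewrite mulr_ge0 // expR_ge0.
 apply: (@le_trans _ _ (c%:E * \int[L1]_u (boxE L u * (gm u * expR (- (u / 2)))%:E))).
  apply: (@le_trans _ _ (c%:E * y'%:E)); last by rewrite lee_wpmul2l.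
  rewrite /psi -!EFinM lee_fin /c mulrAC ler_pM2r ?expR_gt0 //; apply: le_trans eL _.
  by rewrite ler_pM2r; have := expR_ge1Dx (- (e * L)); lra.
 rewrite -ge0_integralZl_EFin //; apply: ge0_le_integral => //.
 - by move=> u _; rewrite mule_ge0 // lee_fin.
 - by apply: emeasurable_funM.
 - mf.
 - move=> u _; rewrite boxP; case: ifPn => uL; last by rewrite mul0e mule0 mule_ge0.
  rewrite mul1e -!EFinM lee_fin mulrCA ler_wpM2l // /c -!expRD ler_expR.
  move: uL; rewrite ler_norml => /andP[u1 u2].
  have tu : (0 <= t + u)%R by lra.
  rewrite !ger0_norm // mulrDr /b.
  have : (e * (- L) <= e * u)%R by rewrite ler_pM2l.
  lra.
apply: (@le_trans _ _ (x%:E * ((2^-1)%:E * (psi b t + y%:E * psi b t)))); last first.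
 by rewrite lee_wpmul2l ?lee_fin ?(ltW x0) // /Aop lee_wpmul2l // leeD2l.
rewrite /psi; move: (expR _) => E.
suff: (E <= x * (2^-1 * (E + y * E)))%R by pos.
by rewrite le_eqVlt; apply/orP; left; apply/eqP; rewrite /y; field; rewrite gt_eqF.
Qed.

Definition decaying (th : R) (Q : nat -> R -> R) := [/\ forall j, mfunT (Q j),
 forall j t, (0 <= Q j t)%R, forall j t, Aop (EFin \o Q j) t = (Q j.+1 t)%:E &
 forall L : R, exists C : R, forall j t, (`|t| <= L)%R -> (Q j t <= C * th ^+ j)%R].

(** Duality. Iterating the comparison bounds [psi] by the sum over [j < n] of [x^j A^j 1_[-L,L]]
    plus [x^n A^n psi]. Paired with [Q 0], the j-th term becomes [x^j] times the integral of [Q j]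
    over [[-L, L]], at most [K (x th)^j], and [x * th < 1]. The remainder tends to 0 since
    [x * hA < 1], once [Q 0] is cut off at [T]; the resulting bound does not involve [T]. *)
Lemma convolution_decay (th : R) : (0 < th < 1)%R -> (hA <= th)%R ->
 exists2 b : R, (0 <= b < 2^-1)%R & forall Q, decaying th Q ->
  exists C : R, forall T : R, (0 <= T)%R ->
   \int[L1]_t (boxE T t * (expR (- (b * `|t|)) * Q 0 t)%:E) <= C%:E.
Proof.
move=> th01 hth; have [th0 th1] := andP th01.
pose x : R := ((1 + th^-1) / 2)%R.
have th1V : (1 < th^-1)%R by rewrite invf_gt1.
have x1 : (1 < x)%R by rewrite /x; lra.
have xth : (x * th < 1)%R.
 have -> : (x * th = (th + 1) / 2)%R by rewrite /x; field; rewrite gt_eqF.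
 by lra.
have [b [L [b0 L0 hpsi]]] := Aop_psi x x1; exists b => // Q [mQ Q0 QA Qloc].
have Q_nn j : nn (EFin \o Q j) by split; [exact/measurable_EFinP|move=> t; rewrite lee_fin].
have iterQ j : iter j Aop (EFin \o Q 0%N) = EFin \o Q j.
 by elim: j => //= j ->; apply/funext => t; exact: QA.
have [C hC] := Qloc L; have hA0 : (0 <= hA)%R by have /andP[] := hA_lt1; lra.
have C0 : (0 <= C)%R.
 have : (`|0 : R| <= L)%R by rewrite normr0.
 by move=> /(hC 0%N 0%R); rewrite expr0 mulr1; apply: le_trans.
pose K : R := (C * (L - - L))%R.
exists (K / (1 - x * th))%R => T T0.
pose u n := iter n Aop (boxE L); pose v n := iter n Aop (psi b).
have nu n : nn (u n) by exact: iter_nn.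
have nv n : nn (v n) by exact: iter_nn.
have x0 : (0 <= x)%R by lra.
have uv n t : v n t <= u n t + x%:E * v n.+1 t.
 elim: n t => [t|n IH t]; first exact: hpsi.
 rewrite [v n.+1]/(v _) [v n.+2]/(v _) /= -/(v n) -/(v n.+1) -AopDZ //; last exact: (nv n.+1).
 apply: Aop_le; [exact: (nv n)| |exact: IH]; split.
  apply: emeasurable_funD; first by case: (nu n).
  by apply: emeasurable_funM => //; case: (nv n.+1).
 move=> s; have [_ A1] := nv n.+1; have [_ A2] := nu n.
 by apply: adde_ge0; [exact: A2|apply: mule_ge0; [rewrite lee_fin|exact: A1]].
have v_le n t : v n t <= (hA ^+ n)%:E.
 elim: n t => [t|n IH t].
  rewrite lee_fin expr0 -expR0 ler_expR oppr_le0 mulr_ge0; by case/andP: b0.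
 rewrite exprS -(Aop_cst _ t) ?exprn_ge0 //; apply: Aop_le => //.
 by split => // s; rewrite lee_fin exprn_ge0.
have ua n : \int[L1]_t (u n t * (Q 0 t)%:E) <= (K * th ^+ n)%:E.
 rewrite (iter_sym n (boxE L) (EFin \o Q 0%N)) // iterQ.
 have -> : (K * th ^+ n = (C * th ^+ n) * (L - - L))%R by rewrite /K; ring.
 rewrite -integral_cst_itv ?mulr_ge0 ?exprn_ge0 ?(ltW th0) //; last by lra.
 apply: ge0_le_integral => //.
 - by move=> t _; rewrite mule_ge0 //; [case: (box_nn L)|rewrite lee_fin].
 - by apply: emeasurable_funM; [case: (box_nn L)|case: (Q_nn n)].
 - by mf.
 - move=> t _; rewrite [leRHS]EFinM muleC -/(boxE L t) boxP; case: ifPn => [tL|_]; last by rewrite !mule0.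
  by rewrite !mule1 lee_fin hC.
have [C' hC'] := Qloc T.
pose I : R := (C' * (T - - T))%R.
have C'0 : (0 <= C')%R.
 have : (`|0 : R| <= T)%R by rewrite normr0.
 by move=> /(hC' 0%N 0%R); rewrite expr0 mulr1; apply: le_trans.
have I0 : (0 <= I)%R by rewrite mulr_ge0; lra.
pose w t : \bar R := boxE T t * (Q 0 t)%:E.
have mw : mfunT w by apply: emeasurable_funM; [case: (box_nn T)|case: (Q_nn 0%N)].
have w0 t : 0 <= w t by rewrite mule_ge0 //; [case: (box_nn T)|rewrite lee_fin].
have wI : \int[L1]_t w t <= I%:E.
 rewrite /I -integral_cst_itv //; last by lra.
 apply: ge0_le_integral => //.
 - by mf.
 - move=> t _; rewrite [leRHS]EFinM muleC -/(boxE T t) /w boxP; case: ifPn => [tL|_]; last by rewrite !mul0e.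
  by rewrite !mul1e lee_fin; have := hC' 0%N t tL; rewrite expr0 mulr1.
pose bb n : \bar R := \int[L1]_t (v n t * w t).
have mvw n : mfunT (fun t => v n t * w t) by mf; case: (nv n).
have vw0 n t : 0 <= v n t * w t by rewrite mule_ge0; case: (nv n).
have bI n : bb n <= (hA ^+ n * I)%:E.
 apply: (@le_trans _ _ ((hA ^+ n)%:E * \int[L1]_t w t)); last first.
  by rewrite EFinM lee_wpmul2l // lee_fin exprn_ge0.
 rewrite -ge0_integralZl_EFin ?exprn_ge0 //; apply: ge0_le_integral => //.
 - exact: mvw.
 - by mf.
 - by move=> t _; rewrite lee_wpmul2r.
have brec n : bb n <= (K * th ^+ n)%:E + x%:E * bb n.+1.
 have mu1 : mfunT (fun t => u n t * (Q 0 t)%:E) by apply: emeasurable_funM; [case: (nu n)|case: (Q_nn 0%N)].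
 have u10 t : 0 <= u n t * (Q 0 t)%:E by rewrite mule_ge0 ?lee_fin; case: (nu n).
 apply: (@le_trans _ _ (\int[L1]_t (u n t * (Q 0 t)%:E) + x%:E * bb n.+1)); last by rewrite leeD2r.
 have E : x%:E * bb n.+1 = \int[L1]_t (x%:E * (v n.+1 t * w t)).
  by rewrite ge0_integralZl_EFin //; exact: mvw.
 have mx : mfunT (fun t => x%:E * (v n.+1 t * w t)).
  by apply: emeasurable_funM => //; mf.
 rewrite E -(ge0_integralD L1 measurableT) //; last first.
  by move=> t _; rewrite mule_ge0 // lee_fin.
 apply: ge0_le_integral => //.
 - exact: mvw.
 - exact: emeasurable_funD.
 - move=> t _; have u0 : 0 <= u n t by case: (nu n).
  have xv0 : 0 <= x%:E * v n.+1 t by rewrite mule_ge0; case: (nv n.+1).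
  apply: (@le_trans _ _ ((u n t + x%:E * v n.+1 t) * w t)); first by rewrite lee_wpmul2r.
  rewrite ge0_muleDl // -muleA leeD2r // lee_wpmul2l // /w boxP.
  by case: ifP => _; rewrite ?mul1e ?mul0e ?lee_fin.
have bfin n : bb n = (fine (bb n))%:E.
 rewrite fineK // ge0_fin_numE; last by apply: integral_ge0 => t _.
 exact: le_lt_trans (bI n) (ltry _).
have -> : \int[L1]_t (boxE T t * (expR (- (b * `|t|)) * Q 0 t)%:E) = bb 0%N.
 by apply: eq_integral => t _; rewrite /v /psi /w EFinM muleCA.
(* The subtracted quantity is the sum of the geometric series from [n] on; it turns the recursion
   into [c n <= x * c n.+1]. *)
rewrite bfin lee_fin; pose c n : R := (fine (bb n) - K * th ^+ n / (1 - x * th))%R.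
have d0 : (0 < 1 - x * th)%R by lra.
have crec n : (c n <= x * c n.+1)%R.
 have := brec n; rewrite (bfin n) (bfin n.+1) -EFinM -EFinD lee_fin /c exprS => h.
 have -> : (K * th ^+ n / (1 - x * th) = K * th ^+ n + x * (K * (th * th ^+ n) / (1 - x * th)))%R.
  by field; rewrite gt_eqF.
 lra.
have c_le n : (c 0%N <= x ^+ n * c n)%R.
 elim: n => [|n IH]; first by rewrite expr0 mul1r.
 by apply: le_trans IH _; rewrite exprSr -mulrA ler_wpM2l ?exprn_ge0.
have K0 : (0 <= K)%R by rewrite mulr_ge0 //; lra.
have cI n : (c 0%N <= I * (x * hA) ^+ n)%R.
 apply: le_trans (c_le n) _.
 have -> : (I * (x * hA) ^+ n = x ^+ n * (hA ^+ n * I))%R by rewrite exprMn; ring.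
 rewrite ler_wpM2l ?exprn_ge0 //.
 have := bI n; rewrite bfin lee_fin /c => h.
 have : (0 <= K * th ^+ n / (1 - x * th))%R by pos.
 lra.
have : (c 0%N <= 0)%R; last by rewrite /c expr0 mulr1 subr_le0.
have xh1 : (`|x * hA| < 1)%R.
 rewrite (ger0_norm (mulr_ge0 x0 hA0)); apply: (le_lt_trans _ xth); exact: ler_wpM2l x0 _ _ hth.
have cv : (fun n => I * (x * hA) ^+ n)%R @ \oo --> (I * 0)%R.
 by apply: cvgM; [exact: cvg_cst|exact: cvg_expr].
rewrite mulr0 in cv; rewrite -(cvg_lim (@Rhausdorff R) cv).
by apply: limr_ge; [by apply/cvg_ex; exists 0%R|near=> n].
Unshelve. all: by end_near.
Qed.

(** If [Q 0] exceeded the bound throughout [[T, T + 1]], this interval alone would violate the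
    integral estimate. *)
Lemma convolution_decay_point (th : R) : (0 < th < 1)%R -> (hA <= th)%R ->
 exists2 b : R, (0 <= b < 2^-1)%R & forall Q, decaying th Q ->
  exists C : R, forall T : R, (0 <= T)%R ->
   exists2 t : R, (T <= t <= T + 1)%R & (Q 0 t <= C * expR (b * t))%R.
Proof.
move=> th01 hth; have [b b0 H] := convolution_decay th th01 hth; exists b => // Q dQ; have [mQ Q0 _ _] := dQ; have [C hC] := H Q dQ.
exists (Num.max C 0 + 1)%R => T T0.
pose K := (Num.max C 0 + 1)%R; have K0 : (0 <= K)%R by rewrite /K addr_ge0 // le_max lexx orbT.
apply: contrapT => hn.
have hn' t : (T <= t <= T + 1)%R -> (K * expR (b * t) <= Q 0 t)%R.
 by move=> tT; rewrite leNgt; apply/negP => /ltW ht; apply: hn; exists t => //; rewrite -/K.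
have T10 : (0 <= T + 1)%R by lra.
have := hC _ T10; apply/negP; rewrite -ltNge.
apply: (@lt_le_trans _ _ (K * (T + 1 - T))%:E).
 by rewrite lte_fin addrAC subrr add0r mulr1 /K ltr_pwDr // le_max lexx.
rewrite -integral_cst_itv //; last by lra.
apply: ge0_le_integral => //.
- by move=> t _; rewrite lee_fin mulr_ge0.
- by mf.
- apply: emeasurable_funM; first by case: (box_nn (T + 1)).
 by mf.
- move=> t _; rewrite indicE mem_setE in_itv; case: (boolP (T <= (t : R) <= T + 1)%R) => [tT|_]; last first.
  by rewrite mulr0 mule_ge0 //; [case: (box_nn (T + 1))|rewrite lee_fin mulr_ge0].
 have [t1 t2] := andP tT; have t0 : (0 <= (t : R))%R by lra.
 rewrite boxP ger0_norm // t2 mul1e mulr1 lee_fin.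
 apply: (@le_trans _ _ (expR (- (b * t)) * (K * expR (b * t)))%R); last by rewrite ler_wpM2l // hn'.
 by rewrite mulrCA -expRD addNr expR0 mulr1.
Qed.

End convolution.

(** * Variance of the symmetrised counting function *)

Section variance_growth.
Context {R : realType}.
Notation P := (plane R).
Notation L1 := (@lebesgue_measure R).
Notation L2 := (L1 \x L1)%E.
Context (G : set 'M[R]_2) (dG : discrete_subgroup_SL2 G) (F : set P) (hF : fdom G F)
 (mF : measurable F) (finF : (L2 F < +oo)%E).
Implicit Types (z : P) (t u : R).
Let mu := muF mF finF.
Let gm : R -> R := gam rho0.

Section cusp.
Context (sb : 'M[R]_2) (hsb : scaling_matrix G sb).
Let hN : G (- 1%:M). Proof. exact: scaling_opp1 _ _ hsb. Qed.
Let v0 : 0 < vol mu. Proof. exact: vol_gt0 _ dG hN _ hF mF finF. Qed.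
Let mk := measurable_kG _ dG hN _ (@rho0_ge1 R).
Let k0 := kG_ge0 G _ (@rho0_ge1 R).
Let kC := kG_sym _ dG (rho0 : R).
Let k1 := kG_int _ dG hN _ hF mF finF _ (@rho0_ge1 R).
Let e t : P -> R := et G sb t.
Let be t : bmp (e t). Proof. exact: bmp_et _ dG _ hsb t. Qed.

(** Both sides are the integral of the kernel applied to [et 0]: the kernel preserves integrals, and
    [Int_et] evaluates the means. *)
Lemma gam_cosh : (\int[L1]_u (gm u * (expR (u / 2) + expR (- (u / 2))))%:E = 2%:E)%E.
Proof.
have b1 : bmp (fun _ : P => 1 : R) by split => //; bm.
have := Int_Kop_et _ dG _ hsb _ hF mF finF (fun=> 1) 0 b1.
have E f : Int mu (fun z : P => f z * 1) = Int mu f by congr (Int mu _); apply/funext => z; rewrite mulr1.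
rewrite E (Int_Kop mu _ mk k0 kC k1 _ (be 0)) (Int_et _ dG _ hsb _ hF mF finF) mul0r oppr0 expR0.
move=> H; rewrite (_ : 2%:E = (1 + 1)%:E) // H; apply: eq_integral => u _.
by rewrite E add0r (Int_et _ dG _ hsb _ hF mF finF).
Qed.

Let Pf j := iter j (Pop mu (kG G rho0)) (e 0).
Let bP j : bmp (Pf j). Proof. by elim: j => [|j IH]; [exact: be|exact: Pop_bmp mu _ mk k0 k1 _ IH]. Qed.
Let IP j : Int mu (Pf j) = 2.
Proof.
elim: j => [|j IH]; first by rewrite (Int_et _ dG _ hsb _ hF mF finF) mul0r oppr0 expR0.
by rewrite (Int_Pop mu _ mk k0 kC k1 _ (bP j)).
Qed.

(** [q j t] correlates [e t] with the j-th iterate of [e 0]. The function [m] is the value expected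
    from the means alone, so [q - m] is a covariance. *)
Let q j t := Int mu (fun z => e t z * Pf j z).
Let m t := (expR (t / 2) + expR (- (t / 2))) * 2 / vol mu.
Let M0 := Var mu (e 0).
Let M0_ge0 : 0 <= M0. Proof. by apply: Var_ge0 => //; case: (be 0). Qed.

Let CovE j t : Cov mu (e t) (Pf j) = q j t - m t.
Proof. by rewrite /Cov IP (Int_et _ dG _ hsb _ hF mF finF). Qed.

Let g0 u : 0 <= gm u. Proof. exact: gam_ge0 _ (@rho0_ge1 R) u. Qed.
Let mg : mfunT gm. Proof. exact: measurable_gam _ (@rho0_ge1 R). Qed.

Let bq j t : bmf (fun z => e t z * Pf j z).
Proof. by apply: bmfM; [case: (be t)|case: (bP j)]. Qed.

Let q_ge0 j t : 0 <= q j t.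
Proof. by apply: Int_ge0 => z; rewrite mulr_ge0 //; [case: (be t)|case: (bP j)]. Qed.

Let m_ge0 t : 0 <= m t.
Proof. by rewrite divr_ge0 ?(ltW v0) // mulr_ge0 addr_ge0 expR_ge0. Qed.

(** The symmetric kernel is moved from the iterate to [e t], on which it acts by convolution. *)
Let Aq j t : Aop gm (EFin \o q j) t = (q j.+1 t)%:E.
Proof.
have bK := Kop_bmp mu _ mk k0 k1 _ (bP j); have bKe := Kop_bmp mu _ mk k0 k1 _ (be t).
have E : q j.+1 t = 2^-1 * (q j t + Int mu (fun z => Kop mu (kG G rho0) (e t) z * Pf j z)).
 have -> : Int mu (fun z => Kop mu (kG G rho0) (e t) z * Pf j z) = Int mu (fun z => e t z * Kop mu (kG G rho0) (Pf j) z).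
  rewrite (Kop_sym mu _ mk k0 kC k1 _ _ (be t) (bP j)).
  by congr (Int mu _); apply/funext => z; rewrite mulrC.
 have b2 : bmf (fun z => e t z * Kop mu (kG G rho0) (Pf j) z) by apply: bmfM; [case: (be t)|case: bK].
 rewrite -IntD // -IntZ; last bm.
 by congr (Int mu _); apply/funext => z; rewrite /= /Pop; ring.
rewrite E EFinM EFinD (Int_Kop_et _ dG _ hsb _ hF mF finF _ _ (bP j)) /Aop /Cv.
done.
Qed.

Let Am t : Aop gm (EFin \o m) t = (m t)%:E.
Proof.
have b1 : bmp (fun _ : P => 1 : R) by split => //; bm.
have E f : Int mu (fun z : P => f z * 1) = Int mu f by congr (Int mu _); apply/funext => z; rewrite mulr1.
have E1 u : Int mu (e u) = expR (u / 2) + expR (- (u / 2)) by exact: Int_et _ dG _ hsb _ hF mF finF u.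
pose c := 2 / vol mu; have c0 : 0 <= c by rewrite divr_ge0 // ltW.
have mE u : m u = c * Int mu (e u) by rewrite /m /c E1; ring.
have := Int_Kop_et _ dG _ hsb _ hF mF finF (fun=> 1) t b1.
rewrite E (Int_Kop mu _ mk k0 kC k1 _ (be t)) => H.
have C : (Cv gm (EFin \o m) t = (m t)%:E)%E.
 rewrite mE EFinM H -ge0_integralZl_EFin //; first last.
 - under eq_fun do rewrite E E1.
  by apply/measurable_EFinP; mf.
 - move=> u _; rewrite lee_fin E E1; exact: mulr_ge0 (g0 u) (addr_ge0 (expR_ge0 _) (expR_ge0 _)).
 apply: eq_integral => u _; rewrite (_ : (EFin \o m) (t + u) = (c * Int mu (fun z => e (t + u) z * 1))%:E).
  set I := Int _ _; have cI (a : R) : (a%:E * (c * I)%:E = c%:E * (a * I)%:E)%E.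
   by rewrite -!EFinM mulrCA.
  exact: cI.
 by rewrite E /comp mE.
transitivity ((2^-1 * (m t + m t))%R%:E); first by rewrite /Aop C.
by congr (_%:E); lra.
Qed.

Let mq j : mfunT (q j).
Proof.
apply: (measurableT_comp (fine_measurable measurableT)).
apply: (measurable_fun_fubini_tonelli_F (m2 := mu) (fun x : measurableTypeR R * P => (e x.1 x.2 * Pf j x.2)%:E)).
- apply/measurable_EFinP; apply: measurable_funM; first exact: measurable_et2 _ dG _ hsb.
 by case: (bP j) => -[mPf _] _; mf.
- by move=> x; rewrite lee_fin mulr_ge0 //; [case: (be x.1)|case: (bP j)].
Qed.

Let mm : mfunT m. Proof. by rewrite /m; mf. Qed.

(** The covariance alone may be negative. Adding [M0], the variance of [e 0], makes it nonnegative
    for [j = 0] by [Q_var]; as [Aop] multiplies constants by [hA], the correction has to be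
    [hA^j * M0] at stage [j]. *)
Definition Qe j t := q j t - m t + hA gm ^+ j * M0.

Let mQ j : mfunT (Qe j).
Proof. by apply: measurable_funD; mf. Qed.

(** The correlation part of each side is [2 Hc t + 2 Hc 0], by the addition formula, and the
    products of means agree because [2 cosh (t / 2) + 2 = (2 cosh (t / 4))^2]. *)
Let Q_var t : Qe 0 t = 2 * Var mu (e (t / 2)).
Proof.
have HH s s' : Int mu (fun z => e s z * e s' z) = _ := Int_et_et _ dG _ hsb _ hF mF finF s s'.
have E1 u : Int mu (e u) = expR (u / 2) + expR (- (u / 2)) by exact: Int_et _ dG _ hsb _ hF mF finF u.
rewrite /Qe /q /m /M0 /Var /Cov !HH !E1 expr0 mul1r addr0 subr0 addr0 subr0 subrr -splitr mul0r oppr0 expR0.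
have -> : expR (t / 2) = expR (t / 2 / 2) * expR (t / 2 / 2) by rewrite -expRD -splitr.
have -> : expR (- (t / 2)) = expR (- (t / 2 / 2)) * expR (- (t / 2 / 2)) by rewrite -expRD -opprD -splitr.
have ab : expR (t / 2 / 2) * expR (- (t / 2 / 2)) = 1 by rewrite -expRD subrr expR0.
move: ab; set a := expR _; set b := expR _; set h := Hc _ _ _; set h' := Hc _ _ _ => ab.
have vn : vol mu != 0 by rewrite gt_eqF.
apply/eqP; rewrite -subr_eq0; apply/eqP.
transitivity ((4 * (a * b) - 4) / vol mu); first by field.
by rewrite ab mulr1 subrr mul0r.
Qed.

Let gmN u : gm (- u) = gm u. Proof. exact: gamN. Qed.
Let glow := gam_lower _ (@rho0_ge1 R).
Let hA01 : 2^-1 <= hA gm < 1. Proof. exact: (hA_lt1 gm mg g0 gam_cosh glow). Qed.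

Let QA_Q0 j : (forall t, 0 <= Qe j t) -> (forall t, Aop gm (EFin \o Qe j) t = (Qe j.+1 t)%:E).
Proof.
move=> Q0 t; have hA0 : 0 <= hA gm by have /andP[] := hA01; lra.
have nQ : ge0_mfun (EFin \o Qe j) by split; [apply/measurable_EFinP; mf|move=> s; rewrite lee_fin; exact: Q0].
have nm : ge0_mfun (EFin \o m) by split; [apply/measurable_EFinP; mf|move=> s; rewrite lee_fin; exact: m_ge0].
have nq : ge0_mfun (EFin \o q j) by split; [apply/measurable_EFinP; mf|move=> s; rewrite lee_fin; pos].
have c0 : 0 <= hA gm ^+ j * M0 by pos.
have nc : ge0_mfun (fun _ : R => (hA gm ^+ j * M0)%:E) by pos.
have e1 : Aop gm (fun s => (EFin \o Qe j) s + 1%:E * (EFin \o m) s)%E t =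
  Aop gm (fun s => (EFin \o q j) s + 1%:E * (hA gm ^+ j * M0)%:E)%E t.
 by congr (Aop gm _ t); apply/funext => s; rewrite !mul1e -!EFinD /Qe; congr (_%:E); ring.
move: e1; rewrite (AopDZ _ mg g0 _ _ _ _ ler01 nQ nm) (AopDZ _ mg g0 _ _ _ _ ler01 nq nc).
rewrite Aq Am (Aop_cst gm mg g0 gam_cosh glow _ _ c0) !mul1e mulrA -exprS.
have [_ A0] := Aop_nn _ mg g0 _ nQ; move: (A0 t); case: (Aop gm (EFin \o Qe j) t) => [a| |] // _.
by rewrite -!EFinD => -[h]; congr (_%:E); rewrite /Qe; lra.
Qed.

Let Q0 j t : 0 <= Qe j t.
Proof.
elim: j t => [t|j IH t].
 rewrite Q_var; apply: mulr_ge0; first pos.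
 exact: (Var_ge0 mu v0 _ (proj1 (be (t / 2)))).
rewrite -lee_fin -(QA_Q0 j IH).
have nQ : ge0_mfun (EFin \o Qe j) by split; [apply/measurable_EFinP; mf|move=> s; rewrite lee_fin; exact: IH].
by have [_] := Aop_nn _ mg g0 _ nQ; exact.
Qed.

Context (th : R) (th0 : 0 <= th)
 (gap : forall f, bmp f -> Var mu (Pop mu (kG G rho0) f) <= th * Var mu f) (th' : R)
 (th'0 : 0 < th') (th'2 : th <= th' ^+ 2) (th'A : hA gm <= th').

Let VarP j : Var mu (Pf j) <= th ^+ j * M0.
Proof.
elim: j => [|j IH]; first by rewrite expr0 mul1r.
by apply: le_trans (gap _ (bP j)) _; rewrite exprS -mulrA ler_wpM2l.
Qed.

Let Var_loc (L : R) : exists2 B : R, 0 <= B & forall t, `|t| <= L -> Var mu (e t) <= B.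
Proof.
pose K := 2 * (expR (L / 2) * (Ccnt * (1 + expR L))).
exists (K ^+ 2 * vol mu) => [|t]; first by pos.
rewrite ler_norml => /andP[t1 t2]; have bet := proj1 (be t).
apply: le_trans (Var_le mu v0 _ 0 bet) _; rewrite -Int_cst; apply: Int_le.
- by bm.
- bm.
- move=> z; rewrite subr0 lerXn2r ?nnegrE //; first by case: (be t).
 + exact: mulr_ge0 (ler0n _ 2) (mulr_ge0 (expR_ge0 _) (mulr_ge0 Ccnt_ge0 (addr_ge0 ler01 (expR_ge0 _)))).
 have H s : - L <= s <= L -> expR (- (s / 2)) * N G sb (expR s) z <= expR (L / 2) * (Ccnt * (1 + expR L)).
  move=> /andP[s1 s2]; apply: ler_pM; rewrite ?N_ge0 //.
   by rewrite ler_expR; lra.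
  apply: le_trans (N_le _ dG _ hsb _ z (expR_gt0 s)) _; rewrite ler_wpM2l ?Ccnt_ge0 //.
  by rewrite lerD2l ler_expR.
 have h1 := H t; have h2 := H (- t); rewrite mulNr opprK in h2.
 rewrite /e /et /K mulr_natl mulr2n; apply: lerD; [apply: h1|apply: h2]; by apply/andP; split; lra.
Qed.

(** Cauchy-Schwarz: the variance of [e t] is bounded for [|t| <= L] and that of the j-th iterate is
    at most [th^j M0]. The square root accounts for the condition [th <= th'^2]. *)
Let Qloc (L : R) : exists C : R, forall j t, `|t| <= L -> Qe j t <= C * th' ^+ j.
Proof.
have [B B0 hB] := Var_loc L; pose E := B * M0 + 1.
have E0 : 0 <= E by rewrite addr_ge0 // mulr_ge0.
exists (E + M0) => j t tL; rewrite /Qe -CovE mulrDl; apply: lerD; last first.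
 rewrite mulrC; apply: ler_wpM2l => //; apply: lerXn2r; rewrite ?nnegrE //.
  by have /andP[] := hA01; lra.
 pos.
have c2 := Cov_sqr mu v0 _ _ (proj1 (be t)) (proj1 (bP j)).
have tj : 0 <= th' ^+ j by pos.
have hV : Var mu (e t) * Var mu (Pf j) <= (E * th' ^+ j) ^+ 2.
 apply: (@le_trans _ _ (B * (th ^+ j * M0))).
  apply: ler_pM; [apply: Var_ge0 => //; exact: (proj1 (be t))|apply: Var_ge0 => //; exact: (proj1 (bP j))|exact: hB|exact: VarP].
 rewrite exprMn mulrCA mulrC; apply: ler_pM => //; rewrite ?exprn_ge0 ?mulr_ge0 //.
  have : 0 <= B * M0 by pos.
  by rewrite /E; move: (B * M0) => y y0; nra.
 by rewrite exprAC; apply: lerXn2r => //; rewrite nnegrE sqr_ge0.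
apply: le_trans (ler_norm _) _.
rewrite -(ler_pXn2r (n := 2)) ?nnegrE ?mulr_ge0 //.
by rewrite real_normK ?num_real //; exact: le_trans c2 hV.
Qed.

Lemma var_et_growth_cusp (b : R) : (forall Q, decaying gm th' Q ->
  exists C : R, forall T : R, (0 <= T)%R ->
   exists2 t : R, (T <= t <= T + 1)%R & (Q 0 t <= C * expR (b * t))%R) ->
 exists C : R, forall T : R, 0 <= T ->
  exists2 t : R, T <= t <= T + 1 & Var mu (et G sb t) <= C * expR (2 * b * t).
Proof.
move=> H; have [C hC] := H Qe (And4 mQ Q0 (fun j => QA_Q0 j (Q0 j)) Qloc).
exists (C / 2) => T T0; have [|s /andP[s1 s2] hs] := hC (2 * T); first by pos.
exists (s / 2); first by apply/andP; split; lra.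
move: hs; rewrite Q_var (_ : 2 * b * (s / 2) = b * s); last by lra.
lra.
Qed.

End cusp.

(** The trivial size of the variance is [exp t], so [2 b < 1] is a power saving. The exponent comes
    from the spectral gap and from [gam], neither of which involves the cusp; only [C] depends on
    [sb]. *)
Theorem var_et_growth (hN : G (- 1%:M)) : (exists sb, scaling_matrix G sb) ->
 exists2 b : R, 0 <= b < 2^-1 & forall sb, scaling_matrix G sb ->
  exists C : R, forall T : R, 0 <= T ->
   exists2 t : R, T <= t <= T + 1 & Var mu (et G sb t) <= C * expR (2 * b * t).
Proof.
move=> [s0 hs0]; have [th /andP[th0 th1] gap] := automorphic_gap _ dG hN _ hF mF finF.
have g0 u : 0 <= gm u by exact: gam_ge0 _ (@rho0_ge1 R) u.
have mg : mfunT gm by exact: measurable_gam _ (@rho0_ge1 R).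
have glow := gam_lower _ (@rho0_ge1 R).
have gmN u : gm (- u) = gm u by exact: gamN.
have /andP[hA0 hA1] := hA_lt1 gm mg g0 (gam_cosh _ hs0) glow.
pose th' := Num.max (Num.sqrt th) (hA gm).
have th'A : hA gm <= th' by rewrite le_max lexx orbT.
have th'0 : 0 < th' by apply: lt_le_trans th'A; lra.
have th'1 : th' < 1 by rewrite gt_max hA1 andbT -sqrtr1 ltr_sqrt.
have th'2 : th <= th' ^+ 2.
 by rewrite -{1}(sqr_sqrtr th0) lerXn2r ?nnegrE ?(ltW th'0) // le_max lexx.
have th'01 : 0 < th' < 1 by rewrite th'0.
have [b b0 H] := convolution_decay_point gm mg g0 gmN (gam_cosh _ hs0) glow th' th'01 th'A.
exists b => // sb hsb; exact: (var_et_growth_cusp sb hsb th th0 gap th' th'0 th'2 th'A b H).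
Qed.

End variance_growth.

(** * Two integrals *)

Section half_disc.
Context {R : realType}.
Notation L1 := (@lebesgue_measure R).
Implicit Types (a b s x : R).

Lemma FTC_open (f F : R -> R) a b : a < b -> (forall x, a < x < b -> is_derive x 1 F (f x)) ->
 continuous F -> continuous f -> (\int[L1]_(x in `[a, b]) (f x)%:E = (F b - F a)%:E)%E.
Proof.
move=> ab dF cF cf; rewrite (@continuous_FTC2 _ _ F) //.
- exact: continuous_subspaceT.
- split => [x||].
 + by rewrite in_itv => /dF xd; exact: ex_derive.
 + by apply: cvg_at_right_filter; exact: cF.
 + by apply: cvg_at_left_filter; exact: cF.
- by move=> x; rewrite in_itv => /dF xd; rewrite derive1E; exact: derive_val.
Qed.

Let continuous_sqrt_comp (g : R -> R) : continuous g -> continuous (fun s => Num.sqrt (g s)).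
Proof. by move=> cg s; apply: continuous_comp; [exact: cg|exact: sqrt_continuous]. Qed.

(** The area of the half-disc with diameter [[a, b]], computed by the substitution
    [s = m - r cos x]. *)
Lemma integral_half_disc a b : a <= b ->
 (\int[L1]_s (Num.sqrt (b - s) * Num.sqrt (s - a))%:E = (pi * (b - a) ^+ 2 / 8)%:E)%E.
Proof.
pose G s := Num.sqrt (b - s) * Num.sqrt (s - a).
have G0 s : ~~ (a <= s <= b) -> G s = 0.
 rewrite negb_and -!ltNge /G => /orP[h|h].
  by rewrite [X in _ * X]ler0_sqrtr ?mulr0 // subr_le0 ltW.
 by rewrite ler0_sqrtr ?mul0r // subr_le0 ltW.
rewrite le_eqVlt => /predU1P[ab|ab].
 rewrite (_ : b - a = 0) ?ab ?subrr // expr0n mulr0 mul0r; apply: integral0_eq => s _.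
 rewrite -ab; have [->|sa] := eqVneq s a; first by rewrite subrr sqrtr0 mulr0.
 by have := G0 s; rewrite /G -ab => -> //; rewrite -eq_le eq_sym.
rewrite -/G; have -> : (\int[L1]_s (G s)%:E = \int[L1]_(s in `[a, b]) (G s)%:E)%E.
 rewrite [RHS]integral_mkcond; apply: eq_integral => s _; rewrite patchE mem_setE in_itv /=.
 by case: ifPn => // /G0 ->.
pose m := (a + b) / 2; pose r := (b - a) / 2; have r0 : 0 < r by rewrite /r; lra.
pose F x := m - r * cos x.
have F0 : F 0 = a by rewrite /F cos0 /m /r; lra.
have Fp : F pi = b by rewrite /F cospi /m /r; lra.
have dF x : is_derive x 1 F (r * sin x).
 by apply: is_derive_eq; rewrite /GRing.scale /=; ring.
have F' : F^`()%classic = fun x => r * sin x.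
 by apply/funext => x; rewrite derive1E; exact: (@derive_val _ _ _ _ _ _ _ (dF x)).
have cF : continuous F.
 by move=> x; apply: differentiable_continuous; apply/derivable1_diffP; exact: (@ex_derive _ _ _ _ _ _ _ (dF x)).
have cF' : continuous (fun x : R => r * sin x).
 by move=> x; apply: cvgM; [exact: cvg_cst|exact: continuous_sin].
have pi0 : (0 : R) < pi by pos.
rewrite -{1}F0 -{1}Fp integration_by_substitution_increasing; first last.
- apply: continuous_subspaceT => s; apply: cvgM; move: s.
  by apply: continuous_sqrt_comp => s; apply: cvgB; [exact: cvg_cst|exact: cvg_id].
 by apply: continuous_sqrt_comp => s; apply: cvgB; [exact: cvg_id|exact: cvg_cst].
- split => [x _||].
 + done.
 + by apply: cvg_at_right_filter; exact: cF.
 + by apply: cvg_at_left_filter; exact: cF.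
- by rewrite F'; apply/cvg_ex; exists (r * sin pi); apply: cvg_at_left_filter; exact: cF'.
- by rewrite F'; apply/cvg_ex; exists (r * sin 0); apply: cvg_at_right_filter; exact: cF'.
- by rewrite F' => x _; exact: cF'.
- by move=> x y xi yi xy; rewrite /F ltrD2l ltrN2 ltr_pM2l // ltr_cos.
- pos.
have -> : (\int[L1]_(x in `[0%R, pi]) (((G \o F) * F^`()%classic) x)%:E =
  \int[L1]_(x in `[0%R, pi]) (r ^+ 2 * (sin x * sin x))%:E)%E.
 apply: eq_integral => x; rewrite inE /= in_itv /= => xp; rewrite F' /G; congr (_%:E).
 have s0 : 0 <= sin x by apply: sin_ge0_pi.
 transitivity (Num.sqrt (b - F x) * Num.sqrt (F x - a) * (r * sin x)); first by [].
 have -> : b - F x = r * (1 + cos x) by rewrite /F /m /r; lra.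
 have -> : F x - a = r * (1 - cos x) by rewrite /F /m /r; lra.
 rewrite -sqrtrM; last by pos.
 have -> : r * (1 + cos x) * (r * (1 - cos x)) = (r * sin x) ^+ 2.
  by have := cos2Dsin2 x => cs; rewrite exprMn (_ : sin x ^+ 2 = 1 - cos x ^+ 2); [ring|rewrite -cs; ring].
 by rewrite sqrtr_sqr (ger0_norm (mulr_ge0 (ltW r0) s0)) expr2 mulrACA.
pose H (x : R) := r ^+ 2 * ((x - sin x * cos x) / 2).
have dH x : is_derive x 1 H (r ^+ 2 * (sin x * sin x)).
 apply: is_derive_eq; rewrite /GRing.scale /=.
 have := cos2Dsin2 x => cs.
 transitivity (r ^+ 2 * ((1 - (cos x ^+ 2 - sin x ^+ 2)) / 2)); first by ring.
 have -> : 1 - (cos x ^+ 2 - sin x ^+ 2) = 2 * (sin x * sin x) by move: cs; rewrite !expr2; lra.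
 by field.
have cH : continuous H.
 by move=> x; apply: differentiable_continuous; apply/derivable1_diffP; exact: (@ex_derive _ _ _ _ _ _ _ (dH x)).
have ch : continuous (fun x : R => r ^+ 2 * (sin x * sin x)).
 by move=> x; apply: cvgM; [exact: cvg_cst|apply: cvgM; exact: continuous_sin].
rewrite (FTC_open _ H 0 pi pi0 (fun x _ => dH x) cH ch).
by rewrite /H sin0 mul0r subrr mul0r mulr0 subr0 sinpi mul0r subr0 /r; congr (_%:E); field.
Qed.

Lemma integral_mul_sqrt : (\int[L1]_(x in `[0%R, 1%R]) (x * Num.sqrt (1 - x))%:E = (4 / 15)%:E)%E.
Proof.
pose F x := 2 / 5 * ((1 - x) * (1 - x)) * Num.sqrt (1 - x) - 2 / 3 * (1 - x) * Num.sqrt (1 - x) : R.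
have cs : continuous (fun x : R => Num.sqrt (1 - x)).
 by apply: continuous_sqrt_comp => s; apply: cvgB; [exact: cvg_cst|exact: cvg_id].
have cl : continuous (fun x : R => 1 - x) by move=> x; apply: cvgB; [exact: cvg_cst|exact: cvg_id].
have dF x : 0 < x < 1 -> is_derive x 1 F (x * Num.sqrt (1 - x)).
 move=> /andP[_ x1]; have d0 : 0 < 1 - x by lra.
 have := is_derive1_sqrt d0 => ds.
 apply: is_derive_eq; rewrite /GRing.scale /=.
 have s0 : 0 < Num.sqrt (1 - x) by rewrite sqrtr_gt0.
 have e : Num.sqrt (1 - x) ^+ 2 = 1 - x by rewrite sqr_sqrtr // ltW.
 move: s0 e; move: (Num.sqrt (1 - x)) => s s0 e.
 have -> : x = 1 - s ^+ 2 by rewrite e; ring.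
 by field; rewrite gt_eqF.
have cF : continuous F.
 move=> x; apply: cvgB; apply: cvgM; try exact: cs; apply: cvgM; try exact: cvg_cst.
  by apply: cvgM; exact: cl.
 exact: cl.
have cf : continuous (fun x : R => x * Num.sqrt (1 - x)) by move=> x; apply: cvgM; [exact: cvg_id|exact: cs].
rewrite (FTC_open (fun x => x * Num.sqrt (1 - x)) F 0 1 ltr01 dF cF cf).
by rewrite /F subrr sqrtr0 subr0 sqrtr1; congr (_%:E); field.
Qed.

Lemma integral_profile (c : R) : 0 < c ->
 (\int[L1]_(s in `]0%R, +oo[) (c * s * Num.sqrt (1 - c * s))%:E = (4 / 15 / c)%:E)%E.
Proof.
move=> c0; pose g (p : R) : \bar R := ((0 < p)%R%:R * (p * Num.sqrt (1 - p)))%:E.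
have cs : continuous (fun x : R => Num.sqrt (1 - x)).
 by apply: continuous_sqrt_comp => s; apply: cvgB; [exact: cvg_cst|exact: cvg_id].
have mg : mfunT g.
 apply/measurable_EFinP; apply: measurable_funM.
  by mf.
 by apply: continuous_measurable_fun => x; apply: cvgM; [exact: cvg_id|exact: cs].
have g0 p : (0 <= g p)%E.
 rewrite lee_fin; case: (boolP (0 < p)) => p0; last by rewrite mul0r.
 by pos.
have I1 : (\int[L1]_p g p = (4 / 15)%:E)%E.
 rewrite -integral_mul_sqrt [RHS]integral_mkcond; apply: eq_integral => p _.
 rewrite patchE mem_setE in_itv /= /g; case: (ltgtP 0 p) => [p0|p0|<-] /=; rewrite ?mul1r ?mul0r //.
  by case: leP => // p1; rewrite ler0_sqrtr ?mulr0 // subr_le0 ltW.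
 by rewrite ler01.
have := integral_scale c g c0 mg g0; rewrite I1 ge0_integralZr ?lee_fin ?(ltW c0) //; last first.
 by mf.
move=> /(congr1 (fun e => e * (c^-1)%:E)%E); rewrite -muleA -EFinM mulfV ?gt_eqF // mule1 -EFinM => <-.
rewrite [LHS]integral_mkcond; apply: eq_integral => s _; rewrite patchE mem_setE in_itv /= andbT /g pmulr_rgt0 //.
by case: (0 < s); rewrite ?mul1r ?mul0r.
Qed.

End half_disc.

(** * Unfolded integrals of the test function *)

Section horocycle_coordinates.
Context {R : realType}.
Notation P := (plane R).
Notation L1 := (@lebesgue_measure R).
Notation L2 := (L1 \x L1)%E.
Implicit Types (z : P).

Lemma measurable_Xc : mfunT (@Xc R).
Proof. by rewrite /Xc; mf. Qed.

Lemma measurable_al : mfunT (@al R).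
Proof. by rewrite /al; mf. Qed.

(** In the real part [X] and the inverse height [s] the invariant area is [dX ds]. *)
Lemma integral_horo (H : P -> \bar R) : mfunT H -> (forall z, (0 <= H z)%E) ->
 (\int[L2]_z H (Xc z, al z) = \int[L1]_(s in `]0%R, +oo[) \int[L1]_X H (X, s))%E.
Proof.
move=> mH H0; have mHc : mfunT (fun z : P => H (Xc z, al z)).
 exact: (measurableT_comp mH (measurable_fun_pair measurable_Xc measurable_al)).
rewrite (integral_plane21 (fun z => H (Xc z, al z)) mHc (fun z => H0 _)).
pose J (s : R) : \bar R := (\int[L1]_X H (X, s))%E.
have J0 s : (0 <= J s)%E by apply: integral_ge0.
have mJ : mfunT J.
 apply: (measurable_fun_fubini_tonelli_F (m2 := L1) (fun x : plane R => H (x.2, x.1))).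
  mf.
 by move=> x.
have E (v : R) : (\int[L1]_t H (Xc (t, v), al (t, v)) = J (expR (- v)) * (expR (- v))%:E)%E.
 have mh : mfunT (fun X : R => H (X, expR (- v))) by mf.
 have := integral_scale (expR v) _ (expR_gt0 v) mh (fun X => H0 _); rewrite -/(J (expR (- v))) => <-.
 rewrite ge0_integralZr; mf.
 rewrite -muleA -EFinM -expRD subrr expR0 mule1.
 by apply: eq_integral => t _; rewrite /Xc /al mulrC.
under eq_integral do rewrite E.
have mhe : mfunT (fun v : R => J (expR v) * (expR v)%:E)%E.
 apply: emeasurable_funM; first by mf.
 by mf.
rewrite (integral_reflect (fun v => J (expR v) * (expR v)%:E)%E) //; last first.
 by move=> v; rewrite mule_ge0 // lee_fin expR_ge0.
exact: integral_expR.
Qed.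

End horocycle_coordinates.

Section test_function.
Context {R : realType}.
Notation P := (plane R).
Notation L1 := (@lebesgue_measure R).
Notation L2 := (L1 \x L1)%E.
Implicit Types (z : P) (s x y X : R).
Context (chi : R -> R) (Lam : R) (mchi : mfunT chi) (chi0 : forall X, 0 <= chi X <= 2)
 (chiL : forall X X', `|chi X - chi X'| <= Lam * `|X - X'|).

Let chi_ge0 X : 0 <= chi X. Proof. by have /andP[] := chi0 X. Qed.
Let chi_le2 X : chi X <= 2. Proof. by have /andP[] := chi0 X. Qed.
Let Lam0 : 0 <= Lam.
Proof. by have := chiL 1 0; rewrite subr0 normr1 mulr1; exact: le_trans. Qed.

Let near (r w X : R) : R := (`|X - r| < w)%R%:R.
Let measurable_near r w : mfunT (near r w).
Proof. by rewrite /near; mf. Qed.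

Let integral_near r w (k : R) : 0 <= w -> 0 <= k -> (\int[L1]_X (k * near r w X)%:E = (k * (2 * w))%:E)%E.
Proof.
move=> w0 k0; have mn : mfunT (fun X : R => (near r w X)%:E) by mf.
transitivity (\int[L1]_X (k%:E * (near r w X)%:E))%E; first by apply: eq_integral.
rewrite ge0_integralZl_EFin //; last by move=> X _; rewrite lee_fin /near ler0n.
rewrite EFinM; congr (_ * _)%E.
have -> : (\int[L1]_X (near r w X)%:E = \int[L1]_X (\1_(`]r - w, r + w[%classic) X)%:E)%E.
 apply: eq_integral => X _; rewrite indicE mem_setE in_itv /= /near ltr_norml; congr ((nat_of_bool _)%:R%:E).
 lra.
rewrite integral_indic // setIT /= lebesgue_measure_itv /= lte_fin.
move: w0; rewrite le_eqVlt => /predU1P[<-|w0]; first by rewrite subr0 addr0 ltxx mulr0.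
by rewrite ifT -?EFinD; [congr (_%:E); ring|lra].
Qed.

(** The mass of [chi] on the interval of half-width [w] about [r]. It is bounded trivially, and
    compared with [2 w chi r] up to [2 Lam w^2] by the Lipschitz condition. *)
Let Jw (r w : R) : \bar R := (\int[L1]_X (chi X * near r w X)%:E)%E.

Let mcn r w : mfunT (fun X : R => (chi X * near r w X)%:E).
Proof. by mf. Qed.

Let Jw_ge0 r w : (0 <= Jw r w)%E.
Proof. by apply: integral_ge0 => X _; rewrite lee_fin mulr_ge0 // /near ler0n. Qed.

Let Jw_le r w : 0 <= w -> (Jw r w <= (4 * w)%:E)%E.
Proof.
move=> w0; have -> : 4 * w = 2 * (2 * w) by ring.
rewrite -(integral_near r w 2) //; apply: ge0_le_integral => //.
- by move=> X _; rewrite lee_fin mulr_ge0 // /near ler0n.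
- mf.
- by mf.
- by move=> X _; rewrite lee_fin ler_wpM2r // /near ler0n.
Qed.

Let Jw_upper r w : 0 <= w -> (Jw r w <= (chi r * (2 * w) + 2 * Lam * w ^+ 2)%:E)%E.
Proof.
move=> w0; have -> : chi r * (2 * w) + 2 * Lam * w ^+ 2 = (chi r + Lam * w) * (2 * w) by ring.
rewrite -(integral_near r w) //; last by pos.
apply: ge0_le_integral => //.
- by move=> X _; rewrite lee_fin mulr_ge0 // /near ler0n.
- mf.
- by mf.
- move=> X _; rewrite lee_fin /near; case: (boolP (`|(X : R) - r| < w)%R) => h; last by rewrite !mulr0.
 rewrite !mulr1; have := chiL X r; rewrite ler_norml => /andP[_ h2].
 have : Lam * `|(X : R) - r| <= Lam * w by rewrite ler_wpM2l // ltW.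
 by lra.
Qed.

Let Jw_lower r w : 0 <= w -> ((chi r * (2 * w))%:E <= Jw r w + (2 * Lam * w ^+ 2)%:E)%E.
Proof.
move=> w0; have -> : 2 * Lam * w ^+ 2 = (Lam * w) * (2 * w) by ring.
rewrite -!(integral_near r w) ?mulr_ge0 // -(ge0_integralD L1 measurableT); first last.
- by mf.
- by move=> X _; rewrite lee_fin mulr_ge0 ?mulr_ge0 // /near ler0n.
- mf.
- by move=> X _; rewrite lee_fin mulr_ge0 // /near ler0n.
apply: ge0_le_integral => //.
- by move=> X _; rewrite lee_fin mulr_ge0 // /near ler0n.
- by mf.
- apply: emeasurable_funD; first mf.
 apply/measurable_EFinP.
 by mf.
- move=> X _; rewrite -EFinD lee_fin /near; case: (boolP (`|(X : R) - r| < w)%R) => h; last by rewrite !mulr0 addr0.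
 rewrite !mulr1; have := chiL X r; rewrite ler_norml => /andP[h2 _].
 have : Lam * `|(X : R) - r| <= Lam * w by rewrite ler_wpM2l // ltW.
 by lra.
Qed.

Context (c1 : R) (c10 : 0 < c1).

(** The square root of a negative number is 0, so the profile is cut off at [s = 1 / c1] without an
    indicator. Its product with the half-width [w] below is a multiple of the square root of a
    quadratic polynomial, which integrates in closed form to a truncated square, the shape needed
    for second differences. *)
Definition prof s : R := c1 * s * Num.sqrt (1 - c1 * s).
Definition psit z : R := chi (Xc z) * prof (al z).

Lemma prof_ge0 s : 0 <= s -> 0 <= prof s.
Proof. by move=> s0; rewrite mulr_ge0 // mulr_ge0 // ltW. Qed.

Lemma measurable_prof : mfunT prof.
Proof.
have ms : mfunT (@Num.sqrt R) by apply: continuous_measurable_fun => s; exact: sqrt_continuous.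
by rewrite /prof; mf.
Qed.

Lemma psit_ge0 z : 0 <= psit z.
Proof. by rewrite mulr_ge0 // prof_ge0 // ltW // al_gt0. Qed.

Lemma measurable_psit : mfunT psit.
Proof.
by apply: measurable_funM; [exact: (measurableT_comp mchi measurable_Xc)|exact: (measurableT_comp measurable_prof measurable_al)].
Qed.

(** [p * sqrt (1 - p) <= 1 / 2] for [p] between 0 and 1 compensates for [chi <= 2]. *)
Lemma psit_le z : psit z <= (al z < c1^-1)%R%:R.
Proof.
rewrite /psit /prof; have := al_gt0 z; move: (al z) => s s0; set p := c1 * s.
have p0 : 0 < p by rewrite mulr_gt0.
have -> : (s < c1^-1) = (p < 1) by rewrite -div1r ltr_pdivlMr // mulrC.
case: (boolP (p < 1)) => [p1|]; last first.
 by rewrite -leNgt => p1; rewrite ler0_sqrtr ?subr_le0 // !mulr0.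
have q0 := sqrtr_ge0 (1 - p); have q2 : Num.sqrt (1 - p) ^+ 2 = 1 - p by rewrite sqr_sqrtr // subr_ge0 ltW.
have q1 : p * Num.sqrt (1 - p) <= 2^-1.
 move: q0 q2; move: (Num.sqrt _) => q q0 q2.
 have -> : p = 1 - q ^+ 2 by rewrite q2; ring.
 have : 0 <= (q - 2^-1) ^+ 2 by pos.
 have q1 : q <= 1 by rewrite -(@ler_pXn2r _ 2) ?nnegrE // q2 expr1n; lra.
 nra.
rewrite mulr1n; apply: (@le_trans _ _ (2 * 2^-1)); last by rewrite mulfV.
by apply: ler_pM => //; pos.
Qed.

Lemma integral_psit_strip (m : R) : (forall X, chi (X + 1) = chi X) ->
 (\int[L1]_(X in `[0%R, 1%R]) (chi X)%:E = m%:E)%E ->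
 (\int[L2]_z (psit z * (strip z)%:R)%:E = (m * (4 / 15 / c1))%:E)%E.
Proof.
move=> _ hm; pose u X : R := (0 <= X < 1)%R%:R.
have mu : mfunT u.
 apply: measurable_fun_natb; apply: measurable_and.
  by apply: measurable_fun_ler; mf.
 by mf.
pose H (p : P) : \bar R := (chi p.1 * prof (Num.max 0 p.2) * u p.1)%:E.
have mH : mfunT H.
 apply/measurable_EFinP; apply: measurable_funM; last mf.
 apply: measurable_funM; first mf.
 apply: (measurableT_comp measurable_prof); apply: measurable_maxr; first mf.
 mf.
have H0 p : (0 <= H p)%E.
 by rewrite lee_fin mulr_ge0 // mulr_ge0 // prof_ge0 // le_max lexx.
have := integral_horo H mH H0.
have -> : (\int[L2]_z H (Xc z, al z) = \int[L2]_z (psit z * (strip z)%:R)%:E)%E.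
 by apply: eq_integral => z _; rewrite /H max_r ?ltW ?al_gt0.
move=> ->.
have mcu : mfunT (fun X : R => (chi X * u X)%:E) by mf.
have Im : (\int[L1]_X (chi X * u X)%:E = m%:E)%E.
 rewrite -hm -integral_itv_bndo_bndc; last by apply: measurable_funTS; mf.
 rewrite [RHS]integral_mkcond; apply: eq_integral => X _; rewrite patchE mem_setE in_itv /= /u.
 by case: ifP => _; rewrite ?mulr1 ?mulr0.
have m0 : 0 <= m.
 by rewrite -lee_fin -Im; apply: integral_ge0 => X _; rewrite lee_fin mulr_ge0 // ler0n.
rewrite EFinM -(integral_profile c1 c10) -ge0_integralZl_EFin //; last 2 first.
- by move=> s; rewrite /= in_itv andbT => s0; rewrite lee_fin; pos.
- by apply: measurable_funTS; apply/measurable_EFinP; exact: measurable_prof.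
apply: eq_integral => s; rewrite inE /= in_itv /= andbT => s0.
rewrite -Im muleC -ge0_integralZl_EFin //; last 2 first.
- by move=> X _; rewrite lee_fin mulr_ge0 // ler0n.
- by pos.
by apply: eq_integral => X _; rewrite /H /= max_r ?(ltW s0) // -EFinM; congr (_%:E); rewrite /prof; ring.
Qed.

Section vector.
Context (a c y : R) (c0 : 0 < c) (y0 : 0 < y).

Let w s := Num.sqrt (y * s - c ^+ 2) / (c * s).
Let r := a / c.

Let w_ge0 s : 0 < s -> 0 <= w s.
Proof. by move=> s0; rewrite divr_ge0 // mulr_ge0 // ltW. Qed.

(** Completing the square, [D (a, c) z = s (c X - a)^2 + c^2 / s], so the condition says how close
    [X] is to [a / c]. If [y s <= c^2] the root defining [w] is 0 and both sides are false. *)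
Let ind_near z : ind (a, c) y z = near r (w (al z)) (Xc z).
Proof.
rewrite /ind /near; congr ((nat_of_bool _)%:R).
have s0 := al_gt0 z; set s := al z in s0 *; set X := Xc z.
have -> : D (a, c) z = s * (c * X - a) ^+ 2 + c ^+ 2 / s.
 have ag := al_ga z; rewrite -/s in ag.
 have bX : be z = X * s by rewrite /X Xc_al -/s divfK // gt_eqF.
 have gE : ga z = (1 + (X * s) ^+ 2) / s by rewrite -bX -ag mulrAC mulfV ?mul1r // gt_eqF.
 by rewrite /D /= -/s gE bX; field; rewrite gt_eqF.
have cs0 : 0 < c * s by pos.
have E1 : `|X - r| * (c * s) = `|s * (c * X - a)|.
 by rewrite -(gtr0_norm cs0) -normrM; congr (`|_|); rewrite /r; field; rewrite gt_eqF.
rewrite ltr_pdivlMr // E1.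
have E2 : (s * (c * X - a) ^+ 2 + c ^+ 2 / s < y) = (`|s * (c * X - a)| ^+ 2 < y * s - c ^+ 2).
 rewrite -(ltr_pM2r s0) mulrDl divfK ?gt_eqF // real_normK ?num_real // exprMn.
 lra.
rewrite E2; have [h|h] := leP (y * s - c ^+ 2) 0.
 by rewrite ler0_sqrtr // ltNge (le_trans h (sqr_ge0 _)) ltNge normr_ge0.
by rewrite -[in LHS](sqr_sqrtr (ltW h)) ltr_pXn2r // nnegrE.
Qed.

Let x := y / c1.

Definition mainterm : R := if c ^+ 2 < x then pi / 4 * (Num.sqrt x * (1 - c ^+ 2 / x) ^+ 2 / c) else 0.

Let mw : mfunT w.
Proof.
have ms : mfunT (@Num.sqrt R) by apply: continuous_measurable_fun => s; exact: sqrt_continuous.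
rewrite (_ : w = fun s => Num.sqrt (y * s - c ^+ 2) * expR (- ln (c * s))); first by mf.
apply/funext => s; rewrite /w; have [s0|s0] := ltP 0 s.
 by rewrite expRN lnK // posrE mulr_gt0.
rewrite ler0_sqrtr ?mul0r //; have := sqr_ge0 c; have : y * s <= 0 by rewrite pmulr_rle0.
by lra.
Qed.

Let prof_w s : 0 < s -> prof s * (2 * w s) =
 2 * (c1 / c) * Num.sqrt (c1 * y) * (Num.sqrt (c1^-1 - s) * Num.sqrt (s - c ^+ 2 / y)).
Proof.
move=> s0; rewrite /prof /w.
have -> : 1 - c1 * s = c1 * (c1^-1 - s) by field; rewrite gt_eqF.
have -> : y * s - c ^+ 2 = y * (s - c ^+ 2 / y) by field; rewrite gt_eqF.
rewrite !sqrtrM ?(ltW c10) ?(ltW y0) //; field.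
by rewrite !gt_eqF.
Qed.

Let integral_prof_w : (\int[L1]_(s in `]0%R, +oo[) (prof s * (2 * w s))%:E = mainterm%:E)%E.
Proof.
pose k := 2 * (c1 / c) * Num.sqrt (c1 * y).
have k0 : 0 <= k by rewrite !mulr_ge0 ?invr_ge0 ?(ltW c10) ?(ltW c0).
pose g s : R := Num.sqrt (c1^-1 - s) * Num.sqrt (s - c ^+ 2 / y).
have mg : mfunT g.
 apply: continuous_measurable_fun => s; apply: cvgM.
  by apply: continuous_comp; [apply: cvgB; [exact: cvg_cst|exact: cvg_id]|exact: sqrt_continuous].
 by apply: continuous_comp; [apply: cvgB; [exact: cvg_id|exact: cvg_cst]|exact: sqrt_continuous].
have g0 s : 0 <= g s by rewrite mulr_ge0.
have cy : 0 < c ^+ 2 / y by pos.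
have -> : (\int[L1]_(s in `]0%R, +oo[) (prof s * (2 * w s))%:E = \int[L1]_s (k%:E * (g s)%:E))%E.
 rewrite integral_mkcond; apply: eq_integral => s _; rewrite patchE mem_setE in_itv /= andbT -EFinM.
 case: (ltP 0 s) => s0; first by rewrite prof_w.
 rewrite /g [X in k * (_ * X)]ler0_sqrtr ?mulr0 // subr_le0; exact: le_trans s0 (ltW cy).
rewrite ge0_integralZl_EFin //; [|by move=> s _; rewrite lee_fin|exact/measurable_EFinP].
rewrite /mainterm.
have ltE : (c ^+ 2 < x) = (c ^+ 2 / y < c1^-1).
 by rewrite ltr_pdivrMr // mulrC -/x.
rewrite ltE; case: ltP => h.
 rewrite integral_half_disc ?(ltW h) // -EFinM; congr (_%:E); rewrite /k.
 have xE : y = x * c1 by rewrite /x divfK // gt_eqF.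
 have x0 : 0 < x by rewrite /x divr_gt0.
 have sx0 : 0 < Num.sqrt x by rewrite sqrtr_gt0.
 have -> : Num.sqrt (c1 * y) = c1 * Num.sqrt x.
  have -> : c1 * y = c1 ^+ 2 * x by rewrite {1}xE; ring.
  by rewrite sqrtrM ?sqr_ge0 // sqrtr_sqr gtr0_norm.
 by rewrite {1}xE; field; rewrite !gt_eqF.
have G0 s : g s = 0.
 rewrite /g; have [s1|s1] := leP c1^-1 s; first by rewrite ler0_sqrtr ?mul0r // subr_le0.
 by rewrite [X in _ * X]ler0_sqrtr ?mulr0 // subr_le0 ltW // (lt_le_trans s1).
by under eq_integral do rewrite G0; rewrite integral0 mule0.
Qed.

Let integral_prof_w2 : (\int[L1]_(s in `]0%R, +oo[) (prof s * (2 * Lam * w s ^+ 2))%:E <=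
 (if c ^+ 2 < x then 2 * Lam * (y / c ^+ 2) else 0)%:E)%E.
Proof.
pose k := 2 * Lam * (c1 * y / c ^+ 2).
have k0 : 0 <= k by rewrite !mulr_ge0 ?invr_ge0 ?sqr_ge0 ?(ltW c10) ?(ltW y0).
have wE s : 0 < s -> prof s * (2 * Lam * w s ^+ 2) <= (if c ^+ 2 < x then k * \1_(`[0, c1^-1]%classic) s else 0).
 move=> s0; have [h|h] := leP (y * s - c ^+ 2) 0.
  rewrite /w ler0_sqrtr // mul0r expr0n !mulr0; case: ifP => // _.
  by pos.
 have [s1|s1] := leP c1^-1 s.
  rewrite /prof ler0_sqrtr ?mulr0 ?mul0r; last first.
   by rewrite subr_le0 -(mulfV (lt0r_neq0 c10)) ler_pM2l.
  by case: ifP => _; pos.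
 have hx : c ^+ 2 < x.
  rewrite /x ltr_pdivlMr //; apply: (@lt_trans _ _ (y * s * c1)).
   by rewrite ltr_pM2r // -subr_gt0.
  by rewrite -mulrA gtr_pMr // mulrC -(mulfV (lt0r_neq0 c10)) ltr_pM2l.
 rewrite hx indicE mem_setE in_itv /= (ltW s0) (ltW s1) mulr1.
 rewrite /w exprMn sqr_sqrtr ?(ltW h) // /prof.
 have q1 : Num.sqrt (1 - c1 * s) <= 1.
  by rewrite -[leRHS]sqrtr1 ler_wsqrtr // gerBl mulr_ge0 // ltW.
 have -> : c1 * s * Num.sqrt (1 - c1 * s) * (2 * Lam * ((y * s - c ^+ 2) * (c * s)^-1 ^+ 2)) =
   (2 * Lam * c1 / c ^+ 2) * (Num.sqrt (1 - c1 * s) * ((y * s - c ^+ 2) / s)).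
  by field; rewrite !gt_eqF.
 have -> : k = (2 * Lam * c1 / c ^+ 2) * (1 * y) by rewrite /k; field; rewrite gt_eqF.
 rewrite ler_wpM2l ?divr_ge0 ?sqr_ge0 ?mulr_ge0 ?(ltW c10) //.
 apply: ler_pM; rewrite ?divr_ge0 ?(ltW h) ?(ltW s0) //.
 by rewrite ler_pdivrMr // gerBl sqr_ge0.
pose b : R := if c ^+ 2 < x then k else 0.
have b0 : 0 <= b by rewrite /b; case: ifP.
apply: (@le_trans _ _ (\int[L1]_s (b * \1_(`[0, c1^-1]%classic) s)%:E)%E).
 rewrite integral_mkcond; apply: ge0_le_integral => //.
 - move=> s _; rewrite patchE mem_setE in_itv /= andbT; case: (ltP 0 s) => // s0.
  rewrite lee_fin; apply: mulr_ge0; first by apply: prof_ge0; pos.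
  by pos.
 - have mm : mfunT (fun s : R => (prof s * (2 * Lam * w s ^+ 2))%:E).
   apply/measurable_EFinP; apply: measurable_funM; first exact: measurable_prof.
   by mf.
  by apply/(measurable_restrictT _ _).1 => //; exact: measurable_funTS.
 - by mf.
 - move=> s _; rewrite patchE mem_setE in_itv /= andbT; case: (ltP 0 s) => s0; last by rewrite lee_fin mulr_ge0.
  rewrite lee_fin /b; have := wE s s0; case: ifP => // _; by rewrite mul0r.
rewrite integral_cst_itv ?invr_ge0 ?(ltW c10) // subr0 lee_fin /b; case: ifP => _; last by rewrite mul0r.
by rewrite /k le_eqVlt; apply/orP; left; apply/eqP; field; rewrite !gt_eqF.
Qed.

(** At inverse height [s] the integral over [X] is the mass of [chi] on an interval of half-width
    [w s] about [a / c]. Freezing [chi] at the centre yields [mainterm], by the half-disc integral,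
    and the error is governed by [Lam * w^2]. *)
Lemma vector_integral : exists V : R, [/\ (\int[L2]_z (psit z * ind (a, c) y z)%:E = V%:E)%E,
 0 <= V, V <= 2 * mainterm &
 `|V - chi r * mainterm| <= if c ^+ 2 < x then 2 * Lam * (y / c ^+ 2) else 0].
Proof.
pose H (p : P) : \bar R := (chi p.1 * prof (Num.max 0 p.2) * near r (w p.2) p.1)%:E.
have mnw : mfunT (fun p : P => near r (w p.2) p.1).
 apply: measurable_fun_natb; apply: measurable_fun_ltr; last mf.
 by mf.
have mH : mfunT H.
 apply/measurable_EFinP; apply: measurable_funM; last mf.
 apply: measurable_funM; first mf.
 apply: (measurableT_comp measurable_prof); apply: measurable_maxr; first mf.
 mf.
have H0 p : (0 <= H p)%E.
 by rewrite lee_fin mulr_ge0 // mulr_ge0 // prof_ge0 // le_max lexx.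
pose VE : \bar R := (\int[L1]_(s in `]0%R, +oo[) ((prof s)%:E * Jw r (w s)))%E.
have E : (\int[L2]_z (psit z * ind (a, c) y z)%:E = VE)%E.
 transitivity (\int[L2]_z H (Xc z, al z))%E.
  by apply: eq_integral => z _; rewrite ind_near /H max_r ?ltW ?al_gt0.
 rewrite (integral_horo H mH H0); apply: eq_integral => s; rewrite inE /= in_itv /= andbT => s0.
 rewrite /Jw -ge0_integralZl_EFin //; first last.
 - by apply: prof_ge0; pos.
 - mf.
 - by move=> X _; rewrite lee_fin mulr_ge0 // ler0n.
 by apply: eq_integral => X _; rewrite /H max_r ?(ltW s0) // -EFinM; congr (_%:E); ring.
have pJ0 s : `]0%R, +oo[%classic s -> (0 <= (prof s)%:E * Jw r (w s))%E.
 by rewrite /= in_itv andbT => s0; rewrite mule_ge0 // lee_fin prof_ge0 // ltW.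
have mJw : mfunT (fun s : R => Jw r (w s)).
 apply: (measurable_fun_fubini_tonelli_F (m2 := L1) (fun p : plane R => (chi p.2 * near r (w p.1) p.2)%:E)).
  apply/measurable_EFinP; mf.
  exact: (measurableT_comp mnw (measurable_fun_pair measurable_snd measurable_fst)).
 by move=> p; rewrite lee_fin mulr_ge0 // /near ler0n.
have mpJ : measurable_fun (`]0%R, +oo[%classic : set R) (fun s : R => (prof s)%:E * Jw r (w s))%E.
 apply: measurable_funTS; mf; exact: measurable_prof.
have mpg (g : R -> R) : mfunT g -> measurable_fun (`]0%R, +oo[%classic : set R) (fun s : R => (prof s * g s)%:E).
 move=> mg; mf; exact: measurable_prof.
have pg0 (g : R -> R) : (forall s, 0 < s -> 0 <= g s) -> forall s, `]0%R, +oo[%classic s -> (0 <= (prof s * g s)%:E)%E.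
 move=> g0 s; rewrite /= in_itv /= andbT => s0; rewrite lee_fin; apply: mulr_ge0; last exact: g0.
 by apply: prof_ge0; pos.
have m2w : mfunT (fun s : R => 2 * w s) by mf.
have mw2 : mfunT (fun s : R => 2 * Lam * w s ^+ 2).
 by mf.
have w20 s : 0 < s -> 0 <= 2 * w s by move=> s0; rewrite mulr_ge0 // w_ge0.
have lw20 s : 0 < s -> 0 <= 2 * Lam * w s ^+ 2 by pos.
have oinf s : `]0%R, +oo[%classic s -> 0 < s by rewrite /= in_itv andbT.
have V1 : (VE <= (2 * mainterm)%:E)%E.
 rewrite EFinM -integral_prof_w -ge0_integralZl_EFin //; [|exact: pg0|exact: mpg].
 apply: ge0_le_integral => //.
 - by apply: emeasurable_funM => //; exact: mpg.
 - move=> s /oinf s0; apply: le_trans (_ : ((prof s)%:E * (4 * w s)%:E <= _)%E).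
   by rewrite lee_wpmul2l ?Jw_le ?w_ge0 // lee_fin prof_ge0 // ltW.
  by rewrite -!EFinM lee_fin le_eqVlt; apply/orP; left; apply/eqP; ring.
pose b : R := if c ^+ 2 < x then 2 * Lam * (y / c ^+ 2) else 0.
have mt : (\int[L1]_(s in `]0%R, +oo[) (chi r * (prof s * (2 * w s)))%:E = (chi r * mainterm)%:E)%E.
 by rewrite EFinM -integral_prof_w -ge0_integralZl_EFin //; [exact: pg0|exact: mpg].
have mt0 s : `]0%R, +oo[%classic s -> (0 <= (chi r * (prof s * (2 * w s)))%:E)%E.
 by move=> s0; rewrite EFinM; apply: mule_ge0; [rewrite lee_fin|exact: pg0 w20 s s0].
have mtm : measurable_fun (`]0%R, +oo[%classic : set R) (fun s : R => (chi r * (prof s * (2 * w s)))%:E).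
 apply: measurable_funTS; apply/measurable_EFinP; apply: measurable_funM; first mf.
 by mf; exact: measurable_prof.
have V2 : (VE <= (chi r * mainterm + b)%:E)%E.
 apply: (@le_trans _ _ (\int[L1]_(s in `]0%R, +oo[) ((chi r * (prof s * (2 * w s)))%:E + (prof s * (2 * Lam * w s ^+ 2))%:E))%E).
  apply: ge0_le_integral => //.
  - by apply: emeasurable_funD => //; exact: mpg.
  - move=> s /oinf s0; apply: le_trans (_ : ((prof s)%:E * (chi r * (2 * w s) + 2 * Lam * w s ^+ 2)%:E <= _)%E).
    by rewrite lee_wpmul2l ?Jw_upper ?w_ge0 // lee_fin prof_ge0 // ltW.
   by rewrite -EFinM -EFinD lee_fin le_eqVlt; apply/orP; left; apply/eqP; ring.
 rewrite ge0_integralD //; [|exact: pg0|exact: mpg].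
 by rewrite EFinD mt leeD2l // integral_prof_w2.
have V3 : ((chi r * mainterm)%:E <= VE + b%:E)%E.
 apply: (@le_trans _ _ (VE + \int[L1]_(s in `]0%R, +oo[) (prof s * (2 * Lam * w s ^+ 2))%:E)%E); last first.
  by rewrite leeD2l // integral_prof_w2.
 rewrite -mt -ge0_integralD //; [|exact: pg0|exact: mpg].
 apply: ge0_le_integral => //.
 - by apply: emeasurable_funD => //; exact: mpg.
 - move=> s /oinf s0.
  have p0 : (0 <= (prof s)%:E)%E by rewrite lee_fin prof_ge0 // ltW.
  apply: (@le_trans _ _ ((prof s)%:E * (Jw r (w s) + (2 * Lam * w s ^+ 2)%:E))%E).
   by rewrite mulrCA EFinM lee_wpmul2l // Jw_lower // w_ge0.
  by rewrite ge0_muleDr // lee_fin lw20.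
have V0 : (0 <= VE)%E by apply: integral_ge0.
rewrite E; move: V0 V1 V2 V3; case: (VE) => [V| |] //; rewrite -?EFinD !lee_fin => V0 V1 V2 V3.
by exists V; split => //; rewrite ler_norml -/b; apply/andP; split; lra.
Qed.

End vector.
End test_function.

(** * The smoothed counting function *)

Section real_sums.
Context {R : realType} {T : choiceType} (A : set T).
Implicit Types (f g e : T -> R).

Definition rsum f : R := fine (\esum_(v in A) (f v)%:E)%E.

Lemma rsumE f : (forall v, A v -> 0 <= f v) -> (\esum_(v in A) (f v)%:E < +oo)%E ->
 (\esum_(v in A) (f v)%:E = (rsum f)%:E)%E.
Proof. by move=> f0 ff; rewrite fineK // ge0_fin_numE //; apply: esum_ge0 => v Av; rewrite lee_fin f0. Qed.

Lemma rsum_close f g e (E : R) : (forall v, A v -> 0 <= f v) -> (forall v, A v -> 0 <= g v) ->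
 (forall v, A v -> `|f v - g v| <= e v) -> (\esum_(v in A) (e v)%:E <= E%:E)%E ->
 (\esum_(v in A) (f v)%:E < +oo)%E ->
 (\esum_(v in A) (g v)%:E < +oo)%E /\ `|rsum f - rsum g| <= E.
Proof.
move=> f0 g0 fge eE ff.
have e0 v : A v -> 0 <= e v by move=> /fge; apply: le_trans.
have gle : (\esum_(v in A) (g v)%:E <= \esum_(v in A) (f v)%:E + \esum_(v in A) (e v)%:E)%E.
 rewrite -esumD; [|by pos|by pos].
 apply: le_esum => v Av; rewrite -EFinD lee_fin.
 by have := fge v Av; rewrite ler_norml => /andP[h1 _]; lra.
have fle : (\esum_(v in A) (f v)%:E <= \esum_(v in A) (g v)%:E + \esum_(v in A) (e v)%:E)%E.
 rewrite -esumD; [|by pos|by pos].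
 apply: le_esum => v Av; rewrite -EFinD lee_fin.
 by have := fge v Av; rewrite ler_norml => /andP[_ h1]; lra.
have ef := le_lt_trans eE (ltry _).
have gf : (\esum_(v in A) (g v)%:E < +oo)%E by apply: le_lt_trans gle _; apply: lte_add_pinfty.
split => //; move: gle fle; rewrite (rsumE f f0 ff) (rsumE g g0 gf) (rsumE e e0 ef) -!EFinD !lee_fin => h1 h2.
have : rsum e <= E by rewrite -lee_fin -(rsumE e e0 ef).
by rewrite ler_norml => h; apply/andP; split; lra.
Qed.

End real_sums.

Lemma expR_half {R : realType} (t : R) : expR (t / 2) = expR (- (t / 2)) * expR t.
Proof. by rewrite -expRD; congr expR; lra. Qed.

Lemma periodic_int {R : realType} {T : Type} (f : R -> T) : (forall x, f (x + 1) = f x) ->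
 forall x (n : int), f (x + n%:~R) = f x.
Proof.
move=> pf; have fn (k : nat) y : f (y + k%:R) = f y.
 by elim: k y => [|k IH] y; rewrite ?addr0 // -natr1 addrA pf IH.
move=> x [k|k]; first exact: fn.
by have := fn k.+1 (x - k.+1%:R); rewrite subrK => ->; rewrite NegzE mulrNz.
Qed.

Lemma smooth_exp1 {R : realType} (t u : R) : t - (t - 16 * u) = 16 * u. Proof. ring. Qed.
Lemma smooth_exp2 {R : realType} (t u : R) : - t - (t - 16 * u) = 16 * u - 2 * t. Proof. ring. Qed.

Lemma sqrt_expR {R : realType} (x : R) : Num.sqrt (expR x) = expR (x / 2).
Proof.
have -> : expR x = expR (x / 2) ^+ 2 by rewrite -expRM_natl; congr expR; rewrite -mulr_natl; field.
by rewrite sqrtr_sqr ger0_norm.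
Qed.

Lemma expR1_le4 {R : realType} : expR 1 <= 4 :> R.
Proof.
have h := expR_ge1Dx (- (1 / 2) : R); rewrite expRN in h.
have e0 := expR_gt0 (1 / 2 : R); have h2 : expR (1 / 2) <= 2 :> R.
 by rewrite -[leRHS]invrK -(invrK (expR _)) lef_pV2 ?posrE; lra.
have -> : 1 = 1 / 2 + 1 / 2 :> R by field.
rewrite expRD; apply: le_trans (ler_pM _ _ h2 h2) _; rewrite ?expR_ge0; lra.
Qed.

(** Here [x = exp (16 u)], [t] lies between [6 u] and [6 u + 1], the scale is [c1 = exp (t - 16 u)]
    and the cutoff is [exp (- 9 u)]. The cutoff keeps both errors of [I_Smooth] at order
    [exp (15 u)]; the variance term is of order [exp (16 u - (1/2 - b) t)], at most
    [exp ((13 + 6 b) u)]. *)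
Lemma smooth_arith {R : realType} (S m v k Km C N C' b Lam t u : R) : 0 <= m <= 2 -> 0 < v ->
 0 < k -> 0 <= Km -> 0 <= C -> 0 <= N -> 0 <= C' -> 0 <= b < 1 / 2 -> 0 <= Lam -> 0 <= u -> 6 * u <= t <= 6 * u + 1 ->
 `|S - 4 / 15 * m * expR (16 * u - t) * expR t / v| <=
  4 / 15 * m * expR (16 * u - t) + 4 / 15 * m * expR (16 * u - t) / v +
  expR (t / 2) * Num.sqrt (N * (1 + expR (- (t - 16 * u))) * (4 / 15 * m * expR (16 * u - t)) * (C' * expR (2 * b * t))) +
  (2 * Km * Num.sqrt (expR (16 * u)) * (C * (1 + expR (- 9 * u) * expR (16 * u))) +
  2 * Lam * (expR (t - 16 * u) / expR (- 9 * u)) * (C * (1 + expR (16 * u)))) +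
  (k^-1 + expR t * (2 * Km * Num.sqrt (expR (16 * u - 2 * t)) * (C * (1 + expR (16 * u - 2 * t))))) ->
 `|S - 4 / 15 * (m / v) * expR (16 * u)| <=
  (1 + v^-1 + 2 * Num.sqrt (N * C') + 4 * Km * C + 4 * expR 1 * C + k^-1 + 4 * Km * C) * (1 + Lam) *
  expR ((16 - Num.min 1 (3 - 6 * b)) * u).
Proof.
move=> /andP[m0 m2] v0 k0 K0 C0 N0 C'0 /andP[b0 b1] L0 u0 /andP[t1 t2].
set q := (16 - Num.min 1 (3 - 6 * b)) * u; set Eq := expR q.
have emin : 0 <= Num.min 1 (3 - 6 * b) by rewrite le_min; apply/andP; split; lra.
have q15 : 15 * u <= q.
 by rewrite /q; apply: ler_wpM2r => //; have : Num.min 1 (3 - 6 * b) <= 1 by [rewrite ge_min lexx]; lra.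
have qb : 16 * u - (1 / 2 - b) * t <= q.
 have : Num.min 1 (3 - 6 * b) <= 3 - 6 * b by rewrite ge_min lexx orbT.
 have : (1 / 2 - b) * (6 * u) <= (1 / 2 - b) * t by rewrite ler_wpM2l; lra.
 by rewrite /q => h1 h2; have := ler_wpM2r u0 h2; lra.
have [u16 u7 u4 q0] : [/\ 0 <= 16 * u, 0 <= - 9 * u + 16 * u, 0 <= 4 * u & 0 <= q] by split; lra.
have [f1 f2 f3 f4 f5] : [/\ 16 * u - t <= 15 * u, 16 * u / 2 + (- 9 * u + 16 * u) <= 15 * u,
 t - 16 * u + 9 * u + 16 * u <= 1 + q, 16 * u - 2 * t <= 4 * u & t + (16 * u - 2 * t) / 2 + 4 * u <= 15 * u].
 by split; lra.
have le15 (p : R) : p <= 15 * u -> expR p <= Eq by move=> h; rewrite ler_expR (le_trans h).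
have E0 : 0 <= Eq by exact: expR_ge0.
have vV0 : 0 <= v^-1 by pos.
have kV0 : 0 <= k^-1 by pos.
have Es : expR (16 * u - t) * expR t = expR (16 * u) by rewrite -expRD; congr expR; ring.
have -> : 4 / 15 * m * expR (16 * u - t) * expR t / v = 4 / 15 * (m / v) * expR (16 * u) by rewrite -Es; ring.
move=> H; apply: le_trans H _.
have a1 : 4 / 15 * m * expR (16 * u - t) <= Eq.
 have h1 := le15 _ f1; have h2 := expR_ge0 (16 * u - t); nra.
have a0 : 0 <= 4 / 15 * m * expR (16 * u - t) by pos.
have a2 : 4 / 15 * m * expR (16 * u - t) / v <= v^-1 * Eq by rewrite mulrC ler_wpM2l.
have a3 : expR (t / 2) * Num.sqrt (N * (1 + expR (- (t - 16 * u))) * (4 / 15 * m * expR (16 * u - t)) * (C' * expR (2 * b * t)))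
  <= 2 * Num.sqrt (N * C') * Eq.
 have -> : - (t - 16 * u) = 16 * u - t by ring.
 pose s := expR (16 * u - t + b * t).
 have s2 : s ^+ 2 = expR (16 * u - t) * expR (16 * u - t) * expR (2 * b * t).
  by rewrite /s -expRM_natl -!expRD; congr expR; ring.
 have h1 : 1 <= 4 * expR (16 * u - t).
  apply: le_trans (_ : expR 1 * expR (16 * u - t) <= _); last by rewrite ler_wpM2r ?expR1_le4.
  by rewrite -expRD -[leLHS]expR0 ler_expR; lra.
 have h2 : N * (1 + expR (16 * u - t)) * (4 / 15 * m * expR (16 * u - t)) * (C' * expR (2 * b * t)) <= (N * C') * (2 * s) ^+ 2.
  have -> : (N * C') * (2 * s) ^+ 2 = N * (5 * expR (16 * u - t)) * (4 / 5 * expR (16 * u - t)) * (C' * expR (2 * b * t)).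
   by rewrite exprMn s2; field.
  apply: ler_wpM2r; first by pos.
  have ep := expR_ge0 (16 * u - t).
  apply: ler_pM => //; [by pos| |].
   by apply: ler_wpM2l => //; lra.
  by apply: ler_wpM2r => //; lra.
 have s0 : 0 <= s by exact: expR_ge0.
 apply: le_trans (_ : expR (t / 2) * (Num.sqrt (N * C') * (2 * s)) <= _).
  rewrite ler_wpM2l //; apply: le_trans (ler_wsqrtr h2) _.
  by rewrite sqrtrM ?mulr_ge0 // sqrtr_sqr ger0_norm // mulr_ge0.
 have -> : expR (t / 2) * (Num.sqrt (N * C') * (2 * s)) = 2 * Num.sqrt (N * C') * (expR (t / 2) * s) by ring.
 apply: ler_wpM2l; first by pos.
 by rewrite /s -expRD ler_expR; lra.
have one_le (p : R) : 0 <= p -> 1 + expR p <= 2 * expR p.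
 by move=> p0; have : 1 <= expR p by [rewrite -[leLHS]expR0 ler_expR]; lra.
have KC0 : 0 <= Km * C by pos.
have a4 : 2 * Km * Num.sqrt (expR (16 * u)) * (C * (1 + expR (- 9 * u) * expR (16 * u))) <= 4 * Km * C * Eq.
 rewrite sqrt_expR -expRD; have h := one_le _ u7.
 apply: le_trans (_ : 2 * Km * expR (16 * u / 2) * (C * (2 * expR (- 9 * u + 16 * u))) <= _).
  by rewrite ler_wpM2l ?mulr_ge0 // ler_wpM2l.
 have -> : 2 * Km * expR (16 * u / 2) * (C * (2 * expR (- 9 * u + 16 * u))) = 4 * (Km * C) * expR (16 * u / 2 + (- 9 * u + 16 * u)).
  by rewrite (expRD (16 * u / 2)); ring.
 by rewrite -!mulrA ler_wpM2l // ler_wpM2l // ler_wpM2l // le15 //; rewrite ?mulrA.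
have a5 : 2 * Lam * (expR (t - 16 * u) / expR (- 9 * u)) * (C * (1 + expR (16 * u))) <= 4 * expR 1 * C * Lam * Eq.
 have h := one_le _ u16.
 apply: le_trans (_ : 2 * Lam * (expR (t - 16 * u) / expR (- 9 * u)) * (C * (2 * expR (16 * u))) <= _).
  by rewrite ler_wpM2l ?mulr_ge0 // ler_wpM2l.
 have -> : 2 * Lam * (expR (t - 16 * u) / expR (- 9 * u)) * (C * (2 * expR (16 * u))) =
   4 * (Lam * C) * expR (t - 16 * u + 9 * u + 16 * u).
  by rewrite (expRD (t - 16 * u + 9 * u)) (expRD (t - 16 * u)) -expRN mulNr opprK; ring.
 have -> : 4 * expR 1 * C * Lam * Eq = 4 * (Lam * C) * (expR 1 * Eq) by ring.
 by rewrite ler_wpM2l ?mulr_ge0 // -expRD ler_expR.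
have a6 : k^-1 <= k^-1 * Eq by rewrite ler_peMr // -expR0 ler_expR.
have a7 : expR t * (2 * Km * Num.sqrt (expR (16 * u - 2 * t)) * (C * (1 + expR (16 * u - 2 * t)))) <= 4 * Km * C * Eq.
 have h : 1 + expR (16 * u - 2 * t) <= 2 * expR (4 * u).
  have : 1 <= expR (4 * u) by rewrite -[leLHS]expR0 ler_expR.
  have : expR (16 * u - 2 * t) <= expR (4 * u) by rewrite ler_expR.
  by move=> h5 h4; rewrite (mulr_natl (expR (4 * u)) 2) mulr2n; exact: lerD.
 rewrite sqrt_expR.
 apply: le_trans (_ : expR t * (2 * Km * expR ((16 * u - 2 * t) / 2) * (C * (2 * expR (4 * u)))) <= _).
  by rewrite ler_wpM2l // ler_wpM2l ?mulr_ge0 // ler_wpM2l.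
 have -> : expR t * (2 * Km * expR ((16 * u - 2 * t) / 2) * (C * (2 * expR (4 * u)))) =
  4 * (Km * C) * expR (t + (16 * u - 2 * t) / 2 + 4 * u) by rewrite (expRD (t + (16 * u - 2 * t) / 2)) (expRD t); ring.
 by rewrite -!mulrA ler_wpM2l // ler_wpM2l // ler_wpM2l // le15 //; rewrite ?mulrA.
have sq0 : 0 <= Num.sqrt (N * C') * Eq by pos.
have eC : 0 <= expR 1 * C * Eq by pos.
have kE : 0 <= k^-1 * Eq by pos.
have vE : 0 <= v^-1 * Eq by pos.
have KE : 0 <= Km * C * Eq by pos.
have l1 := mulr_ge0 sq0 L0; have l2 := mulr_ge0 eC L0; have l3 := mulr_ge0 kE L0.
have l4 := mulr_ge0 vE L0; have l5 := mulr_ge0 KE L0; have l6 := mulr_ge0 E0 L0.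
have fin (A0 A1 A2 A3 A4 A5 A6 : R) : A0 <= Eq -> A1 <= v^-1 * Eq -> A2 <= 2 * Num.sqrt (N * C') * Eq ->
  A3 <= 4 * Km * C * Eq -> A4 <= 4 * expR 1 * C * Lam * Eq -> A5 <= k^-1 * Eq -> A6 <= 4 * Km * C * Eq ->
  A0 + A1 + A2 + (A3 + A4) + (A5 + A6) <=
  (1 + v^-1 + 2 * Num.sqrt (N * C') + 4 * Km * C + 4 * expR 1 * C + k^-1 + 4 * Km * C) * (1 + Lam) * Eq.
 move: KE vE kE eC sq0 l1 l2 l3 l4 l5 l6 E0; clear; lra.
exact: fin a1 a2 a3 a4 a5 a6 a7.
Qed.

Section smoothed.
Context {R : realType}.
Notation P := (plane R).
Notation L1 := (@lebesgue_measure R).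
Notation L2 := (L1 \x L1)%E.
Context (G : set 'M[R]_2) (dG : discrete_subgroup_SL2 G) (F : set P) (hF : fdom G F)
 (mF : measurable F) (finF : (L2 F < +oo)%E) (sa sb : 'M[R]_2) (hsa : scaling_matrix G sa)
 (hsb : scaling_matrix G sb).
Implicit Types (z : P) (v w : R * R) (x y t u : R).
Let mu := muF mF finF.
Let da : \det sa = 1. Proof. exact: scaling_det _ _ hsa. Qed.
Let db : \det sb = 1. Proof. exact: scaling_det _ _ hsb. Qed.
Let hN : G (- 1%:M). Proof. exact: scaling_opp1 _ _ hsb. Qed.
Let v0 : 0 < vol mu. Proof. exact: vol_gt0 _ dG hN _ hF mF finF. Qed.
Notation RPab := (RP G sa sb).

(** A column and its translate by 1 have a wedge of absolute value [v.2^2], to which separation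
    applies. *)
Lemma RP_c_lower v : RPab v -> sepd <= v.2 ^+ 2.
Proof.
move=> [Vv [v20 _]]; have Vw := Vab_shift _ dG sa sb hsa _ 1 Vv.
have := Vab_sep _ dG _ _ hsa hsb _ _ Vv Vw; rewrite mul1r => -[|[|]].
- by move=> /(congr1 fst) /eqP; rewrite -subr_eq0 opprD addrA subrr add0r oppr_eq0 gt_eqF.
- by move=> /(congr1 snd) /eqP; rewrite -subr_eq0 opprK gt_eqF // addr_gt0.
- rewrite /wedge /= => h; apply: le_trans h _; rewrite -(ger0_norm (sqr_ge0 v.2)) -normrN.
 by rewrite le_eqVlt; apply/orP; left; apply/eqP; congr (`|_|); ring.
Qed.

Lemma RP_c_gt0 v : RPab v -> 0 < v.2. Proof. by case=> _ []. Qed.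

Definition Crp : R := 2 * Ccnt.
Lemma Crp_ge0 : 0 <= Crp. Proof. by rewrite mulr_ge0 // Ccnt_ge0. Qed.

Lemma RP_count x (K : R) : 0 <= x -> 0 <= K ->
 (\esum_(v in RPab) (K * (v.2 ^+ 2 < x)%R%:R)%:E <= (K * (Crp * (1 + x)))%:E)%E.
Proof.
move=> x0 K0; rewrite EFinM.
have cRP : countable RPab.
 by apply: sub_countable (Vab_countable _ dG sa sb hsb); apply: subset_card_le => v [].
under eq_esum do rewrite EFinM.
rewrite esumZl //.
rewrite lee_wpmul2l //.
have y0 : 0 < 1 + 2 * x by lra.
apply: le_trans (_ : (\esum_(v in Vab G sa sb) ((D v orig < 1 + 2 * x)%R%:R)%:E <= _)%E); last first.
 apply: le_trans (Vab_card _ dG _ _ hsa hsb orig _ y0) _.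
 rewrite lee_fin -/(Ccnt) /Crp; have := @Ccnt_ge0 R => c0; have : 0 <= Ccnt * x by pos.
 lra.
apply: (@le_trans _ _ (\esum_(v in RPab) ((D v orig < 1 + 2 * x)%R%:R)%:E)%E).
 apply: le_esum => v [_ [v20 /andP[v1 v12]]]; rewrite lee_fin D_orig.
 case: (boolP (v.2 ^+ 2 < x)) => [h|_] //.
 have -> // : v.1 ^+ 2 + v.2 ^+ 2 < 1 + 2 * x.
 have : v.1 ^+ 2 <= v.2 ^+ 2 by rewrite lerXn2r ?nnegrE // ltW.
 by lra.
rewrite (esumID RPab (Vab G sa sb)) //.
rewrite (_ : Vab G sa sb `&` RPab = RPab); last by apply/seteqP; split => [v []//|v Rv]; split => //; case: Rv.
by rewrite leeDl // esum_ge0 // => v _; pos.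
Qed.

(** By separation at most two columns, [v] and its negative, have lower entry 0; they exist only if
    the two cusps are equivalent. On them [D] is [v.1^2 * al]. *)
Lemma Vzero_bound : exists2 k : R, 0 < k &
 forall y z, (\esum_(v in Vzero G sa sb) (ind v y z)%:E <= (2 * (k * al z < y)%R%:R)%:E)%E.
Proof.
have [[v Vv]|noV] := pselect (exists v, Vzero G sa sb v); last first.
 exists 1 => // y z; rewrite (_ : Vzero G sa sb = set0); last first.
  by apply/seteqP; split => v // Vv; apply: noV; exists v.
 by rewrite esum_set0 lee_fin mulr_ge0.
have v1 : v.1 != 0.
 by apply/eqP => v1; case: Vv => /Vab_neq0 H v2; apply: (H dG hsa hsb); case: (v) v1 v2 => a c /= -> ->.
exists (v.1 ^+ 2); first by rewrite exprn_even_gt0.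
move=> y z; have DE w : w = v \/ w = negv v -> D w z = v.1 ^+ 2 * al z.
 case: Vv => _ v2 [->|->]; rewrite ?D_neg /D v2; ring.
have sub w : Vzero G sa sb w -> w = v \/ w = negv v.
 move=> [Vw w2]; case: Vv => Vv v2; have [->|[->|]] := Vab_sep _ dG _ _ hsa hsb _ _ Vw Vv; [by left|by right|].
 by rewrite /wedge w2 v2 mulr0 mul0r subrr normr0 leNgt sepd_gt0.
have [//|h] := boolP (v.1 ^+ 2 * al z < y); last first.
 rewrite mulr0 esum1 // => w /sub /DE e; by rewrite /ind e (negbTE h).
move=> _; rewrite mulr1; apply: (@le_trans _ _ (\esum_(w in Vzero G sa sb) (1 : \bar R))%E).
 by apply: le_esum => w _; rewrite lee_fin /ind; case: (_ < _).
apply: le_trans (esum1_le_card _ bool _ (fun w => w == v) _) _; last by rewrite card_bool.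
move=> w w' /sub[->|->] /sub[->|->] //; rewrite eqxx.
 by move/esym/eqP.
by move/eqP.
Qed.

Let cVz : countable (Vzero G sa sb).
Proof. by apply: sub_countable (Vab_countable _ dG sa sb hsb); apply: subset_card_le => v []. Qed.

Let cRP : countable RPab.
Proof. by apply: sub_countable (Vab_countable _ dG sa sb hsb); apply: subset_card_le => v []. Qed.

Section test.
Context (chi : R -> R) (Lam m : R) (mchi : mfunT chi)
 (chi0 : forall X, 0 <= chi X <= 2) (chiL : forall X X', `|chi X - chi X'| <= Lam * `|X - X'|)
 (chi1 : forall X, chi (X + 1) = chi X) (chim : (\int[L1]_(X in `[0%R, 1%R]) (chi X)%:E = m%:E)%E)
 (c1 : R) (c10 : 0 < c1).

Let chiz (n : int) X : chi (X + n%:~R) = chi X := periodic_int _ chi1 X n.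

Let psis z : R := psit chi c1 z * (strip z)%:R.

Let psis_ge0 z : 0 <= psis z.
Proof. by rewrite mulr_ge0 // (psit_ge0 _ chi0 _ c10). Qed.

Let mpsis : mfunT psis.
Proof. by apply: measurable_funM; [exact: measurable_psit _ mchi c1|exact: measurable_strip]. Qed.

Let psis_le z : psis z <= (al z < c1^-1)%R%:R * (strip z)%:R.
Proof. by rewrite ler_wpM2r // (psit_le _ chi0 _ c10). Qed.

Let If := m * (4 / 15 / c1).

Let int_psis : (\int[L2]_z (psis z)%:E = If%:E)%E.
Proof. exact: integral_psit_strip _ mchi chi0 _ c10 _ chi1 chim. Qed.

Let If_ge0 : 0 <= If.
Proof. by rewrite -lee_fin -int_psis; apply: integral_ge0 => z _; rewrite lee_fin. Qed.

Let Eis_le z : (Eis G sa psis z <= cnt G sa c1^-1 z)%E.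
Proof. by rewrite (cnt_Eis _ dG _ hsa); apply: le_esum => g _; rewrite lee_fin. Qed.

Let c1V0 : 0 < c1^-1. Proof. by pos. Qed.

Let Eis_ge0 z : (0 <= Eis G sa psis z)%E.
Proof. by apply: esum_ge0 => g _; rewrite lee_fin. Qed.

Definition ft z : R := fine (Eis G sa psis z) / 2.

Let ftE z : Eis G sa psis z = (2 * ft z)%:E.
Proof.
rewrite /ft mulrC divfK // fineK // ge0_fin_numE //.
by apply: le_lt_trans (Eis_le z) _; rewrite (cntE _ dG _ hsa) // ltry.
Qed.

Lemma ft_ge0 z : 0 <= ft z. Proof. by rewrite divr_ge0 // fine_ge0. Qed.

Lemma ft_le z : ft z <= Ccnt * (1 + c1^-1).
Proof.
have := Eis_le z; rewrite ftE (cntE _ dG _ hsa) // lee_fin ler_pM2l // => h.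
exact: le_trans h (N_le _ dG _ hsa _ z c1V0).
Qed.

Lemma bmf_ft : bmf ft.
Proof.
split; last by exists (Ccnt * (1 + c1^-1)) => z; rewrite ger0_norm ?ft_ge0 // ft_le.
apply: measurable_funM; last mf.
apply: (measurableT_comp (fine_measurable measurableT)).
exact: measurable_Eis _ dG hN _ da _ mpsis psis_ge0.
Qed.

Lemma Int_ft : Int mu ft = m * (4 / 15 / c1).
Proof.
have := Eis_integral _ dG hN _ hF mF finF _ da psis (cst 1) mpsis psis_ge0 (measurable_cst _) (fun=> ler01) (fun _ _ _ => erefl).
have -> : (\int[L2]_z (psis z * cst 1 (act sa z))%:E = If%:E)%E.
 by rewrite -int_psis; apply: eq_integral => z _; rewrite mulr1.
move=> H; have {}H : (\int[mu]_z (2 * ft z)%:E = (2 * If)%:E)%E.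
 by rewrite EFinM -H; apply: eq_integral => z _; rewrite mule1 ftE.
have b2 : bmf (fun z => 2 * ft z) by apply: bmfM; [bm|exact: bmf_ft].
by apply: (mulfI (_ : 2 != 0 :> R)) => //; rewrite -IntZ ?(IntE _ _ b2) in H *; [case: H|exact: bmf_ft].
Qed.

Context (k : R) (k0 : 0 < k)
 (hk : forall y z, (\esum_(v in Vzero G sa sb) (ind v y z)%:E <= (2 * (k * al z < y)%R%:R)%:E)%E).

(** Unfolding the Eisenstein series. [Z] collects the columns with lower entry 0 and is bounded in
    two ways, by the integral of [ft] and by [y / k]; the second bound serves for small [y]. *)
Lemma Int_ft_N y : 0 < y -> exists Z : R, [/\ 0 <= Z, Z <= m * (4 / 15 / c1), Z <= y / k &
 ((Int mu (fun z => ft z * N G sb y z))%:E =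
  Z%:E + \esum_(v in RPab) \int[L2]_z (psit chi c1 z * ind v y z)%:E)%E].
Proof.
move=> y0; have [bN N0] := bmp_N _ dG _ hsb y y0; have mN := proj1 bN.
have H := Eis_integral _ dG hN _ hF mF finF _ da psis (N G sb y) mpsis psis_ge0 mN N0
 (fun g z => N_act _ dG sb g y z).
pose Vz z := (\esum_(v in Vzero G sa sb) (ind v y z)%:E)%E.
pose Vp z := (\esum_(v in Vpos G sa sb) (ind v y z)%:E)%E.
have i0 v z : (0 <= (ind v y z)%:E :> \bar R)%E by rewrite lee_fin ind_ge0.
have Vz0 z : (0 <= Vz z)%E by apply: esum_ge0.
have Vp0 z : (0 <= Vp z)%E by apply: esum_ge0.
have mi v : mfunT (fun z => (ind v y z)%:E : \bar R) by mf; exact: measurable_ind.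
have mVz : mfunT Vz by apply: measurable_esum.
have mVp : mfunT Vp.
 apply: measurable_esum => //.
 by apply: sub_countable (Vab_countable _ dG sa sb hsb); apply: subset_card_le => v [].
have NE z : ((2 * N G sb y (act sa z))%:E = Vz z + 2%:E * Vp z)%E.
 rewrite -(cntE _ dG _ hsb) // (cnt_Vab G sb sa y z da).
 by rewrite (Vab_split _ dG _ _ hsb (fun v => (ind v y z)%:E)) => [//|v|v]; rewrite // /ind D_neg.
have mps : mfunT (fun z => (psis z)%:E) by mf.
have ps0 z : (0 <= (psis z)%:E)%E by rewrite lee_fin.
have H2 : (2%:E * \int[L2]_z (psis z * N G sb y (act sa z))%:E =
  \int[L2]_z ((psis z)%:E * Vz z) + 2%:E * \int[L2]_z ((psis z)%:E * Vp z))%E.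
 have mz : mfunT (fun z => (psis z)%:E * Vz z)%E by mf.
 have mp : mfunT (fun z => (psis z)%:E * Vp z)%E by exact: emeasurable_funM.
 have z0 z : (0 <= (psis z)%:E * Vz z)%E by rewrite mule_ge0.
 have p0 z : (0 <= (psis z)%:E * Vp z)%E by rewrite mule_ge0.
 rewrite -(ge0_integralZl_EFin L2 measurableT (fun z _ => p0 z) mp (ler0n R 2)).
 have p20 z : (0 <= 2%:E * ((psis z)%:E * Vp z))%E by apply: mule_ge0; [rewrite lee_fin|exact: p0].
 have mp2 : mfunT (fun z => 2%:E * ((psis z)%:E * Vp z))%E.
  by apply: emeasurable_funM => //; exact: measurable_cst.
 apply: etrans (ge0_integralD L2 measurableT (fun z _ => z0 z) mz (fun z _ => p20 z) mp2).
 have n0 z : (0 <= (psis z * N G sb y (act sa z))%:E)%E by rewrite lee_fin; exact: mulr_ge0 (psis_ge0 z) (N0 _).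
 have mn : mfunT (fun z => (psis z * N G sb y (act sa z))%:E).
  apply/measurable_EFinP; apply: measurable_funM => //; apply: (measurableT_comp mN).
  by apply: measurable_act.
 rewrite -(ge0_integralZl_EFin L2 measurableT (fun z _ => n0 z) mn (ler0n R 2)).
 apply: eq_integral => z _; rewrite -EFinM mulrCA EFinM NE.
 by rewrite ge0_muleDr ?mule_ge0 // [X in (_ + X)%E]muleCA.
have pp := pair_pos _ dG _ _ hsa hsb (psit chi c1) y (measurable_psit _ mchi c1) (psit_ge0 _ chi0 _ c10).
have {}pp : (\int[L2]_z ((psis z)%:E * Vp z) = \esum_(v in RPab) \int[L2]_z (psit chi c1 z * ind v y z)%:E)%E.
 by apply: pp => n z; rewrite /psit al_parab Xc_parab chiz.
pose ZE := (\int[L2]_z ((psis z)%:E * Vz z))%E.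
have ZE0 : (0 <= ZE)%E by apply: integral_ge0 => z _; rewrite mule_ge0.
have mkal : mfunT (fun z : P => (k * al z < y)%R%:R : R).
 by apply: measurable_fun_natb; apply: measurable_fun_ltr; [rewrite /al; mf|exact: measurable_cst].
have Z1 : (ZE <= (2 * If)%:E)%E.
 rewrite EFinM -int_psis -ge0_integralZl_EFin //; apply: ge0_le_integral => //.
 - by move=> z _; rewrite mule_ge0.
 - exact: emeasurable_funM.
 - exact: emeasurable_funM.
 - move=> z _; rewrite muleC lee_wpmul2r //; apply: le_trans (hk y z) _.
  by rewrite lee_fin; case: (_ < _); rewrite ?mulr1 ?mulr0.
have Z2 : (ZE <= (2 * (y / k))%:E)%E.
 have yk : 0 < y / k by rewrite divr_gt0.
 pose h (s : R) : \bar R := ((s < y / k)%R%:R)%:E.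
 have mh : mfunT h.
  by apply/measurable_EFinP; apply: measurable_fun_natb; apply: measurable_fun_ltr; [exact: measurable_id|exact: measurable_cst].
 have h0 s : (0 <= h s)%E by rewrite lee_fin ler0n.
 have hI : (\int[L1]_(s in `]0%R, +oo[) h s = (y / k)%:E)%E.
  rewrite integral_mkcond (_ : _ \_ _ = fun s : R => (\1_(`]0, (y / k)[%classic) s)%:E); last first.
   by apply/funext => s; rewrite patchE indicE !mem_setE !in_itv /= andbT; case: (0 < s).
  by rewrite integral_indic // setIT /= lebesgue_measure_itv /= lte_fin yk sube0.
 rewrite EFinM -hI -(strip_integral h mh h0) -ge0_integralZl_EFin //; last 2 first.
 - by move=> z _; rewrite mule_ge0 // lee_fin.
 - apply: emeasurable_funM; first exact: (measurableT_comp mh measurable_al).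
  by apply/measurable_EFinP; exact: measurable_strip.
 apply: ge0_le_integral => //.
 - by move=> z _; rewrite mule_ge0.
 - exact: emeasurable_funM.
 - apply: emeasurable_funM => //; apply: emeasurable_funM; first exact: (measurableT_comp mh measurable_al).
  by apply/measurable_EFinP; exact: measurable_strip.
 - move=> z _; rewrite muleC; apply: (@le_trans _ _ ((2 * (k * al z < y)%R%:R)%:E * (psis z)%:E)%E).
   by rewrite lee_wpmul2r //; exact: hk.
  rewrite -!EFinM lee_fin -mulrA ler_wpM2l //.
  have -> : (k * al z < y) = (al z < y / k) by rewrite ltr_pdivlMr // mulrC.
  rewrite ler_wpM2l ?ler0n //; apply: le_trans (psis_le z) _.
  by case: (_ < _); rewrite ?mul1r ?mul0r ?ler0n.
have [q [ZEq q0 q1 q2]] : exists q : R, [/\ ZE = q%:E, 0 <= q, q <= 2 * If & q <= 2 * (y / k)].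
 move: (ZE) ZE0 Z1 Z2 => [q| |] //; rewrite !lee_fin => q0 q1 q2; by exists q.
exists (q / 2); split.
- exact: divr_ge0 q0 (ler0n R 2).
- by rewrite ler_pdivrMr // -/If mulrC.
- by rewrite ler_pdivrMr // mulrC.
have bfN : bmf (fun z => ft z * N G sb y z) by apply: bmfM => //; exact: bmf_ft.
rewrite -IntE //.
have h2 (x x' : \bar R) : (2%:E * x = 2%:E * x' -> x = x')%E.
 by move=> /(congr1 (fun e => (2^-1)%:E * e)%E); rewrite !muleA -!EFinM mulVf // !mul1e.
apply: h2; transitivity (\int[mu]_z (Eis G sa psis z * (N G sb y z)%:E))%E.
 rewrite -ge0_integralZl_EFin //; last 2 first.
 - by move=> z _; rewrite lee_fin mulr_ge0 ?ft_ge0.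
 - by apply/measurable_EFinP; case: bfN.
 by apply: eq_integral => z _; rewrite ftE -!EFinM mulrA.
rewrite H H2 -/ZE pp ZEq ge0_muleDr.
- by rewrite -EFinM mulrC divfK.
- by rewrite lee_fin; exact: divr_ge0 q0 (ler0n R 2).
- apply: esum_ge0 => v _; apply: integral_ge0 => z _.
 by rewrite lee_fin; exact: mulr_ge0 (psit_ge0 _ chi0 _ c10 z) (ind_ge0 _ _ _).
Qed.

Let m0 : 0 <= m.
Proof.
rewrite -lee_fin -chim; apply: integral_ge0 => X _; rewrite lee_fin.
by have /andP[] := chi0 X.
Qed.

Let m2 : m <= 2.
Proof.
have := integral_cst_itv (2 : R) 0 1 (ler0n _ _) ler01; rewrite subr0 mulr1 => e.
rewrite -lee_fin -e -chim integral_mkcond; apply: ge0_le_integral => //.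
- by move=> X _; rewrite patchE; case: ifP => // _; rewrite lee_fin; have /andP[] := chi0 X.
- apply/(measurable_restrictT _ _).1 => //; apply: measurable_funTS; exact/measurable_EFinP.
- by apply/measurable_EFinP; apply: measurable_funM; [exact: measurable_cst|exact: measurable_indic].
- move=> X _; rewrite patchE indicE; case: ifP => _; rewrite ?mulr1 ?mulr0 // lee_fin.
 by have /andP[] := chi0 X.
Qed.

Lemma mean_bound : 0 <= m <= 2. Proof. by rewrite m0 m2. Qed.

Let Lam0 : 0 <= Lam.
Proof. by have := chiL 1 0; rewrite subr0 normr1 mulr1; exact: le_trans. Qed.

(** [mainterm] as a function of [x = y / c1]: [y] and [c1] may vary as long as their quotient is
    fixed. *)
Definition mt (c x : R) : R := if c ^+ 2 < x then pi / 4 * (Num.sqrt x * (1 - c ^+ 2 / x) ^+ 2 / c) else 0.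

Definition Km : R := pi / 4 / Num.sqrt sepd.

Lemma mt_le v x : RPab v -> 0 < x -> 0 <= mt v.2 x /\ mt v.2 x <= Km * Num.sqrt x * (v.2 ^+ 2 < x)%R%:R.
Proof.
move=> Rv x0; have c0 := RP_c_gt0 v Rv; have cl := RP_c_lower v Rv.
rewrite /mt; case: ifPn => [h|_]; last by rewrite mulr0.
have pi0 : 0 <= pi / 4 :> R by rewrite divr_ge0 ?pi_ge0.
have sq0 : 0 <= Num.sqrt x * (1 - v.2 ^+ 2 / x) ^+ 2 by apply: mulr_ge0; [exact: sqrtr_ge0|exact: sqr_ge0].
split; first by apply: mulr_ge0 => //; exact: divr_ge0 sq0 (ltW c0).
have s0 : 0 < Num.sqrt (sepd : R) by rewrite sqrtr_gt0 sepd_gt0.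
have sc : Num.sqrt sepd <= v.2 by rewrite -(ger0_norm (ltW c0)) -sqrtr_sqr ler_wsqrtr.
have -> : Km * Num.sqrt x * true%:R = pi / 4 * (Num.sqrt x / Num.sqrt sepd) by rewrite /Km mulr1; ring.
apply: ler_wpM2l => //; apply: ler_pM => //.
- by rewrite invr_ge0 ltW.
- rewrite -[leRHS]mulr1; apply: ler_wpM2l; first exact: sqrtr_ge0.
 have h1 : v.2 ^+ 2 / x <= 1 by rewrite ler_pdivrMr // mul1r ltW.
 have h2 : 0 <= v.2 ^+ 2 / x by rewrite divr_ge0 ?sqr_ge0 // ltW.
 by rewrite -[leRHS](expr1n _ 2) lerXn2r ?nnegrE //; lra.
- by rewrite lef_pV2 ?posrE.
Qed.

Lemma Km_ge0 : 0 <= Km.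
Proof. by rewrite /Km divr_ge0 ?sqrtr_ge0 // divr_ge0 // pi_ge0. Qed.

Definition Smooth (x : R) : R := rsum RPab (fun v => chi (v.1 / v.2) * mt v.2 x).

Let I y : R := Int mu (fun z => ft z * N G sb y z).

Let V y v : R := fine (\int[L2]_z (psit chi c1 z * ind v y z)%:E)%E.

Let VP y v : 0 < y -> RPab v -> [/\ (\int[L2]_z (psit chi c1 z * ind v y z)%:E = (V y v)%:E)%E,
 0 <= V y v, V y v <= 2 * mt v.2 (y / c1) &
 `|V y v - chi (v.1 / v.2) * mt v.2 (y / c1)| <= if v.2 ^+ 2 < y / c1 then 2 * Lam * (y / v.2 ^+ 2) else 0].
Proof.
move=> y0 Rv; have [W [E W0 W1 W2]] := vector_integral _ _ mchi chi0 chiL _ c10 v.1 v.2 y (RP_c_gt0 v Rv) y0.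
have EV : V y v = W by rewrite /V [v in ind v]surjective_pairing E.
by rewrite EV; split => //; rewrite -E -[v in ind v]surjective_pairing.
Qed.

Let V_fin y : 0 < y -> (\esum_(v in RPab) (V y v)%:E <= (2 * Km * Num.sqrt (y / c1) * (Crp * (1 + y / c1)))%:E)%E.
Proof.
move=> y0; have x0 : 0 < y / c1 by rewrite divr_gt0.
have K0 : 0 <= 2 * Km * Num.sqrt (y / c1) by rewrite mulr_ge0 ?sqrtr_ge0 // mulr_ge0 // Km_ge0.
apply: le_trans (RP_count _ _ (ltW x0) K0); apply: le_esum => v Rv; rewrite lee_fin.
have [_ _ h _] := VP y v y0 Rv; apply: le_trans h _; have [_ h] := mt_le v _ Rv x0.
by rewrite -!mulrA ler_pM2l // !mulrA.
Qed.

Let I_split y : 0 < y -> exists Z : R, [/\ 0 <= Z, Z <= If, Z <= y / k & I y = Z + rsum RPab (V y)].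
Proof.
move=> y0; have [Z [Z0 Z1 Z2 E]] := Int_ft_N y y0; exists Z; split => //.
have V0 v : RPab v -> 0 <= V y v by move=> Rv; have [] := VP y v y0 Rv.
have Vf := le_lt_trans (V_fin y y0) (ltry _).
move: E; rewrite (eq_esum (b := fun v => (V y v)%:E)); last by move=> v Rv; have [] := VP y v y0 Rv.
by rewrite (rsumE _ _ V0 Vf) -EFinD => -[].
Qed.

Let I_small y : 0 < y -> I y <= y / k + 2 * Km * Num.sqrt (y / c1) * (Crp * (1 + y / c1)).
Proof.
move=> y0; have [Z [_ _ Z2 ->]] := I_split y y0; apply: lerD => //.
have V0 v : RPab v -> 0 <= V y v by move=> Rv; have [] := VP y v y0 Rv.
by rewrite -lee_fin -(rsumE _ _ V0 (le_lt_trans (V_fin y y0) (ltry _))) V_fin.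
Qed.

(** The sum is split at [v.2^2 = del * x]. Below it both quantities are bounded trivially and the
    representatives are few; above it each Lipschitz error is at most [2 Lam c1 / del]. *)
Let I_Smooth y (del : R) : 0 < y -> 0 < del ->
 `|I y - Smooth (y / c1)| <= If + (2 * Km * Num.sqrt (y / c1) * (Crp * (1 + del * (y / c1))) +
   2 * Lam * (c1 / del) * (Crp * (1 + y / c1))).
Proof.
move=> y0 d0; set x := y / c1; have x0 : 0 < x by rewrite divr_gt0.
have [Z [Z0 Z1 _ ->]] := I_split y y0.
have V0 v : RPab v -> 0 <= V y v by move=> Rv; have [] := VP y v y0 Rv.
have Vf := le_lt_trans (V_fin y y0) (ltry _).
pose K1 := 2 * Km * Num.sqrt x; pose K2 := 2 * Lam * (c1 / del).
have K10 : 0 <= K1 by rewrite mulr_ge0 ?sqrtr_ge0 // mulr_ge0 // Km_ge0.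
have K20 : 0 <= K2 by exact: mulr_ge0 (mulr_ge0 (ler0n _ 2) Lam0) (divr_ge0 (ltW c10) (ltW d0)).
have chi_ge0 X : 0 <= chi X by have /andP[] := chi0 X.
have chi_le2 X : chi X <= 2 by have /andP[] := chi0 X.
pose e v := K1 * (v.2 ^+ 2 < del * x)%R%:R + K2 * (v.2 ^+ 2 < x)%R%:R.
have [] := @rsum_close _ _ RPab (V y) (fun v => chi (v.1 / v.2) * mt v.2 x) e
  (K1 * (Crp * (1 + del * x)) + K2 * (Crp * (1 + x))) V0.
- by move=> v Rv; have [m_0 _] := mt_le v _ Rv x0; exact: mulr_ge0 (chi_ge0 _) m_0.
- move=> v Rv; have [_ W0 W1 W2] := VP y v y0 Rv; have [m_0 m_1] := mt_le v _ Rv x0.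
 have c0 := RP_c_gt0 v Rv; rewrite -/x in W1 W2.
 have e0 : 0 <= e v by rewrite /e addr_ge0 // mulr_ge0 ?ler0n.
 case: (boolP (v.2 ^+ 2 < x)) W2 => [h W2|h W2]; last exact: le_trans W2 e0.
 rewrite /e h mulr1; have [hd|hd] := ltP (v.2 ^+ 2) (del * x).
  rewrite mulr1; apply: (@le_trans _ _ K1); last by rewrite lerDl.
  apply: (@le_trans _ _ (2 * mt v.2 x)); last first.
   by rewrite /K1 -mulrA ler_pM2l //; apply: le_trans m_1 _; rewrite h mulr1.
  have cm1 := mulr_ge0 (chi_ge0 (v.1 / v.2)) m_0.
  have cm2 : chi (v.1 / v.2) * mt v.2 x <= 2 * mt v.2 x by rewrite ler_wpM2r.
  by rewrite ler_norml; apply/andP; split; lra.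
 rewrite mulr0 add0r; apply: le_trans W2 _; rewrite /K2; apply: ler_wpM2l; first exact: mulr_ge0.
 have -> : c1 / del = y / (del * x) by rewrite /x; field; rewrite !gt_eqF.
 by apply: ler_wpM2l; [exact: ltW|rewrite lef_pV2 ?posrE ?mulr_gt0 ?exprn_gt0].
- rewrite EFinD (eq_esum (b := fun v => (K1 * (v.2 ^+ 2 < del * x)%R%:R)%:E + (K2 * (v.2 ^+ 2 < x)%R%:R)%:E)%E) //.
 rewrite esumD; [|by move=> v _; rewrite lee_fin mulr_ge0 ?ler0n|by move=> v _; rewrite lee_fin mulr_ge0 ?ler0n].
 by apply: leeD; apply: RP_count => //; [rewrite mulr_ge0 // ltW|exact: ltW].
- exact: Vf.
move=> _; rewrite -/(Smooth x) !ler_norml => /andP[h1 h2].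
by rewrite -/K1 -/K2; apply/andP; split; lra.
Qed.

Let Var_ft : Var mu ft <= Ccnt * (1 + c1^-1) * If.
Proof.
apply: le_trans (Var_le mu v0 _ 0 bmf_ft) _; rewrite -[X in _ * X]Int_ft -IntZ; last exact: bmf_ft.
apply: Int_le.
- by apply: bmfX; apply: bmfB; [exact: bmf_ft|exact: bmf_cst].
- by apply: bmfM; [exact: bmf_cst|exact: bmf_ft].
- by move=> z; rewrite subr0 expr2 ler_wpM2r ?ft_ge0 // ft_le.
Qed.

(** Cauchy-Schwarz for the covariance of [ft] with [et t], multiplied by [exp (t / 2)] to clear the
    weights. *)
Let I_et t (Vb : R) : Var mu (et G sb t) <= Vb ->
 `|I (expR t) + expR t * I (expR (- t)) - If * (expR t + 1) / vol mu| <=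
  expR (t / 2) * Num.sqrt (Ccnt * (1 + c1^-1) * If * Vb).
Proof.
move=> hV; have be := proj1 (bmp_et _ dG _ hsb t).
have c2 := Cov_sqr mu v0 _ _ bmf_ft be.
have bN s := proj1 (bmp_N _ dG _ hsb _ (expR_gt0 s)).
have bfN s : bmf (fun z => ft z * N G sb (expR s) z) by apply: bmfM; [exact: bmf_ft|exact: bN].
have E : Int mu (fun z => ft z * et G sb t z) = expR (- (t / 2)) * I (expR t) + expR (t / 2) * I (expR (- t)).
 rewrite -!IntZ // -IntD; [|by apply: bmfM => //; exact: bmf_cst|by apply: bmfM => //; exact: bmf_cst].
 by congr (Int mu _); apply/funext => z; rewrite /et; ring.
have CE : Cov mu ft (et G sb t) = expR (- (t / 2)) * (I (expR t) + expR t * I (expR (- t)) - If * (expR t + 1) / vol mu).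
 rewrite /Cov E Int_ft (Int_et _ dG _ hsb _ hF mF finF).
 have fin (p q s i1 i2 f vv : R) : q = p * s -> p * i1 + q * i2 - f * (q + p) / vv = p * (i1 + s * i2 - f * (s + 1) / vv).
  by move=> ->; ring.
 exact: fin (expR_half t).
have nV := Var_ge0 mu v0 _ be; have nf := Var_ge0 mu v0 _ bmf_ft.
have c3 : `|Cov mu ft (et G sb t)| <= Num.sqrt (Ccnt * (1 + c1^-1) * If * Vb).
 rewrite -[leLHS]ger0_norm // -sqrtr_sqr ler_wsqrtr // real_normK ?num_real //.
 by apply: le_trans c2 _; apply: ler_pM.
move: c3; rewrite CE normrM (gtr0_norm (expR_gt0 _)) => c3.
have fin (p q x y : R) : 0 <= p -> p * q = 1 -> q * x <= y -> x <= p * y.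
 by move=> p0 pq h; rewrite -[x]mul1r -pq -mulrA; exact: ler_wpM2l.
by apply: fin c3; [exact: expR_ge0|rewrite -expRD subrr expR0].
Qed.

(** [et] also brings in the pairing at [exp (- t)], which carries no information and is estimated by
    [I_small]. *)
Lemma Smooth_close t (Vb del : R) : Var mu (et G sb t) <= Vb -> 0 < del ->
 `|Smooth (expR t / c1) - If * expR t / vol mu| <=
  If + If / vol mu + expR (t / 2) * Num.sqrt (Ccnt * (1 + c1^-1) * If * Vb) +
  (2 * Km * Num.sqrt (expR t / c1) * (Crp * (1 + del * (expR t / c1))) +
   2 * Lam * (c1 / del) * (Crp * (1 + expR t / c1))) +
  (k^-1 + expR t * (2 * Km * Num.sqrt (expR (- t) / c1) * (Crp * (1 + expR (- t) / c1)))).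
Proof.
move=> hV d0; have h1 := I_et t Vb hV; have h2 := I_Smooth _ del (expR_gt0 t) d0.
have h3 := I_small _ (expR_gt0 (- t)).
have h4 : expR t * I (expR (- t)) <= k^-1 + expR t * (2 * Km * Num.sqrt (expR (- t) / c1) * (Crp * (1 + expR (- t) / c1))).
 apply: le_trans (_ : expR t * (expR (- t) / k + 2 * Km * Num.sqrt (expR (- t) / c1) * (Crp * (1 + expR (- t) / c1))) <= _).
  by rewrite ler_pM2l ?expR_gt0.
 by rewrite mulrDr mulrA -expRD subrr expR0 mul1r.
have I0 : 0 <= expR t * I (expR (- t)).
 rewrite mulr_ge0 ?expR_ge0 //; apply: Int_ge0 => z; rewrite mulr_ge0 ?ft_ge0 //.
 exact: N_ge0.
have f0 : 0 <= If / vol mu by rewrite divr_ge0 // ltW.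
have e1 : If * (expR t + 1) / vol mu = If * expR t / vol mu + If / vol mu by ring.
rewrite e1 in h1; move: h1 h2 h4 I0.
move: (expR t * I (expR (- t))) => J.
move: (Smooth _) (I (expR t)) => S I1.
move: (If * expR t / vol mu) => M.
move: (k^-1 + _) => X1.
move: (2 * Km * Num.sqrt (expR t / c1) * _ + _) => X2.
move: (expR (t / 2) * _) => X3.
rewrite !ler_norml => /andP[a1 a2] /andP[b1 b2] c_1 c_2.
by apply/andP; split; lra.
Qed.

End test.

(** A good [t] exists near [6 u] but cannot be prescribed; setting [c1 = exp (t - 16 u)] makes
    [exp t / c1] equal to the given [exp (16 u)]. *)
Lemma smooth_asymptotic (b C : R) : 0 <= b < 1 / 2 ->
 (forall T : R, 0 <= T -> exists2 t, T <= t <= T + 1 & Var mu (et G sb t) <= C * expR (2 * b * t)) ->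
 exists2 K, 0 <= K & forall (chi : R -> R) (Lam m : R), mfunT chi ->
  (forall X, 0 <= chi X <= 2) -> (forall X X', `|chi X - chi X'| <= Lam * `|X - X'|) ->
  (forall X, chi (X + 1) = chi X) -> (\int[L1]_(X in `[0%R, 1%R]) (chi X)%:E = m%:E)%E ->
  forall u, 0 <= u -> `|Smooth chi (expR (16 * u)) - 4 / 15 * (m / vol mu) * expR (16 * u)| <=
   K * (1 + Lam) * expR ((16 - Num.min 1 (3 - 6 * b)) * u).
Proof.
move=> /andP[b0 b1] hV; have [k k0 hk] := Vzero_bound.
have Cr0 := Crp_ge0; have K0 := Km_ge0; have cc0 := @Ccnt_ge0 R.
pose C' := Num.max 0 C; have C'0 : 0 <= C' by rewrite le_max lexx.
pose Ks := Num.sqrt (Ccnt * C').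
pose K := 1 + (vol mu)^-1 + 2 * Ks + 4 * Km * Crp + 4 * expR 1 * Crp + k^-1 + 4 * Km * Crp.
have vV0 : 0 <= (vol mu)^-1 by rewrite invr_ge0 ltW.
have kV0 : 0 <= k^-1 by rewrite invr_ge0 ltW.
have Ks0 : 0 <= Ks by exact: sqrtr_ge0.
have KC : 0 <= 4 * Km * Crp by apply: mulr_ge0 Cr0; exact: mulr_ge0.
have eC : 0 <= 4 * expR 1 * Crp by apply: mulr_ge0 Cr0; apply: mulr_ge0; rewrite ?expR_ge0.
have Kp : 0 <= K by rewrite /K !addr_ge0 // mulr_ge0.
exists K => // chi Lam m mchi chi0 chiL chi1 chim u u0.
have Lam0 : 0 <= Lam by have := chiL 1 0; rewrite subr0 normr1 mulr1; exact: le_trans.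
have /andP[m0 m2] := mean_bound _ _ mchi chi0 chim.
have [t /andP[t1 t2] vt] := hV (6 * u) (mulr_ge0 (ler0n _ 6) u0).
pose c1 := expR (t - 16 * u); have c10 : 0 < c1 by exact: expR_gt0.
have e1 : expR t / c1 = expR (16 * u) by rewrite -expRN -expRD; congr expR; exact: smooth_exp1.
have e2 : expR (- t) / c1 = expR (16 * u - 2 * t) by rewrite -expRN -expRD; congr expR; exact: smooth_exp2.
have vt' : Var mu (et G sb t) <= C' * expR (2 * b * t).
 by apply: le_trans vt _; rewrite ler_wpM2r ?expR_ge0 // le_max lexx orbT.
have := Smooth_close _ _ _ mchi chi0 chiL chi1 chim _ c10 _ k0 hk _ _ (expR (- 9 * u)) vt' (expR_gt0 _).
have e3 : m * (4 / 15 * expR (- (t - 16 * u))) = 4 / 15 * m * expR (16 * u - t) by rewrite opprB; ring.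
rewrite e1 e2 -(expRN (t - 16 * u)) e3.
have H := @smooth_arith _ (Smooth chi (expR (16 * u))) m (vol mu) k Km Crp Ccnt C' b Lam t u.
by apply: H => //; apply/andP.
Qed.

End smoothed.

(** * A Tauberian argument *)

Section tauber.
Context {R : realType}.
Implicit Types (x h t M E a : R).

(** Taylor bounds for the power 5/2, written in the square roots [y] and [z]: the difference of the
    two sides is [(z - y)^3] times a quadratic form in [y] and [z - y] with positive
    coefficients. *)
Lemma pow5_diff (y z : R) : 0 <= y -> y <= z ->
 [/\ 15 / 8 * y * (z ^+ 2 - y ^+ 2) ^+ 2 <= z ^+ 5 - y ^+ 5 - 5 / 2 * y ^+ 3 * (z ^+ 2 - y ^+ 2),
   z ^+ 5 - y ^+ 5 - 5 / 2 * y ^+ 3 * (z ^+ 2 - y ^+ 2) <= 15 / 8 * z * (z ^+ 2 - y ^+ 2) ^+ 2,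
   15 / 8 * y * (z ^+ 2 - y ^+ 2) ^+ 2 <= y ^+ 5 - z ^+ 5 + 5 / 2 * z ^+ 3 * (z ^+ 2 - y ^+ 2) &
   y ^+ 5 - z ^+ 5 + 5 / 2 * z ^+ 3 * (z ^+ 2 - y ^+ 2) <= 15 / 8 * z * (z ^+ 2 - y ^+ 2) ^+ 2].
Proof.
move=> y0 yz; pose d := z - y; have d0 : 0 <= d by rewrite subr_ge0.
have -> : z = y + d by rewrite /d addrC subrK.
have pos (p q r : R) : 0 <= p -> 0 <= q -> 0 <= r -> 0 <= d ^+ 3 * (p * y ^+ 2 + q * (y * d) + r * d ^+ 2).
 move=> p0 q0 r0; apply: mulr_ge0; first pos.
 by pos.
split; rewrite -subr_ge0.
- by rewrite (_ : _ - _ = d ^+ 3 * (5 / 2 * y ^+ 2 + 25 / 8 * (y * d) + 1 * d ^+ 2)); [apply: pos; lra|field].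
- by rewrite (_ : _ - _ = d ^+ 3 * (5 * y ^+ 2 + 35 / 8 * (y * d) + 7 / 8 * d ^+ 2)); [apply: pos; lra|field].
- by rewrite (_ : _ - _ = d ^+ 3 * (5 * y ^+ 2 + 45 / 8 * (y * d) + 3 / 2 * d ^+ 2)); [apply: pos; lra|field].
- by rewrite (_ : _ - _ = d ^+ 3 * (5 / 2 * y ^+ 2 + 15 / 8 * (y * d) + 3 / 8 * d ^+ 2)); [apply: pos; lra|field].
Qed.

Definition p5 x : R := x ^+ 2 * Num.sqrt x.

Lemma p5_diff2 x h : 0 <= x -> 0 <= h ->
 15 / 4 * h ^+ 2 * Num.sqrt x <= p5 (x + 2 * h) - 2 * p5 (x + h) + p5 x <= 15 / 4 * h ^+ 2 * Num.sqrt (x + 2 * h).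
Proof.
move=> x0 h0.
have p5E u : 0 <= u -> p5 u = Num.sqrt u ^+ 5.
 by move=> u0; rewrite /p5 -{1}(sqr_sqrtr u0) -exprM -exprSr.
rewrite !p5E ?addr_ge0 ?mulr_ge0 //.
have s1 : Num.sqrt (x + h) ^+ 2 - Num.sqrt x ^+ 2 = h by rewrite !sqr_sqrtr ?addr_ge0 //; ring.
have s2 : Num.sqrt (x + 2 * h) ^+ 2 - Num.sqrt (x + h) ^+ 2 = h by rewrite !sqr_sqrtr ?addr_ge0 ?mulr_ge0 //; ring.
have l1 : Num.sqrt x <= Num.sqrt (x + h) by apply: ler_wsqrtr; lra.
have l2 : Num.sqrt (x + h) <= Num.sqrt (x + 2 * h) by apply: ler_wsqrtr; lra.
have [_ _ a1 a2] := pow5_diff _ _ (sqrtr_ge0 _) l1; have [b1 b2 _ _] := pow5_diff _ _ (sqrtr_ge0 _) l2.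
rewrite s1 in a1 a2; rewrite s2 in b1 b2.
have hl1 : h ^+ 2 * Num.sqrt x <= h ^+ 2 * Num.sqrt (x + h) by rewrite ler_wpM2l ?sqr_ge0.
have hl2 : h ^+ 2 * Num.sqrt (x + h) <= h ^+ 2 * Num.sqrt (x + 2 * h) by rewrite ler_wpM2l ?sqr_ge0.
lra.
Qed.

Definition psq t : R := Num.max 0 t ^+ 2.

Lemma psq_diff2 t h : 0 <= h ->
 2 * h ^+ 2 * (0 <= t)%R%:R <= psq (t + 2 * h) - 2 * psq (t + h) + psq t <= 2 * h ^+ 2 * (0 <= t + 2 * h)%R%:R.
Proof.
move=> h0; rewrite /psq.
case: (lerP 0 t) => t0; case: (lerP 0 (t + h)) => t1; case: (lerP 0 (t + 2 * h)) => t2; rewrite ?mulr1 ?mulr0; try lra; apply/andP; split; nra.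
Qed.

Section weights.
Context (V : Type) (s : seq V) (w c : V -> R) (w0 : forall v, 0 <= w v) (c0 : forall v, 0 <= c v).

Definition wS0 x : R := \sum_(v <- s) w v * (c v ^+ 2 <= x)%R%:R.
Definition wS2 x : R := \sum_(v <- s) w v * psq (x - c v ^+ 2).

(** The second difference of the truncated square lies between [2 h^2] times the step functions at
    its two ends. *)
Lemma wS_sandwich x h : 0 <= h ->
 2 * h ^+ 2 * wS0 x <= wS2 (x + 2 * h) - 2 * wS2 (x + h) + wS2 x <= 2 * h ^+ 2 * wS0 (x + 2 * h).
Proof.
move=> h0; rewrite /wS0 /wS2 !mulr_sumr -sumrB -big_split /=.
have H v := psq_diff2 (x - c v ^+ 2) h h0.
have e1 v : x + 2 * h - c v ^+ 2 = x - c v ^+ 2 + 2 * h by ring.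
have e2 v : x + h - c v ^+ 2 = x - c v ^+ 2 + h by ring.
apply/andP; split; apply: ler_sum => v _; rewrite -subr_ge0 e1 e2 in H *; have /andP[h1 h2] := H v; have := w0 v.
 move: (psq _) (psq _) (psq _) h1 => p3 p2 p1 h1 wv; rewrite -[_ <= x]subr_ge0 -subr_ge0.
 rewrite (_ : _ - _ = w v * (p1 - 2 * p2 + p3 - 2 * h ^+ 2 * (0 <= x - c v ^+ 2)%R%:R)); last by ring.
 by rewrite mulr_ge0 // subr_ge0.
move: (psq _) (psq _) (psq _) h2 => p3 p2 p1 h2 wv; rewrite -[_ <= x + _]subr_ge0 -subr_ge0 e1.
rewrite (_ : _ - _ = w v * (2 * h ^+ 2 * (0 <= x - c v ^+ 2 + 2 * h)%R%:R - (p1 - 2 * p2 + p3))); last by ring.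
by rewrite mulr_ge0 // subr_ge0.
Qed.

(** Second differences with step [h = th * X / 4], taken upwards and downwards from [X], bound
    [wS0 X] from both sides. The factor 8/15 in the hypothesis cancels the 15/4 of [p5_diff2] to 2;
    moving the argument by [2 h] costs [a * th * sqrt X], and the error [B] is divided by [h^2]. *)
Lemma wS0_asymptotic X th a B : 0 < X -> 0 < th <= 1 -> 0 <= a ->
 (forall x, X / 2 <= x <= 3 / 2 * X -> `|wS2 x - 8 / 15 * a * p5 x| <= B) ->
 `|wS0 X - a * Num.sqrt X| <= a * th * Num.sqrt X + 32 * B / (th * X) ^+ 2.
Proof.
move=> X0 /andP[th0 th1] a0 H; pose h := th * X / 4.
have h0 : 0 < h by rewrite /h divr_gt0 // mulr_gt0.
have hX : 4 * h <= X by rewrite /h mulrC divfK // ler_piMl // ltW.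
have [up lo] : 2 * h ^+ 2 * wS0 X <= 2 * h ^+ 2 * (a * Num.sqrt (X + 2 * h)) + 4 * B /\
  2 * h ^+ 2 * (a * Num.sqrt (X - 2 * h)) - 4 * B <= 2 * h ^+ 2 * wS0 X.
 split.
  have /andP[w1 _] := wS_sandwich X h (ltW h0); have /andP[_ p1] := p5_diff2 X h (ltW X0) (ltW h0).
  have := H X ltac:(apply/andP; split; lra); have := H (X + h) ltac:(apply/andP; split; lra).
  have := H (X + 2 * h) ltac:(apply/andP; split; lra).
  have := ler_wpM2l a0 p1; rewrite !ler_norml => p2 /andP[? ?] /andP[? ?] /andP[? ?]; lra.
 have /andP[_ w1] := wS_sandwich (X - 2 * h) h (ltW h0).
 have /andP[p1 _] := p5_diff2 (X - 2 * h) h ltac:(lra) (ltW h0).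
 have e1 : X - 2 * h + 2 * h = X by ring.
 have e2 : X - 2 * h + h = X - h by ring.
 rewrite e1 e2 in w1 p1.
 have := H X ltac:(apply/andP; split; lra); have := H (X - h) ltac:(apply/andP; split; lra).
 have := H (X - 2 * h) ltac:(apply/andP; split; lra).
 have := ler_wpM2l a0 p1; rewrite !ler_norml => p2 /andP[? ?] /andP[? ?] /andP[? ?]; lra.
have q0 := sqrtr_ge0 X.
have thh : th * X = 4 * h by rewrite /h; field.
have th2 : th ^+ 2 <= th by rewrite expr2 ler_piMl // ltW.
have s1 : Num.sqrt (X + 2 * h) <= Num.sqrt X * (1 + th).
 have t1 : 0 <= 1 + th by lra.
 rewrite -[leRHS]ger0_norm ?mulr_ge0 // -sqrtr_sqr; apply: ler_wsqrtr.
 rewrite exprMn sqr_sqrtr ?ltW //; have := sqr_ge0 th; have : 0 <= X * th ^+ 2 by pos.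
 lra.
have s2 : Num.sqrt X * (1 - th) <= Num.sqrt (X - 2 * h).
 rewrite -[leLHS]ger0_norm ?mulr_ge0 ?subr_ge0 // -sqrtr_sqr; apply: ler_wsqrtr.
 rewrite exprMn sqr_sqrtr ?ltW //; have : X * th ^+ 2 <= X * th by rewrite ler_wpM2l // ltW.
 lra.
have hh : 0 < 2 * h ^+ 2 by pos.
rewrite thh -(ler_pM2l hh) -[X in X * `|_|]gtr0_norm // -normrM.
have -> : 2 * h ^+ 2 * (a * th * Num.sqrt X + 32 * B / (4 * h) ^+ 2) = 2 * h ^+ 2 * (a * th * Num.sqrt X) + 4 * B.
 by field; rewrite gt_eqF.
have k1 : 2 * h ^+ 2 * (a * Num.sqrt (X + 2 * h)) <= 2 * h ^+ 2 * (a * (Num.sqrt X * (1 + th))).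
 by rewrite ler_pM2l // ler_wpM2l.
have k2 : 2 * h ^+ 2 * (a * (Num.sqrt X * (1 - th))) <= 2 * h ^+ 2 * (a * Num.sqrt (X - 2 * h)).
 by rewrite ler_pM2l // ler_wpM2l.
by rewrite ler_norml; apply/andP; split; lra.
Qed.

(** Partial summation: the integral of [wS0 (t^2)] over [[0, M]] is the sum of [w v * (M - c v)]
    over [c v <= M], so the sum weighted by [c v] is [M * wS0 (M^2)] minus this integral. *)
Lemma wS0_sum M a E : 0 < M -> 0 <= a -> 0 <= E -> (forall t, 0 <= t <= M -> `|wS0 (t ^+ 2) - a * t| <= E) ->
 `|\sum_(v <- s) w v * c v * (c v <= M)%R%:R - a * M ^+ 2 / 2| <= 2 * (E * M).
Proof.
move=> M0 a0 E0 H;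
have cle v t : 0 <= t -> (c v ^+ 2 <= t ^+ 2) = (c v <= t) by move=> t0; rewrite ler_pXn2r ?nnegrE.
pose J := \sum_(v <- s) w v * (M - c v) * (c v <= M)%R%:R.
have JE : (\int[@lebesgue_measure R]_(t in `[0%R, M]) (wS0 (t ^+ 2))%:E = J%:E)%E.
 rewrite /J -sumEFin.
 have m1 v : mfunT (fun t : R => (c v ^+ 2 <= t ^+ 2)%R%:R : R).
  by mf.
 under eq_integral do rewrite -sumEFin.
 rewrite ge0_integral_sum //.
 - apply: eq_bigr => v _; case: (boolP (c v <= M)) => [cM|cM].
   rewrite mulr1 -(integral_cst_itv _ _ _ (w0 v) cM) integral_mkcond; apply: eq_integral => t _.
   rewrite patchE indicE !mem_setE !in_itv /=; case: (boolP (0 <= t <= M)) => [/andP[t0 tM]|/negbTE tM].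
    by rewrite cle // tM andbT.
   congr EFin; case: (boolP (c v <= t <= M)) => [/andP[ct tM']|_]; last by rewrite mulr0.
   by move: tM; rewrite tM' (le_trans (c0 v) ct).
  rewrite mulr0 integral0_eq // => t; rewrite /= in_itv /= => /andP[t0 tM]; rewrite cle //.
  by rewrite [_ <= t]negbTE ?mulr0 // -ltNge (le_lt_trans tM) // ltNge.
 - move=> v; mf.
 - by move=> v t _; rewrite lee_fin mulr_ge0 // ler0n.
have mS : mfunT (fun t => wS0 (t ^+ 2)).
 apply: measurable_sum => v; apply: measurable_funM; first mf.
 by mf.
have S0ge t : 0 <= wS0 (t ^+ 2) by apply: sumr_ge0 => v _; pos.
have lin k : (\int[@lebesgue_measure R]_(t in `[0%R, M]) (a * t + k)%:E = (a * M ^+ 2 / 2 + k * M)%:E)%E.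
 apply: etrans (FTC_open (fun t : R => a * t + k) (fun t : R => a * t ^+ 2 / 2 + k * t) 0 M M0 _ _ _) _.
 - by move=> t _; apply: is_derive_eq; rewrite /GRing.scale /=; field.
 - by move=> t; apply: cvgD; [apply: cvgMl; apply: cvgMr; apply: (@exprn_continuous _ 2)|apply: cvgMr; exact: cvg_id].
 - by move=> t; apply: cvgD; [apply: cvgMr; exact: cvg_id|exact: cvg_cst].
 - by congr EFin; ring.
have mlin k : measurable_fun `[0%R, M] (fun t => (a * t + k)%:E).
 by mf.
have J1 : J <= a * M ^+ 2 / 2 + E * M.
 rewrite -lee_fin -JE -lin; apply: ge0_le_integral => //.
 - by move=> t _; rewrite lee_fin.
 - by apply/measurable_EFinP; exact: measurable_funTS.
 - mf.
 - by move=> t; rewrite /= in_itv => tM; rewrite lee_fin; have := H t tM; rewrite ler_norml => /andP[_]; lra.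
have J2 : a * M ^+ 2 / 2 + 0 * M <= J + E * M.
 rewrite -lee_fin -lin EFinD -JE.
 have eE : (\int[@lebesgue_measure R]_(t in `[0%R, M]) (cst E%:E t) = (E * M)%:E)%E.
  by rewrite integral_cst //= lebesgue_measure_itv lte_fin M0 sube0.
 have mW : measurable_fun `[0%R, M] (fun t : R => (wS0 (t ^+ 2))%:E).
  by apply/measurable_EFinP; exact: measurable_funTS.
 have mE : measurable_fun `[0%R, M] (cst E%:E : R -> \bar R) by mf.
 apply: (@le_trans _ _ (\int[@lebesgue_measure R]_(t in `[0%R, M]) ((wS0 (t ^+ 2))%:E + cst E%:E t))%E); last first.
  by rewrite ge0_integralD //; [rewrite eE|move=> t _; rewrite lee_fin].
 apply: ge0_le_integral => //.
 - by move=> t; rewrite /= in_itv => /andP[t0 _]; rewrite lee_fin addr0 mulr_ge0.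
 - mf.
 - exact: emeasurable_funD.
 - by move=> t; rewrite /= in_itv => tM; rewrite lee_fin; have := H t tM; rewrite ler_norml => /andP[+ _]; lra.
have -> : \sum_(v <- s) w v * c v * (c v <= M)%R%:R = M * wS0 (M ^+ 2) - J.
 rewrite /J /wS0 mulr_sumr -sumrB; apply: eq_bigr => v _; rewrite cle ?(ltW M0); ring.
have := H M ltac:(by rewrite lexx ltW); rewrite !ler_norml => /andP[h1 h2].
have g1 := ler_wpM2l (ltW M0) h1; have g2 := ler_wpM2l (ltW M0) h2.
lra.
Qed.

(* The error E x^{5/2-e} of the second moment costs x^{-e/4} in the zeroth one when the step of the
  second difference is a multiple of x^{1-e/4}. *)
Lemma tauber M a e E : 1 <= M -> 0 <= a <= E -> 0 < e <= 1 ->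
 (forall x, 1 <= x <= 2 * M ^+ 2 -> `|wS2 x - 8 / 15 * a * p5 x| <= E * p5 x * x `^ (- e)) ->
 wS0 2 <= E ->
 `|\sum_(v <- s) w v * c v * (c v <= M)%R%:R - a * M ^+ 2 / 2| <= 516 * E * M `^ (2 - e / 2).
Proof.
move=> M1 /andP[a0 aE] /andP[e0 e1] H H2; have M0 : 0 < M by lra.
have E0 : 0 <= E by lra.
have pM : M * M `^ (1 - e / 2) = M `^ (2 - e / 2).
 rewrite -{1}(powRr1 (ltW M0)) -powRD; last by apply/implyP => _; rewrite gt_eqF.
 by congr (_ `^ _); ring.
have p1 : 1 <= M `^ (1 - e / 2) by rewrite -[leLHS](powRr0 M) ler_powR; lra.
rewrite -pM (_ : 516 * E * _ = 2 * (258 * E * M `^ (1 - e / 2) * M)); last by ring.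
apply: (wS0_sum _ _ _ M0 a0 (mulr_ge0 (mulr_ge0 (ler0n R 258) E0) (powR_ge0 _ _))).
move=> t /andP[t0 tM]; have [t2|t2] := ltP (t ^+ 2) 2.
 have t3 : t <= 2 by rewrite leNgt; apply/negP => h; have := ltr_pM _ _ h h; rewrite -expr2; lra.
 have S1 : wS0 (t ^+ 2) <= E.
  apply: le_trans H2; apply: ler_sum => v _; rewrite ler_wpM2l //.
  by case: (boolP (c v ^+ 2 <= t ^+ 2)) => [h|_]; [rewrite (le_trans h (ltW t2))|rewrite ler0n].
 have S2 : 0 <= wS0 (t ^+ 2) by apply: sumr_ge0 => v _; pos.
 have at0 : 0 <= a * t by pos.
 have at2 : a * t <= E * 2 by exact: ler_pM.
 have EM : E <= E * M `^ (1 - e / 2) by rewrite ler_peMr.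
 by rewrite ler_norml; apply/andP; split; lra.
have tp : 0 < t by rewrite lt_neqAle t0 andbT; apply/eqP => h; move: t2; rewrite -h expr0n /=; lra.
pose X := t ^+ 2; have X0 : 0 < X by exact: exprn_gt0.
have X2 : 2 <= X := t2.
pose th := X `^ (- (e / 4)).
have th0 : 0 < th by exact: powR_gt0.
have th1 : th <= 1 by rewrite -[leRHS](powRr0 X) ler_powR; lra.
have th4 : th ^+ 4 = X `^ (- e).
 by rewrite -powR_mulrn ?powR_ge0 // -powRrM; congr (_ `^ _); field.
have sX : Num.sqrt X = t by rewrite sqrtr_sqr ger0_norm.
have XM : X <= M ^+ 2 by rewrite lerXn2r ?nnegrE // ltW.
have HB x : X / 2 <= x <= 3 / 2 * X -> `|wS2 x - 8 / 15 * a * p5 x| <= 8 * E * X ^+ 2 * t * th ^+ 4.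
 move=> /andP[x1 x2]; have xM : 1 <= x <= 2 * M ^+ 2 by clear -X2 XM x1 x2; apply/andP; split; lra.
 apply: le_trans (H x xM) _.
 have [xp Xx2 x20 xX X20] : [/\ 0 < x, X <= x * 2, 0 <= x * 2, x <= 3 / 2 * X & 0 <= 3 / 2 * X].
  by clear -x1 x2 X0; split; lra.
 have xe : x `^ (- e) <= 2 * X `^ (- e).
  have Xx : X `^ e <= x `^ e * 2.
   apply: le_trans (_ : (x * 2) `^ e <= _); first by rewrite ge0_ler_powR ?nnegrE ?(ltW X0) ?(ltW e0).
   by rewrite powRM ?(ltW xp) // ler_wpM2l ?powR_ge0 // -[leRHS]powRr1 // ler_powR ?ler1n.
  by rewrite !powRN ler_pdivlMr ?powR_gt0 // mulrC ler_pdivrMr ?powR_gt0 // mulrC.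
 have px : p5 x <= (3 / 2 * X) ^+ 2 * (3 / 2 * t).
  rewrite /p5; apply: ler_pM; rewrite ?sqr_ge0 ?sqrtr_ge0 //; first by rewrite lerXn2r ?nnegrE ?(ltW xp).
  rewrite -[leRHS]ger0_norm; last by lra.
  by rewrite -sqrtr_sqr; apply: ler_wsqrtr; rewrite exprMn -/X; lra.
 have p50 : 0 <= p5 x by rewrite /p5 mulr_ge0 ?sqr_ge0.
 rewrite th4 (_ : 8 * E * X ^+ 2 * t * X `^ (- e) = E * (4 * X ^+ 2 * t) * (2 * X `^ (- e))); last by ring.
 apply: ler_pM => //; [pos|pos|].
 apply: ler_wpM2l => //; apply: le_trans px _.
 have : 0 <= X ^+ 2 * t by pos.
 by lra.
have := wS0_asymptotic X th a _ X0 ltac:(by rewrite th0 th1) a0 HB.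
rewrite sX -/X (_ : 32 * _ / _ = 256 * E * (th ^+ 2 * t)); last by field; rewrite !gt_eqF.
move=> h; apply: le_trans h _.
have tth : th * t <= M `^ (1 - e / 2).
 have -> : th * t = t `^ (1 - e / 2).
  rewrite /th /X -powR_mulrn // -powRrM -{2}(powRr1 t0) -powRD; last by apply/implyP => _; rewrite gt_eqF.
  by congr (_ `^ _); field.
 have e2 : 0 <= 1 - e / 2 by rewrite subr_ge0 ler_pdivrMr // mul1r (le_trans e1) // ler1n.
 by rewrite ge0_ler_powR ?nnegrE // ?ltW.
have th2t : th ^+ 2 * t <= th * t by rewrite ler_wpM2r // expr2 ler_piMl // ltW.
have tt0 : 0 <= th * t by pos.
have k1 : E * (th ^+ 2 * t) <= E * M `^ (1 - e / 2) by rewrite ler_wpM2l // (le_trans th2t).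
have k2 : a * (th * t) <= E * M `^ (1 - e / 2) by exact: ler_pM.
have k3 : 0 <= E * M `^ (1 - e / 2) by pos.
lra.
Qed.

End weights.
End tauber.

From mathcomp Require Import finmap.
(** * Weighted counting of the vectors *)

Section finite_sums.
Context {R : realType} {T : choiceType}.
Implicit Types (A B : set T).

Lemma sum1_size (I : Type) (s : seq I) : \sum_(i <- s) (1 : R) = (size s)%:R.
Proof. by elim: s => [|i s IH]; rewrite ?big_nil // big_cons IH -natr1 addrC. Qed.

Lemma esum1_finite A (C : R) : (\esum_(v in A) 1 <= C%:E :> \bar R)%E -> finite_set A.
Proof.
move=> hC; apply: contrapT => infA; have C0 : 0 <= C by rewrite -lee_fin (le_trans _ hC) // esum_ge0.
have [B BA Bn] := infinite_set_fset (Num.truncn C).+1 infA.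
have : ((size (finmap.enum_fset B))%:R%:E <= C%:E :> \bar R)%E.
 apply: le_trans hC; apply: esum_ge; exists [set` B]; first by split => //; exact: finite_fset.
 by rewrite fsbig_finite //= set_fsetK sumEFin sum1_size lexx.
rewrite lee_fin leNgt => /negP; apply; apply: (@lt_le_trans _ _ (Num.truncn C).+1%:R); last by rewrite ler_nat.
by have /andP[] := truncn_itv C0.
Qed.

Lemma rsum_fin A B (f : T -> R) : finite_set B -> B `<=` A -> (forall v, A v -> 0 <= f v) ->
 (forall v, A v -> ~ B v -> f v = 0) -> rsum A f = \sum_(v <- finmap.enum_fset (fset_set B)) f v.
Proof.
move=> fB BA f0 fz; rewrite /rsum (esumID B) //.
rewrite setIidr // [X in (_ + X)%E]esum1 => [|v [Av nB]]; last by rewrite fz.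
rewrite adde0 esum_fset // => [|v]; last by rewrite in_setE => /BA Av; rewrite lee_fin f0.
by rewrite fsbig_finite //= sumEFin.
Qed.

End finite_sums.

Section counting.
Context {R : realType}.
Notation P := (plane R).
Notation L1 := (@lebesgue_measure R).
Context (G : set 'M[R]_2) (dG : discrete_subgroup_SL2 G) (sa sb : 'M[R]_2)
 (hsa : scaling_matrix G sa) (hsb : scaling_matrix G sb).

Definition RPM (M : R) : set (R * R) := [set v | RP G sa sb v /\ v.2 <= M].

Lemma RPM_count M : 0 <= M -> finite_set (RPM M) /\
 (size (finmap.enum_fset (fset_set (RPM M))))%:R <= 2 * Crp * (1 + M ^+ 2).
Proof.
move=> M0; have C0 := @Crp_ge0 R.
have x0 : 0 <= 1 + M ^+ 2 by pos.
have H : (\esum_(v in RPM M) 1 <= (2 * Crp * (1 + M ^+ 2))%:E :> \bar R)%E.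
 apply: le_trans (_ : (\esum_(v in RP G sa sb) (1 * (v.2 ^+ 2 < 1 + M ^+ 2)%R%:R)%:E <= _)%E); last first.
  apply: le_trans (RP_count _ dG _ _ hsa hsb _ _ x0 ler01) _; rewrite lee_fin mul1r.
  by have := mulr_ge0 C0 (sqr_ge0 M); lra.
 rewrite [leRHS](esumID (RPM M)) //.
 rewrite setIidr; last by move=> v [].
 apply: le_trans (leeDl _ _); last by apply: esum_ge0 => v _; pos.
 apply: le_esum => v [Rv vM]; rewrite lee_fin mul1r.
 have v0 : 0 < v.2 by case: Rv => _ [].
 by have -> // : v.2 ^+ 2 < 1 + M ^+ 2; have : v.2 ^+ 2 <= M ^+ 2 by [rewrite lerXn2r ?nnegrE // ltW]; lra.
have fM := esum1_finite _ _ H; split => //.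
rewrite -lee_fin (le_trans _ H) // esum_fset // fsbig_finite //=.
by rewrite sumEFin sum1_size lexx.
Qed.

Context (chi : R -> R) (chi0 : forall X, 0 <= chi X <= 2).

Let w (v : R * R) := chi (v.1 / v.2) / `|v.2|.
Let c (v : R * R) := `|v.2|.

(** [(1 - c^2 / x)^2] is a truncated square divided by [x^2], so the smoothed count is a
    second-moment sum with weights [chi / c]; partial summation later removes the [1 / c]. *)
Lemma wS2_Smooth M x : 0 <= M -> 0 < x <= M ^+ 2 ->
 wS2 _ (finmap.enum_fset (fset_set (RPM M))) w c x = 4 / pi * (p5 x / x) * Smooth G sa sb chi x.
Proof.
move=> M0 /andP[x0 xM]; have [fM _] := RPM_count M M0.
rewrite /Smooth (rsum_fin _ (RPM M)) //.
- rewrite mulr_sumr /wS2 big_seq [RHS]big_seq; apply: eq_bigr => v; rewrite in_fset_set // in_setE => -[Rv vM].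
 have v0 : 0 < v.2 by case: Rv => _ [].
 rewrite /w /c ger0_norm ?(ltW v0) // /mt /psq; case: (ltP (v.2 ^+ 2) x) => h.
  rewrite max_r ?subr_ge0 ?ltW // /p5.
  have -> : 1 - v.2 ^+ 2 / x = (x - v.2 ^+ 2) / x by rewrite mulrBl divff // gt_eqF.
  have s0 : 0 < Num.sqrt x by rewrite sqrtr_gt0.
  have fin (r ch v2 p : R) : 0 < r -> 0 < v2 -> 0 < p -> ch / v2 * (r ^+ 2 - v2 ^+ 2) ^+ 2 =
    4 / p * ((r ^+ 2) ^+ 2 * r / r ^+ 2) * (ch * (p / 4 * (r * ((r ^+ 2 - v2 ^+ 2) / r ^+ 2) ^+ 2 / v2))).
   by move=> *; field; rewrite !gt_eqF.
  by have := fin _ (chi (v.1 / v.2)) _ _ s0 v0 (pi_gt0 R); rewrite sqr_sqrtr // ltW.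
 by rewrite max_l ?subr_le0 // expr0n !mulr0.
- by move=> v [].
- move=> v Rv; have [m0 _] := mt_le _ dG _ _ hsa hsb v _ Rv x0.
 by apply: mulr_ge0 m0; have /andP[] := chi0 (v.1 / v.2).
- move=> v Rv nv; rewrite /mt ifF ?mulr0 //; apply/negbTE; rewrite -leNgt; apply: le_trans xM _.
 have v0 : 0 < v.2 by case: Rv => _ [].
 have vM : M < v.2 by rewrite ltNge; apply/negP => h; exact: nv.
 by rewrite lerXn2r ?nnegrE // ltW.
Qed.

End counting.

Section counting_theorem.
Context {R : realType}.
Notation P := (plane R).
Notation L1 := (@lebesgue_measure R).
Context (G : set 'M[R]_2) (dG : discrete_subgroup_SL2 G) (F : set P) (hF : fdom G F)
 (mF : measurable F) (finF : ((L1 \x L1)%E F < +oo)%E).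
Let mu := muF mF finF.

Lemma weighted_count : exists2 delta : R, 0 < delta <= 1 &
 forall sa sb, scaling_matrix G sa -> scaling_matrix G sb ->
 exists2 K : R, 0 <= K & forall (chi : R -> R) (Lam m : R), mfunT chi ->
  (forall X, 0 <= chi X <= 2) -> (forall X X', `|chi X - chi X'| <= Lam * `|X - X'|) ->
  (forall X, chi (X + 1) = chi X) -> (\int[L1]_(X in `[0%R, 1%R]) (chi X)%:E = m%:E)%E ->
  forall M, 1 <= M ->
  `|\sum_(v <- finmap.enum_fset (fset_set (RPM G sa sb M))) chi (v.1 / v.2) - m * (M ^+ 2 / (pi * vol mu))| <=
   K * (1 + Lam) * M `^ (2 - delta).
Proof.
have [[sb0 hsb0]|nosb] := pselect (exists sb, scaling_matrix G sb); last first.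
 (* Without cusps the claim is vacuous. Otherwise a scaling matrix shows that [-1] belongs to [G],
    as the gap requires. *)
 by exists 1; [rewrite ltr01 lexx|move=> sa sb ha hb; case: nosb; exists sb].
have hN := scaling_opp1 _ _ hsb0.
have [b /andP[b0 b1] hb] := var_et_growth _ dG _ hF mF finF hN (ex_intro _ sb0 hsb0).
(* The saving [exp (- eps u)] at [x = exp (16 u)] is [x^(- eps / 16)]. *)
pose eps := Num.min 1 (3 - 6 * b); pose e := eps / 16.
have eps0 : 0 < eps by rewrite lt_min; apply/andP; split; lra.
have eps1 : eps <= 1 by rewrite ge_min lexx.
have e0 : 0 < e <= 1 by rewrite /e; apply/andP; split; lra.
exists (e / 2) => [|sa sb hsa hsb]; first by case/andP: e0 => *; apply/andP; split; lra.
have v0 : 0 < vol mu := vol_gt0 _ dG hN _ hF mF finF.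
have [C hC] := hb sb hsb.
have b2 : 0 <= b < 1 / 2 by apply/andP; split; lra.
have [K K0 hK] := smooth_asymptotic _ dG _ hF mF finF _ _ hsa hsb _ _ b2 hC.
have s0 : 0 < Num.sqrt (sepd : R) by rewrite sqrtr_gt0 sepd_gt0.
have p0 := @pi_gt0 R; have C0 := @Crp_ge0 R.
have pv0 : 0 < pi * vol mu by pos.
pose K1 := 4 / pi * K; pose K2 := 4 / (pi * vol mu); pose K3 := 2 / Num.sqrt (sepd : R) * (Crp * 4).
have K10 : 0 <= K1 by rewrite mulr_ge0 // divr_ge0 // ltW.
have K20 : 0 <= K2 by rewrite divr_ge0 // ltW.
have K30 : 0 <= K3 := mulr_ge0 (divr_ge0 (ler0n _ 2) (ltW s0)) (mulr_ge0 C0 (ler0n _ 4)).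
exists (516 * (K1 + K2 + K3)) => [|chi Lam m mchi chi0 chiL chi1 chim M M1]; first by pos.
have Lam0 : 0 <= Lam by have := chiL 1 0; rewrite subr0 normr1 mulr1; exact: le_trans.
have /andP[m0 m2] := mean_bound _ _ mchi chi0 chim.
have M0 := le_trans ler01 M1.
(* The Tauberian step looks at [x] up to [2 M^2], so representatives with lower entry up to [2 M]
   are kept and cut back to [M] at the end. *)
pose s := finmap.enum_fset (fset_set (RPM G sa sb (2 * M))).
have M20 := mulr_ge0 (ler0n R 2) M0.
have [fM _] := RPM_count _ dG _ _ hsa hsb M M0.
have [fM2 _] := RPM_count _ dG _ _ hsa hsb _ M20.
pose w (v : R * R) := chi (v.1 / v.2) / `|v.2|; pose c (v : R * R) := `|v.2|.
pose a := 2 * m / (pi * vol mu); pose E := (K1 + K2 + K3) * (1 + Lam).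
have w0 v : 0 <= w v by rewrite divr_ge0; have /andP[] := chi0 (v.1 / v.2).
have c0 v : 0 <= c v by exact: normr_ge0.
have KE : K1 + K2 + K3 <= E by rewrite /E ler_peMr ?addr_ge0 // lerDl.
have aE : 0 <= a <= E.
 have a0 : 0 <= a by rewrite divr_ge0 ?mulr_ge0 // ltW.
 have aK : a <= K2 by rewrite /a /K2 ler_wpM2r ?invr_ge0 ?(ltW pv0) // (le_trans (ler_wpM2l (ler0n R 2) m2)) // -natrM.
 by rewrite a0 (le_trans aK) // (le_trans _ KE) // addrAC lerDr addr_ge0.
have inRP v : v \in s -> RP G sa sb v /\ v.2 <= 2 * M by rewrite in_fset_set // in_setE => -[].
have fin1 (p q x S m' v : R) : 0 < p -> 0 < x -> 0 < v ->
  4 / p * (q / x) * S - 8 / 15 * (2 * m' / (p * v)) * q = 4 / p * (q / x) * (S - 4 / 15 * (m' / v) * x).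
 by move=> *; field; rewrite !gt_eqF.
have fin2 (p q x K' L y : R) : 0 < p -> 0 < x -> 4 / p * (q / x) * (K' * L * (x * y)) = 4 / p * K' * (L * (q * y)).
 by move=> *; field; rewrite !gt_eqF.
have fin3 (p m' v N : R) : 0 < p -> 0 < v -> 2 * m' / (p * v) * N / 2 = m' * (N / (p * v)).
 by move=> *; field; rewrite !gt_eqF.
have H1 x : 1 <= x <= 2 * M ^+ 2 -> `|wS2 _ s w c x - 8 / 15 * a * p5 x| <= E * p5 x * x `^ (- e).
 move=> /andP[x1 x2]; have x0 := lt_le_trans ltr01 x1.
 have x3 : 0 < x <= (2 * M) ^+ 2 by rewrite x0 exprMn (le_trans x2) // ler_wpM2r ?sqr_ge0 // expr2 ler_pMr // ler1n.
 rewrite (wS2_Smooth _ dG _ _ hsa hsb _ chi0 _ _ M20 x3).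
 have l0 : 0 <= ln x / 16 by rewrite divr_ge0 // ln_ge0.
 have := hK _ _ _ mchi chi0 chiL chi1 chim _ l0.
 have -> : expR (16 * (ln x / 16)) = x by rewrite mulrC divfK // lnK // posrE.
 have -> : expR ((16 - Num.min 1 (3 - 6 * b)) * (ln x / 16)) = x * x `^ (- e).
  by rewrite -{2}(lnK x0) /powR gt_eqF // -expRD; congr expR; rewrite /e /eps; field.
 have q0 : 0 <= p5 x / x by rewrite divr_ge0 ?(ltW x0) // mulr_ge0 ?sqr_ge0.
 have q1 : 0 <= 4 / pi * (p5 x / x) by pos.
 move=> h; have {}h := ler_wpM2l q1 h; rewrite -[X in X * `|_|]ger0_norm // -normrM in h.
 have -> : 4 / pi * (p5 x / x) * Smooth G sa sb chi x - 8 / 15 * a * p5 x =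
  4 / pi * (p5 x / x) * (Smooth G sa sb chi x - 4 / 15 * (m / vol mu) * x).
  exact: fin1 p0 x0 v0.
 apply: le_trans h _.
 have -> : 4 / pi * (p5 x / x) * (K * (1 + Lam) * (x * x `^ (- e))) = K1 * ((1 + Lam) * (p5 x * x `^ (- e))).
  exact: fin2 p0 x0.
 have -> : E * p5 x * x `^ (- e) = (K1 + K2 + K3) * ((1 + Lam) * (p5 x * x `^ (- e))) by rewrite /E; ring.
 apply: ler_wpM2r; last by rewrite -addrA lerDl addr_ge0.
 exact: mulr_ge0 (addr_ge0 ler01 Lam0) (mulr_ge0 (mulr_ge0 (sqr_ge0 x) (sqrtr_ge0 x)) (powR_ge0 _ _)).
have H2 : wS0 _ s w c 2 <= E.
 apply: (@le_trans _ _ K3); last by apply: le_trans KE; rewrite lerDr addr_ge0.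
 have := RP_count _ dG _ _ hsa hsb 3 _ (ler0n R 3) (divr_ge0 (ler0n R 2) (ltW s0)).
 have -> : (1 + 3 : R) = 4 by ring.
 rewrite -/K3 -lee_fin; apply: le_trans.
 rewrite (esumID (RPM G sa sb (2 * M))) //.
 rewrite setIidr; last by move=> v [].
 apply: le_trans (leeDl _ _); last first.
  by apply: esum_ge0 => v _; pos.
 rewrite esum_fset //.
 rewrite fsbig_finite //= sumEFin lee_fin /wS0 big_seq [leRHS]big_seq; apply: ler_sum => v /inRP [Rv _].
 have vl := RP_c_lower _ dG _ _ hsa hsb v Rv; have vp : 0 < v.2 by case: Rv => _ [].
 have cl : Num.sqrt sepd <= c v by rewrite /c -sqrtr_sqr ler_wsqrtr.
 apply: ler_pM => //.
  rewrite /w; have /andP[h1 h2] := chi0 (v.1 / v.2); apply: ler_pM => //.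
  by rewrite lef_pV2 ?posrE // (lt_le_trans s0).
 rewrite /c real_normK ?num_real // ler_nat; case: (boolP (v.2 ^+ 2 <= 2)) => // h.
 by rewrite (le_lt_trans h) // ltr_nat.
have := tauber _ _ _ _ w0 c0 _ _ _ _ M1 aE e0 H1 H2.
rewrite (_ : 516 * (K1 + K2 + K3) * (1 + Lam) = 516 * E); last by rewrite /E mulrA.
rewrite (_ : a * M ^+ 2 / 2 = m * (M ^+ 2 / (pi * vol mu))); last exact: fin3.
suff -> : \sum_(v <- s) w v * c v * (c v <= M)%R%:R =
 \sum_(v <- finmap.enum_fset (fset_set (RPM G sa sb M))) chi (v.1 / v.2) by [].
have chi_ge0 X : 0 <= chi X by have /andP[] := chi0 X.
have g0 v : 0 <= chi (v.1 / v.2) * (v.2 <= M)%R%:R by pos.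
have Rsub u v : u <= v -> RPM G sa sb u `<=` RPM G sa sb v by move=> uv z [Rz zu]; split => //; exact: le_trans uv.
transitivity (rsum (RPM G sa sb (2 * M)) (fun v => chi (v.1 / v.2) * (v.2 <= M)%R%:R)).
 rewrite (rsum_fin _ (RPM G sa sb (2 * M))) // big_seq [RHS]big_seq; apply: eq_bigr => v /inRP [[_ [vp _]] _].
 by rewrite /w /c ger0_norm ?(ltW vp) // divfK // gt_eqF.
rewrite (rsum_fin _ (RPM G sa sb M)) //.
- rewrite big_seq [RHS]big_seq; apply: eq_bigr => v; rewrite in_fset_set // in_setE => -[_ ->].
 by rewrite mulr1.
- by apply: Rsub; rewrite ler_peMl ?ler1n.
- move=> v [Rv _] nv; case: (boolP (v.2 <= M)) => [h|_]; [by case: nv|by rewrite mulr0].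
Qed.

End counting_theorem.

(** * Fejer means *)

Section fourier.
Context {R : realType}.
Implicit Types (z : R[i]) (x y : R) (f g h : R -> R[i]).
Notation L1 := (@lebesgue_measure R).
Notation I01 := (`[0%R, 1%R]%classic : set R).
Local Notation Rint f := (Rintegral L1 I01 f).

Lemma normcE' z : `|z| = (cabs z)%:C%C. Proof. done. Qed.
Lemma cabs0 : cabs (0 : R[i]) = 0. Proof. exact: Normc.normc0. Qed.
Lemma cabs_ge0 z : 0 <= cabs z. Proof. by case: z => a b; exact: sqrtr_ge0. Qed.
Lemma cabsM z z' : cabs (z * z') = cabs z * cabs z'. Proof. exact: Normc.normcM. Qed.
Lemma cabsD z z' : cabs (z + z') <= cabs z + cabs z'. Proof. exact: le_normcD. Qed.
Lemma cabsC x : cabs x%:C%C = `|x|. Proof. by rewrite /cabs /= expr0n addr0 sqrtr_sqr. Qed.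
Lemma cabsB z z' : cabs (z - z') = cabs (z' - z).
Proof. by rewrite -opprB -mulN1r cabsM (_ : -1 = (-1)%:C%C) ?cabsC ?normrN1 ?mul1r // rmorphN1. Qed.
Lemma cabsN z : cabs (- z) = cabs z. Proof. by rewrite -sub0r cabsB subr0. Qed.
Lemma cabs_sum (I : Type) (s : seq I) (F : I -> R[i]) : cabs (\sum_(i <- s) F i) <= \sum_(i <- s) cabs (F i).
Proof.
elim: s => [|i s IH]; first by rewrite !big_nil cabs0.
by rewrite !big_cons; apply: le_trans (cabsD _ _) _; rewrite lerD2l.
Qed.
Lemma cabs_Re z : `|complex.Re z| <= cabs z.
Proof. by case: z => a b; rewrite -sqrtr_sqr ler_wsqrtr // lerDl sqr_ge0. Qed.
Lemma cabs_Im z : `|complex.Im z| <= cabs z.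
Proof. by case: z => a b; rewrite -sqrtr_sqr ler_wsqrtr // lerDr sqr_ge0. Qed.
Lemma cabs_le z : cabs z <= `|complex.Re z| + `|complex.Im z|.
Proof.
case: z => a b /=; rewrite -[leRHS]ger0_norm // -sqrtr_sqr ler_wsqrtr //.
by rewrite sqrrD !real_normK ?num_real // lerD2r lerDl mulrn_wge0 // mulr_ge0.
Qed.

Definition ex x : R[i] := expi (2 * pi * x).
Lemma exD x y : ex (x + y) = ex x * ex y.
Proof. by rewrite /ex /expi mulrDr cosD sinD; simpc; congr (_ +i* _)%C; rewrite addrC [X in _ + X]mulrC addrC. Qed.
Lemma ex0 : ex 0 = 1. Proof. by rewrite /ex /expi mulr0 cos0 sin0. Qed.
Lemma cabs_ex x : cabs (ex x) = 1. Proof. by rewrite /cabs /= cos2Dsin2 sqrtr1. Qed.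
Lemma ex_conj x : ((ex x)^*)%C = ex (- x). Proof. by rewrite /ex /expi mulrN cosN sinN. Qed.
Lemma ex1 : ex 1 = 1.
Proof.
rewrite /ex /expi mulr1 (_ : 2 * pi = pi *+ 2); last by rewrite mulr_natl.
by rewrite cos2pi sin2pi.
Qed.
Lemma ex_int (n : int) : ex n%:~R = 1.
Proof.
have exn (k : nat) : ex k%:R = 1 by elim: k => [|k IH]; rewrite ?ex0 // -natr1 exD IH ex1 mulr1.
case: n => k; first exact: exn.
by rewrite NegzE mulrNz -ex_conj (exn k.+1) conjc1.
Qed.

Definition cc f := continuous (fun x => complex.Re (f x)) /\ continuous (fun x => complex.Im (f x)).

Lemma ccD f g : cc f -> cc g -> cc (fun x => f x + g x).
Proof.
by move=> [f1 f2] [g1 g2]; split=> x; [rewrite (_ : (fun _ => _) = (fun x => complex.Re (f x) + complex.Re (g x)))|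
 rewrite (_ : (fun _ => _) = (fun x => complex.Im (f x) + complex.Im (g x)))];
 try (by apply: cvgD; [exact: f1|exact: g1]); try (by apply: cvgD; [exact: f2|exact: g2]);
 apply/funext => y; case: (f y) (g y) => a b [].
Qed.

Lemma ccM f g : cc f -> cc g -> cc (fun x => f x * g x).
Proof.
move=> [f1 f2] [g1 g2]; split=> x.
 rewrite (_ : (fun _ => _) = (fun x => complex.Re (f x) * complex.Re (g x) - complex.Im (f x) * complex.Im (g x))).
  by apply: cvgB; [apply: cvgM; [exact: f1|exact: g1]|apply: cvgM; [exact: f2|exact: g2]].
 by apply/funext => y; case: (f y) (g y) => a b [].
rewrite (_ : (fun _ => _) = (fun x => complex.Re (f x) * complex.Im (g x) + complex.Im (f x) * complex.Re (g x))).
 by apply: cvgD; [apply: cvgM; [exact: f1|exact: g2]|apply: cvgM; [exact: f2|exact: g1]].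
by apply/funext => y; case: (f y) (g y) => a b [].
Qed.

Lemma cc_cst z : cc (fun=> z). Proof. by split=> x; exact: cvg_cst. Qed.

Lemma cc_ex x (k : R) : cc (fun y => ex (k * (x - y))).
Proof.
have c y : {for y, continuous (fun y => 2 * pi * (k * (x - y)))}.
 by apply: cvgMr; apply: cvgMr; apply: cvgB; [exact: cvg_cst|exact: cvg_id].
split=> y; [apply: (@continuous_comp _ _ _ (fun y => 2 * pi * (k * (x - y))) cos)|
 apply: (@continuous_comp _ _ _ (fun y => 2 * pi * (k * (x - y))) sin)]; try exact: c.
- exact: continuous_cos.
- exact: continuous_sin.
Qed.

Lemma cc_sum (I : Type) (s : seq I) (F : I -> R -> R[i]) : (forall i, cc (F i)) -> cc (fun x => \sum_(i <- s) F i x).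
Proof.
move=> cF; elim: s => [|i s IH].
 by rewrite (_ : (fun _ => _) = fun=> 0); [exact: cc_cst|apply/funext => x; rewrite big_nil].
by rewrite (_ : (fun _ => _) = fun x => F i x + \sum_(i <- s) F i x); [exact: ccD|apply/funext => x; rewrite big_cons].
Qed.

Lemma cont_int (u : R -> R) : continuous u -> L1.-integrable I01 (EFin \o u).
Proof.
move=> cu; apply: continuous_compact_integrable; first exact: segment_compact.
by apply: continuous_subspaceT => x; exact: cu.
Qed.

Lemma cintD f g : cc f -> cc g -> cint (fun x => f x + g x) = cint f + cint g.
Proof.
move=> [f1 f2] [g1 g2]; rewrite /cint.
have -> : (fun x => complex.Re (f x + g x)) = (fun x => complex.Re (f x) + complex.Re (g x)).
 by apply/funext => y; case: (f y) (g y) => a b [].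
have -> : (fun x => complex.Im (f x + g x)) = (fun x => complex.Im (f x) + complex.Im (g x)).
 by apply/funext => y; case: (f y) (g y) => a b [].
by rewrite !RintegralD //; exact: cont_int.
Qed.

Lemma cintZ z f : cc f -> cint (fun x => z * f x) = z * cint f.
Proof.
move=> [f1 f2]; case: z => a b; rewrite /cint; simpc.
have -> : (fun x => complex.Re ((a +i* b)%C * f x)) = (fun x => a * complex.Re (f x) - b * complex.Im (f x)).
 by apply/funext => y; case: (f y).
have -> : (fun x => complex.Im ((a +i* b)%C * f x)) = (fun x => a * complex.Im (f x) + b * complex.Re (f x)).
 by apply/funext => y; case: (f y).
have ci (k : R) u : continuous u -> L1.-integrable I01 (EFin \o (fun x => k * u x)).
 by move=> cu; apply: cont_int => x; apply: cvgMr; exact: cu.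
by rewrite RintegralB ?RintegralD ?RintegralZl //; try exact: ci; exact: cont_int.
Qed.

Lemma cint_sum (I : Type) (s : seq I) (F : I -> R -> R[i]) : (forall i, cc (F i)) ->
 cint (fun x => \sum_(i <- s) F i x) = \sum_(i <- s) cint (F i).
Proof.
move=> cF; elim: s => [|i s IH].
 rewrite big_nil (_ : (fun _ => _) = fun=> 0 * 0); last by apply/funext => x; rewrite big_nil mul0r.
 by rewrite (cintZ 0 _ (cc_cst 0)) mul0r.
rewrite big_cons -IH -cintD //; last exact: cc_sum.
by congr cint; apply/funext => x; rewrite big_cons.
Qed.

(** The factor 2 comes from estimating real and imaginary parts separately. *)
Lemma cint_le f (u : R -> R) : cc f -> continuous u -> (forall x, cabs (f x) <= u x) -> cabs (cint f) <= 2 * Rint u.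
Proof.
move=> [f1 f2] cu fu; apply: le_trans (cabs_le _) _; rewrite /cint /= mulr_natl mulr2n.
have H (p : R -> R) : continuous p -> (forall x, `|p x| <= u x) -> `|Rint p| <= Rint u.
 move=> cp pu; apply: le_trans (le_normr_Rintegral _ (cont_int _ cp)) _ => //.
 apply: le_Rintegral => //; last exact: cont_int.
 by apply: cont_int => x; apply: cvg_norm; exact: cp.
by apply: lerD; apply: H => // x; [exact: le_trans (cabs_Re _) (fu x)|exact: le_trans (cabs_Im _) (fu x)].
Qed.

Lemma cint_ex (k : int) x : cint (fun y => ex (k%:~R * (x - y))) = (k == 0)%:R.
Proof.
have [->|k0] := eqVneq k 0.
 rewrite (_ : (fun _ => _) = fun=> 1); last by apply/funext => y; rewrite mul0r ex0.
 rewrite /cint !Rintegral_cst //= lebesgue_measure_itv /= lte_fin ltr01 oppr0 adde0 mul1r mul0r //.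
pose w : R := 2 * pi * k%:~R; have w0 : w != 0.
 by rewrite !mulf_neq0 ?intr_eq0 // gt_eqF // pi_gt0.
have [p1 p2] : cos (w * (x - 1)) = cos (w * x) /\ sin (w * (x - 1)) = sin (w * x).
 have : ex (k%:~R * (x - 1)) = ex (k%:~R * x) by rewrite mulrBr mulr1 exD -mulrNz ex_int mulr1.
 by rewrite /ex /expi !mulrA => -[].
have d1 y : is_derive y (1 : R) (fun y => - sin (w * (x - y)) / w) (cos (w * (x - y))).
 have : is_derive y (1 : R) (fun y => w * (x - y)) (- w) by apply: is_derive_eq; rewrite /GRing.scale /=; ring.
 move=> /(is_derive1_comp (is_derive_sin _)) d; apply: is_derive_eq; rewrite /GRing.scale /=; field.
 by [].
have d2 y : is_derive y (1 : R) (fun y => cos (w * (x - y)) / w) (sin (w * (x - y))).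
 have : is_derive y (1 : R) (fun y => w * (x - y)) (- w) by apply: is_derive_eq; rewrite /GRing.scale /=; ring.
 move=> /(is_derive1_comp (is_derive_cos _)) d; apply: is_derive_eq; rewrite /GRing.scale /=; field.
 by [].
have [c1 c2] := cc_ex x k%:~R.
have e1 : (fun y => complex.Re (ex (k%:~R * (x - y)))) = (fun y => cos (w * (x - y))) by apply/funext => y; rewrite /= /w mulrA.
have e2 : (fun y => complex.Im (ex (k%:~R * (x - y)))) = (fun y => sin (w * (x - y))) by apply/funext => y; rewrite /= /w mulrA.
have dc (u v : R -> R) : (forall y, is_derive y (1 : R) u (v y)) -> continuous u.
 by move=> d y; apply: differentiable_continuous; apply/derivable1_diffP; case: (d y).
rewrite /cint e1 e2 in c1 c2 *.
have -> : Rint (fun y => cos (w * (x - y))) = 0.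
 apply: etrans (congr1 fine (FTC_open _ _ 0 1 ltr01 (fun y _ => d1 y) (dc _ _ d1) c1)) _.
 by rewrite p2 subr0 subrr.
have -> // : Rint (fun y => sin (w * (x - y))) = 0.
apply: etrans (congr1 fine (FTC_open _ _ 0 1 ltr01 (fun y _ => d2 y) (dc _ _ d2) c2)) _.
by rewrite p1 subr0 subrr.
Qed.

End fourier.
Section fejer.
Context {R : realType}.
Implicit Types (z : R[i]) (x y u : R) (h : R -> R[i]).
Notation L1 := (@lebesgue_measure R).
Notation I01 := (`[0%R, 1%R]%classic : set R).

Lemma cont_cabs h : continuous h -> forall x (e : R), 0 < e -> \forall y \near x, cabs (h x - h y) < e.
Proof.
move=> ch x e e0; have e0' : 0 < (e%:C%C : R[i]) by rewrite ltcR.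
have /(@cvgrPdist_lt _ (R[i])^o) H := ch x; have := H _ e0'.
by apply: filterS => y; rewrite normcE' ltcR.
Qed.

Lemma cont_cc h : continuous h -> cc h.
Proof.
move=> ch; split=> x; apply/cvgrPdist_lt => e e0; apply: filterS (cont_cabs h ch x e e0) => y; apply: le_lt_trans.
 by apply: le_trans (cabs_Re _); case: (h x) (h y) => a b [].
by apply: le_trans (cabs_Im _); case: (h x) (h y) => a b [].
Qed.

Definition chord u : R := 2 - 2 * cos (2 * pi * u).

Lemma chordE u : cabs (1 - ex u) ^+ 2 = chord u.
Proof.
rewrite /cabs sqr_sqrtr ?addr_ge0 ?sqr_ge0 // /chord.
have := cos2Dsin2 (2 * pi * u); move: (cos _) (sin _) => c s e.
lra.
Qed.

Lemma chord_int u (n : int) : chord (u + n%:~R) = chord u.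
Proof. by rewrite -!chordE exD ex_int mulr1. Qed.

Lemma bounded_periodic h : periodic1 h -> continuous h -> exists2 B, 0 <= B & forall x, cabs (h x) <= B.
Proof.
move=> ph ch; have cu : continuous (fun x => cabs (h x)).
 move=> x; apply/cvgrPdist_lt => e e0; apply: filterS (cont_cabs h ch x e e0) => y; apply: le_lt_trans.
 have := cabsD (h x - h y) (h y); have := cabsD (h y - h x) (h x); rewrite !subrK (cabsB (h y)).
 by rewrite ler_norml => ? ?; apply/andP; split; lra.
have [c _ H] := EVT_max (@ler01 R) (continuous_subspaceT cu).
exists (cabs (h c)) => [|x]; first exact: cabs_ge0.
have := periodic_int h ph x (- Num.floor x); rewrite mulrNz => <-; apply: H; rewrite in_itv /=.
by have /andP[h1 h2] := floor_itv x; rewrite intrD in h2; apply/andP; split; lra.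
Qed.

(** Uniform continuity serves for points at circle distance below [d]; for the others [chord] is at
    least [chord d], and a multiple of it dominates [2 B]. This form of the modulus is chosen
    because the Fejer kernel times [chord] stays bounded. *)
Lemma periodic_modulus h : periodic1 h -> continuous h -> forall e, 0 < e ->
 exists2 C, 0 <= C & forall x y, cabs (h x - h y) <= e + C * chord (x - y).
Proof.
move=> ph ch e e0; have [B B0 hB] := bounded_periodic h ph ch.
have [d [d0 d1 hd]] : exists d : R, [/\ 0 < d, d <= 1 / 2 & forall x y, 0 <= x <= 1 -> `|x - y| < d -> cabs (h x - h y) <= e].
 have : \forall d \near 0^'+, `[0%R, 1%R] `<=` (fun x => forall y, `|x - y| < d -> cabs (h x - h y) <= e).
  apply: ((compact_near_coveringP _).1 (@segment_compact R 0 1)) => x _.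
  have e20 : 0 < e / 2 by lra.
  have /nbhs_ballP[r /= r0 hr] := cont_cabs h ch x _ e20.
  have r2 : 0 < r / 2 by lra.
  exists (ball x (r / 2), [set d : R | d < r / 2]) => /=.
   by split; [exact: nbhsx_ballx|exact: nbhs_right_lt].
  move=> [x' d] /= [xx' dr] y yd.
  have b1 : cabs (h x - h x') < e / 2 by apply: hr; apply: le_ball xx'; lra.
  have b2 : cabs (h x - h y) < e / 2.
   apply: hr; rewrite /ball /= in xx' *; have := ler_distD x' x y; lra.
  have := cabsD (h x' - h x) (h x - h y); rewrite addrA subrK (cabsB (h x')); lra.
 move=> H; have H2 : \forall d \near 0^'+, (d : R) < 1 / 2 by apply: nbhs_right_lt; lra.
 have H3 : \forall d \near 0^'+, 0 < (d : R) by exact: nbhs_right_gt.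
 have [d [[h1 h2] h3]] := filter_ex (filterI (filterI H H2) H3).
 exists d; split => //; first pos.
 by move=> x y x01 xy; apply: (h1 x) => //=; rewrite in_itv.
have p0 := @pi_gt0 R.
have cd : 0 < chord d.
 have : cos (2 * pi * d) < cos 0.
  rewrite ltr_cos ?in_itv /= ?lexx ?(ltW p0) ?mulr_gt0 //; apply/andP; split; first by pos.
  by have := ler_wpM2l (ltW p0) d1; lra.
 by rewrite cos0 /chord; lra.
exists (2 * B / chord d) => [|x y]; first by pos.
(* Representatives with [x'] in [[0, 1]] and [|x' - y'| <= 1 / 2], so that [chord] is monotone in
   their distance. *)
pose x' := x - (Num.floor x)%:~R; pose n := Num.floor (y - x' + 1 / 2); pose y' := y - n%:~R.
have hx : h x = h x' by rewrite -(periodic_int h ph x (- Num.floor x)) mulrNz.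
have hy : h y = h y' by rewrite -(periodic_int h ph y (- n)) mulrNz.
have -> : chord (x - y) = chord (x' - y').
 rewrite -(chord_int (x' - y') (Num.floor x - n)); congr chord; rewrite /x' /y' intrB; ring.
have x01 : 0 <= x' <= 1.
 by rewrite /x'; have /andP[h1 h2] := floor_itv x; rewrite intrD in h2; apply/andP; split; lra.
have uy : `|x' - y'| <= 1 / 2.
 rewrite /y' /n; have /andP[h1 h2] := floor_itv (y - x' + 1 / 2); rewrite intrD in h2.
 by rewrite ler_norml; apply/andP; split; lra.
rewrite hx hy; have ch0 u : 0 <= chord u by rewrite -chordE sqr_ge0.
have [xy|xy] := ltP `|x' - y'| d.
 by apply: le_trans (hd _ _ x01 xy) _; rewrite lerDl mulr_ge0 // divr_ge0 ?mulr_ge0 // ltW.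
apply: (@le_trans _ _ (2 * B)).
 have := cabsD (h x') (- h y'); have := hB x'; have := hB y'.
 by rewrite cabsN; lra.
apply: (@le_trans _ _ (2 * B / chord d * chord d)); first by rewrite divfK // gt_eqF.
apply: (@le_trans _ _ (2 * B / chord d * chord (x' - y'))); last by rewrite lerDr ltW.
apply: ler_wpM2l; first by pos.
have -> : chord (x' - y') = chord `|x' - y'|.
 by rewrite /chord; case: (ger0P (x' - y')) => // _; rewrite mulrN cosN.
rewrite lerD2l lerN2 ler_pM2l // leNgt ltr_cos ?in_itv /= -?leNgt.
- by rewrite ler_pM2l // mulr_gt0.
- apply/andP; split; first by pos.
 by have := ler_wpM2l (ltW p0) d1; have := ler_wpM2l (ltW p0) uy; lra.
- apply/andP; split; first by pos.
 by have := ler_wpM2l (ltW p0) d1; have := ler_wpM2l (ltW p0) uy; lra.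
Qed.

Definition dirichlet (N : nat) u : R[i] := \sum_(j < N) ex (j%:R * u).

(** Telescoping: [1 - e(u)] times the Dirichlet sum is [1 - e(N u)], of absolute value at most 2. *)
Lemma dirichlet_chord N u : cabs (dirichlet N u) ^+ 2 * chord u <= 4.
Proof.
have -> : cabs (dirichlet N u) ^+ 2 * chord u = cabs (1 - ex (N%:R * u)) ^+ 2.
 rewrite -chordE -exprMn -cabsM; congr (cabs _ ^+ 2); rewrite /dirichlet.
 elim: N => [|N IH]; first by rewrite big_ord0 mul0r mul0r ex0 subrr.
 rewrite big_ord_recr mulrDl IH -natr1 mulrDl mul1r exD; ring.
rewrite chordE /chord; have := cos_geN1 (2 * pi * (N%:R * u)); lra.
Qed.

Lemma dirichlet_sqr N u : \sum_(j < N) \sum_(l < N) ex ((j%:Z - l%:Z)%:~R * u) = (cabs (dirichlet N u) ^+ 2)%:C%C.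
Proof.
have -> : (cabs (dirichlet N u) ^+ 2)%:C%C = dirichlet N u * ((dirichlet N u)^*)%C.
 by rewrite -sqr_normc normcE' rmorphXn.
rewrite /dirichlet rmorph_sum /= mulr_suml; apply: eq_bigr => j _; rewrite mulr_sumr; apply: eq_bigr => l _.
by rewrite [X in _ = _ * X](ex_conj (l%:R * u)) -exD intrB mulrBl.
Qed.

(** The double sum is [N] times the Fejer mean, that is the integral of [h] against the squared
    Dirichlet kernel, whose mass is [N]. The modulus of continuity contributes [e * N], and [4 * C]
    by [dirichlet_chord]. *)
Lemma fejer_close h x N (e C : R) : cc h -> (forall y, cabs (h x - h y) <= e + C * chord (x - y)) -> 0 <= C ->
 cabs (N%:R * h x - \sum_(j < N) \sum_(l < N) fcoef h (j%:Z - l%:Z) * ex ((j%:Z - l%:Z)%:~R * x)) <= 2 * (e * N%:R + 4 * C).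
Proof.
move=> ch H C0; pose K (j l : 'I_N) (y : R) := ex ((j%:Z - l%:Z)%:~R * (x - y)).
have cK j l : cc (K j l) by exact: cc_ex.
pose P (y : R) := cabs (dirichlet N (x - y)) ^+ 2.
have PE y : (P y)%:C%C = \sum_(j < N) \sum_(l < N) K j l y by rewrite /P -dirichlet_sqr.
have cP : cc (fun y => (P y)%:C%C).
 by under eq_fun do rewrite PE; apply: cc_sum => j; apply: cc_sum => l.
have iP : cint (fun y => (P y)%:C%C) = N%:R.
 under eq_fun do rewrite PE; rewrite cint_sum => [|j]; last by apply: cc_sum => l.
 transitivity (\sum_(j < N) (1 : R[i])); last by rewrite sumr_const card_ord.
 apply: eq_bigr => j _; rewrite cint_sum // (bigD1 j) //= cint_ex subrr eqxx big1 ?addr0 // => l lj.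
 by rewrite cint_ex subr_eq0 eqz_nat eq_sym (inj_eq val_inj) (negbTE lj).
have chP : cc (fun y => h y * (P y)%:C%C) by exact: ccM.
have -> : \sum_(j < N) \sum_(l < N) fcoef h (j%:Z - l%:Z) * ex ((j%:Z - l%:Z)%:~R * x) = cint (fun y => h y * (P y)%:C%C).
 transitivity (cint (fun y => \sum_(j < N) \sum_(l < N) h y * K j l y)); last first.
  by congr cint; apply/funext => y; rewrite PE mulr_sumr; apply: eq_bigr => j _; rewrite mulr_sumr.
 have chK j l : cc (fun y => h y * K j l y) by exact: ccM.
 rewrite cint_sum => [|j]; last by apply: cc_sum => l.
 apply: eq_bigr => j _; rewrite cint_sum //; apply: eq_bigr => l _.
 have kE y : ex ((j%:Z - l%:Z)%:~R * x) * expi (- (2 * pi * (j%:Z - l%:Z)%:~R * y)) = K j l y.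
  by rewrite /K mulrBr exD; congr (_ * _); rewrite /ex mulrN mulrA.
 rewrite /fcoef mulrC -cintZ; first by congr cint; apply/funext => y; rewrite mulrCA kE.
 apply: ccM => //; rewrite (_ : (fun _ => _) = fun y => ex ((j%:Z - l%:Z)%:~R * (0 - y))); first exact: cc_ex.
 by apply/funext => y; rewrite /ex sub0r !mulrN mulrA.
have -> : N%:R * h x - cint (fun y => h y * (P y)%:C%C) = cint (fun y => (h x - h y) * (P y)%:C%C).
 rewrite -iP mulrC -cintZ // -mulN1r -cintZ // -cintD; first by congr cint; apply/funext => y; ring.
  by apply: ccM => //; exact: cc_cst.
 by apply: ccM => //; exact: cc_cst.
have cPr : continuous P by have [] := cP.
have iPr : Rintegral L1 I01 P = N%:R.
 have := congr1 (@complex.Re R) iP; rewrite /cint /= => ->.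
 by rewrite -(rmorph_nat (real_complex R)).
have ci (k : R) (u : R -> R) : continuous u -> L1.-integrable I01 (EFin \o (fun x => k * u x)).
 by move=> cu; apply: cont_int => y; apply: cvgMr; exact: cu.
have -> : e * N%:R + 4 * C = Rintegral L1 I01 (fun y => e * P y + 4 * C).
 have k4 : L1.-integrable I01 (EFin \o (fun=> 4 * C)) by apply: cont_int => y; exact: cvg_cst.
 rewrite (RintegralD _ (ci e P cPr) k4) // (RintegralZl e _ (cont_int P cPr)) // iPr Rintegral_cst //=.
 by rewrite lebesgue_measure_itv /= lte_fin ltr01 oppr0 adde0 mulr1.
apply: cint_le.
- apply: ccM => //; apply: ccD; first exact: cc_cst.
 have -> : (fun y => - h y) = (fun y => -1 * h y) by apply/funext => y; rewrite mulN1r.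
 by apply: ccM => //; exact: cc_cst.
- by move=> y; apply: cvgD; [apply: cvgMr; exact: cPr|exact: cvg_cst].
- move=> y; have P0 : 0 <= P y by exact: sqr_ge0.
 rewrite cabsM cabsC ger0_norm //; apply: le_trans (ler_wpM2r P0 (H y)) _.
 have := ler_wpM2l C0 (dirichlet_chord N (x - y)); rewrite -/(P y); lra.
Qed.

End fejer.

(** * Exponential sums over the cusp parameters *)

Lemma lipschitz1 {R : realType} (f df : R -> R) (x y : R) : (forall x, is_derive x (1 : R) f (df x)) ->
 (forall x, `|df x| <= 1) -> `|f x - f y| <= `|x - y|.
Proof.
move=> d b; wlog xy : x y / y <= x => [H|].
 by have [/H//|/ltW/H] := leP y x; rewrite distrC [leRHS]distrC.
have cf : continuous f by move=> u; apply: differentiable_continuous; apply/derivable1_diffP; case: (d u).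
have [c _ ->] := MVT_segment xy (fun x _ => d x) (continuous_subspaceT cf).
by rewrite normrM ler_piMl.
Qed.

Section cusp_sums.
Context {R : realType}.
Notation P := (plane R).
Notation L1 := (@lebesgue_measure R).
Context (G : set 'M[R]_2) (dG : discrete_subgroup_SL2 G).

Section cusps.
Context (sa sb : 'M[R]_2) (hsa : scaling_matrix G sa) (hsb : scaling_matrix G sb).
Notation RPs M := (finmap.enum_fset (fset_set (RPM G sa sb M))).

(** Reducing the fraction modulo 1 is an integer translation of the column. *)
Lemma Tab_RPM M : Tab G sa sb M = (fun v : R * R => v.1 / v.2) @` RPM G sa sb M.
Proof.
apply/seteqP; split => [r [tau [g Gg ->]] [c0 cM ->]|r [v [[[g Gg ev] [v0 /andP[v1 v2]]] vM] <-]].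
 set ta := _ *m _ in c0 cM *; have Vt : Vab G sa sb (col1 ta) by exists g.
 have := Vab_shift _ dG sa sb hsa _ (- Num.floor (ma ta / mc ta)) Vt.
 set n := Num.floor _; rewrite mulrNz /= mulNr => Vn.
 exists (ma ta - n%:~R * mc ta, mc ta); last by rewrite /Defs.frac mulrBl mulfK // gt_eqF.
 split => //; split => //; split => //=; rewrite subr_ge0 ltrBlDr -{2}[mc ta]mul1r -mulrDl.
 rewrite -ler_pdivlMr // -ltr_pdivrMr //; have /andP[h1 h2] := floor_itv (ma ta / mc ta).
 lra.
exists (invmx sa *m g *m sb); first by exists g.
have [-> ->] : ma (invmx sa *m g *m sb) = v.1 /\ mc (invmx sa *m g *m sb) = v.2 by rewrite ev.
split => //; rewrite /Defs.frac (@floor_def _ _ 0) ?subr0 //.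
by rewrite divr_ge0 ?(ltW v0) //= add0r ltr_pdivrMr // mul1r.
Qed.

(** Equal fractions have wedge 0, so by separation the columns agree up to sign, and both lower
    entries are positive. This is the well-definedness of the denominator of a fraction. *)
Lemma RPM_inj M : set_inj (RPM G sa sb M) (fun v : R * R => v.1 / v.2).
Proof.
move=> v w; rewrite !in_setE => -[[Vv [v0 _]] _] [[Vw [w0 _]] _] e.
have [//|[vw|]] := Vab_sep _ dG _ _ hsa hsb v w Vv Vw; first by move: v0; rewrite vw oppr_gt0 ltNge ltW.
have -> : wedge v w = 0 by rewrite /wedge -{1}(divfK (lt0r_neq0 v0) v.1) e; field; rewrite gt_eqF.
by rewrite normr0 leNgt sepd_gt0.
Qed.

Lemma Tab_sum (V : nmodType) (f : R -> V) M : 0 <= M ->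
 \sum_(r \in Tab G sa sb M) f r = \sum_(v <- RPs M) f (v.1 / v.2).
Proof.
move=> M0; have [fM _] := RPM_count _ dG _ _ hsa hsb M M0.
by rewrite Tab_RPM (fsbig_image _ (fun v : R * R => v.1 / v.2) f (RPM_inj M)) fsbig_finite.
Qed.

End cusps.

Context (F : set P) (hF : fdom G F) (mF : measurable F) (finF : ((L1 \x L1)%E F < +oo)%E).
Let mu := muF mF finF.

(** Weights must lie between 0 and 2, so [weighted_count] is applied to 1 plus the cosine or sine of
    [2 pi n X], with Lipschitz constant [2 pi |n|], and the plain count is subtracted. *)
Lemma exp_sums : exists2 delta : R, 0 < delta <= 1 &
 forall sa sb, scaling_matrix G sa -> scaling_matrix G sb ->
 exists2 K : R, 0 <= K & forall (n : int) M, 1 <= M ->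
  cabs (\sum_(v <- finmap.enum_fset (fset_set (RPM G sa sb M))) ex (n%:~R * (v.1 / v.2))
     - (n == 0)%:R * (M ^+ 2 / (pi * vol mu))%:C%C) <= K * (1 + `|n%:~R|) * M `^ (2 - delta).
Proof.
have [delta d0 H] := weighted_count _ dG _ hF mF finF; exists delta => // sa sb hsa hsb.
have [K K0 {}H] := H sa sb hsa hsb; have p0 := @pi_gt0 R.
exists (2 * (K * (2 + 2 * pi))) => [|n M M1]; first by pos.
set s := finmap.enum_fset _; set Q := M ^+ 2 / _; set E := M `^ _.
have E0 : 0 <= E by exact: powR_ge0.
have H1 : `|(size s)%:R - Q| <= K * E.
 have H1 : `|\sum_(v <- s) 1 - 1 * Q| <= K * (1 + 0) * E.
  apply: (H (fun=> 1) 0 1) => //.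
  - by move=> X; rewrite ler01 ler1n.
  - by move=> X X'; rewrite subrr normr0 mul0r.
  - by rewrite integral_cst //= lebesgue_measure_itv /= lte_fin ltr01 oppr0 adde0 mule1.
 by move: H1; rewrite sum1_size mul1r addr0 mulr1.
have [->|n0] := eqVneq n 0.
 under eq_bigr do rewrite mul0r ex0.
 have -> : \sum_(v <- s) 1 - true%:R * Q%:C%C = ((size s)%:R - Q)%:C%C :> R[i].
  by rewrite mul1r rmorphB -sum1_size rmorph_sum.
 rewrite cabsC normr0 addr0 mulr1; apply: le_trans H1 _; rewrite ler_wpM2r //.
 by have := mulr_ge0 K0 (ltW p0); lra.
rewrite mul0r subr0.
set k : R := n%:~R.
have kn : k = n%:~R by [].
(* [t] is the real or the imaginary part of [e(n X)]. *)
have trig (t dt : R -> R) : (forall x, is_derive x (1 : R) t (dt x)) -> (forall x, `|t x| <= 1) -> (forall x, `|dt x| <= 1) ->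
  (forall x, t (2 * pi * (k * (x + 1))) = t (2 * pi * (k * x))) ->
  Rintegral L1 `[0%R, 1%R] (fun x => t (2 * pi * (k * x))) = 0 ->
  `|\sum_(v <- s) t (2 * pi * (k * (v.1 / v.2)))| <= K * (2 + 2 * pi) * (1 + `|k|) * E.
 move=> dtt t1 dt1 tp t0.
 have ct : continuous (fun x => t (2 * pi * (k * x))).
  have ctt : continuous t by move=> u; apply: differentiable_continuous; apply/derivable1_diffP; case: (dtt u).
  move=> x; apply: (@continuous_comp _ _ _ (fun x => 2 * pi * (k * x)) t); last exact: ctt.
  by apply: cvgMr; apply: cvgMr; exact: cvg_id.
 have c1 : continuous (fun x => 1 + t (2 * pi * (k * x))) by move=> x; apply: cvgD; [exact: cvg_cst|exact: ct].
 have H2 : `|\sum_(v <- s) (1 + t (2 * pi * (k * (v.1 / v.2)))) - 1 * Q| <= K * (1 + 2 * pi * `|k|) * E.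
  apply: (H (fun x => 1 + t (2 * pi * (k * x))) (2 * pi * `|k|) 1) => //.
  - exact: continuous_measurable_fun.
  - by move=> X; have := t1 (2 * pi * (k * X)); rewrite ler_norml => /andP[? ?]; apply/andP; split; lra.
  - move=> X X'; rewrite opprD addrACA subrr add0r; apply: le_trans (lipschitz1 _ _ _ _ dtt dt1) _.
   by rewrite -!mulrBr !normrM !mulrA (ger0_norm (ltW p0)) ger0_norm.
  - by move=> X; rewrite tp.
  - have := cont_int _ ct => it; have i1 : L1.-integrable `[0%R, 1%R] (EFin \o (fun=> 1 : R)) by apply: cont_int => y; exact: cvg_cst.
   have := @RintegralD _ _ R L1 `[0%R, 1%R]%classic (fun=> 1) (fun x : R => t (2 * pi * (k * x))) (measurable_itv _) i1 it; rewrite t0 addr0 Rintegral_cst //= lebesgue_measure_itv /= lte_fin ltr01 oppr0 adde0 mul1r => e2.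
   rewrite -[LHS]fineK; last exact: integrable_fin_num (cont_int _ c1).
   by apply: (congr1 EFin); exact: e2.
 move: H1 H2; rewrite mul1r big_split /= sum1_size; move: (\sum_(v <- s) _) => S; rewrite !ler_norml => /andP[a1 a2] /andP[b1 b2].
 have q1 : 0 <= K * `|k| * E by pos.
 have q2 : 0 <= K * pi * E by pos.
 lra.
have [per1 per2] : (forall x, cos (2 * pi * (k * (x + 1))) = cos (2 * pi * (k * x))) /\
  (forall x, sin (2 * pi * (k * (x + 1))) = sin (2 * pi * (k * x))).
 have pe x : ex (k * (x + 1)) = ex (k * x) by rewrite mulrDr mulr1 exD ex_int mulr1.
 by split=> x; have := pe x; rewrite /ex /expi => -[].
have i0 := cint_ex (- n) (0 : R); rewrite oppr_eq0 (negbTE n0) in i0.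
have {}i0 : cint (fun y => ex (k * y)) = 0.
 by rewrite mulr0n in i0; rewrite -[RHS]i0; congr cint; apply/funext => y; rewrite sub0r mulrNz mulrNN.
have S1 := trig cos _ (@is_derive_cos R) (@cos_max R) _ per1 (congr1 (@complex.Re R) i0).
have S2 := trig sin _ (@is_derive_sin R) (@sin_max R) (@cos_max R) per2 (congr1 (@complex.Im R) i0).
apply: le_trans (cabs_le _) _; rewrite !raddf_sum /=.
have -> : 2 * (K * (2 + 2 * pi)) * (1 + `|k|) * E = K * (2 + 2 * pi) * (1 + `|k|) * E + K * (2 + 2 * pi) * (1 + `|k|) * E by ring.
by apply: lerD => //; apply: S1 => x; rewrite normrN sin_max.
Qed.

End cusp_sums.

(** * From exponential sums to general functions *)

Section conclusion.
Context {R : realType}.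
Implicit Types (h : R -> R[i]).

(** With everything multiplied by [N], the values of [h] are replaced by Fejer means and the
    exponential sums by their main terms. Only frequency 0, which occurs [N] times, has a main
    term. *)
Lemma fejer_sum (V : Type) (s : seq V) (xs : V -> R) h (Q : R) (D : int -> R) (e C : R) (N : nat) :
 cc h -> 0 <= C -> (forall x y, cabs (h x - h y) <= e + C * chord (x - y)) ->
 (forall n : int, cabs (\sum_(v <- s) ex (n%:~R * xs v) - (n == 0)%:R * Q%:C%C) <= D n) ->
 cabs (\sum_(v <- s) h (xs v) - cint h * Q%:C%C) * N%:R <=
  2 * (e * N%:R + 4 * C) * (size s)%:R + \sum_(j < N) \sum_(l < N) cabs (fcoef h (j%:Z - l%:Z)) * D (j%:Z - l%:Z).
Proof.
move=> ch C0 hm hD; pose f (j l : 'I_N) := fcoef h (j%:Z - l%:Z).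
pose S n : R[i] := \sum_(v <- s) ex (n%:~R * xs v).
pose T x := \sum_(j < N) \sum_(l < N) f j l * ex ((j%:Z - l%:Z)%:~R * x).
have f0 : fcoef h 0 = cint h.
 by rewrite /fcoef; congr cint; apply/funext => x; rewrite mulr0 mul0r oppr0 -(mulr0 (2 * pi)) -/(ex 0) ex0 mulr1.
have E : N%:R * (\sum_(v <- s) h (xs v) - cint h * Q%:C%C) = \sum_(v <- s) (N%:R * h (xs v) - T (xs v)) +
  \sum_(j < N) \sum_(l < N) f j l * (S (j%:Z - l%:Z) - (j%:Z - l%:Z == 0)%:R * Q%:C%C).
 have -> : \sum_(j < N) \sum_(l < N) f j l * (S (j%:Z - l%:Z) - (j%:Z - l%:Z == 0)%:R * Q%:C%C) =
   \sum_(v <- s) T (xs v) - N%:R * (cint h * Q%:C%C).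
  rewrite exchange_big /=.
  have -> : \sum_(v <- s) T (xs v) = \sum_(l < N) \sum_(j < N) f j l * S (j%:Z - l%:Z).
   rewrite /T exchange_big /= [RHS]exchange_big; apply: eq_bigr => j _; rewrite exchange_big; apply: eq_bigr => l _.
   by rewrite /S mulr_sumr.
  rewrite mulr_natl -[N in _ *+ N]card_ord -sumr_const -sumrB; apply: eq_bigr => l _.
  under eq_bigr do rewrite mulrBr.
  rewrite sumrB; congr (_ - _); rewrite (bigD1 l) //= /f subrr eqxx mul1r f0 big1 ?addr0 // => j jl.
  by rewrite subr_eq0 eqz_nat (inj_eq val_inj) (negbTE jl) mul0r mulr0.
 by rewrite sumrB mulrBr mulr_sumr; ring.
have <- : cabs (N%:R : R[i]) = N%:R by rewrite -(rmorph_nat (real_complex R)) cabsC ger0_norm.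
rewrite mulrC -cabsM E; apply: le_trans (cabsD _ _) _; apply: lerD; apply: le_trans (cabs_sum _ _ _) _.
 rewrite -sum1_size mulr_sumr; apply: ler_sum => v _; rewrite mulr1.
 by have := fejer_close h (xs v) N e C ch (hm _) C0; rewrite -(rmorph_nat (real_complex R)) cabsC ger0_norm.
apply: ler_sum => j _; apply: le_trans (cabs_sum _ _ _) _; apply: ler_sum => l _.
by rewrite cabsM; apply: ler_wpM2l (hD _); exact: cabs_ge0.
Qed.

(** For fixed [j] the frequencies [j - l] are distinct, so the row is a partial sum of the norm. *)
Lemma HA_norm_row (A : R) h (N : nat) (j : 'I_N) : (HA_norm A h < +oo)%E ->
 \sum_(l < N) cabs (fcoef h (j%:Z - l%:Z)) * (1 + `|(j%:Z - l%:Z)%:~R|) `^ A <= fine (HA_norm A h).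
Proof.
move=> hf; have t0 n : 0 <= cabs (fcoef h n) * (1 + `|n%:~R|) `^ A by rewrite mulr_ge0 ?cabs_ge0.
have H0 : (0 <= HA_norm A h)%E by apply: esum_ge0 => n _; rewrite lee_fin mulr_ge0 ?cabs_ge0.
rewrite -lee_fin fineK ?ge0_fin_numE //.
pose r := [seq j%:Z - l%:Z | l : 'I_N <- enum 'I_N].
have ur : uniq r by rewrite map_inj_uniq ?enum_uniq // => a b /addrI/oppr_inj [] /val_inj.
apply: esum_ge; exists [set` r]; first by split => //; exact: finite_seq.
rewrite -fsbig_seq // big_map big_enum /= -sumEFin le_eqVlt; apply/orP; left; apply/eqP.
by apply: eq_big => // l _; rewrite intr_norm.
Qed.

(** Divide by [N], let [N] tend to infinity for fixed [e], then let [e] tend to 0. *)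
Lemma ler_gap (a b c d : R) : 0 <= c -> 0 <= d ->
 (forall e : R, 0 < e -> exists2 C, 0 <= C & forall N : nat, a * N%:R <= 2 * (e * N%:R + 4 * C) * c + b * N%:R) -> a <= b.
Proof.
move=> c0 d0 H; rewrite leNgt; apply/negP => ab.
pose g := a - b; have g0 : 0 < g by rewrite subr_gt0.
pose e := g / (4 * (c + 1)); have e0 : 0 < e by rewrite divr_gt0 // mulr_gt0 // ltr_wpDl.
have [C C0 {}H] := H e e0.
have ec : 4 * (e * c) <= g.
 by rewrite /e -mulrA mulrCA [_^-1 * _]mulrC !mulrA; rewrite ler_pdivrMr; nra.
pose N := (Num.truncn (16 * C * c / g)).+1; have := H N; rewrite (_ : a = b + g); last by rewrite /g; ring.
have Ng : 16 * C * c < g * N%:R.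
 have q0 : 0 <= 16 * C * c / g by pos.
 by rewrite [ltRHS]mulrC -ltr_pdivrMr; have /andP[] := truncn_itv q0.
have N0 : 0 < N%:R :> R by rewrite ltr0n.
have := ler_wpM2r (ltW N0) ec; lra.
Qed.

Lemma powR_small (delta t : R) : 0 < delta -> 0 < t -> exists2 M0, 1 <= M0 & forall M, M0 <= M -> M `^ (- delta) <= t.
Proof.
move=> d0 t0; exists (Num.max 1 (t^-1 `^ delta^-1)) => [|M]; first by rewrite le_max lexx.
rewrite ge_max => /andP[M1 M2]; have M0 : 0 < M by lra.
rewrite powRN -[leRHS]invrK lef_pV2 ?posrE ?invr_gt0 ?powR_gt0 //.
have -> : t^-1 = (t^-1 `^ delta^-1) `^ delta by rewrite -powRrM mulVf ?gt_eqF // powRr1 // invr_ge0 ltW.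
by rewrite ge0_ler_powR ?nnegrE ?powR_ge0 // ltW.
Qed.

End conclusion.
Section asymptotics.
Context {R : realType}.
Notation P := (plane R).
Notation L1 := (@lebesgue_measure R).
Context (G : set 'M[R]_2) (dG : discrete_subgroup_SL2 G) (sa sb : 'M[R]_2)
 (hsa : scaling_matrix G sa) (hsb : scaling_matrix G sb) (kap delta K : R) (kap0 : 0 < kap)
 (delta0 : 0 < delta <= 1) (K0 : 0 <= K).
Let s (M : R) := finmap.enum_fset (fset_set (RPM G sa sb M)).
Hypothesis hS : forall (n : int) M, 1 <= M ->
  cabs (\sum_(v <- s M) ex (n%:~R * (v.1 / v.2)) - (n == 0)%:R * (M ^+ 2 * kap)%:C%C) <= K * (1 + `|n%:~R|) * M `^ (2 - delta).
Implicit Types (h : R -> R[i]) (M : R).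

Let pM M : 0 < M -> M `^ (2 - delta) = M ^+ 2 * M `^ (- delta).
Proof. by move=> M0; rewrite -powR_mulrn ?ltW // -powRD //; apply/implyP => _; rewrite gt_eqF. Qed.

(** The choices are made in the order [e], [C], then [N] large enough to beat [C], and finally [M]
    large in terms of the finitely many frequencies below [N]. *)
Lemma equidistribution h : periodic1 h -> continuous h -> forall eps : R, 0 < eps -> exists2 M0, 1 <= M0 &
 forall M, M0 <= M -> 0 < (size (s M))%:R :> R /\
  cabs (\sum_(v <- s M) h (v.1 / v.2) / ((size (s M))%:R)%:C%C - cint h) <= eps.
Proof.
move=> ph ch eps eps0; have e80 : 0 < eps / 8 by pos.
have [C C0 hC] := periodic_modulus h ph ch _ e80.
pose N := (Num.truncn (32 * C / eps)).+1.
have CN : 32 * C < eps * N%:R.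
 have q0 : 0 <= 32 * C / eps by pos.
 by rewrite [ltRHS]mulrC -ltr_pdivrMr; have /andP[] := truncn_itv q0.
pose W := \sum_(j < N) \sum_(l < N) cabs (fcoef h (j%:Z - l%:Z)) * (2 * K * (1 + `|(j%:Z - l%:Z)%:~R|)).
have W0 : 0 <= W by apply: sumr_ge0 => j _; apply: sumr_ge0 => l _; rewrite mulr_ge0 ?cabs_ge0 // mulr_ge0 // mulr_ge0.
pose t := Num.min (kap / (2 * (K + 1))) (eps * kap / (4 * (W + 1))).
have t0 : 0 < t by rewrite lt_min !divr_gt0 ?mulr_gt0 ?ltr_wpDl.
have /andP[d0 _] := delta0.
have [M0 M01 hM] := powR_small delta t d0 t0; exists M0 => // M MM.
have M1 : 1 <= M by exact: le_trans MM.
have Mp : 0 < M by lra.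
have y0 := powR_ge0 M (- delta); have := hM M MM; rewrite le_min ler_pdivlMr ?mulr_gt0 ?ltr_wpDl // => /andP[yK].
rewrite ler_pdivlMr ?mulr_gt0 ?ltr_wpDl // => yW.
set y := M `^ (- delta) in y0 yK yW; pose n : R := (size (s M))%:R.
have M2 : 0 < M ^+ 2 by pos.
have nk : `|n - M ^+ 2 * kap| <= K * (M ^+ 2 * y).
 have := hS 0 M M1; under eq_bigr do rewrite mul0r ex0.
 have -> : \sum_(v <- s M) 1 - (0 == 0 :> int)%:R * (M ^+ 2 * kap)%:C%C = (n - M ^+ 2 * kap)%:C%C :> R[i].
  by rewrite eqxx mul1r rmorphB /n -sum1_size rmorph_sum.
 by rewrite cabsC normr0 addr0 mulr1 pM.
have n0 : M ^+ 2 * kap / 2 <= n.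
 have : M ^+ 2 * (y * K) <= M ^+ 2 * (kap / 2) by rewrite ler_pM2l; nra.
 by move: nk; rewrite ler_norml => /andP[]; lra.
have np : 0 < n by apply: lt_le_trans n0; pos.
(* With the actual count [n] as main term, frequency 0 contributes no error. *)
split => //; have hD (k : int) : cabs (\sum_(v <- s M) ex (k%:~R * (v.1 / v.2)) - (k == 0)%:R * n%:C%C) <=
  2 * K * (1 + `|k%:~R|) * (M ^+ 2 * y).
 have [->|k0] := eqVneq k 0.
  under eq_bigr do rewrite mul0r ex0.
  rewrite mul1r (_ : _ - _ = 0) ?cabs0; last by rewrite /n -sum1_size rmorph_sum subrr.
  by pos.
 have := hS k M M1; rewrite (negbTE k0) !mul0r subr0 pM // => h1; apply: le_trans h1 _.
 by have : 0 <= K * (1 + `|k%:~R|) * (M ^+ 2 * y) by [rewrite mulr_ge0 ?mulr_ge0 // ltW]; rewrite -/y; lra.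
have := fejer_sum _ (s M) (fun v : R * R => v.1 / v.2) h n _ _ C N (cont_cc h ch) C0 hC hD.
set Z := \sum_(v <- _) h _ - _; set W' := \sum_(j < N) _; rewrite -/n => H.
have WE : W' = W * (M ^+ 2 * y).
 by rewrite /W' /W mulr_suml; apply: eq_bigr => j _; rewrite mulr_suml; apply: eq_bigr => l _; ring.
have nV : n%:C%C * (n^-1)%:C%C = 1 :> R[i] by rewrite -rmorphM divff ?gt_eqF.
have -> : \sum_(v <- s M) h (v.1 / v.2) / n%:C%C - cint h = Z * (n^-1)%:C%C.
 rewrite -mulr_suml /Z mulrBl -mulrA nV mulr1; congr (_ * _ - _).
 by rewrite -[LHS]mulr1 -nV mulrA mulVf ?mul1r // -(rmorph0 (real_complex R)) (inj_eq (@complexI R)) gt_eqF.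
rewrite cabsM cabsC gtr0_norm ?invr_gt0 // ler_pdivrMr //.
have N0 : 1 <= N%:R :> R by rewrite ler1n.
have h1 : 32 * C * n <= eps * N%:R * n by rewrite ler_pM2r // ltW.
have h2 : (y * (4 * (W + 1))) * M ^+ 2 <= eps * kap * M ^+ 2 by rewrite ler_pM2r.
have h3 : eps * (M ^+ 2 * kap / 2) <= eps * n by rewrite ler_pM2l.
have h4 : eps * n <= eps * n * N%:R by rewrite ler_peMr // mulr_ge0 // ltW.
have h5 : 0 <= y * M ^+ 2 by pos.
have Np : 0 < N%:R :> R by lra.
rewrite -(ler_pM2r Np); apply: le_trans H _; rewrite WE; lra.
Qed.

(** For each frequency the bounds [K (1 + |n|) M^(2 - delta)] and [B M^2] are combined by their
    geometric mean, which gives the weight of the norm and halves the saving. The Fejer order is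
    then sent to infinity at fixed [M]. *)
Lemma discrepancy : exists2 C : R, 0 <= C & forall h, periodic1 h -> continuous h -> (HA_norm 2^-1 h < +oo)%E ->
 forall M, 1 <= M -> cabs (\sum_(v <- s M) h (v.1 / v.2) - cint h * (M ^+ 2 * kap)%:C%C) <=
  C * fine (HA_norm 2^-1 h) * M `^ (2 - delta / 2).
Proof.
have /andP[d0 _] := delta0; have C0 := @Crp_ge0 R; pose B := 4 * Crp + kap.
have B0 : 0 <= B := addr_ge0 (mulr_ge0 (ler0n _ 4) C0) (ltW kap0).
exists (Num.sqrt (K * B)) => [|h ph ch hf M M1]; first pos.
have Mp : 0 < M by lra.
have M2 : 1 <= M ^+ 2 by rewrite -(expr1n _ 2) lerXn2r ?nnegrE; lra.
have [_ nM] := RPM_count _ dG _ _ hsa hsb M (ltW Mp).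
pose A := Num.sqrt (K * B) * M `^ (2 - delta / 2).
have A0 : 0 <= A by rewrite mulr_ge0 ?powR_ge0.
have hD (n : int) : cabs (\sum_(v <- s M) ex (n%:~R * (v.1 / v.2)) - (n == 0)%:R * (M ^+ 2 * kap)%:C%C) <= (1 + `|n%:~R|) `^ 2^-1 * A.
 set z := _ - _; have z0 := cabs_ge0 z; have z1 : cabs z <= K * (1 + `|n%:~R|) * M `^ (2 - delta) := hS n M M1.
 have z2 : cabs z <= B * M ^+ 2.
  apply: le_trans (cabsD _ _) _; rewrite cabsN cabsM cabsC ger0_norm; last by pos.
  have := cabs_sum _ (s M) (fun v : R * R => ex (n%:~R * (v.1 / v.2))).
  rewrite [leRHS](eq_bigr (fun=> 1)) => [|v _]; last exact: cabs_ex.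
  rewrite sum1_size => h1.
  have h2 : cabs ((n == 0)%:R : R[i]) <= 1 by case: eqP => _; rewrite ?cabs0 // /cabs Normc.normc1.
  have h3 : 0 <= M ^+ 2 * kap by pos.
  have := ler_wpM2r h3 h2; have := ler_wpM2l C0 M2; rewrite /B; move: nM h1; rewrite -/(s M); lra.
 have n0 : 0 <= 1 + `|n%:~R : R| by pos.
 have zz : cabs z ^+ 2 <= (K * B) * (1 + `|n%:~R|) * (M `^ (2 - delta / 2)) ^+ 2.
  have -> : (M `^ (2 - delta / 2)) ^+ 2 = M `^ (2 - delta) * M ^+ 2.
   rewrite -!powR_mulrn ?powR_ge0 ?(ltW Mp) // -powRrM -powRD; last by apply/implyP => _; rewrite gt_eqF.
   by congr (_ `^ _); field.
  have -> : K * B * (1 + `|n%:~R|) * (M `^ (2 - delta) * M ^+ 2) = K * (1 + `|n%:~R|) * M `^ (2 - delta) * (B * M ^+ 2) by ring.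
  by rewrite expr2; apply: ler_pM.
 rewrite -[cabs z]ger0_norm // -sqrtr_sqr; apply: le_trans (ler_wsqrtr zz) _.
 have KB : 0 <= K * B by pos.
 rewrite (sqrtrM _ (mulr_ge0 KB n0)) sqrtr_sqr [X in _ * X <= _]ger0_norm ?powR_ge0 // (sqrtrM _ KB).
 rewrite powR12_sqrt // /A.
 lra.
rewrite (_ : _ * M `^ _ = A * fine (HA_norm 2^-1 h)); last by rewrite /A mulrAC.
apply: (@ler_gap _ _ _ (size (s M))%:R 0) => // e e0.
have [C C0' hC] := periodic_modulus h ph ch _ e0; exists C => // N.
apply: le_trans (fejer_sum _ (s M) (fun v : R * R => v.1 / v.2) h _ _ _ C N (cont_cc h ch) C0' hC hD) _.
rewrite lerD2l; apply: (@le_trans _ _ (\sum_(j < N) A * fine (HA_norm 2^-1 h))); last by rewrite sumr_const card_ord mulr_natr.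
apply: ler_sum => j _; under eq_bigr do rewrite mulrA mulrC.
by rewrite -mulr_sumr ler_wpM2l //; exact: HA_norm_row.
Qed.

End asymptotics.

Theorem theorem3p4 (R : realType) (G : set 'M[R]_2)
    (F : set (measurableTypeR R * measurableTypeR R)) :
  discrete_subgroup_SL2 G ->
  fund_domain G F ->
  (hyp_area F < +oo)%E ->
  (forall sa sb : 'M[R]_2, scaling_matrix G sa -> scaling_matrix G sb ->
     forall h : R -> R[i], periodic1 h -> continuous h ->
       ((\sum_(r \in Tab G sa sb M) h r) / (card_Tab G sa sb M)%:C)%C
         @[M --> +oo] --> cint h)
  /\
  (exists2 delta : R, 0 < delta &
     forall sa sb : 'M[R]_2, scaling_matrix G sa -> scaling_matrix G sb ->
     exists C M0 : R, forall h : R -> R[i], periodic1 h -> continuous h ->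
       (HA_norm (2^-1) h < +oo)%E ->
       forall M : R, M0 <= M ->
         cabs ((\sum_(r \in Tab G sa sb M) h r)
               - cint h * (M ^+ 2 / (pi * fine (hyp_area F)))%:C)%C
         <= C * fine (HA_norm (2^-1) h) * M `^ (2 - delta)).
Proof.
move=> dG fG hfin; have [mF0 Fu _ _] := fG.
have hF := fund_domain_plane _ dG F fG.
have [mF _ _] := hF.
have finF : ((@lebesgue_measure R \x @lebesgue_measure R) (@Phi R @^-1` F) < +oo)%E by rewrite -hyp_areaE.
have [delta d0 H] := exp_sums _ dG _ hF mF finF.
pose kap : R := (pi * fine (hyp_area F))^-1.
have volE : vol (muF mF finF) = fine (hyp_area F) by rewrite vol_muF hyp_areaE.
have kap0 sb : scaling_matrix G sb -> 0 < kap.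
  move=> hsb; have v0 := vol_gt0 _ dG (scaling_opp1 _ _ hsb) _ hF mF finF; rewrite volE in v0.
  rewrite /kap invr_gt0; exact: mulr_gt0 (pi_gt0 R) v0.
rewrite volE in H.
split=> [sa sb hsa hsb h ph ch|].
  have [K K0 hS] := H sa sb hsa hsb.
  (* A positive element of [R[i]] has zero imaginary part, so the radius is a positive real [e]. *)
  apply/(@cvgrPdist_le R[i] (R[i])^o) => -[e b]; rewrite ltcE /= => /andP[/eqP -> e0].
  have [M0 M01 E] := equidistribution _ _ _ _ _ _ (kap0 sb hsb) d0 K0 hS h ph ch e e0.
  near=> M; have MM : M0 <= M by near: M; apply: nbhs_pinfty_ge; exact: num_real.
  have M00 : 0 <= M by lra.
  have [n0 EM] := E M MM; rewrite distrC normcE' -[X in _ <= X]/(e%:C%C) lecR /card_Tab.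
  rewrite (Tab_sum _ dG _ _ hsa hsb _ h M M00) (Tab_sum _ dG _ _ hsa hsb _ (fun=> 1) M M00) sum1_size.
  by rewrite mulr_suml.
exists (delta / 2) => [|sa sb hsa hsb]; first by case/andP: d0 => *; rewrite divr_gt0.
have [K K0 hS] := H sa sb hsa hsb.
have [C C0 E] := discrepancy _ dG _ _ hsa hsb _ _ _ (kap0 sb hsb) d0 K0 hS.
exists C, 1 => h ph ch hf M M1; rewrite (Tab_sum _ dG _ _ hsa hsb); last by lra.
exact: E.
Unshelve. all: by end_near.
Qed.
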